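(* Let $N\ge 2$, $s\in(0,1)$ and $\alpha\in(s,1]$. Let $\mathcal{G}\subset\mathbb{R}^{N-1}$ (identified with $\{x_N=0\}\subset\mathbb{R}^N$) be a non-empty bounded open set with smooth boundary, let $\mathcal{C}=\mathcal{G}\times\mathbb{R}\subset\mathbb{R}^N$, and let $\Gamma_0=\partial\mathcal{C}\cap\{x_N=0\}=\partial\mathcal{G}\times\{0\}$. Let $\mathcal{M}\subset\mathbb{R}^N$ be an orientable compact $(N-1)$-dimensional $C^{1,\alpha}$ manifold with $\partial\mathcal{M}=\Gamma_0$. If $\mathcal{M}$ is a critical point of $\mathrm{Per}_s$ under normal variations, then $\mathcal{M}$ is a piece of hyperplane lying on $\{x_N=0\}$, namely $$\mathcal{M}=\overline{\mathcal{C}}\cap\{x_N=0\}\;(=\overline{\mathcal{G}}\times\{0\}).$$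
   Context: Points of $\mathbb{R}^N$ are written $x=(x',x_N)\in\mathbb{R}^{N-1}\times\mathbb{R}$. For a compact $(N-1)$-dimensional manifold $\mathcal{M}\subset\mathbb{R}^N$ (with or without boundary), $\mathcal{X}(\mathcal{M})$ denotes the set of pairs $(x,y)\in\mathbb{R}^N\times\mathbb{R}^N$ such that the segment $[x;y]$ has an odd number of cross intersections with $\mathcal{M}$ and is not tangent to $\mathcal{M}$ (when an endpoint of the segment is a point $z\in\mathcal{M}$, the intersection at $z$ itself is not counted). For a bounded domain $\Omega\supset\mathcal{M}$ the fractional area is $$\mathrm{Per}_s(\mathcal{M};\Omega)=c_N\iint_{\mathcal{X}(\mathcal{M})}\frac{\max\{\chi_\Omega(x),\chi_\Omega(y)\}}{|x-y|^{N+s}}\,dx\,dy,$$ with $c_N>0$ a dimensional constant. For orientable $\mathcal{M}$ with unit normal field $\nu_{\mathcal{M}}$ and $z\in\mathcal{M}$, set $$\mathcal{A}_i(z)=\{y:\ [(z,y)\in\mathcal{X}(\mathcal{M}),\ (z-y)\cdot\nu_{\mathcal{M}}(z)<0]\ \text{or}\ [(z,y)\notin\mathcal{X}(\mathcal{M}),\ (z-y)\cdot\nu_{\mathcal{M}}(z)>0]\},$$ $$\mathcal{A}_e(z)=\{y:\ [(z,y)\in\mathcal{X}(\mathcal{M}),\ (z-y)\cdot\nu_{\mathcal{M}}(z)>0]\ \text{or}\ [(z,y)\notin\mathcal{X}(\mathcal{M}),\ (z-y)\cdot\nu_{\mathcal{M}}(z)<0]\},$$ and define the fractional mean curvature $$H_{\mathcal{M},s}(z)=c_N\int_{\mathbb{R}^N}\frac{\chi_{\mathcal{A}_i(z)}(y)-\chi_{\mathcal{A}_e(z)}(y)}{|y-z|^{N+s}}\,dy$$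 (Cauchy principal value). $\mathcal{M}$ is a critical point of $\mathrm{Per}_s$ under normal variations if the first variation of $\mathrm{Per}_s(\cdot;\Omega)$ at $\mathcal{M}$ vanishes for perturbations of $\mathcal{M}$ along its unit normal vector; by the Euler–Lagrange equation of Paroni, Podio-Guidugli and Seguin, this is equivalent to $H_{\mathcal{M},s}(z)=0$ for every $z\in\mathcal{M}$. *)

(* Defs.v *)
From HB Require Import structures.
From mathcomp Require Import all_boot all_order all_algebra.
From mathcomp Require Import all_classical all_reals all_analysis.

Set Implicit Arguments.
Unset Strict Implicit.
Unset Printing Implicit Defensive.

Import Order.TTheory GRing.Theory Num.Theory.
Import numFieldNormedType.Exports.

Local Open Scope classical_set_scope.
Local Open Scope ring_scope.

Section tuple_lebesgue.
Context {R : realType}.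

Definition tcons {n} (p : measurableTypeR R * n.-tuple (measurableTypeR R)) :
  n.+1.-tuple (measurableTypeR R) := [tuple of p.1 :: p.2].

Lemma measurable_tcons n : measurable_fun [set: _] (@tcons n).
Proof. exact: measurable_cons. Qed.

Lemma sigma_finite_prod d1 d2 (T1 : measurableType d1) (T2 : measurableType d2)
    (m1 : {sigma_finite_measure set T1 -> \bar R})
    (m2 : {sigma_finite_measure set T2 -> \bar R}) :
  sigma_finite setT (m1 \x m2)%E.
Proof.
have /sigma_finiteP[F [TF ndF Foo]] := sigma_finiteT m1.
have /sigma_finiteP[G [TG ndG Goo]] := sigma_finiteT m2.
exists (fun n => F n `*` G n).
  rewrite -setXTT TF TG predeqE => -[x y]; split.
    move=> [/= [n _ Fnx] [k _ Gky]]; exists (maxn n k) => //; split.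
    - by move: x Fnx; exact/subsetPset/ndF/leq_maxl.
    - by move: y Gky; exact/subsetPset/ndG/leq_maxr.
  by move=> [n _ []/= ? ?]; split; exists n.
move=> k; have [? ?] := Foo k; have [? ?] := Goo k.
split; first exact: measurableX.
by rewrite product_measure1E// lte_mul_pinfty// ge0_fin_numE.
Qed.

Section step.
Variables (n : nat)
  (mu : {sigma_finite_measure set (n.-tuple (measurableTypeR R)) -> \bar R}).

Definition lebesgue_step :
    set (n.+1.-tuple (measurableTypeR R)) -> \bar R :=
  pushforward (@lebesgue_measure R \x mu)%E (@tcons n).

Let step0 : lebesgue_step set0 = 0%E.
Proof. by rewrite /lebesgue_step /pushforward preimage_set0 measure0. Qed.

Let step_ge0 A : (0 <= lebesgue_step A)%E.
Proof. by rewrite /lebesgue_step /pushforward; exact: measure_ge0. Qed.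

Let step_sigma_additive : semi_sigma_additive lebesgue_step.
Proof.
move=> F mF tF mUF; rewrite /lebesgue_step /pushforward preimage_bigcup.
have mt B : measurable B -> measurable (@tcons n @^-1` B).
  by move=> mB; rewrite -[X in measurable X]setTI; exact: measurable_tcons.
apply: measure_semi_sigma_additive.
- by move=> i; apply: mt.
- apply/trivIsetP => /= i j _ _ ij; rewrite -preimage_setI.
  by move/trivIsetP : tF => /(_ _ _ _ _ ij) ->//; rewrite preimage_set0.
- by rewrite -preimage_bigcup; apply: mt.
Qed.

HB.instance Definition _ := isMeasure.Build _ _ _
  lebesgue_step step0 step_ge0 step_sigma_additive.

Let step_sigma_finite : sigma_finite setT lebesgue_step.
Proof.
have [F FT Fl] := sigma_finite_prod (@lebesgue_measure R) mu.
pose unc (t : n.+1.-tuple (measurableTypeR R)) :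
  measurableTypeR R * n.-tuple (measurableTypeR R) :=
  (thead t, [tuple of behead t]).
have munc : measurable_fun [set: _] unc.
  apply/measurable_fun_pair; first exact: measurable_tnth.
  exact: measurable_behead.
have uncK p : unc (tcons p) = p.
  by case: p => a t; congr pair; apply/val_inj.
exists (fun i => unc @^-1` F i).
  by rewrite -preimage_bigcup -FT preimage_setT.
move=> i; have [mFi lFi] := Fl i; split.
  by rewrite -[X in measurable X]setTI; exact: munc.
rewrite /lebesgue_step /pushforward.
rewrite (_ : _ @^-1` _ = F i) //.
by apply/seteqP; split => p /=; rewrite uncK.
Qed.

HB.instance Definition _ := @Measure_isSigmaFinite.Build _ _ _
  lebesgue_step step_sigma_finite.

End step.

Fixpoint lebesgue_tuple (n : nat) :
    {sigma_finite_measure set (n.-tuple (measurableTypeR R)) -> \bar R} :=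
  match n with
  | 0 => [the {sigma_finite_measure set _ -> \bar R} of dirac [tuple]]
  | n'.+1 => [the {sigma_finite_measure set _ -> \bar R} of
               lebesgue_step (lebesgue_tuple n')]
  end.

End tuple_lebesgue.

Section regularity.
Context {R : realType}.

(* Only used between finite-dimensional spaces, where continuity of all the
   directional derivatives amounts to continuity of the differential. *)
Fixpoint Ck {V W : normedModType R} (k : nat) (U : set V) (f : V -> W) : Prop :=
  match k with
  | 0 => forall x, U x -> {for x, continuous f}
  | k'.+1 => (forall x, U x -> differentiable f x) /\
             forall v : V, Ck k' U (fun x => 'D_v f x)
  end.

Definition holder_diff {V W : normedModType R} (alpha L : R) (U : set V)
    (f : V -> W) : Prop :=
  forall x y v, U x -> U y ->
    `|'D_v f x - 'D_v f y| <= L * `|x - y| `^ alpha * `|v|.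

Definition C1holder {V W : normedModType R} (alpha : R) (U : set V)
    (f : V -> W) : Prop :=
  Ck 1 U f /\ exists L : R, holder_diff alpha L U f.

End regularity.

Section geometry.
Context {R : realType}.

(* The library norm on row vectors is the sup norm. *)
Definition dot {N} (x y : 'rV[R]_N) : R := \sum_(i < N) x 0 i * y 0 i.
Definition enorm {N} (x : 'rV[R]_N) : R := Num.sqrt (dot x x).

Definition frontier {T : topologicalType} (A : set T) : set T :=
  closure A `\` interior A.

(* Near each of its boundary points, G is a superlevel set of a smooth function
   with nonzero gradient; in particular G lies on one side of its boundary. *)
Definition smooth_boundary {m} (G : set 'rV[R]_m) : Prop :=
  forall z, frontier G z ->
    exists (U : set 'rV[R]_m) (f : 'rV[R]_m -> R),
      [/\ open U, U z, forall k, Ck k U f,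
          exists v, 'D_v f z != 0 &
          forall p, U p -> (G p <-> 0 < f p)].

Definition C1holder_chart {N} (alpha : R) (U V : set 'rV[R]_N)
    (psi : 'rV[R]_N -> 'rV[R]_N) : Prop :=
  [/\ open U, open V, psi @` U = V, C1holder alpha U psi &
      exists theta : 'rV[R]_N -> 'rV[R]_N,
        (forall p, U p -> theta (psi p) = p) /\ C1holder alpha V theta].

(* From here on the ambient dimension N is n.+2, which encodes N >= 2, and the
   last coordinate x_N has index ord_max. *)

(* M is flattened near z, as an interior or as a boundary point of a
   hypersurface of class C^(1,alpha). *)
Definition interior_point {n} (alpha : R) (M : set 'rV[R]_n.+2)
    (z : 'rV[R]_n.+2) : Prop :=
  exists (U V : set 'rV[R]_n.+2) (psi : 'rV[R]_n.+2 -> 'rV[R]_n.+2),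
    [/\ C1holder_chart alpha U V psi, U z, M z &
        forall p, U p -> (M p <-> psi p 0 ord_max = 0)].

Definition boundary_point {n} (alpha : R) (M : set 'rV[R]_n.+2)
    (z : 'rV[R]_n.+2) : Prop :=
  exists (U V : set 'rV[R]_n.+2) (psi : 'rV[R]_n.+2 -> 'rV[R]_n.+2),
    [/\ C1holder_chart alpha U V psi, U z, M z, psi z 0 ord0 = 0 &
        forall p, U p ->
          (M p <-> psi p 0 ord_max = 0 /\ 0 <= psi p 0 ord0)].

Definition compact_hypersurface {n} (alpha : R) (M : set 'rV[R]_n.+2) : Prop :=
  compact M /\
  forall z, M z -> interior_point alpha M z \/ boundary_point alpha M z.

Definition manifold_boundary {n} (alpha : R) (M : set 'rV[R]_n.+2) :
  set 'rV[R]_n.+2 := [set z | boundary_point alpha M z].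

Definition inward_velocity {N} (M : set 'rV[R]_N) (p v : 'rV[R]_N) : Prop :=
  exists gamma : R -> 'rV[R]_N,
    [/\ gamma 0 = p, is_derive (0 : R) 1 gamma v &
        \forall t \near (0 : R)^'+, M (gamma t)].

(* At a boundary point the inward velocities only fill a half-space of the
   tangent space. *)
Definition tangent_space {N} (M : set 'rV[R]_N) (p : 'rV[R]_N) :
  set 'rV[R]_N :=
  [set v | inward_velocity M p v \/ inward_velocity M p (- v)].

Definition unit_normal_field {N} (M : set 'rV[R]_N)
    (nu : 'rV[R]_N -> 'rV[R]_N) : Prop :=
  [/\ {within M, continuous nu},
      forall z, M z -> enorm (nu z) = 1 &
      forall z v, M z -> tangent_space M z v -> dot v (nu z) = 0].

Definition orientable {N} (M : set 'rV[R]_N) : Prop :=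
  exists nu, unit_normal_field M nu.

(* Intersections of M with the segment [x; y], endpoints not counted. *)
Definition crossings {N} (M : set 'rV[R]_N) (x y : 'rV[R]_N) :
  set 'rV[R]_N :=
  [set p | M p /\ exists2 t : R, 0 < t < 1 & p = x + t *: (y - x)].

(* Non-tangency makes every intersection with the segment a cross one. *)
Definition odd_crossing {N} (M : set 'rV[R]_N) (x y : 'rV[R]_N) : Prop :=
  (forall p, crossings M x y p -> ~ tangent_space M p (y - x)) /\
  exists2 k : nat, odd k & (crossings M x y #= `I_k)%card.

Definition row_of {N} (t : N.-tuple (measurableTypeR R)) : 'rV[R]_N :=
  \row_(i < N) (tnth t i : R).

Definition fractional_area {N} (c s : R) (M Omega : set 'rV[R]_N) : \bar R :=
  (c%:E *
   \int[lebesgue_tuple N \x lebesgue_tuple N]_(p in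
       [set p | odd_crossing M (row_of p.1) (row_of p.2)])
     (Num.max (\1_Omega (row_of p.1)) (\1_Omega (row_of p.2))
        / enorm (row_of p.1 - row_of p.2) `^ (N%:R + s))%:E)%E.

(* A family of perturbations of M, fixing a neighbourhood of its boundary, whose
   velocity at time 0 along M is phi * nu.  Being C^1 in (t, x) and the identity
   off a compact set, Phi t is a diffeomorphism for small t; the bound uniform in
   t on the Hoelder seminorm keeps Phi t @` M in the class C^(1,alpha).  Since nu
   is merely of class C^alpha, the maps z |-> z + t * phi z * nu z would in
   general not even send M to a C^1 hypersurface. *)
Definition normal_variation {n} (alpha : R) (M : set 'rV[R]_n.+2)
    (nu : 'rV[R]_n.+2 -> 'rV[R]_n.+2) (phi : 'rV[R]_n.+2 -> R)
    (Phi : R -> 'rV[R]_n.+2 -> 'rV[R]_n.+2) : Prop :=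
  [/\ forall x, Phi 0 x = x,
      Ck 1 [set: R * 'rV[R]_n.+2] (fun p => Phi p.1 p.2),
      exists L : R,
        \forall t \near (0 : R), holder_diff alpha L [set: _] (Phi t),
      exists K : set 'rV[R]_n.+2,
        [/\ compact K, K `&` manifold_boundary alpha M = set0 &
            forall t x, ~ K x -> Phi t x = x] &
      forall z, M z -> is_derive (0 : R) 1 (Phi ^~ z) (phi z *: nu z)].

Definition critical_point {n} (c s alpha : R) (Omega M : set 'rV[R]_n.+2) :
  Prop :=
  forall nu phi Phi, unit_normal_field M nu ->
    normal_variation alpha M nu phi Phi ->
    is_derive (0 : R) 1
      (fun t => fine (fractional_area c s (Phi t @` M) Omega)) 0.

Definition hproj {n} (x : 'rV[R]_n.+2) : 'rV[R]_n.+1 :=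
  \row_(i < n.+1) x 0 (widen_ord (leqnSn n.+1) i).

Definition height0 {n} : set 'rV[R]_n.+2 := [set x | x 0 ord_max = 0].

Definition cylinder {n} (G : set 'rV[R]_n.+1) : set 'rV[R]_n.+2 :=
  [set x | G (hproj x)].

End geometry.

(* Main.v *)
From HB Require Import structures.
Require Import Defs.
From mathcomp Require Import all_boot all_order all_algebra finmap.
From mathcomp Require Import all_classical all_reals all_analysis.
From mathcomp Require Import measurable_realfun.
From mathcomp Require Import zify ring lra.
(** Suppose that M contains a point with x_N > 0, and let h be the maximal height
on M.  Since the boundary of M has height 0, points of M near the top are
interior points of the hypersurface, and since the tangent plane at a top
point is horizontal, M is the graph of a C^(1, alpha) function u above some
level k < h (global_graph).

Such a top can be lowered.  Replace the heights r above a level k1 > k by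
r - t eps g(r)^2, where g is a bump function.  This shrinks differences of
heights.  The resulting surfaces M_t are the images of M under a family of
maps whose initial velocity is normal to M (flow_velocity, flow_graph).  The
point is to keep the family of class C^1 although the normal is only
Hoelder continuous: the derivatives of u are replaced by difference quotients at
scale t, which become C^1 after multiplication by t (slope, tamed).

The area strictly decreases, at a linear rate.  Off a null set of pairs, whose
segments touch one of the graphs (touching_null, a form of Sard's theorem on
the line), the parities of the crossings of [x; y] with M and with M_t can
only differ when one of x, y lies in the swept region between the two graphs
and the other one does not (pair_parity, crossing_swap).  So the change of area is
controlled by two explicit integrals over pairs of points (loss, gain,
area_comparison).  On two vertical lines the kernel is an even function of
the difference of heights, and a rearrangement on the line shows that the area
does not increase when the difference of heights of the two graph points
shrinks (rectangle_exchange_wlog, integral_loss_gain).  Comparing a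
neighbourhood of the top with points far away gives a decrease of order t
(area_drop).  As the area is finite (area_density_finite), its derivative at
t = 0 cannot be 0, which contradicts criticality (not_critical).

The same argument upside down shows that M has no point with x_N < 0, so M is
contained in the hyperplane.  There M is relatively open away from the
frontier of G and closed, hence locally constant; across each frontier point
of G it fills exactly one of the two sides, because these points are boundary
points of M (one_side).  Hence the agreement of M with the closure of G
propagates from infinity, where both are empty (flat_hypersurfaceE). *)

Set Implicit Arguments.
Unset Strict Implicit.
Unset Printing Implicit Defensive.

Import Order.TTheory GRing.Theory Num.Theory.
Import numFieldNormedType.Exports.

Local Open Scope classical_set_scope.
Local Open Scope ring_scope.

(** * Preliminaries on normed spaces and coordinates *)
Section epsilon.
Context {R : realType}.

Lemma nbhs_normedP (V : normedModType R) (x : V) (P : set V) :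
  nbhs x P <-> exists2 d : R, 0 < d & forall y, `|y - x| < d -> P y.
Proof.
split=> [/nbhs_ballP[d /= d0 dP]|[d d0 dP]].
  by exists d => // y yd; apply: dP; rewrite -ball_normE /ball_/= distrC.
by apply/nbhs_ballP; exists d => //= y; rewrite -ball_normE /ball_/= distrC => /dP.
Qed.

Lemma continuous_normedP (V W : normedModType R) (f : V -> W) (x : V) :
  {for x, continuous f} <->
  forall e : R, 0 < e -> exists2 d : R, 0 < d &
    forall y, `|y - x| < d -> `|f y - f x| < e.
Proof.
split=> [cf e e0|H].
  apply/(nbhs_normedP x (fun y => `|f y - f x| < e)).
  move/cvgrPdist_lt : cf => /(_ e e0); rewrite nearE.
  by under eq_fun do rewrite distrC.
apply/cvgrPdist_lt => e /H/nbhs_normedP; rewrite nearE.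
by under eq_fun do rewrite distrC.
Qed.

Lemma open_normedP (V : normedModType R) (A : set V) :
  open A <-> forall x, A x -> exists2 d : R, 0 < d & forall y, `|y - x| < d -> A y.
Proof.
rewrite openE; split=> H x /H; first by move/nbhs_normedP.
by move=> ?; apply/nbhs_normedP.
Qed.

Lemma is_diff_normedP (V W : normedModType R) (f : V -> W) (df : {linear V -> W})
    (x : V) : continuous df ->
  is_diff x f df <->
  forall e : R, 0 < e -> exists2 d : R, 0 < d &
    forall y, `|y - x| < d -> `|f y - f x - df (y - x)| <= e * `|y - x|.
Proof.
move=> cdf; split=> [H e e0|H].
  have dfx : differentiable f x by exact: ex_diff.
  have dE : 'd f x = df :> (V -> W) by exact: diff_val.
  move/diff_locallyP : dfx => [_] /eqaddoP/(_ e e0) /nbhs_normedP[d d0 hd].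
  exists d => // y yd; have := hd (y - x); rewrite subr0 => /(_ yd).
  rewrite /= !fctE /= subrK dE; set u := (X in `|X| <= _ -> _).
  suff -> : u = f y - f x - df (y - x) by [].
  by rewrite /u opprD addrA.
have eqd : f \o shift x = cst (f x) + df +o_ 0 id.
  apply/eqaddoP => e e0; apply/nbhs_normedP; have [d d0 hd] := H e e0.
  exists d => // y; rewrite subr0 => yd; have := hd (y + x); rewrite addrK => /(_ yd).
  by rewrite /= !fctE opprD addrA.
have dE := diff_unique cdf eqd.
apply: DiffDef => //; apply/diff_locallyP; rewrite dE; split => //.
Qed.

End epsilon.

Lemma lipschitz_continuous {R : realType} {V W : normedModType R} (f : V -> W)
    (L : R) :
  (forall x y, `|f x - f y| <= L * `|x - y|) -> continuous f.
Proof.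
move=> fL x; apply/cvgrPdist_lt => e e0; near=> y.
have L0 : 0 < `|L| + 1 by rewrite ltr_pwDr.
rewrite (le_lt_trans (fL _ _))// (@le_lt_trans _ _ ((`|L| + 1) * `|x - y|))//.
  by rewrite ler_wpM2r// ler_wpDr// ler_norm.
rewrite -ltr_pdivlMl//; near: y; apply: cvgr_dist_lt => //.
by rewrite mulr_gt0// invr_gt0.
Unshelve. all: by end_near. Qed.

Section coordinates.
Context {R : realType} {n : nat}.
Implicit Types (sg : bool) (x y : 'rV[R]_n.+2) (w : 'rV[R]_n.+1).

(** The sign makes it possible to treat the part of M above the hyperplane
{x_N = 0} and the part below it at once. *)
Definition ht sg x : R := (-1) ^+ sg * x 0 ord_max.

Definition emb sg w (r : R) : 'rV[R]_n.+2 :=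
  \row_(i < n.+2) (if unlift ord_max i is Some j then w 0 j else (-1) ^+ sg * r).

Lemma widen_lift_max (i : 'I_n.+1) : widen_ord (leqnSn n.+1) i = lift ord_max i.
Proof. by apply/val_inj; rewrite /= /bump leqNgt ltn_ord. Qed.

Lemma hproj_emb sg w r : hproj (emb sg w r) = w.
Proof. by apply/rowP => i; rewrite !mxE widen_lift_max liftK. Qed.

Lemma ht_emb sg w r : ht sg (emb sg w r) = r.
Proof. by rewrite /ht mxE unlift_none mulrA -signr_addb addbb mul1r. Qed.

Lemma emb_hproj sg x : emb sg (hproj x) (ht sg x) = x.
Proof.
apply/rowP => i; rewrite mxE; case: unliftP => [j|] ->.
  by rewrite mxE widen_lift_max.
by rewrite /ht mulrA -signr_addb addbb mul1r.
Qed.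

Lemma hprojD x y : hproj (x + y) = hproj x + hproj y.
Proof. by apply/rowP => i; rewrite !mxE. Qed.

Lemma hprojB x y : hproj (x - y) = hproj x - hproj y.
Proof. by apply/rowP => i; rewrite !mxE. Qed.

Lemma hprojZ (k : R) x : hproj (k *: x) = k *: hproj x.
Proof. by apply/rowP => i; rewrite !mxE. Qed.

Lemma htD sg x y : ht sg (x + y) = ht sg x + ht sg y.
Proof. by rewrite /ht mxE mulrDr. Qed.

Lemma htN sg x : ht sg (- x) = - ht sg x.
Proof. by rewrite /ht mxE mulrN. Qed.

Lemma htB sg x y : ht sg (x - y) = ht sg x - ht sg y.
Proof. by rewrite htD htN. Qed.

Lemma htZ sg (k : R) x : ht sg (k *: x) = k * ht sg x.
Proof. by rewrite /ht mxE mulrCA. Qed.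

Lemma embD sg w w' r r' : emb sg (w + w') (r + r') = emb sg w r + emb sg w' r'.
Proof.
by apply/rowP => i; rewrite !mxE; case: unlift => [j|]; [rewrite mxE|exact: mulrDr].
Qed.

Lemma embB sg w w' r r' : emb sg (w - w') (r - r') = emb sg w r - emb sg w' r'.
Proof.
by apply/rowP => i; rewrite !mxE; case: unlift => [j|]; [rewrite !mxE|exact: mulrBr].
Qed.

Lemma embZ sg k w r : emb sg (k *: w) (k * r) = k *: emb sg w r.
Proof.
by apply/rowP => i; rewrite !mxE; case: unlift => [j|]; [rewrite mxE|exact: mulrCA].
Qed.

Lemma hproj_is_linear : linear (@hproj R n).
Proof. by move=> k x y; rewrite hprojD hprojZ. Qed.

HB.instance Definition _ :=
  GRing.isLinear.Build R 'rV[R]_n.+2 'rV[R]_n.+1 _ (@hproj R n) hproj_is_linear.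

Lemma ht_is_linear sg : linear (ht sg : _ -> R^o).
Proof. by move=> k x y; rewrite htD htZ. Qed.

HB.instance Definition _ sg :=
  GRing.isLinear.Build R 'rV[R]_n.+2 R^o _ (ht sg) (ht_is_linear sg).

Definition embp sg (p : 'rV[R]_n.+1 * R) := emb sg p.1 p.2.

Lemma emb_is_linear sg : linear (embp sg).
Proof. by move=> k [x r] [y s]; rewrite /embp /= -embZ -embD. Qed.

HB.instance Definition _ sg :=
  GRing.isLinear.Build R ('rV[R]_n.+1 * R^o)%type 'rV[R]_n.+2 _ (embp sg)
    (emb_is_linear sg).

Lemma norm_coord m (x : 'rV[R]_m) i : `|x 0 i| <= `|x|.
Proof. by rewrite [leRHS]/Num.Def.normr/= mx_normrE; exact: (le_bigmax _ _ (0, i)). Qed.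

Lemma norm_rV_le m (x : 'rV[R]_m) (c : R) :
  0 <= c -> (forall i, `|x 0 i| <= c) -> `|x| <= c.
Proof.
move=> c0 h; rewrite [leLHS]/Num.Def.normr/= mx_normrE bigmax_le// => -[i j] _.
by rewrite ord1.
Qed.

Lemma norm_hproj x : `|hproj x| <= `|x|.
Proof. by apply: norm_rV_le => // i; rewrite mxE; exact: norm_coord. Qed.

Lemma norm_ht sg x : `|ht sg x| <= `|x|.
Proof. by rewrite normrM normrX normrN1 expr1n mul1r; exact: norm_coord. Qed.

Lemma norm_emb sg w r : `|emb sg w r| <= Num.max `|w| `|r|.
Proof.
apply: norm_rV_le => [|i]; first by rewrite le_max normr_ge0.
rewrite mxE le_max; case: unlift => [j|]; first by rewrite norm_coord.
by rewrite normrM normrX normrN1 expr1n mul1r lexx orbT.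
Qed.

Lemma continuous_hproj : continuous (@hproj R n).
Proof.
apply: (@lipschitz_continuous _ _ _ _ 1) => x y; rewrite mul1r -hprojB.
exact: norm_hproj.
Qed.

Lemma continuous_ht sg : continuous (ht sg : 'rV[R]_n.+2 -> R).
Proof.
apply: (@lipschitz_continuous _ _ _ _ 1) => x y; rewrite mul1r -htB.
exact: norm_ht.
Qed.

Lemma continuous_embp sg : continuous (embp sg).
Proof.
apply: (@lipschitz_continuous _ _ _ _ 1) => x y; rewrite mul1r.
have -> : embp sg x - embp sg y = emb sg (x.1 - y.1) (x.2 - y.2).
  by rewrite /embp embB.
exact: norm_emb.
Qed.

Lemma is_diff_hproj x : is_diff x (@hproj R n) (@hproj R n).
Proof.
apply: DiffDef; first exact: (linear_differentiable _ (@continuous_hproj)).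
by rewrite (diff_lin _ (@continuous_hproj)).
Qed.

Lemma is_diff_ht sg x : is_diff x (ht sg : _ -> R) (ht sg).
Proof.
apply: DiffDef; first exact: (linear_differentiable _ (@continuous_ht sg)).
by rewrite (diff_lin _ (@continuous_ht sg)).
Qed.

Lemma is_diff_embp sg (p : 'rV[R]_n.+1 * R) : is_diff p (embp sg) (embp sg).
Proof.
apply: DiffDef; first exact: (linear_differentiable _ (@continuous_embp sg)).
by rewrite (diff_lin _ (@continuous_embp sg)).
Qed.

Lemma dot_emb sg w w' r r' : dot (emb sg w r) (emb sg w' r') = dot w w' + r * r'.
Proof.
rewrite /dot (bigD1 ord_max)//= !mxE unlift_none addrC; congr (_ + _).
  rewrite (reindex (lift ord_max)) /=; last first.
    exists (fun i => odflt ord0 (unlift ord_max i)) => i; first by rewrite liftK.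
    by case: (unliftP ord_max i) => [j ->|->]; rewrite ?liftK// inE eqxx.
  apply: eq_big => [i|i _]; first by rewrite eq_sym neq_lift.
  by rewrite !mxE liftK.
by rewrite mulrACA -signr_addb addbb mul1r.
Qed.

End coordinates.

Import HBNNSimple.

(** * Integrals of functions that need not be measurable *)
Section lower_integral.
Context d (T : measurableType d) (R : realType) (mu : {measure set T -> \bar R}).
Local Open Scope ereal_scope.

Lemma ge0_integral_le_simple (f : T -> \bar R) (c : \bar R) :
  (forall x, 0 <= f x) ->
  (forall h : {nnsfun T >-> R}, (forall x, (h x)%:E <= f x) ->
    \int[mu]_x (h x)%:E <= c) -> \int[mu]_x f x <= c.
Proof.
move=> f0 H; rewrite ge0_integralTE//; apply: ge_ereal_sup => _ /= [h hf <-].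
by rewrite -integralT_nnsfun; exact: H.
Qed.

Lemma ge0_integral_ge_measurable (f g : T -> \bar R) :
  measurable_fun [set: _] g -> (forall x, 0 <= g x) -> (forall x, g x <= f x) ->
  \int[mu]_x g x <= \int[mu]_x f x.
Proof.
move=> mg g0 gf; have f0 x : 0 <= f x by exact: le_trans (gf x).
rewrite !ge0_integralTE//; apply: le_ereal_sup => _ /= [h hg <-].
by exists h => //= x; exact: le_trans (gf x).
Qed.

Lemma ge0_le_integral_nonmeasurable (f g : T -> \bar R) :
  (forall x, 0 <= f x) -> (forall x, f x <= g x) ->
  \int[mu]_x f x <= \int[mu]_x g x.
Proof.
move=> f0 fg; have g0 x : 0 <= g x by exact: le_trans (fg x).
rewrite !ge0_integralTE//; apply: le_ereal_sup => _ /= [h hg <-].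
by exists h => //= x; exact: le_trans (fg x).
Qed.

(** The density of the fractional area is not known to be measurable, so that
its integral can neither be split nor subtracted.  It is the supremum of the
integrals of the simple functions below it; replacing the value of a simple
function by a on D and by itself off D uses only measurable functions, and
yields the comparison of f and g from that of the measurable functions a and
b, which live on D. *)
Lemma integral_exchange_le (f g a b : T -> \bar R) (D N : set T) (e : R) :
  measurable D -> measurable N -> mu N = 0 ->
  measurable_fun [set: _] a -> measurable_fun setT b ->
  (forall x, 0 <= f x) -> (forall x, 0 <= g x) ->
  (forall x, 0 <= a x) -> (forall x, 0 <= b x) ->
  (forall x, ~ N x -> ~ D x -> g x <= f x) ->
  (forall x, ~ N x -> D x -> g x <= a x) ->
  (forall x, ~ N x -> D x -> b x <= f x) ->
  (forall x, ~ N x -> ~ D x -> b x = 0) ->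
  \int[mu]_x a x + e%:E <= \int[mu]_x b x ->
  \int[mu]_x g x + e%:E <= \int[mu]_x f x.
Proof.
move=> mD mN N0 ma mb f0 g0 a0 b0 gf ga bf bD aeb.
rewrite -leeBrDr//; apply: ge0_integral_le_simple => // h hg.
rewrite leeBrDr//.
pose A := ~` D `\` N; pose B := D `\` N.
have mA : measurable A by apply: measurableD => //; exact: measurableC.
have mB : measurable B by exact: measurableD.
have mh (E : set T) : measurable_fun E (EFin \o h).
  by apply/measurable_EFinP; exact: measurable_funTS.
have AB : setT `\` N = A `|` B by rewrite -setDUl setUC setUv.
have dAB : [disjoint A & B].
  by apply/disj_setPS => x [[? _] [? _]].
rewrite (@ge0_negligible_integral _ _ _ _ _ N)//; last first.
  by move=> x _; rewrite lee_fin.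
rewrite AB ge0_integral_setU//; last first.
- by move=> x _; rewrite lee_fin.

apply: (@le_trans _ _ (\int[mu]_(x in A) (h x)%:E + \int[mu]_x b x)).
  rewrite -addeA leeD2l//; apply: le_trans aeb; rewrite leeD2r//.
  apply: (@le_trans _ _ (\int[mu]_(x in B) a x)).
    apply: ge0_le_integral => //.
    - by move=> x _; rewrite lee_fin.
    - exact: measurable_funTS.
    - by move=> x [Dx Nx]; exact: le_trans (hg x) (ga _ Nx Dx).
  by apply: ge0_subset_integral.
have -> : \int[mu]_x b x = \int[mu]_(x in B) b x.
  rewrite (@ge0_negligible_integral _ _ _ _ _ N)// AB ge0_integral_setU//.
    by rewrite integral0_eq ?add0e// => x [Dx Nx]; exact: bD.
  exact: measurable_funTS.
rewrite integral_mkcond [X in _ + X]integral_mkcond.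
have mhA : measurable_fun [set: _] ((EFin \o h) \_ A).
  exact/(measurable_restrictT _ mA).1.
have mbB : measurable_fun [set: _] (b \_ B).
  by apply/(measurable_restrictT _ mB).1; exact: measurable_funTS.
have hA0 x : 0 <= ((EFin \o h) \_ A) x.
  by rewrite patchE; case: ifPn => // _; rewrite /= lee_fin.
have bB0 x : 0 <= (b \_ B) x by rewrite patchE; case: ifPn.
rewrite -ge0_integralD//.
apply: ge0_integral_ge_measurable.
- exact: emeasurable_funD.
- by move=> x; rewrite adde_ge0.
move=> x; rewrite !patchE; case: ifPn => xA; case: ifPn => xB.
- by case/set_mem: xA => + _; case/set_mem: xB.
- by rewrite adde0; case/set_mem: xA => /gf H /H; exact: le_trans (hg x).
- by rewrite add0e; case/set_mem: xB => Dx Nx; exact: bf.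
- by rewrite adde0.
Qed.

End lower_integral.

(** * Lebesgue measure on rows, last coordinate first *)
Section last_coordinate.
Context {R : realType}.
Local Open Scope ereal_scope.
Local Notation mT := (measurableTypeR R).
Local Notation mu := (@lebesgue_tuple R).

Lemma integral_lebesgue_tupleS n (f : n.+1.-tuple mT -> \bar R) :
  measurable_fun [set: _] f -> (forall x, 0 <= f x) ->
  \int[mu n.+1]_x f x =
  \int[@lebesgue_measure R]_r \int[mu n]_t f (tcons (r, t)).
Proof.
move=> mf f0; transitivity (\int[lebesgue_step (mu n)]_x f x) => //.
rewrite /lebesgue_step ge0_integral_pushforward//; last exact: measurable_tcons.
rewrite preimage_setT fubini_tonelli1//.
  by apply: measurableT_comp => //; exact: measurable_tcons.
by move=> x; exact: f0.
Qed.

Definition trcons {n} (t : n.-tuple mT) (r : mT) : n.+1.-tuple mT :=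
  [tuple of rcons t r].

Lemma measurable_trcons n :
  measurable_fun [set: _] (fun p : n.-tuple mT * mT => trcons p.1 p.2).
Proof.
elim: n => [|n IH].
  rewrite (_ : (fun p => _) = fun p => tcons (p.2, p.1)).
    apply: measurableT_comp; first exact: measurable_tcons.
    by apply: measurable_fun_pair.
  by apply/funext => -[t r]; apply/val_inj; rewrite /= tuple0.
rewrite (_ : (fun p => _) = fun p : n.+1.-tuple mT * mT =>
    tcons (thead p.1, trcons [tuple of behead p.1] p.2)).
  apply: measurableT_comp; first exact: measurable_tcons.
  apply: measurable_fun_pair.
    by apply: measurableT_comp => //; exact: measurable_tnth.
  have mg : measurable_fun [set: _] (fun p : n.+1.-tuple mT * mT =>
      ([tuple of behead p.1] : n.-tuple mT, p.2)).
    apply: measurable_fun_pair => //.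
    exact: (measurableT_comp (@measurable_behead _ mT n) measurable_fst).
  exact: (measurableT_comp IH mg).
by apply/funext => -[[[//|a s] ts] r]; apply: val_inj.
Qed.

Lemma measurable_trcons_comp n (f : n.+1.-tuple mT -> \bar R) :
  measurable_fun [set: _] f ->
  measurable_fun [set: _] (fun p : n.-tuple mT * mT => f (trcons p.1 p.2)).
Proof. by move=> mf; apply: measurableT_comp => //; exact: measurable_trcons. Qed.

Lemma integral_lebesgue_tuple_last n (f : n.+1.-tuple mT -> \bar R) :
  measurable_fun [set: _] f -> (forall x, 0 <= f x) ->
  \int[mu n.+1]_x f x =
  \int[mu n]_t \int[@lebesgue_measure R]_r f (trcons t r).
Proof.
have mF k (g : k.+1.-tuple mT -> \bar R) : measurable_fun [set: _] g ->
    (forall x, 0 <= g x) -> measurable_fun [set: _] (fun t =>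
      \int[@lebesgue_measure R]_r g (trcons t r)).
  move=> mg g0; apply: (measurable_fun_fubini_tonelli_F
    (fun p : k.-tuple mT * mT => g (trcons p.1 p.2))) => //.
  exact: measurable_trcons_comp.
elim: n f => [|n IH] f mf f0.
  rewrite integral_lebesgue_tupleS// /= integral_dirac//; last exact: mF.
  rewrite diracT mul1e; apply: eq_integral => r _; rewrite integral_dirac//; last first.
    apply: measurableT_comp => //.
    apply: (measurableT_comp (@measurable_tcons R _)).
    exact: measurable_fun_pair.
  by rewrite diracT mul1e; congr f; apply/val_inj.
rewrite integral_lebesgue_tupleS//.
under eq_integral.
  move=> r _; rewrite IH//; last first.
    apply: measurableT_comp => //.
    apply: (measurableT_comp (@measurable_tcons R _)).
    exact: measurable_fun_pair.
  over.
have RE := @integral_lebesgue_tupleS n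
  (fun t => \int[@lebesgue_measure R]_r f (trcons t r)) (mF _ _ mf f0)
  (fun t => integral_ge0 _ (fun r _ => f0 (trcons t r))).
apply/esym; apply: (etrans RE).
apply: eq_integral => r _; apply: eq_integral => t _; apply: eq_integral => r' _.
by congr f; apply/val_inj.
Qed.

End last_coordinate.

Section measurable_vectors.
Context {R : realType} d (T : measurableType d).
Local Notation mT := (measurableTypeR R).

Definition measurable_vec {N} (x : T -> 'rV[R]_N) : Prop :=
  forall i, measurable_fun [set: T] (fun t => x t 0 i).

Lemma measurable_vec_box N (x : T -> 'rV[R]_N) (c : 'I_N -> R) (r : R) :
  measurable_vec x -> measurable [set t | forall i, `|x t 0 i - c i| < r].
Proof.
move=> mx.
rewrite (_ : [set t | _] = \bigcap_(i in [set: 'I_N]) [set t | `|x t 0 i - c i| < r]).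
  apply: fin_bigcap_measurable; first exact: finite_finset.
  move=> i _; rewrite -[X in measurable X]setTI.
  apply: measurable_fun_ltr => //.
  by apply: measurableT_comp => //; exact: measurable_funB.
by apply/seteqP; split => t /= h => [i _|i]; exact: h.
Qed.

Lemma measurable_continuous_vec N (f : 'rV[R]_N -> R) (x : T -> 'rV[R]_N) :
  continuous f -> measurable_vec x -> measurable_fun [set: T] (fun t => f (x t)).
Proof.
move=> cf mx; apply: (measurability _ (RGenOInfty.measurableE R)) => // _ [_ [a ->] <-].
rewrite setTI.
pose box (p : 'rV[rat]_N * nat) : set 'rV[R]_N :=
  [set y | forall i, `|y 0 i - ratr (p.1 0 i)| < p.2.+1%:R^-1].
pose F p := if `[< box p `<=` [set y | a < f y] >] then [set t | box p (x t)] else set0.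
rewrite (_ : _ @^-1` _ = \bigcup_p F p).
  apply: countable_bigcupT_measurable => // p; rewrite /F; case: asboolP => // _.
  exact: (measurable_vec_box (fun i => ratr (p.1 0 i)) _ mx).
apply/seteqP; split => [t /=|t [p _]]; last first.
  rewrite /F; case: asboolP => // H /H /=.
  by rewrite in_itv/= andbT.
rewrite in_itv/= andbT => aft.
have [e e0 He] : exists2 e : R, 0 < e & forall y, `|y - x t| < e -> a < f y.
  have [d1 d0 hd] := (continuous_normedP _ _).1 (cf (x t)) (f (x t) - a) ltac:(by rewrite subr_gt0).
  by exists d1 => // y /hd; rewrite ltr_norml => /andP[]; lra.
have [k _ ke] : \forall k \near \oo, (k.+1%:R^-1 : R) < e / 3.
  by apply: near_infty_natSinv_lt (PosNum (divr_gt0 e0 _)).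
have {}ke := ke k (leqnn k).
have k0 : 0 < k.+1%:R^-1 :> R by rewrite invr_gt0.
have /choice[q hq] : forall i, exists q : rat, `|x t 0 i - ratr q| < k.+1%:R^-1.
  move=> i; have [q] := @rat_in_itvoo R (x t 0 i - k.+1%:R^-1) (x t 0 i + k.+1%:R^-1) ltac:(by rewrite ltrBlDr -addrA ltrDl addr_gt0).
  rewrite in_itv/= => /andP[q1 q2]; exists q.
  by rewrite distrC ltr_distl q1 q2.
exists (\row_i q i, k) => //; rewrite /F; case: asboolP => /= [_ i|].
  by rewrite mxE; exact: hq.
case=> y hy; apply: He.
move: ke k0; set dlt := k.+1%:R^-1 => ke k0.
rewrite (@le_lt_trans _ _ (2 * dlt))//; last by lra.
apply: norm_rV_le => [|i]; first by lra.
move: (hy i) (hq i); rewrite !mxE /= -/dlt !ltr_norml => /andP[? ?] /andP[? ?].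
by rewrite ler_norml; lra.
Qed.

End measurable_vectors.

Section lebesgue_box.
Context {R : realType}.
Local Notation mT := (measurableTypeR R).
Local Notation mu := (@lebesgue_tuple R).

Lemma measurable_row_of N : measurable_vec (fun t : N.-tuple mT => row_of t).
Proof.
move=> i; rewrite (_ : (fun t => _) = (fun t => tnth t i)).
  exact: measurable_tnth.
by apply/funext => t; rewrite mxE.
Qed.

Local Open Scope ereal_scope.

Lemma lebesgue_tuple_box N (c : 'I_N -> R) (r : R) : (0 <= r)%R ->
  mu N [set t | forall i, (`|row_of t 0 i - c i| <= r)%R] = ((2 * r) ^+ N)%:E.
Proof.
move=> r0; elim: N c => [|N IH] c.
  by rewrite expr0 /= /dirac indicE mem_set// => -[].
rewrite [LHS]/= /lebesgue_step /pushforward.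
have mbox : measurable [set t : N.-tuple mT | forall i,
    (`|row_of t 0 i - c (lift ord0 i)| <= r)%R].
  rewrite (_ : [set t | _] = \bigcap_(i in [set: 'I_N])
      [set t | (`|row_of t 0 i - c (lift ord0 i)| <= r)%R]).
    apply: fin_bigcap_measurable; first exact: finite_finset.
    move=> i _; rewrite -[X in measurable X]setTI.
    apply: measurable_fun_ler => //.
    apply: measurableT_comp => //; apply: measurable_funB => //.
    exact: measurable_row_of.
  by apply/seteqP; split => t /= h => [i _|i]; exact: h.
rewrite (_ : _ @^-1` _ = `[(c ord0 - r)%R, (c ord0 + r)%R]%classic `*`
    [set t | forall i, (`|row_of t 0 i - c (lift ord0 i)| <= r)%R]).
  rewrite product_measure1E ?IH//.
  rewrite [X in X * _](@lebesgue_measure_itv R `[(c ord0 - r)%R, (c ord0 + r)%R])/=.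
  rewrite lte_fin exprS.
  case: ifPn => [_|]; first by rewrite -EFinB -EFinM; congr (_%:E); ring.
  rewrite -leNgt => h; have -> : r = 0%R by lra.
  by rewrite mulr0 mul0r mul0e.
apply/seteqP; split => [[a t] /= h|[a t] /= [+ h] i].
  split=> [|i].
    by have := h ord0; rewrite mxE tnth0 in_itv/= ler_distl.
  by have := h (lift ord0 i); rewrite !mxE tnthS.
rewrite in_itv/= => ha.
have [j ->|->] := unliftP ord0 i; last first.
  by rewrite mxE /tcons tnth0 ler_distl.
by have := h j; rewrite !mxE /tcons tnthS.
Qed.

End lebesgue_box.

(** * Rearrangement of an even kernel on the line *)
Section line_invariance.
Context {R : realType}.
Local Notation mT := (measurableTypeR R).
Local Notation leb := (@lebesgue_measure R).
Local Open Scope ereal_scope.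

Definition translate (c : R) : mT -> mT := fun x => (x + c)%R.

Lemma measurable_translate c : measurable_fun [set: mT] (translate c).
Proof. exact: measurable_funD. Qed.

HB.instance Definition _ c :=
  isMeasurableFun.Build _ _ mT mT (translate c) (measurable_translate c).

Lemma lebesgue_measure_shift (c : R) (A : set R) : measurable A ->
  pushforward leb (translate c) A = leb A.
Proof.
move=> mA; apply/esym/lebesgue_measure_unique => //= _ [[a b]] _ <-.
rewrite /pushforward (_ : _ @^-1` _ = `](a - c)%R, (b - c)%R]%classic).
  by rewrite !lebesgue_measure_itv/= !lte_fin ltrD2r -!EFinB; case: ifP => // _; congr (_%:E); ring.
by apply/seteqP; split => x /=; rewrite !in_itv/= ltrBlDr lerBrDr.
Qed.

Lemma integral_shift (c : R) (f : R -> \bar R) :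
  measurable_fun [set: mT] f -> (forall x, 0 <= f x) ->
  \int[leb]_x f (x + c)%R = \int[leb]_x f x.
Proof.
move=> mf f0.
have mc := measurable_translate c.
rewrite [RHS](@eq_measure_integral _ _ _ _ (pushforward leb (translate c))).
  by rewrite ge0_integral_pushforward// preimage_setT.
by move=> /= A mA _; exact/esym/lebesgue_measure_shift.
Qed.

Lemma integral_opp (f : R -> \bar R) :
  measurable_fun [set: mT] f -> (forall x, 0 <= f x) ->
  \int[leb]_x f (- x)%R = \int[leb]_x f x.
Proof.
move=> mf f0.
have mc : measurable_fun [set: mT] ((fun x => - x)%R : mT -> mT).
  exact: oppr_measurable.
rewrite [RHS](@eq_measure_integral _ _ _ _ (pushforward leb ((fun x => - x)%R : mT -> mT))).
  by rewrite ge0_integral_pushforward// preimage_setT.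
by move=> /= A mA _; exact/esym/lebesgue_measureN.
Qed.

Lemma integral_refl (c : R) (f : R -> \bar R) :
  measurable_fun [set: mT] f -> (forall x, 0 <= f x) ->
  \int[leb]_x f (c - x)%R = \int[leb]_x f x.
Proof.
move=> mf f0; rewrite -[RHS]integral_opp// -[RHS](integral_shift (- c))//.
  by apply: eq_integral => x _; rewrite opprD opprK addrC.
by apply: measurableT_comp => //; exact: oppr_measurable.
Qed.

End line_invariance.

Section even_kernel.
Context {R : realType}.
Local Notation mT := (measurableTypeR R).
Local Notation leb := (@lebesgue_measure R).
Local Open Scope ereal_scope.
Variable k : mT -> \bar R.
Hypothesis mk : measurable_fun [set: mT] k.
Hypothesis k_ge0 : forall x, 0 <= k x.
Hypothesis k_even : forall x, k (- x)%R = k x.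

Definition tail (r : R) : \bar R := \int[leb]_q (if (r < q)%R then k q else 0).

Lemma tail_ge0 r : 0 <= tail r.
Proof. by apply: integral_ge0 => q _; case: ifP. Qed.

Lemma measurable_tail_fun r :
  measurable_fun [set: mT] (fun q : mT => if (r < q)%R then k q else 0).
Proof.
by apply: measurable_fun_ifT => //; exact: measurable_fun_ltr.
Qed.

Lemma measurable_tail : measurable_fun [set: mT] (tail : mT -> \bar R).
Proof.
apply: (measurable_fun_fubini_tonelli_F
  (fun p : mT * mT => if (p.1 < p.2)%R then k p.2 else 0)).
  apply: measurable_fun_ifT => //; first exact: measurable_fun_ltr.
  exact: measurableT_comp.
by move=> x; case: ifP.
Qed.

Lemma tail_le r s : (r <= s)%R -> tail s <= tail r.
Proof.
move=> rs; apply: ge0_le_integral_nonmeasurable => q; first by case: ifP.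
by case: ifPn => [/(le_lt_trans rs)->//|_]; case: ifP.
Qed.

Lemma integral_below (x b : R) :
  \int[leb]_y (if (y < b)%R then k (x - y)%R else 0) = tail (x - b).
Proof.
rewrite -[RHS](integral_refl x)//; last 2 first.
- exact: measurable_tail_fun.
- by move=> q; case: ifP.
by apply: eq_integral => y _; rewrite ltrD2l ltrN2.
Qed.

Lemma integral_above (x b : R) :
  \int[leb]_y (if (b < y)%R then k (x - y)%R else 0) = tail (b - x).
Proof.
rewrite -[RHS](integral_shift (- x)%R)//; last 2 first.
- exact: measurable_tail_fun.
- by move=> q; case: ifP.
by apply: eq_integral => y _; rewrite ltrD2r -[in LHS]k_even opprB.
Qed.

Definition tail_on (u v : R) : \bar R :=
  \int[leb]_r (if (u < r <= v)%R then tail r else 0).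

Lemma measurable_if_itv (u v : mT) (f : mT -> \bar R) :
  measurable_fun [set: mT] f ->
  measurable_fun [set: mT] (fun r : mT => if (u < r <= v)%R then f r else 0).
Proof.
move=> mf; apply: measurable_fun_ifT => //.
by apply: measurable_and; [exact: measurable_fun_ltr|exact: measurable_fun_ler].
Qed.

Lemma tail_on_shift c u v :
  \int[leb]_r (if (u < r <= v)%R then tail (r - c) else 0) = tail_on (u - c) (v - c).
Proof.
rewrite -[RHS](integral_shift (- c)%R)//; last 2 first.
- by apply: measurable_if_itv; exact: measurable_tail.
- by move=> r; case: ifP => // _; exact: tail_ge0.
by apply: eq_integral => r _; rewrite ltrD2r lerD2r.
Qed.

Lemma tail_on_refl c u v :
  \int[leb]_r (if (u <= r < v)%R then tail (c - r) else 0) = tail_on (c - v) (c - u).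
Proof.
rewrite -[RHS](integral_refl c)//; last 2 first.
- by apply: measurable_if_itv; exact: measurable_tail.
- by move=> r; case: ifP => // _; exact: tail_ge0.
by apply: eq_integral => r _; rewrite ltrD2l lerD2l ltrN2 lerN2 andbC.
Qed.

Lemma tail_on_split u v w : (u <= v <= w)%R ->
  tail_on u w = tail_on u v + tail_on v w.
Proof.
move=> /andP[uv vw]; rewrite -ge0_integralD//; last 4 first.
- by move=> r _; case: ifP => // _; exact: tail_ge0.
- by apply: measurable_if_itv; exact: measurable_tail.
- by move=> r _; case: ifP => // _; exact: tail_ge0.
- by apply: measurable_if_itv; exact: measurable_tail.
apply: eq_integral => r _; case: (leP r v) => rv.
  by rewrite (le_trans rv vw) /= adde0.
by rewrite (le_lt_trans uv rv) /= add0e.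
Qed.

(** Reflection at the origin turns the window [-p, -p'] into [p', p]; the tail
is larger on the left, and by at least kap at distance p' from the origin. *)
Lemma tail_on_flip (p' p kap : R) : (0 <= p' <= p)%R -> (0 <= kap)%R ->
  tail p' + kap%:E <= tail (- p')%R ->
  tail_on p' p + ((p - p') * kap)%:E <= tail_on (- p) (- p').
Proof.
move=> /andP[p'0 p'p] kap0 hkap.
have -> : ((p - p') * kap)%:E = \int[leb]_r (if (p' < r <= p)%R then kap%:E else 0).
  transitivity (\int[leb]_(r in `]p', p]) kap%:E).
    rewrite integral_cst//= lebesgue_measure_itv/= lte_fin -EFinB.
    case: ltP => [_|pp']; first by rewrite -EFinM mulrC.
    have -> : (p - p' = 0)%R by apply/eqP; rewrite subr_eq0 eq_le pp' p'p.
    by rewrite mul0r mule0.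
  rewrite integral_mkcond; apply: eq_integral => r _.
  by rewrite patchE mem_setE in_itv.
rewrite -ge0_integralD//; last 4 first.
- by move=> r _; case: ifP => // _; exact: tail_ge0.
- by apply: measurable_if_itv; exact: measurable_tail.
- by move=> r _; case: ifP.
- exact: measurable_if_itv.
have -> : tail_on (- p) (- p') =
    \int[leb]_r (if (p' < r <= p)%R then tail (r - (p + p'))%R else 0).
  by rewrite tail_on_shift; congr tail_on; ring.
apply: ge0_le_integral_nonmeasurable => r.
  by rewrite adde_ge0//; case: ifP => // _; exact: tail_ge0.
case: ifP => [/andP[p'r rp]|]; last by rewrite adde0.
apply: (@le_trans _ _ (tail p' + kap%:E)); first by rewrite leeD2r// tail_le// ltW.
by apply: le_trans hkap _; apply: tail_le; lra.
Qed.

(** Each of the four terms is the integral of the tail over a window.  With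
p' = a' - b' and p = a - b, the windows of the two sides cancel, except for
[p', p] on the left and its mirror image [-p, -p'] on the right, which
tail_on_flip compares. *)
Lemma tail_exchange (a a' b b' kap : R) :
  (b <= a)%R -> (b' <= a')%R -> (a' <= a)%R -> (b' <= b)%R ->
  (a' - b' <= a - b)%R -> (0 <= kap)%R ->
  tail (a' - b') + kap%:E <= tail (b' - a') ->
  \int[leb]_x (if (a' < x <= a)%R then tail (x - b') else 0) +
  \int[leb]_y (if (b' < y <= b)%R then tail (y - a') else 0) +
    (((a - b) - (a' - b')) * kap)%:E <=
  \int[leb]_x (if (a' <= x < a)%R then tail (b - x) else 0) +
  \int[leb]_y (if (b' <= y < b)%R then tail (a - y) else 0).
Proof.
move=> ba b'a' a'a b'b pp kap0 hkap.
rewrite !tail_on_shift !tail_on_refl.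
rewrite (@tail_on_split (a' - b') (a - b))%R; last by apply/andP; split; lra.
rewrite (@tail_on_split (b - a) (b' - a'))%R; last by apply/andP; split; lra.
have H : tail_on (a' - b') (a - b) + (((a - b) - (a' - b')) * kap)%:E <=
    tail_on (b - a) (b' - a').
  rewrite -[(b - a)%R]opprB -[(b' - a')%R]opprB; apply: tail_on_flip => //.
    by apply/andP; split; lra.
  by rewrite opprB.
have rearrange (x1 x2 x3 y1 g : \bar R) : x1 + g <= y1 ->
    x1 + x2 + x3 + g <= y1 + x3 + x2.
  move=> h; rewrite [leLHS]addeAC [X in X + _]addeAC [leLHS]addeAC.
  by rewrite leeD2r// leeD2r.
exact: rearrange.
Qed.

(** One-dimensional form of the area estimate.  On two vertical lines, a graph
is lowered from heights a, b to a', b', and the height difference shrinks.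
The pairs that the new graph separates and the old one does not are on the
left, those of the opposite kind on the right. *)
Lemma rectangle_exchange_wlog (a a' b b' kap : R) :
  (b <= a)%R -> (b' <= a')%R -> (a' <= a)%R -> (b' <= b)%R ->
  (a' - b' <= a - b)%R -> (0 <= kap)%R ->
  tail (a' - b') + kap%:E <= tail (b' - a') ->
  \int[leb]_x \int[leb]_y ((if (a' < x <= a)%R && (y < b')%R then k (x - y)%R else 0) +
    (if (x < a')%R && (b' < y <= b)%R then k (x - y)%R else 0)) +
    (((a - b) - (a' - b')) * kap)%:E <=
  \int[leb]_x \int[leb]_y ((if (a' <= x < a)%R && (b < y)%R then k (x - y)%R else 0) +
    (if (a < x)%R && (b' <= y < b)%R then k (x - y)%R else 0)).
Proof.
move=> ba b'a' a'a b'b pp kap0 hkap.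
have mkd : measurable_fun [set: mT * mT] (fun p : mT * mT => k (p.1 - p.2)%R).
  by apply: measurableT_comp => //; exact: measurable_funB.
have mP (P : mT * mT -> bool) : measurable_fun [set: mT * mT] P ->
    measurable_fun [set: mT * mT] (fun p => if P p then k (p.1 - p.2)%R else 0).
  by move=> ?; exact: measurable_fun_ifT.
have split2 (P Q : mT -> mT -> bool) :
    measurable_fun [set: mT * mT] (fun p : mT * mT => P p.1 p.2) ->
    measurable_fun [set: mT * mT] (fun p : mT * mT => Q p.1 p.2) ->
    \int[leb]_x \int[leb]_y ((if P x y then k (x - y)%R else 0) +
      (if Q x y then k (x - y)%R else 0)) =
    \int[leb]_x \int[leb]_y (if P x y then k (x - y)%R else 0) +
    \int[leb]_y \int[leb]_x (if Q x y then k (y - x)%R else 0).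
  move=> /mP mP1 /mP mQ1.
  pose fP := fun p : mT * mT => if P p.1 p.2 then k (p.1 - p.2)%R else 0.
  pose fQ := fun p : mT * mT => if Q p.1 p.2 then k (p.1 - p.2)%R else 0.
  have fP0 p : 0 <= fP p by rewrite /fP; case: ifP.
  have fQ0 p : 0 <= fQ p by rewrite /fQ; case: ifP.
  transitivity (\int[leb]_x (\int[leb]_y fP (x, y) + \int[leb]_y fQ (x, y))).
    apply: eq_integral => x _; rewrite -ge0_integralD//.
    - exact: measurableT_comp.
    - exact: measurableT_comp.
  rewrite ge0_integralD; last 5 first.
  - exact: measurableT.
  - by move=> x _; apply: integral_ge0 => y _; exact: fP0.
  - exact: (measurable_fun_fubini_tonelli_F fP mP1 fP0).
  - by move=> x _; apply: integral_ge0 => y _; exact: fQ0.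
  - exact: (measurable_fun_fubini_tonelli_F fQ mQ1 fQ0).
  congr (_ + _); rewrite (fubini_tonelli fQ mQ1 fQ0).
  apply: eq_integral => y _; apply: eq_integral => x _.
  by rewrite /fQ /= -[in LHS]k_even opprB.
have pull (P Q : bool) (v : \bar R) :
    (if P && Q then v else 0) = (if P then (if Q then v else 0) else 0).
  by case: P.
have pull' (P Q : bool) (v : \bar R) :
    (if P && Q then v else 0) = (if Q then (if P then v else 0) else 0).
  by case: P; case: Q.
have mlt (f g : mT * mT -> mT) : measurable_fun [set: mT * mT] f ->
    measurable_fun [set: mT * mT] g ->
    measurable_fun [set: mT * mT] (fun p => f p < g p)%R.
  by move=> ? ?; exact: measurable_fun_ltr.
have mle (f g : mT * mT -> mT) : measurable_fun [set: mT * mT] f ->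
    measurable_fun [set: mT * mT] g ->
    measurable_fun [set: mT * mT] (fun p => f p <= g p)%R.
  by move=> ? ?; exact: measurable_fun_ler.
rewrite split2; last 2 first.
- by repeat apply: measurable_and; (apply: mlt || apply: mle).
- by repeat apply: measurable_and; (apply: mlt || apply: mle).
rewrite split2; last 2 first.
- by repeat apply: measurable_and; (apply: mlt || apply: mle).
- by repeat apply: measurable_and; (apply: mlt || apply: mle).
have int_if (P : bool) (f : mT -> \bar R) :
    \int[leb]_y (if P then f y else 0) = if P then \int[leb]_y f y else 0.
  by case: P => //; rewrite integral0.
under [X in X + _ + _ <= _]eq_integral => x _.
  under eq_integral do rewrite pull.
  rewrite int_if integral_below; over.
under [X in _ + X + _ <= _]eq_integral => y _.
  under eq_integral do rewrite pull'.
  rewrite int_if integral_below; over.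
under [X in _ <= X + _]eq_integral => x _.
  under eq_integral do rewrite pull.
  rewrite int_if integral_above; over.
under [X in _ <= _ + X]eq_integral => y _.
  under eq_integral do rewrite pull'.
  rewrite int_if integral_above; over.
exact: tail_exchange.
Qed.

(** The difference of the two tails is the integral of k over [-eta, eta]. *)
Lemma tail_gap (eta k0 : R) : (0 <= eta)%R -> (0 <= k0)%R ->
  (forall q : R, (`|q| <= eta)%R -> k0%:E <= k q) ->
  tail eta + (2 * eta * k0)%:E <= tail (- eta)%R.
Proof.
move=> eta0 k00 hk.
have -> : (2 * eta * k0)%:E =
    \int[leb]_q (if (- eta < q <= eta)%R then k0%:E else 0).
  transitivity (\int[leb]_(r in `](- eta)%R, eta]) k0%:E).
    rewrite integral_cst//= lebesgue_measure_itv/= lte_fin -EFinB.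
    case: ltP => [_|pp']; first by rewrite -EFinM; congr (_%:E); ring.
    have -> : (eta = 0)%R by lra.
    by rewrite mulr0 mul0r mule0.
  rewrite integral_mkcond; apply: eq_integral => r _.
  by rewrite patchE mem_setE in_itv.
rewrite -ge0_integralD//; last 4 first.
- by move=> r _; case: ifP.
- exact: measurable_tail_fun.
- by move=> r _; case: ifP => // _; rewrite lee_fin.
- exact: measurable_if_itv.
apply: ge0_le_integral_nonmeasurable => q.
  by rewrite adde_ge0//; case: ifP => // _; rewrite lee_fin.
case: (ltP eta q) => [h|h]; first by rewrite andbF adde0 (_ : - eta < q)%R//; lra.
rewrite andbT add0e; case: ifP => // h'; apply: hk; rewrite ler_norml.
by rewrite (ltW h').
Qed.

Lemma tail_gapW (p' eta kap : R) : (eta <= p')%R ->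
  tail eta + kap%:E <= tail (- eta)%R -> tail p' + kap%:E <= tail (- p')%R.
Proof.
move=> ep h; apply: (@le_trans _ _ (tail eta + kap%:E)).
  by rewrite leeD2r// tail_le.
by apply: le_trans h _; apply: tail_le; rewrite lerN2.
Qed.

End even_kernel.

(** * Lowering a graph by a contraction of heights *)
Section graph_contraction.
Context {R : realType} {n : nat}.
Local Notation mT := (measurableTypeR R).
Local Notation leb := (@lebesgue_measure R).
Local Notation mu := (@lebesgue_tuple R).
Local Notation W := 'rV[R]_n.+1.
Local Notation V := 'rV[R]_n.+2.
Local Notation tW := (n.+1.-tuple mT).
Local Notation tV := (n.+2.-tuple mT).
Variables (sg : bool).
Local Open Scope ereal_scope.

Definition temb (w : tW) (r : mT) : tV := trcons w ((-1) ^+ sg * r)%R.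

Lemma row_of_temb w r : row_of (temb w r) = emb sg (row_of w) r.
Proof.
apply/rowP => i; rewrite !mxE; case: unliftP => [j|] ->.
  by rewrite mxE !(tnth_nth 0%R) [LHS]nth_rcons size_tuple lift_max ltn_ord.
by rewrite (tnth_nth 0%R) /= nth_rcons size_tuple ltnn eqxx.
Qed.

Lemma measurable_temb : measurable_fun [set: tW * mT] (fun p : tW * mT => temb p.1 p.2).
Proof.
have mg : measurable_fun [set: tW * mT]
    (fun p : tW * mT => (p.1, ((-1) ^+ sg * p.2)%R : mT)).
  apply: measurable_fun_pair => //.
  exact: measurable_funM.
exact: (measurableT_comp (@measurable_trcons R n.+1) mg).
Qed.

Lemma integral_temb (f : tV -> \bar R) :
  measurable_fun [set: _] f -> (forall x, 0 <= f x) ->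
  \int[mu n.+2]_x f x = \int[mu n.+1]_w \int[leb]_r f (temb w r).
Proof.
move=> mf f0; rewrite (integral_lebesgue_tuple_last mf f0).
apply: eq_integral => w _; rewrite /temb; case: sg.
  rewrite -[LHS]integral_opp//.
    by apply: eq_integral => r _; rewrite expr1 mulN1r.
  have mg : measurable_fun [set: mT] (fun r : mT => (w, r)).
    exact: measurable_fun_pair.
  exact: (measurableT_comp (measurable_trcons_comp mf) mg).
by apply: eq_integral => r _; rewrite expr0 mul1r.
Qed.

Lemma integral_temb2 (f : tV * tV -> \bar R) :
  measurable_fun [set: _] f -> (forall x, 0 <= f x) ->
  let H := fun p : tW * tW =>
    \int[leb]_r \int[leb]_s f (temb p.1 r, temb p.2 s) in
  measurable_fun [set: _] H /\
  \int[mu n.+2 \x mu n.+2]_p f p = \int[mu n.+1 \x mu n.+1]_p H p.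
Proof.
move=> mf f0 H.
pose g := fun q : ((tW * tW) * mT) * mT => f (temb q.1.1.1 q.1.2, temb q.1.1.2 q.2).
have mg : measurable_fun [set: _] g.
  apply: (measurableT_comp mf); apply: measurable_fun_pair.
    have m1 : measurable_fun [set: ((tW * tW) * mT) * mT] (fun q => (q.1.1.1, q.1.2)).
      apply: measurable_fun_pair; last exact: measurableT_comp.
      by repeat apply: measurableT_comp => //.
    exact: (measurableT_comp measurable_temb m1).
  have m1 : measurable_fun [set: ((tW * tW) * mT) * mT] (fun q => (q.1.1.2, q.2)).
    apply: measurable_fun_pair => //.
    by repeat apply: measurableT_comp => //.
  exact: (measurableT_comp measurable_temb m1).
have g0 q : 0 <= g q by exact: f0.
pose g1 := fun q : (tW * tW) * mT => \int[leb]_s g (q, s).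
have mg1 : measurable_fun [set: _] g1.
  exact: (measurable_fun_fubini_tonelli_F g mg g0).
have g10 q : 0 <= g1 q by exact: integral_ge0.
have mH : measurable_fun [set: _] H.
  exact: (measurable_fun_fubini_tonelli_F g1 mg1 g10).
split => //.
have H0 p : 0 <= H p by do 2 apply: integral_ge0 => ? _.
rewrite (fubini_tonelli1 f mf f0) (fubini_tonelli1 H mH H0).
rewrite /fubini_F integral_temb; last 2 first.
- exact: (measurable_fun_fubini_tonelli_F f mf f0).
- by move=> x; exact: integral_ge0.
apply: eq_integral => w _.
transitivity (\int[leb]_r \int[mu n.+1]_w' g1 ((w, w'), r)).
  apply: eq_integral => r _; rewrite integral_temb//.
  have mp : measurable_fun [set: tV] (fun y : tV => (temb w r, y)).
    exact: measurable_fun_pair.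
  exact: (measurableT_comp mf mp).
pose g2 := fun q : mT * tW => g1 ((w, q.2), q.1).
have mg2 : measurable_fun [set: _] g2.
  apply: (measurableT_comp mg1); apply: measurable_fun_pair => //.
  exact: measurable_fun_pair.
exact: (fubini_tonelli g2 mg2 (fun q => g10 _)).
Qed.

Lemma measurable_enorm d (T : measurableType d) N (x : T -> 'rV[R]_N) :
  measurable_vec x -> measurable_fun [set: T] (fun t => enorm (x t)).
Proof.
move=> mx; rewrite /enorm.
apply: (measurableT_comp (f := @Num.sqrt R : mT -> mT)).
  by apply: continuous_measurable_fun; exact: sqrt_continuous.
by apply: measurable_sum => i; exact: measurable_funM.
Qed.

Variable s : R.

Definition ker (x y : V) : R := ((enorm (x - y)) `^ (n.+2%:R + s))^-1.

Lemma ker_ge0 x y : (0 <= ker x y)%R.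
Proof. by rewrite invr_ge0 powR_ge0. Qed.

Lemma measurable_vecB d (T : measurableType d) N (x y : T -> 'rV[R]_N) :
  measurable_vec x -> measurable_vec y -> measurable_vec (fun t => x t - y t)%R.
Proof.
move=> mx my i; rewrite (_ : (fun t => _) = (fun t => x t 0 i - y t 0 i)%R).
  exact: measurable_funB.
by apply/funext => t; rewrite !mxE.
Qed.

Lemma measurable_ker d (T : measurableType d) (x y : T -> V) :
  measurable_vec x -> measurable_vec y ->
  measurable_fun [set: T] (fun t => ker (x t) (y t)).
Proof.
move=> mx my; rewrite /ker; under eq_fun do rewrite -powRN.
apply: (measurableT_comp (@measurable_powR R _)).
exact/measurable_enorm/measurable_vecB.
Qed.

Definition line_ker (d : R) (q : R) : R :=
  ((Num.sqrt (d + q * q)) `^ (n.+2%:R + s))^-1.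

Lemma ker_emb w w' r r' :
  ker (emb sg w r) (emb sg w' r') = line_ker (dot (w - w') (w - w'))%R (r - r').
Proof. by rewrite /ker /enorm -embB dot_emb. Qed.

Lemma measurable_line_ker d : measurable_fun [set: mT] (fun q => (line_ker d q)%:E).
Proof.
apply/measurable_EFinP; rewrite /line_ker; under eq_fun do rewrite -powRN.
apply: (measurableT_comp (@measurable_powR R _)).
apply: (measurableT_comp (f := @Num.sqrt R : mT -> mT)).
  by apply: continuous_measurable_fun; exact: sqrt_continuous.
by apply: measurable_funD => //; exact: measurable_funM.
Qed.

Lemma line_ker_even d q : line_ker d (- q)%R = line_ker d q.
Proof. by rewrite /line_ker mulrNN. Qed.

Lemma line_ker_lower (D Q d q : R) : (0 <= s)%R -> (0 < D)%R -> (0 <= d <= D)%R ->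
  (`|q| <= Q)%R -> (d + q * q != 0)%R -> (line_ker D Q <= line_ker d q)%R.
Proof.
move=> s0 D0 /andP[d0 dD] qQ dq.
have Q0 : (0 <= Q)%R by apply: le_trans qQ.
have qq : (q * q <= Q * Q)%R.
  by rewrite -!expr2 -(ger0_norm (sqr_ge0 q)) normrX lerXn2r// nnegrE.
have p0 : (0 < d + q * q)%R by rewrite lt_neqAle eq_sym dq addr_ge0// -expr2 sqr_ge0.
have e0 : (0 <= n.+2%:R + s)%R by rewrite addr_ge0.
rewrite /line_ker lef_pV2 ?posrE ?powR_gt0 ?sqrtr_gt0//; last first.
  by apply: lt_le_trans p0 _; lra.
apply: ge0_ler_powR => //; rewrite ?nnegrE ?sqrtr_ge0//.
by rewrite ler_wsqrtr//; lra.
Qed.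

(** The graph of U is lowered to that of Ut.  A pair with one point between the
graphs and the other one below both is separated by the graph of Ut only. *)
Definition loss (U Ut : W -> R) (x y : V) : \bar R :=
  (if (Ut (hproj x) < ht sg x <= U (hproj x))%R && (ht sg y < Ut (hproj y))%R
   then (ker x y)%:E else 0) +
  (if (ht sg x < Ut (hproj x))%R && (Ut (hproj y) < ht sg y <= U (hproj y))%R
   then (ker x y)%:E else 0).

(** A pair with one point between the graphs and the other one above both is
separated by the graph of U only. *)
Definition gain (U Ut : W -> R) (x y : V) : \bar R :=
  (if (Ut (hproj x) <= ht sg x < U (hproj x))%R && (U (hproj y) < ht sg y)%R
   then (ker x y)%:E else 0) +
  (if (U (hproj x) < ht sg x)%R && (Ut (hproj y) <= ht sg y < U (hproj y))%R
   then (ker x y)%:E else 0).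

Lemma loss_ge0 U Ut x y : 0 <= loss U Ut x y.
Proof. by rewrite /loss adde_ge0//; case: ifP => // _; rewrite lee_fin ker_ge0. Qed.

Lemma gain_ge0 U Ut x y : 0 <= gain U Ut x y.
Proof. by rewrite /gain adde_ge0//; case: ifP => // _; rewrite lee_fin ker_ge0. Qed.

Lemma measurable_vec_hproj d (T : measurableType d) (x : T -> V) :
  measurable_vec x -> measurable_vec (fun t => hproj (x t)).
Proof.
move=> mx i; rewrite (_ : (fun t => _) = (fun t => x t 0%R (widen_ord (leqnSn n.+1) i)))//.
by apply/funext => t; rewrite mxE.
Qed.

Lemma measurable_ht d (T : measurableType d) (x : T -> V) :
  measurable_vec x -> measurable_fun [set: T] (fun t => ht sg (x t)).
Proof. by move=> mx; apply: measurable_funM. Qed.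

Lemma measurable_vec_pair1 N N' :
  measurable_vec (fun p : N.-tuple mT * N'.-tuple mT => row_of p.1).
Proof. by move=> i; apply: (measurableT_comp (measurable_row_of i)). Qed.

Lemma measurable_vec_pair2 N N' :
  measurable_vec (fun p : N.-tuple mT * N'.-tuple mT => row_of p.2).
Proof. by move=> i; apply: (measurableT_comp (measurable_row_of i)). Qed.

Section measurability.
Variables (U Ut : W -> R) (cU : continuous U) (cUt : continuous Ut).

Let mker : measurable_fun [set: tV * tV]
  (fun p : tV * tV => (ker (row_of p.1) (row_of p.2))%:E).
Proof.
apply/measurable_EFinP; apply: measurable_ker.
  exact: measurable_vec_pair1.
exact: measurable_vec_pair2.
Qed.

Let mU1 (f : W -> R) : continuous f ->
  measurable_fun [set: tV * tV] (fun p : tV * tV => f (hproj (row_of p.1))).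
Proof.
move=> cf; apply: (measurable_continuous_vec cf).
by apply: measurable_vec_hproj; exact: measurable_vec_pair1.
Qed.

Let mU2 (f : W -> R) : continuous f ->
  measurable_fun [set: tV * tV] (fun p : tV * tV => f (hproj (row_of p.2))).
Proof.
move=> cf; apply: (measurable_continuous_vec cf).
by apply: measurable_vec_hproj; exact: measurable_vec_pair2.
Qed.

Let mh1 : measurable_fun [set: tV * tV] (fun p : tV * tV => ht sg (row_of p.1)).
Proof. by apply: measurable_ht; exact: measurable_vec_pair1. Qed.

Let mh2 : measurable_fun [set: tV * tV] (fun p : tV * tV => ht sg (row_of p.2)).
Proof. by apply: measurable_ht; exact: measurable_vec_pair2. Qed.

Lemma measurable_loss : measurable_fun [set: tV * tV]
  (fun p : tV * tV => loss U Ut (row_of p.1) (row_of p.2)).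
Proof.
apply: emeasurable_funD; apply: measurable_fun_ifT => //.
  by repeat apply: measurable_and;
    (apply: measurable_fun_ltr || apply: measurable_fun_ler); auto.
by repeat apply: measurable_and;
    (apply: measurable_fun_ltr || apply: measurable_fun_ler); auto.
Qed.

Lemma measurable_gain : measurable_fun [set: tV * tV]
  (fun p : tV * tV => gain U Ut (row_of p.1) (row_of p.2)).
Proof.
apply: emeasurable_funD; apply: measurable_fun_ifT => //.
  by repeat apply: measurable_and;
    (apply: measurable_fun_ltr || apply: measurable_fun_ler); auto.
by repeat apply: measurable_and;
    (apply: measurable_fun_ltr || apply: measurable_fun_ler); auto.
Qed.

End measurability.

Definition box (c : W) (r : R) : set tW := [set t | forall i, (`|row_of t 0%R i - c 0%R i| <= r)%R].

Lemma measurable_box c r : measurable (box c r).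
Proof.
rewrite /box (_ : [set t | _] = \bigcap_(i in [set: 'I_n.+1])
    [set t | (`|row_of t 0%R i - c 0%R i| <= r)%R]).
  apply: fin_bigcap_measurable; first exact: finite_finset.
  move=> i _; rewrite -[X in measurable X]setTI.
  apply: measurable_fun_ler => //.
  apply: measurableT_comp => //; apply: measurable_funB => //.
  exact: measurable_row_of.
by apply/seteqP; split => t /= h => [i _|i]; exact: h.
Qed.

Lemma dot_ge0 N (x : 'rV[R]_N) : (0 <= dot x x)%R.
Proof. by apply: sumr_ge0 => i _; rewrite -expr2 sqr_ge0. Qed.

Lemma dot_eq0 N (x : 'rV[R]_N) : (dot x x == 0)%R = (x == 0)%R.
Proof.
apply/eqP/eqP => [|->]; last by rewrite /dot big1// => i _; rewrite mxE mul0r.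
move=> /eqP; rewrite /dot psumr_eq0; last by move=> i _; rewrite -expr2 sqr_ge0.
move=> /allP h; apply/rowP => i; rewrite mxE; apply/eqP.
by have := h i; rewrite mem_index_enum mulf_eq0 orbb => /(_ isT).
Qed.

Lemma dot_le_norm N (x : 'rV[R]_N) : (dot x x <= N%:R * `|x| ^+ 2)%R.
Proof.
apply: (@le_trans _ _ (\sum_(i < N) `|x| ^+ 2)%R).
  apply: ler_sum => i _; rewrite -expr2 -(ger0_norm (sqr_ge0 (x 0%R i))) normrX.
  by rewrite lerXn2r// ?nnegrE// norm_coord.
by rewrite sumr_const card_ord mulr_natl.
Qed.

(** Over two fixed base points the kernel is an even function of the difference
of heights; the two cases of the one-dimensional inequality correspond to
which of the two base points carries the higher value. *)
Lemma loss_gain_fibre (U Ut : W -> R) (w w' : W) (kap : R) :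
  (forall w, Ut w <= U w)%R ->
  (forall w w', U w' <= U w -> Ut w' <= Ut w /\ Ut w - Ut w' <= U w - U w')%R ->
  (0 <= kap)%R -> (kap = 0%R \/ (U w' <= U w)%R /\
    tail (EFin \o line_ker (dot (w - w') (w - w'))%R) (Ut w - Ut w')%R + kap%:E <=
    tail (EFin \o line_ker (dot (w - w') (w - w'))%R) (Ut w' - Ut w)%R) ->
  \int[leb]_r \int[leb]_q loss U Ut (emb sg w r) (emb sg w' q) +
    (((U w - U w') - (Ut w - Ut w')) * kap)%:E <=
  \int[leb]_r \int[leb]_q gain U Ut (emb sg w r) (emb sg w' q).
Proof.
move=> UtU ctr kap0 hkap.
set k := EFin \o line_ker (dot (w - w') (w - w'))%R in hkap *.
have mk : measurable_fun [set: mT] k by exact: measurable_line_ker.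
have k0 q : 0 <= k q by rewrite lee_fin invr_ge0 powR_ge0.
have ke q : k (- q)%R = k q by rewrite /k /= line_ker_even.
under eq_integral do under eq_integral do rewrite /loss !hproj_emb !ht_emb ker_emb.
under [leRHS]eq_integral do under eq_integral do rewrite /gain !hproj_emb !ht_emb ker_emb.
case: (leP (U w') (U w)) => ww'.
  have [c1 c2] := ctr _ _ ww'.
  apply: (@rectangle_exchange_wlog R k mk k0 ke) => //.
  case: hkap => [->|[_]//]; rewrite adde0; apply: (@tail_le R k k0).
  by rewrite (@le_trans _ _ 0%R)// ?subr_le0 ?subr_ge0.
case: hkap => [->|[+ _]]; last by rewrite leNgt ww'.
rewrite mulr0 adde0.
have [c1 c2] := ctr _ _ (ltW ww').
have := @rectangle_exchange_wlog R k mk k0 ke (U w') (Ut w') (U w) (Ut w) 0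
  (ltW ww') c1 (UtU _) (UtU _) c2 (lexx _).
rewrite mulr0 !adde0 => h.
have hle : (Ut w - Ut w' <= Ut w' - Ut w)%R.
  by rewrite (@le_trans _ _ 0%R)// ?subr_le0 ?subr_ge0.
have {}h := h (tail_le k0 hle).
have mkd : measurable_fun [set: mT * mT] (fun p : mT * mT => k (p.1 - p.2)%R).
  by apply: measurableT_comp => //; exact: measurable_funB.
have msum (P Q : mT * mT -> bool) : measurable_fun [set: mT * mT] P ->
    measurable_fun [set: mT * mT] Q ->
    measurable_fun [set: mT * mT] (fun p => (if P p then k (p.1 - p.2)%R else 0) +
      (if Q p then k (p.1 - p.2)%R else 0)).
  by move=> mP mQ; apply: emeasurable_funD; exact: measurable_fun_ifT.
have swap (P Q P' Q' : mT -> mT -> bool) :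
    (forall x y, P x y = Q' y x) -> (forall x y, Q x y = P' y x) ->
    measurable_fun [set: mT * mT] (fun p : mT * mT => P p.1 p.2) ->
    measurable_fun [set: mT * mT] (fun p : mT * mT => Q p.1 p.2) ->
    \int[leb]_x \int[leb]_y ((if P x y then k (x - y)%R else 0) +
      (if Q x y then k (x - y)%R else 0)) =
    \int[leb]_x \int[leb]_y ((if P' x y then k (x - y)%R else 0) +
      (if Q' x y then k (x - y)%R else 0)).
  move=> PQ' QP' mP mQ; have m := msum _ _ mP mQ.
  pose f := fun p : mT * mT => (if P p.1 p.2 then k (p.1 - p.2)%R else 0) +
      (if Q p.1 p.2 then k (p.1 - p.2)%R else 0).
  have f0 p : 0 <= f p by rewrite /f adde_ge0//; case: ifP.
  apply: (etrans (fubini_tonelli f m f0)).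
  apply: eq_integral => y _; apply: eq_integral => x _ /=.
  by rewrite /f /= addeC PQ' QP' -[k (x - y)%R]ke opprB.
have mlt (f g : mT * mT -> mT) : measurable_fun [set: mT * mT] f ->
    measurable_fun [set: mT * mT] g ->
    measurable_fun [set: mT * mT] (fun p => f p < g p)%R.
  by move=> ? ?; exact: measurable_fun_ltr.
have mle (f g : mT * mT -> mT) : measurable_fun [set: mT * mT] f ->
    measurable_fun [set: mT * mT] g ->
    measurable_fun [set: mT * mT] (fun p => f p <= g p)%R.
  by move=> ? ?; exact: measurable_fun_ler.
rewrite -[X in X <= _](swap (fun x y => (Ut w' < x <= U w')%R && (y < Ut w)%R)
  (fun x y => (x < Ut w')%R && (Ut w < y <= U w)%R)); last 4 first.
- by move=> x y; exact: andbC.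
- by move=> x y; exact: andbC.
- by repeat apply: measurable_and; (apply: mlt || apply: mle).
- by repeat apply: measurable_and; (apply: mlt || apply: mle).
rewrite -[X in _ <= X](swap (fun x y => (Ut w' <= x < U w')%R && (U w < y)%R)
  (fun x y => (U w' < x)%R && (Ut w <= y < U w)%R)); last 4 first.
- by move=> x y; exact: andbC.
- by move=> x y; exact: andbC.
- by repeat apply: measurable_and; (apply: mlt || apply: mle).
- by repeat apply: measurable_and; (apply: mlt || apply: mle).
exact: h.
Qed.

(** The fibrewise inequality is integrated over all pairs of base points.  It is
strict on a pair of boxes over which the heights differ by at least eta and
the lowering shrinks this difference by at least del; there the kernel has a
lower bound that does not depend on U and Ut, so the surplus is linear in
del. *)
Lemma integral_loss_gain (c1 c2 : W) (r eta : R) :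
  (0 < r)%R -> (0 < eta)%R -> (0 <= s)%R ->
  exists2 C : R, (0 < C)%R & forall (U Ut : W -> R) (del : R),
    continuous U -> continuous Ut -> (0 <= del)%R ->
    (forall w, Ut w <= U w)%R ->
    (forall w w', U w' <= U w -> Ut w' <= Ut w /\ Ut w - Ut w' <= U w - U w')%R ->
    (forall w w' : tW, box c1 r w -> box c2 r w' ->
      eta <= Ut (row_of w) - Ut (row_of w') /\
      del <= (U (row_of w) - U (row_of w')) - (Ut (row_of w) - Ut (row_of w')))%R ->
    \int[mu n.+2 \x mu n.+2]_p loss U Ut (row_of p.1) (row_of p.2) + (del * C)%:E <=
    \int[mu n.+2 \x mu n.+2]_p gain U Ut (row_of p.1) (row_of p.2).
Proof.
move=> r0 eta0 s0.
pose D : R := (n.+1%:R * (`|c1 - c2| + 2 * r) ^+ 2 + 1)%R.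
have D0 : (0 < D)%R.
  by rewrite /D ltr_pwDr// mulr_ge0// exprn_ge0// addr_ge0// mulr_ge0// ltW.
pose k0 := line_ker D eta.
have k00 : (0 < k0)%R.
  rewrite /k0 invr_gt0 powR_gt0// sqrtr_gt0 ltr_pwDl// -expr2 sqr_ge0//.
pose m : R := ((2 * r) ^+ n.+1)%R.
have m0 : (0 < m)%R by rewrite exprn_gt0// mulr_gt0.
exists (2 * eta * k0 * (m * m))%R; first by rewrite !mulr_gt0.
move=> U Ut del cU cUt del0 UtU ctr hbox.
have mloss := measurable_loss cU cUt; have mgain := measurable_gain cU cUt.
have [mHl ->] := integral_temb2 mloss (fun p => loss_ge0 _ _ _ _).
have [mHg ->] := integral_temb2 mgain (fun p => gain_ge0 _ _ _ _).
pose B := box c1 r `*` box c2 r.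
have mB : measurable B by apply: measurableX; exact: measurable_box.
pose e (p : tW * tW) : \bar R := (del * (2 * eta * k0))%:E * (\1_B p)%:E.
have e0 p : 0 <= e p.
  by rewrite /e mule_ge0// lee_fin ?mulr_ge0// ?ltW// ?mulr_gt0.
have m1 : measurable_fun [set: tW * tW] (fun p => (\1_B p : R)%:E).
  by apply/measurable_EFinP; exact: measurable_indic.
have me : measurable_fun [set: tW * tW] e by exact: measurable_funeM.
have -> : (del * (2 * eta * k0 * (m * m)))%:E = \int[mu n.+1 \x mu n.+1]_p e p.
  rewrite /e ge0_integralZl//; last first.
    by rewrite lee_fin mulr_ge0// mulr_ge0 ?ltW// mulr_gt0.
  have PB : (mu n.+1 \x mu n.+1) B = (m * m)%:E.
    transitivity (mu n.+1 (box c1 r) * mu n.+1 (box c2 r)).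
      by apply: product_measure1E; exact: measurable_box.
    by rewrite /box !(lebesgue_tuple_box (fun i => _ 0%R i)) ?ltW// -EFinM.
  by rewrite integral_indic// setIT [X in _ * X]PB -EFinM mulrA.
rewrite -(ge0_integralD _ measurableT _ mHl _ me); last 2 first.
- by move=> p _; do 2 apply: integral_ge0 => ? _; exact: loss_ge0.
- by move=> p _; exact: e0.
apply: ge0_le_integral_nonmeasurable => [p|[w w']].
  by rewrite adde_ge0//; do 2 apply: integral_ge0 => ? _; exact: loss_ge0.
rewrite /=.
under eq_integral do under eq_integral do rewrite !row_of_temb.
under [leRHS]eq_integral do under eq_integral do rewrite !row_of_temb.
rewrite /e indicE; have [|] := boolP ((w, w') \in B); last first.
  move=> _; rewrite mule0.
  have := @loss_gain_fibre U Ut (row_of w) (row_of w') 0 UtU ctr (lexx _) (or_introl erefl).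
  by rewrite mulr0.
rewrite inE => -[/= h1 h2]; rewrite mule1.
have [e1 e2] := hbox _ _ h1 h2.
have mono : (U (row_of w') <= U (row_of w))%R.
  rewrite leNgt; apply/negP => h; have [h3 _] := ctr _ _ (ltW h).
  by move: e1; rewrite leNgt => /negP; apply; rewrite (le_lt_trans _ eta0)// subr_le0.
pose k := EFin \o line_ker (dot (row_of w - row_of w') (row_of w - row_of w'))%R.
have mk : measurable_fun [set: mT] k by exact: measurable_line_ker.
have kk0 q : 0 <= k q by rewrite lee_fin invr_ge0 powR_ge0.
have dpos : (0 < dot (row_of w - row_of w') (row_of w - row_of w'))%R.
  rewrite lt_neqAle dot_ge0 andbT eq_sym dot_eq0 subr_eq0; apply/eqP => ww'.
  by move: e1; rewrite ww' subrr leNgt eta0.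
have dD : (dot (row_of w - row_of w') (row_of w - row_of w') <= D)%R.
  apply: le_trans (dot_le_norm _) _; rewrite /D ler_wpDr// ler_wpM2l// lerXn2r ?nnegrE//.
    by rewrite addr_ge0// mulr_ge0// ltW.
  have -> : (row_of w - row_of w' = (c1 - c2) + ((row_of w - c1) - (row_of w' - c2)))%R.
    by apply/rowP => i; rewrite !mxE; ring.
  apply: le_trans (ler_normD _ _) _; rewrite lerD2l.
  apply: le_trans (ler_normB _ _) _; rewrite mulr2n mulrDl mul1r.
  apply: lerD; (apply: norm_rV_le => [|i]; first exact: ltW).
    by have := h1 i; rewrite !mxE.
  by have := h2 i; rewrite !mxE.
have gap : tail k eta + (2 * eta * k0)%:E <= tail k (- eta)%R.
  apply: tail_gap => //; [exact: ltW|exact: ltW|move=> q qe].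
  rewrite lee_fin; apply: line_ker_lower => //; first by rewrite ltW.
  by rewrite gt_eqF// ltr_pwDl// -expr2 sqr_ge0.
have gap' := tail_gapW kk0 e1 gap; rewrite opprB in gap'.
have kap0 : (0 <= 2 * eta * k0)%R by rewrite mulr_ge0 ?ltW// mulr_gt0.
apply: le_trans (loss_gain_fibre UtU ctr kap0 (or_intror (conj mono gap'))).
by rewrite leeD2l// lee_fin ler_wpM2r.
Qed.

End graph_contraction.

(** * Finiteness of the fractional area *)
Section geometric_bound.
Context d (T : measurableType d) {R : realType} (mu : {measure set T -> \bar R}).
Local Open Scope ereal_scope.

Lemma integral_geometric_bound (f : T -> \bar R) (g : nat -> T -> \bar R) (C q : R) :
  (0 <= C)%R -> (0 <= q < 1)%R -> (forall x, 0 <= f x) ->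
  (forall j, measurable_fun [set: _] (g j)) -> (forall j x, 0 <= g j x) ->
  (forall x, exists j, f x <= g j x) ->
  (forall j, \int[mu]_x g j x <= (C * q ^+ j)%:E) -> \int[mu]_x f x < +oo.
Proof.
move=> C0 /andP[q0 q1] f0 mg g0 fg gq.
apply: (@le_lt_trans _ _ (\int[mu]_x \sum_(j <oo) g j x)).
  apply: ge0_le_integral_nonmeasurable => // x; have [j fj] := fg x.
  apply: le_trans fj _; apply: (@le_trans _ _ (\sum_(0 <= i < j.+1) g i x)).
    by rewrite big_nat_recr//= leeDr// sume_ge0.
  by apply: nneseries_lim_ge.
rewrite integral_nneseries//.
apply: (@le_lt_trans _ _ (\sum_(j <oo) (C * q ^+ j)%:E)).
  by apply: lee_nneseries => // j _ _; exact: integral_ge0.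
apply: (@le_lt_trans _ _ (C * (1 - q)^-1)%:E); last exact: ltry.
apply: lime_le.
  by apply: is_cvg_nneseries => j _ _; rewrite lee_fin mulr_ge0// exprn_ge0.
apply: nearW => k; rewrite sumEFin lee_fin -mulr_sumr ler_wpM2l//.
rewrite big_mkord -[leRHS]div1r ler_pdivlMr ?subr_gt0//.
have -> : ((\sum_(i < k) q ^+ i) * (1 - q) = 1 - q ^+ k)%R.
  by rewrite -[RHS]opprB subrX1 mulrC -mulNr opprB.
by rewrite gerBl exprn_ge0.
Qed.

End geometric_bound.

Lemma dyadic_small {R : realType} (dlt : R) : 0 < dlt <= 1 ->
  exists j, (2^-1) ^+ j.+1 < dlt <= (2^-1) ^+ j.
Proof.
move=> /andP[d0 d1].
have ex : exists j, (2^-1 : R) ^+ j.+1 < dlt.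
  have [j _ hj] := near_infty_natSinv_expn_lt (PosNum d0).
  exists j; have := hj j (leqnn j); rewrite /= exprVn; apply: le_lt_trans.
  rewrite div1r lef_pV2 ?posrE ?exprn_gt0//.
  by rewrite exprS ler_peMl// ?exprn_ge0// ler1n.
exists (ex_minn ex); case: ex_minnP => -[|j] hj jmin; rewrite hj//=.
rewrite leNgt; apply/negP => h; have := jmin j h; by rewrite ltnn.
Qed.

Lemma dyadic_large {R : realType} (dlt : R) : 1 < dlt ->
  exists j, 2 ^+ j < dlt <= 2 ^+ j.+1.
Proof.
move=> d1.
have ex : exists j, dlt <= (2 : R) ^+ j.+1.
  have d0 : 0 < dlt^-1 by rewrite invr_gt0; lra.
  have [j _ hj] := near_infty_natSinv_expn_lt (PosNum d0).
  exists j; have := hj j (leqnn j); rewrite /= div1r ltf_pV2 ?posrE ?exprn_gt0//; last lra.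
  by move=> /ltW h; apply: le_trans h _; rewrite exprS ler_peMl// ?exprn_ge0// ler1n.
exists (ex_minn ex); case: ex_minnP => -[|j] hj jmin; rewrite hj ?expr0 ?andbT//=.
rewrite ltNge; apply/negP => h; have := jmin j h; by rewrite ltnn.
Qed.

Section dyadic_cells.
Context {R : realType} (N : nat).
Local Notation mT := (measurableTypeR R).
Local Notation mu := (@lebesgue_tuple R).
Local Notation tV := (N.-tuple mT).
Local Open Scope ereal_scope.

Definition cell (c : 'rV[R]_N) (rho r : R) : set (tV * tV) :=
  [set p | (`|row_of p.1 - c| <= rho)%R /\ (`|row_of p.2 - row_of p.1| <= r)%R].

Lemma norm_rV_leP (x : 'rV[R]_N) (r : R) : (0 <= r)%R ->
  (`|x| <= r)%R <-> (forall i, (`|x 0%R i| <= r)%R).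
Proof.
move=> r0; split=> [h i|h]; last exact: norm_rV_le.
by apply: le_trans h; exact: norm_coord.
Qed.

Lemma measurable_norm d (T : measurableType d) (x : T -> 'rV[R]_N) :
  measurable_vec x -> measurable_fun [set: T] (fun t => `|x t|%R).
Proof.
move=> mx; apply: (measurable_continuous_vec (f := fun x => `|x|%R)) => //.
by move=> y; exact: norm_continuous.
Qed.

Lemma measurable_cell c rho r : measurable (cell c rho r).
Proof.
have m1 : measurable_vec (fun p : tV * tV => row_of p.1).
  by move=> i; apply: (measurableT_comp (measurable_row_of i)).
have m2 : measurable_vec (fun p : tV * tV => row_of p.2).
  by move=> i; apply: (measurableT_comp (measurable_row_of i)).
rewrite /cell (_ : [set p | _] = [set p : tV * tV | (`|row_of p.1 - c| <= rho)%R] `&`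
  [set p | (`|row_of p.2 - row_of p.1| <= r)%R])//.
apply: measurableI; rewrite -[X in measurable X]setTI;
  apply: measurable_fun_ler => //; apply: measurable_norm; apply: measurable_vecB => //.
Qed.

Lemma lebesgue_ball (c : 'rV[R]_N) (r : R) : (0 <= r)%R ->
  mu N [set t | (`|row_of t - c| <= r)%R] = ((2 * r) ^+ N)%:E.
Proof.
move=> r0; rewrite -(lebesgue_tuple_box (fun i => c 0%R i) r0); congr (mu N _).
apply/seteqP; split => t /=.
  by move=> /norm_rV_leP-/(_ r0) h i; have := h i; rewrite !mxE.
by move=> h; apply/norm_rV_leP => // i; have := h i; rewrite !mxE.
Qed.

Lemma lebesgue_cell c rho r : (0 <= rho)%R -> (0 <= r)%R ->
  (mu N \x mu N) (cell c rho r) = ((2 * rho) ^+ N * (2 * r) ^+ N)%:E.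
Proof.
move=> rho0 r0; have r0' : (0 <= (2 * r) ^+ N)%R by rewrite exprn_ge0// mulr_ge0.
pose B := [set t : tV | (`|row_of t - c| <= rho)%R].
have mB : measurable B.
  rewrite -[X in measurable X]setTI; apply: measurable_fun_ler => //.
  apply: measurable_norm; apply: measurable_vecB => //; exact: measurable_row_of.
transitivity (\int[mu N]_x (((2 * r) ^+ N)%:E * (\1_B x)%:E)).
  apply: eq_integral => x _ /=.
  rewrite indicE; have [|xB] := boolP (x \in B).
    rewrite inE mule1 => xB; rewrite -(lebesgue_ball (row_of x) r0); congr (mu N _).
    by apply/seteqP; split => y /=; rewrite /xsection /= inE; [move=> []|].
  rewrite mule0 (_ : xsection _ _ = set0) ?measure0//.
  apply/seteqP; split => // y; rewrite /xsection /= inE => -[xB' _].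
  by move: xB; rewrite notin_setE; exact.
rewrite ge0_integralZl//; last by apply/measurable_EFinP; exact: measurable_indic.
by rewrite integral_indic// setIT [X in _ * X](lebesgue_ball c rho0) -EFinM mulrC.
Qed.

End dyadic_cells.

Section finite_area.
Context {R : realType} {n : nat}.
Local Notation mT := (measurableTypeR R).
Local Notation mu := (@lebesgue_tuple R).
Local Notation V := 'rV[R]_n.+2.
Local Notation tV := (n.+2.-tuple mT).
Local Notation N := n.+2.

(** Discrete form of a finite upper Minkowski content of codimension one. *)
Definition covered (M : set V) (C : R) : Prop :=
  0 <= C /\ forall m : nat, (0 < m)%N -> exists l : seq V,
    (size l)%:R <= C * m%:R ^+ n.+1 /\
    forall p, M p -> exists2 c, c \in l & `|p - c| <= C / m%:R.

Lemma norm_le_enorm (x : V) : `|x| <= enorm x.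
Proof.
apply: norm_rV_le => [|i]; first exact: sqrtr_ge0.
rewrite -sqrtr_sqr ler_wsqrtr// /dot (bigD1 i)//= expr2 lerDl.
by apply: sumr_ge0 => j _; rewrite -expr2 sqr_ge0.
Qed.

Lemma ker_le (s dlt : R) (x y : V) : 0 <= s -> 0 < dlt -> dlt <= `|x - y| ->
  ker s x y <= (dlt `^ (N%:R + s))^-1.
Proof.
move=> s0 d0 dxy; have e0 : dlt <= enorm (x - y) := le_trans dxy (norm_le_enorm _).
rewrite /ker lef_pV2 ?posrE ?powR_gt0//; last exact: lt_le_trans e0.
apply: ge0_ler_powR => //; first by rewrite addr_ge0.
- by rewrite nnegrE ltW.
- by rewrite nnegrE ltW// (lt_le_trans d0).
Qed.

Definition cellf (c : V) (rho r : R) (p : tV * tV) : \bar R :=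
  (\1_(cell c rho r) p)%:E.

Lemma crossings_near (M : set V) (x y : V) :
  odd_crossing M x y -> exists2 p, M p & `|x - p| <= `|x - y|.
Proof.
move=> [_ [k ok ck]].
have [p [Mp [t /andP[t0 t1] pE]]] : crossings M x y !=set0.
  apply/set0P/eqP => c0; move: ck; rewrite c0 card_eq_sym card_eq0.
  by case: k ok => // k _ /eqP/seteqP[/(_ 0%N)] /(_ isT).
exists p => //; rewrite pE opprD addNKr normrN normrZ distrC.
by rewrite ger0_norm ?(ltW t0)// ler_piMl// ltW.
Qed.

Local Open Scope ereal_scope.

Lemma measurable_cellf c rho r : measurable_fun [set: tV * tV] (cellf c rho r).
Proof.
by apply/measurable_EFinP; apply: measurable_indic; exact: measurable_cell.
Qed.

Lemma cellf_ge0 c rho r p : 0 <= cellf c rho r p.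
Proof. by rewrite lee_fin. Qed.

Lemma cellf1 c rho r p : cell c rho r p -> cellf c rho r p = 1.
Proof. by move=> h; rewrite /cellf indicE mem_set. Qed.

Lemma integral_cellf c rho r : (0 <= rho)%R -> (0 <= r)%R ->
  \int[mu N \x mu N]_p cellf c rho r p = ((2 * rho) ^+ N * (2 * r) ^+ N)%:E.
Proof.
move=> ? ?; rewrite -(lebesgue_cell c)//.
by rewrite /cellf integral_indic ?setIT//; exact: measurable_cell.
Qed.

Lemma integral_prod_swap (f : tV * tV -> \bar R) :
  measurable_fun [set: _] f -> (forall p, 0 <= f p) ->
  \int[mu N \x mu N]_p f (p.2, p.1) = \int[mu N \x mu N]_p f p.
Proof.
move=> mf f0.
have mf' : measurable_fun [set: tV * tV] (fun p => f (p.2, p.1)).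
  by apply: (measurableT_comp mf); exact: measurable_fun_pair.
by rewrite (fubini_tonelli1 _ mf' (fun p => f0 _)) (fubini_tonelli2 f mf f0).
Qed.

Definition area_density (s : R) (M Omega : set V) (p : tV * tV) : \bar R :=
  if `[< odd_crossing M (row_of p.1) (row_of p.2) >] then
    (Num.max (\1_Omega (row_of p.1)) (\1_Omega (row_of p.2)) *
     ker s (row_of p.1) (row_of p.2))%:E else 0.

Lemma area_density_ge0 s M Omega p : 0 <= area_density s M Omega p.
Proof.
rewrite /area_density; case: asboolP => // _; rewrite lee_fin mulr_ge0 ?ker_ge0//.
Qed.

Lemma fractional_areaE c s M Omega : fractional_area c s M Omega =
  c%:E * \int[mu N \x mu N]_p area_density s M Omega p.
Proof.
rewrite /fractional_area; congr (_ * _); rewrite integral_mkcond.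
apply: eq_integral => p _; rewrite patchE /area_density.
by have [|] := boolP (p \in _); rewrite ?inE ?notin_setE /= => h;
  case: asboolP.
Qed.

Lemma powR_exprn (a b : R) j : (0 < a)%R -> ((a ^+ j) `^ b = (a `^ b) ^+ j)%R.
Proof.
move=> a0; rewrite -powR_mulrn; last exact: ltW.
by rewrite -powRrM mulrC powRrM powR_mulrn// powR_ge0.
Qed.

(** A pair counted by the area has a point of M on its segment, so both points
are within |x - y| of M.  At the dyadic scale |x - y| ~ 2^-j such pairs have
measure O(2^-j(N + 1)) by the covering bound, and the kernel is O(2^j(N + s)):
the contributions are summable because s < 1.  At large scales one of the
points lies in the bounded set Omega, and the kernel is integrable at
infinity because s > 0. *)
Lemma area_density_finite (s : R) (M Omega : set V) (C B : R) :
  (0 < s < 1)%R -> covered M C -> (0 <= B)%R -> (forall x, Omega x -> `|x| <= B)%R ->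
  \int[mu N \x mu N]_p area_density s M Omega p < +oo.
Proof.
move=> /andP[s0 s1] [C0 covM] B0 OB.
have cov j : exists l : seq V, ((size l)%:R <= C * (2 ^ j)%:R ^+ n.+1)%R /\
    forall p, M p -> exists2 c, c \in l & (`|p - c| <= C / (2 ^ j)%:R)%R.
  by apply: covM; rewrite expn_gt0.
have [l hl] := choice cov.
pose h : R := (2^-1)%R.
have h0 : (0 < h)%R by rewrite /h; lra.
pose b : R := (2 `^ s)%R.
pose a : R := (2 ^+ N * b)%R.
have b0 : (0 < b)%R by rewrite powR_gt0.
have a0 : (0 < a)%R by rewrite mulr_gt0// exprn_gt0.
have pow2 (t : R) : (0 < t)%R -> (1 < 2 `^ t)%R.
  move=> t0; rewrite -[ltLHS](congr1 (fun f => f t) (powR1 R)).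
  by apply: gt0_ltr_powR => //; rewrite ?nnegrE// ltr1n.
have b1 : (1 < b)%R by exact: pow2.
have b2 : (b < 2)%R.
  have -> : (2 = 2 `^ (1 - s) * b)%R.
    by rewrite /b -powRD ?subrK ?powRr1//; apply/implyP => _.
  by rewrite ltr_pMl// pow2// subr_gt0.
have aE : (2 `^ (N%:R + s) = a)%R by rewrite /a /b -(powR_mulrn N (ler0n R 2)) -powRD//; apply/implyP.
pose K1 j : R := (a ^+ j.+1)%R.
pose K2 j : R := (a^-1 ^+ j)%R.
pose g1 j p := \sum_(c <- l j) cellf c ((C + 1) * h ^+ j) (h ^+ j) p.
pose g2 j p := cellf 0 B (2 ^+ j.+1) p + cellf 0 B (2 ^+ j.+1) (p.2, p.1).
pose g j p := (K1 j)%:E * g1 j p + (K2 j)%:E * g2 j p.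
have K10 j : (0 <= K1 j)%R by rewrite exprn_ge0// ltW.
have K20 j : (0 <= K2 j)%R by rewrite exprn_ge0// invr_ge0 ltW.
have g10 j p : 0 <= g1 j p by apply: sume_ge0 => *; exact: cellf_ge0.
have g20 j p : 0 <= g2 j p by rewrite adde_ge0// cellf_ge0.
have mg1 j : measurable_fun [set: _] (g1 j).
  by apply: emeasurable_sum => c; exact: measurable_cellf.
have msw c rho r : measurable_fun [set: tV * tV] (fun p => cellf c rho r (p.2, p.1)).
  by apply: (measurableT_comp (@measurable_cellf c rho r)); exact: measurable_fun_pair.
have mg2 j : measurable_fun [set: _] (g2 j).
  apply: emeasurable_funD; last exact: msw.
  exact: measurable_cellf.
have mg j : measurable_fun [set: _] (g j).
  by apply: emeasurable_funD; exact: measurable_funeM.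
pose C1 : R := (C * (4 * (C + 1)) ^+ N * a)%R.
pose C2 : R := (2 * (2 * B) ^+ N * 4 ^+ N)%R.
have C10 : (0 <= C1)%R.
  apply: mulr_ge0; last exact: ltW.
  by apply: mulr_ge0 => //; apply: exprn_ge0; apply: mulr_ge0 => //; exact: addr_ge0.
have C20 : (0 <= C2)%R.
  by apply: mulr_ge0; [apply: mulr_ge0 => //; apply: exprn_ge0; exact: mulr_ge0|exact: exprn_ge0].
apply: (@integral_geometric_bound _ _ _ _ _ g (C1 + C2)%R (Num.max (b / 2) b^-1)%R).
- by rewrite addr_ge0.
- apply/andP; split; first by rewrite le_max divr_ge0// ltW.
  by rewrite gt_max invf_lt1// b1 andbT ltr_pdivrMr// mul1r.
- exact: area_density_ge0.
- exact: mg.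
- by move=> j p; rewrite adde_ge0// mule_ge0// lee_fin.
- move=> p; set x := row_of p.1; set y := row_of p.2.
  have gj0 j : 0 <= g j p by rewrite adde_ge0// mule_ge0// lee_fin.
  rewrite /area_density -/x -/y; case: asboolP => [oxy|_]; last by exists 0%N.
  have [xO|xO] := boolP (`[< Omega x >] || `[< Omega y >]); last first.
    exists 0%N; move: xO; rewrite negb_or => /andP[/asboolPn xO /asboolPn yO].
    by rewrite !indicE !memNset//= maxxx mul0r.
  have dens : (Num.max (\1_Omega x) (\1_Omega y) * ker s x y <= ker s x y)%R.
    have ind1 (z : V) : (\1_Omega z <= 1 :> R)%R by rewrite indicE; case: (_ \in _).
    by rewrite ler_piMl ?ker_ge0// ge_max !ind1.
  have [xy0|xyn] := eqVneq x y.
    exists 0%N; rewrite /ker xy0 subrr /enorm /dot big1; last first.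
      by move=> i _; rewrite mxE mul0r.
    rewrite sqrtr0 powR0 ?invr0 ?mulr0//.
    by rewrite gt_eqF// ltr_wpDr// ?ltW// ltr0n.
  have d0 : (0 < `|x - y|)%R by rewrite normr_gt0 subr_eq0.
  have [d1|d1] := leP `|x - y|%R 1%R.
    have [j /andP[j1 j2]] := @dyadic_small R `|x - y|%R ltac:(by rewrite d0 d1).
    exists j; have [p0 Mp0 xp0] := crossings_near oxy.
    have [_ /(_ _ Mp0)[c cl pc]] := hl j.
    have Eh : (h ^+ j = ((2 ^ j)%:R)^-1)%R by rewrite /h exprVn natrX.
    have cp : cell c ((C + 1) * h ^+ j) (h ^+ j) p.
      split; last by rewrite -/x -/y distrC.
      rewrite -/x (_ : x - c = (x - p0) + (p0 - c))%R; last first.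
        by rewrite addrA subrK.
      apply: le_trans (ler_normD _ _) _; rewrite mulrDl mul1r addrC lerD//.
        by rewrite Eh.
      exact: le_trans xp0 j2.
    apply: (@le_trans _ _ ((K1 j)%:E * g1 j p)); last by rewrite leeDl// mule_ge0// lee_fin.
    apply: (@le_trans _ _ ((K1 j)%:E * cellf c ((C + 1) * h ^+ j) (h ^+ j) p)).
      rewrite (cellf1 cp) mule1 lee_fin; apply: le_trans dens _.
      apply: le_trans (ker_le _ _ (ltW j1)) _; [exact: ltW|by rewrite exprn_gt0|].
      rewrite powR_exprn// (_ : 2^-1 `^ _ = a^-1)%R ?exprVn ?invrK//.
      apply: (mulIf (lt0r_neq0 a0)); rewrite mulVf ?gt_eqF// -{1}aE -powRM//.
      by rewrite mulVf// powR1.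
    rewrite lee_wpmul2l ?lee_fin// /g1 (big_rem c)//= leeDl// sume_ge0// => c' _.
    exact: cellf_ge0.
  have [j /andP[j1 j2]] := dyadic_large d1.
  exists j.
  apply: (@le_trans _ _ ((K2 j)%:E * g2 j p)); last by rewrite leeDr// mule_ge0// lee_fin.
  have Kd : (ker s x y <= K2 j)%R.
    apply: le_trans (ker_le _ _ (ltW j1)) _; [exact: ltW|by rewrite exprn_gt0|].
    by rewrite powR_exprn// aE /K2 exprVn.
  have g21 : 1 <= g2 j p.
    rewrite /g2; have [Ox|Oy] : Omega x \/ Omega y.
      by case/orP : xO => /asboolP; [left|right].
    - apply: le_trans (leeDl _ (cellf_ge0 _ _ _ _)).
      by rewrite cellf1//; split; rewrite /= ?subr0 ?OB// distrC.
    - apply: le_trans (leeDr _ (cellf_ge0 _ _ _ _)).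
      by rewrite cellf1//; split; rewrite /= ?subr0 ?OB.
  apply: (@le_trans _ _ ((K2 j)%:E * 1)); last by rewrite lee_wpmul2l// lee_fin.
  by rewrite mule1 lee_fin (le_trans dens).
- move=> j.
  have R0 : (0 <= 2 ^+ j.+1 :> R)%R by rewrite exprn_ge0.
  have hj0 : (0 <= h ^+ j)%R by rewrite exprn_ge0// ltW.
  have I1 : \int[mu N \x mu N]_p g1 j p =
      ((size (l j))%:R * ((2 * ((C + 1) * h ^+ j)) ^+ N * (2 * h ^+ j) ^+ N))%:E.
    rewrite ge0_integral_sum//; last 2 first.
    - by move=> c; exact: measurable_cellf.
    - by move=> c p _; exact: cellf_ge0.
    under eq_bigr do rewrite integral_cellf// ?mulr_ge0// ?addr_ge0//.
    by rewrite sumEFin big_const_seq count_predT iter_addr_0 (mulr_natl _ (size (l j))).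
  have I2 : \int[mu N \x mu N]_p g2 j p =
      (2 * ((2 * B) ^+ N * (2 * 2 ^+ j.+1) ^+ N))%:E.
    rewrite ge0_integralD//; last 3 first.
    - by move=> p _; exact: cellf_ge0.
    - exact: measurable_cellf.
    - by move=> p _; exact: cellf_ge0.
    rewrite (integral_prod_swap (@measurable_cellf 0%R B (2 ^+ j.+1)%R)); last first.
      by move=> p; exact: cellf_ge0.
    rewrite integral_cellf// -EFinD; congr (_%:E).
    by rewrite [RHS]mulrC mulr_natr mulr2n.
  have IG : \int[mu N \x mu N]_p g j p =
      (K1 j)%:E * \int[mu N \x mu N]_p g1 j p + (K2 j)%:E * \int[mu N \x mu N]_p g2 j p.
    rewrite -!ge0_integralZl ?lee_fin// -ge0_integralD//.
    - by move=> p _; rewrite mule_ge0// lee_fin.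
    - exact: measurable_funeM.
    - by move=> p _; rewrite mule_ge0// lee_fin.
    - exact: measurable_funeM.
  rewrite IG I1 I2 -!EFinM -EFinD lee_fin (mulrDl C1 C2).
  have q0 : (0 <= b / 2)%R by rewrite divr_ge0// ltW.
  have q0' : (0 <= b^-1)%R by rewrite invr_ge0 ltW.
  apply: lerD.
    apply: (@le_trans _ _ (C1 * (b / 2) ^+ j)%R); last first.
      by rewrite ler_wpM2l// lerXn2r ?nnegrE// ?le_max ?q0 ?lexx.
    apply: (@le_trans _ _ (K1 j * ((C * (2 ^ j)%:R ^+ n.+1) *
        ((2 * ((C + 1) * h ^+ j)) ^+ N * (2 * h ^+ j) ^+ N)))%R).
      rewrite ler_wpM2l// ler_wpM2r//; last by have [] := hl j.
      by rewrite mulr_ge0// exprn_ge0// !mulr_ge0// addr_ge0.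
    rewrite le_eqVlt; apply/orP; left; apply/eqP.
    pose X : R := (2 ^+ j)%R; pose Y : R := (h ^+ j)%R.
    have XY : (X * Y = 1)%R by rewrite -exprMn mulfV// expr1n.
    have PQ : (X ^+ n.+1 * Y ^+ n.+1 = 1)%R by rewrite -exprMn XY expr1n.
    have aj : (a ^+ j = X * X ^+ n.+1 * b ^+ j)%R by rewrite exprMn exprAC exprS.
    have bj : ((b / 2) ^+ j = b ^+ j * Y)%R by rewrite exprMn.
    have f4 : ((4 * (C + 1)) ^+ N = 2 ^+ N * 2 ^+ N * (C + 1) ^+ N :> R)%R.
      by rewrite -!exprMn -natrM.
    rewrite /K1 /C1 exprS aj bj f4 natrX -/X -/Y !exprMn !(exprS Y n.+1).
    transitivity (C * (2 ^+ N * 2 ^+ N * (C + 1) ^+ N) * a * (b ^+ j * Y) *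
      (X * Y) * (X ^+ n.+1 * Y ^+ n.+1) * (X ^+ n.+1 * Y ^+ n.+1))%R.
      clear XY PQ aj bj; move: X Y (2 ^+ N)%R ((C + 1) ^+ N)%R (b ^+ j)%R (X ^+ n.+1)%R (Y ^+ n.+1)%R.
      by move=> t1 t2 t3 t4 t5 t6 t7; ring.
    by rewrite XY PQ !mulr1.
  apply: (@le_trans _ _ (C2 * (b^-1) ^+ j)%R); last first.
    by rewrite ler_wpM2l// lerXn2r ?nnegrE// ?le_max ?q0' ?lexx ?orbT.
  rewrite le_eqVlt; apply/orP; left; apply/eqP.
  have X0 : ((2 ^+ j) ^+ N != 0 :> R)%R by rewrite !expf_neq0.
  have f4 : ((2 * 2 ^+ j.+1) ^+ N = 4 ^+ N * (2 ^+ j) ^+ N :> R)%R.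
    rewrite -[RHS]exprMn; congr (_ ^+ _)%R; rewrite exprS mulrA; congr (_ * _)%R.
    by rewrite -natrM.
  have aj' : (a ^+ j = (2 ^+ j) ^+ N * b ^+ j)%R by rewrite /a exprMn exprAC.
  rewrite /K2 /C2 f4 !exprVn aj' invfM.
  transitivity (2 * (2 * B) ^+ N * 4 ^+ N * (b ^+ j)^-1 *
    (((2 ^+ j) ^+ N)^-1 * (2 ^+ j) ^+ N))%R; last by rewrite mulVf// mulr1.
  move: ((2 * B) ^+ N)%R (4 ^+ N)%R ((b ^+ j)^-1)%R ((2 ^+ j) ^+ N)%R (((2 ^+ j) ^+ N)^-1)%R.
  by move=> t1 t2 t3 t4 t5; ring.
Qed.

End finite_area.

(** * Calculus along segments and covering of hypersurfaces *)
Section segment_calculus.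
Context {R : realType}.

Lemma is_derive_line (V W : normedModType R) (f : V -> W) (x v : V) (t : R) :
  derivable f (x + t *: v) v ->
  is_derive t (1 : R) (fun u : R => f (x + u *: v)) ('D_v f (x + t *: v)).
Proof.
move=> df; set g := fun u : R => f (x + u *: v).
have E : (fun h : R => h^-1 *: ((g \o shift t) (h *: (1 : R)) - g t)) =
    (fun h : R => h^-1 *: ((f \o shift (x + t *: v)) (h *: v) - f (x + t *: v))).
  apply/funext => h; congr (_ *: (_ - _)); rewrite /g /=.
  have -> : h *: (1 : R) = h by rewrite /GRing.scale/= mulr1.
  by congr f; rewrite scalerDl addrCA.
by split; [rewrite /derivable E|rewrite /derive E].
Qed.

Lemma MVT_line (V : normedModType R) (f : V -> R) (x y : V) :
  (forall t : R, 0 <= t <= 1 -> differentiable f (x + t *: (y - x))) ->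
  exists2 t : R, 0 < t < 1 & f y - f x = 'D_(y - x) f (x + t *: (y - x)).
Proof.
move=> df; pose g (t : R) := f (x + t *: (y - x)).
have dg (t : R) : 0 <= t <= 1 -> is_derive t (1 : R) g ('D_(y - x) f (x + t *: (y - x))).
  by move=> /df dft; apply: is_derive_line; exact: diff_derivable.
have [||t] := @MVT R g (fun t => 'D_(y - x) f (x + t *: (y - x))) 0 1 ltr01.
- by move=> t; rewrite in_itv/= => /andP[t0 t1]; apply: dg; rewrite !ltW.
- apply: continuous_in_subspaceT => t; rewrite inE/= in_itv/= => /dg [h _].
  by apply: differentiable_continuous; apply/derivable1_diffP.
rewrite in_itv/= => t01; rewrite /g scale1r scale0r addr0 (addrC x) subrK subr0 mulr1.
by exists t.
Qed.

Lemma derive_delta N (W : normedModType R) (f : 'rV[R]_N -> W) (x v : 'rV[R]_N) :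
  differentiable f x ->
  'D_v f x = \sum_j v 0 j *: 'D_(delta_mx 0 j) f x.
Proof.
move=> df; rewrite deriveE// {1}(row_sum_delta v) linear_sum/=.
by apply: eq_bigr => j _; rewrite linearZ/= deriveE.
Qed.

Lemma norm_derive_le N (f : 'rV[R]_N -> R) (x v : 'rV[R]_N) (B : R) :
  differentiable f x -> (forall j, `|'D_(delta_mx 0 j) f x| <= B) ->
  `|'D_v f x| <= N%:R * B * `|v|.
Proof.
move=> df hB; rewrite derive_delta//; apply: le_trans (ler_norm_sum _ _ _) _.
apply: (@le_trans _ _ (\sum_(j < N) B * `|v|)).
  apply: ler_sum => j _; rewrite normrM mulrC ler_pM//; exact: norm_coord.
by rewrite sumr_const card_ord -mulrA mulr_natl.
Qed.

Lemma C1_bounded_derive N (f : 'rV[R]_N -> R) (A : set 'rV[R]_N) (q : 'rV[R]_N) :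
  open A -> A q -> Ck 1 A f -> exists r B : R, [/\ 0 < r, 0 <= B,
    (forall x, `|x - q| < r -> A x) &
    forall x v, `|x - q| < r -> `|'D_v f x| <= B * `|v|].
Proof.
move=> /open_normedP oA Aq [df cf].
have [r0 r00 hr0] := oA q Aq.
have /choice[rj hrj] : forall j : 'I_N, exists r : R, 0 < r /\
    forall x, `|x - q| < r -> `|'D_(delta_mx 0 j) f x| <= `|'D_(delta_mx 0 j) f q| + 1.
  move=> j; have [r r_gt0 hr] :=
    (continuous_normedP _ _).1 (cf (delta_mx 0 j) q Aq) 1 ltr01.
  exists r; split=> // x /hr h; rewrite -lerBlDl.
  by apply: le_trans (lerB_dist _ _) _; exact: ltW.
pose r := \big[Num.min/r0]_j rj j.
have rr0 : r <= r0 by rewrite /r; elim/big_rec: _ => // i x _ h; rewrite ge_min h orbT.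
have rrj j : r <= rj j by exact: bigmin_le_cond.
pose B0 : R := \sum_j (`|'D_(delta_mx 0 j) f q| + 1).
exists r, (N%:R * B0); split.
- rewrite /r; elim/big_ind: _ => // [x y ? ?|j _]; first by rewrite lt_min; apply/andP.
  by have [] := hrj j.
- by rewrite mulr_ge0// sumr_ge0// => j _; rewrite addr_ge0.
- by move=> x xr; apply: hr0; exact: lt_le_trans xr rr0.
move=> x v xr; apply: norm_derive_le.
  by apply: df; apply: hr0; exact: lt_le_trans xr rr0.
move=> j; have [_ h] := hrj j; apply: le_trans (h x (lt_le_trans xr (rrj j))) _.
rewrite /B0 (bigD1 j)//= lerDl sumr_ge0// => i _; exact: addr_ge0.
Qed.

Lemma ball_segment (V : normedModType R) (q x y : V) (r t : R) :
  0 <= t <= 1 -> `|x - q| < r -> `|y - q| < r -> `|x + t *: (y - x) - q| < r.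
Proof.
move=> /andP[t0 t1] hx hy.
have -> : x + t *: (y - x) - q = (1 - t) *: (x - q) + t *: (y - q).
  have -> : y - x = (y - q) - (x - q) by rewrite opprB addrA subrK.
  by rewrite scalerBl scale1r scalerBr addrAC -[RHS]addrA [X in _ = _ + X]addrC.
apply: le_lt_trans (ler_normD _ _) _.
rewrite !normrZ (ger0_norm t0) ger0_norm ?subr_ge0//.
have := t0; rewrite le_eqVlt => /predU1P[<-|t0'].
  by rewrite subr0 mul1r mul0r addr0.
have h1 : (1 - t) * `|x - q| <= (1 - t) * r by rewrite ler_wpM2l ?subr_ge0// ltW.
have h2 : t * `|y - q| < t * r by rewrite ltr_pM2l.
by apply: lt_le_trans (ler_ltD h1 h2) _; rewrite -mulrDl subrK mul1r.
Qed.

Lemma C1_lipschitz N (f : 'rV[R]_N -> R) (A : set 'rV[R]_N) (q : 'rV[R]_N) :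
  open A -> A q -> Ck 1 A f -> exists r B : R, [/\ 0 < r, 0 <= B,
    (forall x, `|x - q| < r -> A x) &
    forall x y, `|x - q| < r -> `|y - q| < r -> `|f x - f y| <= B * `|x - y|].
Proof.
move=> oA Aq Cf; have [r [B [r0 B0 rA hB]]] := C1_bounded_derive oA Aq Cf.
exists r, B; split=> // x y xr yr.
have [|t /andP[t0 t1] ->] := @MVT_line _ f y x.
  move=> t t01; case: Cf => df _; apply: df; apply: rA; exact: ball_segment.
by apply: hB; apply: ball_segment => //; rewrite !ltW.
Qed.

End segment_calculus.

(** Compactness as an induction principle: a property of sets that is local,
monotone and stable under finite unions holds for the whole compact set. *)
Lemma compact_ind {R : realType} (V : normedModType R) (A : set V) (P : set V -> Prop) :
  compact A -> P set0 -> (forall B C, P B -> P C -> P (B `|` C)) ->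
  (forall B C, B `<=` C -> P C -> P B) ->
  (forall z, A z -> exists2 d : R, 0 < d & P [set x | A x /\ `|x - z| < d]) -> P A.
Proof.
rewrite compact_cover => cA P0 PU PS loc.
have /choice[d hd] : forall z, exists d : R, A z -> 0 < d /\ P [set x | A x /\ `|x - z| < d].
  move=> z; have [Az|nAz] := pselect (A z); last by exists 0.
  by have [d d0 Pd] := loc z Az; exists d.
have [||D DA AD] := cA V A (fun z => [set x | `|x - z| < d z]).
- move=> z Az; apply/open_normedP => x /= xz.
  exists (d z - `|x - z|); first by rewrite subr_gt0.
  move=> y; rewrite ltrBrDr; apply: le_lt_trans.
  have -> : y - z = (y - x) + (x - z) by rewrite addrA subrK.
  exact: ler_normD.
- by move=> z Az; exists z => //=; rewrite subrr normr0; have [] := hd z Az.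
have PD : P (\bigcup_(z in [set` D]) [set x | A x /\ `|x - z| < d z]).
  rewrite bigcup_fset big_seq; elim/big_ind : _ => // z zD.
  by have /hd[_] : A z by apply/set_mem; exact: DA.
by apply: PS PD => x Ax; have [z Dz xz] := AD x Ax; exists z.
Qed.

Section covering.
Context {R : realType} {n : nat}.
Local Notation V := 'rV[R]_n.+2.

Lemma covered_set0 : covered (set0 : set V) (0 : R).
Proof. by split=> // m _; exists [::]; rewrite mul0r; split. Qed.

Lemma coveredU (M1 M2 : set V) (C1 C2 : R) :
  covered M1 C1 -> covered M2 C2 -> covered (M1 `|` M2) (C1 + C2).
Proof.
move=> [C10 h1] [C20 h2]; split; first exact: addr_ge0.
move=> m m0; have [l1 [s1 c1]] := h1 m m0; have [l2 [s2 c2]] := h2 m m0.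
exists (l1 ++ l2); split; first by rewrite size_cat natrD mulrDl lerD.
move=> p [/c1|/c2] [c cl pc]; exists c.
- by rewrite mem_cat cl.
- by apply: le_trans pc _; rewrite ler_pM2r ?invr_gt0 ?ltr0n// lerDl.
- by rewrite mem_cat cl orbT.
- by apply: le_trans pc _; rewrite ler_pM2r ?invr_gt0 ?ltr0n// lerDr.
Qed.

Lemma covered_sub (M1 M2 : set V) (C : R) :
  M1 `<=` M2 -> covered M2 C -> covered M1 C.
Proof.
move=> M12 [C0 h]; split=> // m m0; have [l [sl hl]] := h m m0.
by exists l; split=> // p /M12/hl.
Qed.

Lemma derive_coord (U : normedModType R) (N' : nat) (f : U -> 'rV[R]_N') i u v :
  differentiable f u -> 'D_v (fun w => f w 0 i) u = 'D_v f u 0 i.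
Proof. by move=> df; rewrite derive_mx ?mxE//; exact: diff_derivable. Qed.

Lemma Ck1_coord (U : normedModType R) (N' : nat) (A : set U) (f : U -> 'rV[R]_N') i :
  open A -> Ck 1 A f -> Ck 1 A (fun x => f x 0 i).
Proof.
move=> oA [df cf]; split=> [x Ax|v x Ax].
  exact: (differentiable_comp (df x Ax) (differentiable_coord _ _ _)).
apply/continuous_normedP => e e0.
have [d d0 hd] := (continuous_normedP _ _).1 (cf v x Ax) e e0.
have [d' d'0 hd'] := (open_normedP _).1 oA x Ax.
exists (Num.min d d'); first by rewrite lt_min d0.
move=> y; rewrite lt_min => /andP[/hd yd /hd' Ay].
rewrite !derive_coord; [|exact: df..].
by apply: le_lt_trans yd; have := norm_coord ('D_v f y - 'D_v f x) i; rewrite !mxE.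
Qed.

Lemma C1_lipschitz_rV (N N' : nat) (A : set 'rV[R]_N) (f : 'rV[R]_N -> 'rV[R]_N') q :
  open A -> A q -> Ck 1 A f -> exists r B : R, [/\ 0 < r, 0 <= B,
    (forall x, `|x - q| < r -> A x) &
    forall x y, `|x - q| < r -> `|y - q| < r -> `|f x - f y| <= B * `|x - y|].
Proof.
move=> oA Aq Cf; have [r0 r00 hr0] := (open_normedP _).1 oA q Aq.
have /choice[rB hrB] : forall i, exists rB : R * R, [/\ 0 < rB.1, 0 <= rB.2 &
    forall x y, `|x - q| < rB.1 -> `|y - q| < rB.1 ->
      `|f x 0 i - f y 0 i| <= rB.2 * `|x - y|].
  by move=> i; have [r [B [? ? _ h]]] := C1_lipschitz oA Aq (Ck1_coord i oA Cf);
    exists (r, B).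
pose r := \big[Num.min/r0]_j (rB j).1.
have rr0 : r <= r0 by rewrite /r; elim/big_rec: _ => // i x _ h; rewrite ge_min h orbT.
have rrj j : r <= (rB j).1 by exact: bigmin_le_cond.
exists r, (\sum_j (rB j).2); split.
- rewrite /r; elim/big_ind: _ => // [x y ? ?|j _]; first by rewrite lt_min; apply/andP.
  by have [] := hrB j.
- by rewrite sumr_ge0// => j _; have [] := hrB j.
- by move=> x xr; apply: hr0; exact: lt_le_trans xr rr0.
move=> x y xr yr.
have s0 : 0 <= \sum_j (rB j).2 by rewrite sumr_ge0// => j _; have [] := hrB j.
apply: norm_rV_le => [|i]; first by rewrite mulr_ge0.
have [_ _ h] := hrB i; rewrite !mxE.
apply: le_trans (h x y (lt_le_trans xr (rrj i)) (lt_le_trans yr (rrj i))) _.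
rewrite ler_wpM2r// (bigD1 i)//= lerDl sumr_ge0// => j _.
by have [] := hrB j.
Qed.

(** The inverse chart is Lipschitz and M corresponds to a piece of a hyperplane,
where a grid of step 1/m has O(m^(N - 1)) nodes. *)
Lemma chart_covered (alpha : R) (M A B : set V) psi (z : V) :
  C1holder_chart alpha A B psi -> A z -> M z ->
  (forall p, A p -> M p -> psi p 0 ord_max = 0) ->
  exists2 d : R, 0 < d & exists C, covered [set x | M x /\ `|x - z| < d] C.
Proof.
move=> [oA oB psiAB [[dpsi _] _] [theta [thK [Cth _]]]] Az Mz M0.
set q := psi z; have Bq : B q by rewrite -psiAB; exists z.
have [r [L [r0 L0 rB hL]]] := C1_lipschitz_rV oB Bq Cth.
have qN : q 0 ord_max = 0 by exact: M0.
have [dA dA0 hdA] := (open_normedP _).1 oA z Az.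
have [d2 d20 hd2] := (continuous_normedP _ _).1
  (differentiable_continuous (dpsi z Az)) (r / 2) ltac:(by rewrite divr_gt0).
exists (Num.min dA d2); first by rewrite lt_min dA0.
exists (3 ^+ n.+1 + L * (r / 2)); split.
  by rewrite addr_ge0 ?exprn_ge0// mulr_ge0// divr_ge0// ltW.
move=> m m0; have m0' : 0 < m%:R :> R by rewrite ltr0n.
pose G (k : {ffun 'I_n.+1 -> 'I_(2 * m).+1}) : V :=
  emb false (\row_i (hproj q 0 i + (r / 2) * (((k i)%:R - m%:R) / m%:R))) 0.
exists [seq theta (G k) | k : {ffun 'I_n.+1 -> 'I_(2 * m).+1}]; split.
  rewrite size_map -cardE card_ffun !card_ord natrX.
  apply: (@le_trans _ _ ((3 * m%:R) ^+ n.+1)).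
    apply: lerXn2r; rewrite ?nnegrE ?mulr_ge0//.
    by rewrite -natrM ler_nat; lia.
  by rewrite exprMn ler_wpM2r ?exprn_ge0// lerDl mulr_ge0// divr_ge0// ltW.
move=> p [Mp]; rewrite lt_min => /andP[/hdA Ap /hd2 pq]; rewrite -/q in pq.
have r20 : 0 < r / 2 by rewrite divr_gt0.
have /choice[k hk] : forall i, exists k : 'I_(2 * m).+1,
    `|(psi p 0 (widen_ord (leqnSn n.+1) i) - q 0 (widen_ord (leqnSn n.+1) i)) / (r / 2)
      - ((k%:R - m%:R) / m%:R)| <= m%:R^-1.
  move=> i; set u := (psi p 0 _ - _) / _.
  have : `|u| < 1.
    rewrite normrM normfV (gtr0_norm r20) ltr_pdivrMr// mul1r.
    by apply: le_lt_trans pq; have := norm_coord (psi p - q) (widen_ord (leqnSn n.+1) i); rewrite !mxE.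
  rewrite ltr_norml => /andP[u1 u2].
  have um0 : 0 <= (u + 1) * m%:R by rewrite mulr_ge0//; lra.
  have /andP[t1 t2] := truncn_itv um0.
  have tm : (Num.truncn ((u + 1) * m%:R) < (2 * m).+1)%N.
    rewrite -(ltr_nat R); apply: le_lt_trans t1 _.
    rewrite -addn1 natrD natrM ltr_pwDr// ler_pM2r//; lra.
  exists (Ordinal tm) => /=; move: t1 t2; set T := (Num.truncn _)%:R.
  rewrite -addn1 natrD -/T => t1 t2.
  rewrite -[u](mulfK (lt0r_neq0 m0')) -mulrBl normrM normfV (gtr0_norm m0').
  rewrite ler_pdivrMr// mulVf ?gt_eqF// ler_norml; lra.
have Gc i : G [ffun i => k i] 0 (widen_ord (leqnSn n.+1) i) =
    q 0 (widen_ord (leqnSn n.+1) i) + (r / 2) * (((k i)%:R - m%:R) / m%:R).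
  by rewrite mxE widen_lift_max liftK !mxE ffunE widen_lift_max.
have Gmax : G [ffun i => k i] 0 ord_max = 0 by rewrite mxE unlift_none mulr0.
have mxB (x y : V) i : (x - y) 0 i = x 0 i - y 0 i by rewrite !mxE.
have Gq : `|G [ffun i => k i] - q| <= r / 2.
  apply: norm_rV_le => [|i]; first exact: ltW.
  rewrite mxB; case: (unliftP ord_max i) => [j|] ->; last first.
    by rewrite Gmax qN subr0 normr0 ltW.
  rewrite -widen_lift_max Gc addrAC subrr add0r normrM (gtr0_norm r20).
  rewrite ler_piMr ?(ltW r20)// normrM normfV (gtr0_norm m0').
  rewrite ler_pdivrMr// mul1r ler_norml.
  have : (k j <= 2 * m)%N by rewrite -ltnS.
  rewrite -(ler_nat R) natrM => kj; have := ler0n R (k j).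
  by move: (m%:R) ((k j)%:R) kj m0' => ? ? ? ? ?; apply/andP; split; lra.
have Gp : `|psi p - G [ffun i => k i]| <= (r / 2) / m%:R.
  apply: norm_rV_le => [|i]; first by rewrite divr_ge0// ltW.
  rewrite mxB; case: (unliftP ord_max i) => [j|] ->; last first.
    by rewrite Gmax M0// subr0 normr0 divr_ge0// ltW.
  rewrite -widen_lift_max Gc.
  have := hk j; set u := psi p 0 _; set w := q 0 _; set g := (_ / m%:R).
  move=> h; have -> : u - (w + r / 2 * g) = (r / 2) * ((u - w) / (r / 2) - g).
    by move: (r / 2) (gt_eqF r20) => c c0; field; rewrite c0.
  by rewrite normrM (gtr0_norm r20) ler_pM2l.
exists (theta (G [ffun i => k i])); first by apply: map_f; rewrite mem_enum.
rewrite -[X in `|X - _|](thK p Ap).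
have rr : r / 2 < r by lra.
apply: le_trans (hL _ _ (lt_trans pq rr) (le_lt_trans Gq rr)) _.
apply: (@le_trans _ _ (L * (r / 2 / m%:R))); first by rewrite ler_wpM2l.
by rewrite mulrA ler_wpM2r ?invr_ge0// lerDr exprn_ge0.
Qed.

Lemma hypersurface_covered (alpha : R) (M : set V) :
  compact_hypersurface alpha M -> exists C, covered M C.
Proof.
move=> [cM hM]; apply: (@compact_ind R _ M (fun B => exists C, covered B C) cM).
- by exists 0; exact: covered_set0.
- by move=> B C [CB hB] [CC hC]; exists (CB + CC); exact: coveredU.
- by move=> B C BC [CC hC]; exists CC; exact: covered_sub hC.
move=> z Mz; case: (hM z Mz) => -[A [B [psi]]].
  by move=> [ch Az _ MA]; apply: (chart_covered ch Az Mz) => p Ap /(MA p Ap).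
by move=> [ch Az _ _ MA]; apply: (chart_covered ch Az Mz) => p Ap /(MA p Ap)[].
Qed.

End covering.

(** * Parity of the zeros of two functions *)
Section parity.
Context {R : realType}.

(** The linear function d * (t - t0) is compared with f, so that d records
whether f increases or decreases through its zero. *)
Definition sign_change (f : R -> R) (t0 : R) : Prop :=
  exists d r : R, [/\ d != 0, 0 < r &
    forall t, t != t0 -> `|t - t0| < r -> 0 < f t * (d * (t - t0))].

Lemma finite_odd_setU1 (A : set R) (x : R) : finite_set A -> ~ A x ->
  finite_set (A `|` [set x]) /\ odd #|` fset_set (A `|` [set x])| = ~~ odd #|` fset_set A|.
Proof.
move=> fA Ax; split; first by rewrite finite_setU.
rewrite fset_setU// fset_set1 fsetUC cardfsU1 in_fset_set//.
by rewrite memNset//= oddD.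
Qed.

Lemma sign_change_local (f : R -> R) (t0 : R) : continuous f ->
  (f t0 = 0 -> sign_change f t0) ->
  exists2 r : R, 0 < r & (forall t, t != t0 -> `|t - t0| < r -> f t != 0) /\
    forall c c', c <= c' -> `|c - t0| < r -> `|c' - t0| < r ->
      f c != 0 -> f c' != 0 ->
      (f c * f c' < 0) = [&& f t0 == 0, c < t0 & t0 <= c'].
Proof.
move=> cf hf; have [f0|f0] := eqVneq (f t0) 0; last first.
  have f0' : 0 < `|f t0| by rewrite normr_gt0.
  have [r r0 hr] := (continuous_normedP _ _).1 (cf t0) _ f0'.
  have same t : `|t - t0| < r -> 0 < f t * f t0.
    move=> /hr; have [h|h|h] := ltgtP (f t0) 0.
    - by rewrite (ltr0_norm h) ltr_norml => /andP[h1 h2]; nra.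
    - by rewrite (gtr0_norm h) ltr_norml => /andP[h1 h2]; nra.
    - by rewrite h eqxx in f0.
  exists r => //; split=> [t _ /same h|c c' _ /same h /same h' _ _].
    by apply: contraTneq h => ->; rewrite mul0r ltxx.
  apply/negbTE; rewrite -leNgt; nra.
have [d [r [d0 r0 hr]]] := hf f0.
exists r => //; split=> [t tt0 /(hr _ tt0) h|].
  by apply: contraTneq h => ->; rewrite mul0r ltxx.
move=> c c' cc' hc hc' fc fc'; rewrite /=.
have ct0 : c != t0 by apply: contraNneq fc => ->; apply/eqP.
have ct0' : c' != t0 by apply: contraNneq fc' => ->; apply/eqP.
have h1 := hr c ct0 hc; have h2 := hr c' ct0' hc'.
have d2 : 0 < d * d by rewrite -expr2 exprn_even_gt0.
have hh : 0 < (f c * f c') * (d * d) * ((c - t0) * (c' - t0)).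
  have -> : (f c * f c') * (d * d) * ((c - t0) * (c' - t0)) =
    (f c * (d * (c - t0))) * (f c' * (d * (c' - t0))) by ring.
  exact: mulr_gt0.
move: hh; rewrite mulrAC pmulr_lgt0// => hh.
have [ct|ct] := ltP c t0; have [c't|c't] := leP t0 c' => /=.
- have c't' : t0 < c' by rewrite lt_neqAle eq_sym ct0'.
  have D0 : (c - t0) * (c' - t0) < 0 by rewrite nmulr_rlt0 ?subr_gt0 ?subr_lt0.
  by move: hh; rewrite nmulr_lgt0.
- have D0 : 0 < (c - t0) * (c' - t0) by rewrite nmulr_rgt0 ?subr_lt0.
  by move: hh; rewrite pmulr_lgt0// => h; apply/negbTE; rewrite -leNgt ltW.
- have ct' : t0 < c by rewrite lt_neqAle eq_sym ct0.
  have D0 : 0 < (c - t0) * (c' - t0).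
    by rewrite pmulr_rgt0 ?subr_gt0//; exact: lt_le_trans cc'.
  by move: hh; rewrite pmulr_lgt0// => h; apply/negbTE; rewrite -leNgt ltW.
- by move: (le_lt_trans (le_trans ct cc') c't); rewrite ltxx.
Qed.

Variables (f g H : R -> R) (k1 : R).
Hypotheses (cf : continuous f) (cg : continuous g) (cH : continuous H).
Hypothesis fg_low : forall t, 0 <= t <= 1 -> H t < k1 -> 0 <= f t * g t.
Hypothesis f_simple : forall t, 0 <= t <= 1 -> k1 <= H t -> f t = 0 -> sign_change f t.
Hypothesis g_simple : forall t, 0 <= t <= 1 -> k1 <= H t -> g t = 0 -> sign_change g t.

(** The times at which f and g may be compared: below the level k1, where the
product does not change sign, or away from both zero sets. *)
Let adm t := H t < k1 \/ (f t != 0 /\ g t != 0).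
Definition high_zeros (u : R -> R) (c : R) : set R :=
  [set t | 0 <= t <= c /\ (k1 <= H t /\ u t = 0)].
Let par (A : set R) := odd #|` fset_set A|.
Let G c := [/\ adm c, finite_set (high_zeros f c), finite_set (high_zeros g c) &
  par (high_zeros f c) (+) par (high_zeros g c) (+) (f 0 * g 0 < 0) = (f c * g c < 0)].

Lemma high_zeros_step (u : R -> R) (t0 c c' : R) :
  (forall t, t != t0 -> c <= t <= c' -> u t != 0) -> 0 <= c -> c <= c' ->
  u c != 0 -> k1 <= H t0 -> finite_set (high_zeros u c) ->
  finite_set (high_zeros u c') /\
  par (high_zeros u c') = par (high_zeros u c) (+) [&& u t0 == 0, c < t0 & t0 <= c'].
Proof.
move=> hu c0 cc' uc Ht0 fc.
have [/and3P[/eqP u0 ct tc']|hn] := boolP [&& u t0 == 0, c < t0 & t0 <= c'].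
  have E : high_zeros u c' = high_zeros u c `|` [set t0].
    apply/seteqP; split=> t.
      move=> [/andP[t00 tc] [Ht ut]]; have [->|tt0] := eqVneq t t0; first by right.
      left; split => //; rewrite t00/= leNgt; apply/negP => ct1.
      by have := hu t tt0; rewrite ut eqxx tc ltW// => /(_ isT).
    move=> [[/andP[t00 tc] h]|->]; split=> //; first by rewrite t00 (le_trans tc).
    by rewrite tc' (le_trans c0)// ltW.
  have nz : ~ high_zeros u c t0 by move=> [/andP[_]]; rewrite leNgt ct.
  by rewrite E /par; have [? ->] := finite_odd_setU1 fc nz; rewrite addbT.
have E : high_zeros u c' = high_zeros u c.
  apply/seteqP; split=> t; last first.
    by move=> [/andP[t00 tc] h]; split=> //; rewrite t00 (le_trans tc).
  move=> [/andP[t00 tc] [Ht ut]]; split => //; rewrite t00/= leNgt; apply/negP => ct1.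
  have [tt0|tt0] := eqVneq t t0; last first.
    by have := hu t tt0; rewrite ut eqxx tc ltW// => /(_ isT).
  by move/negP: hn; apply; rewrite -tt0 ut eqxx ct1 tc.
by rewrite E addbF.
Qed.

Lemma parity_step (t0 : R) : 0 <= t0 <= 1 ->
  exists2 r : R, 0 < r & (forall c, 0 <= c <= 1 -> c != t0 -> `|c - t0| < r -> adm c) /\
    forall c c', 0 <= c -> c <= c' -> c' <= 1 -> `|c - t0| < r -> `|c' - t0| < r ->
      adm c' -> G c -> G c'.
Proof.
move=> t01; have [Ht|Ht] := ltP (H t0) k1.
  have pos : 0 < k1 - H t0 by rewrite subr_gt0.
  have [r r0 hr] := (continuous_normedP _ _).1 (@cH t0) _ pos.
  have Hlow t : `|t - t0| < r -> H t < k1 by move=> /hr; rewrite ltr_norml => /andP[_]; lra.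
  exists r => //; split=> [c _ _ /Hlow|c c' c0 cc' c'1 hc hc' ac' [ac fA fB pc]].
    by left.
  have E u : high_zeros u c' = high_zeros u c.
    apply/seteqP; split=> t [/andP[t00 tc] [Hk ut]]; split=> //; rewrite t00/=; last exact: le_trans cc'.
    rewrite leNgt; apply/negP => ct; move: Hk; rewrite leNgt => /negP; apply; apply: Hlow.
    move: hc hc'; rewrite !ltr_norml => /andP[? ?] /andP[? ?]; apply/andP; split; lra.
  split; rewrite ?E//; rewrite pc.
  have n1 : (f c * g c < 0) = false.
    by apply/negbTE; rewrite -leNgt; apply: fg_low; last exact: Hlow _ hc; apply/andP; split; lra.
  have n2 : (f c' * g c' < 0) = false.
    by apply/negbTE; rewrite -leNgt; apply: fg_low; last exact: Hlow _ hc'; apply/andP; split; lra.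
  by rewrite n1 n2.
have [rf rf0 [nf sf]] := sign_change_local (@cf) (f_simple t01 Ht).
have [rg rg0 [ng sg]] := sign_change_local (@cg) (g_simple t01 Ht).
exists (Num.min rf rg); first by rewrite lt_min rf0.
have admN c : `|c - t0| < Num.min rf rg -> adm c -> f c != 0 /\ g c != 0.
  rewrite lt_min => /andP[h1 h2]; have [->|ct] := eqVneq c t0; last by rewrite nf// ng.
  by case=> //; rewrite ltNge Ht.
split=> [c _ ct|c c' c0 cc' c'1 hc hc' ac' [ac fA fB pc]].
  by rewrite lt_min => /andP[h1 h2]; right; rewrite nf// ng.
have [fc gc] := admN c hc ac; have [fc' gc'] := admN c' hc' ac'.
move: (hc) (hc'); rewrite !lt_min => /andP[hcf hcg] /andP[hcf' hcg'].
have btw r t : `|c - t0| < r -> `|c' - t0| < r -> c <= t <= c' -> `|t - t0| < r.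
  by rewrite !ltr_norml => /andP[? ?] /andP[? ?] /andP[? ?]; apply/andP; split; lra.
have [fA' pA'] := @high_zeros_step f t0 c c'
  (fun t tt h => nf t tt (btw _ _ hcf hcf' h)) c0 cc' fc Ht fA.
have [fB' pB'] := @high_zeros_step g t0 c c'
  (fun t tt h => ng t tt (btw _ _ hcg hcg' h)) c0 cc' gc Ht fB.
split => //; rewrite pA' pB' -(sf c c')// -(sg c c')//.
have key : (f c' * g c' < 0) = (f c * g c < 0) (+) (f c * f c' < 0) (+) (g c * g c' < 0).
  rewrite !mulr_lt0 fc fc' gc gc' /=.
  by case: (f c < 0); case: (f c' < 0); case: (g c < 0); case: (g c' < 0).
rewrite key -pc.
by case: (f c * f c' < 0); case: (g c * g c' < 0); case: (par _); case: (par _); case: (_ < 0).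
Qed.

(** Along a segment, f and g are the heights above two graphs, which agree
below the level k1.  Each simple zero of f or g above this level flips the
sign of f * g, and below it f * g stays nonnegative, whatever f and g do
separately.  The property G is therefore propagated along [0, 1] by local
steps. *)
Lemma pair_parity : adm 0 -> adm 1 ->
  [/\ finite_set (high_zeros f 1), finite_set (high_zeros g 1) &
    odd #|` fset_set (high_zeros f 1)| (+) odd #|` fset_set (high_zeros g 1)| =
    (f 0 * g 0 < 0) (+) (f 1 * g 1 < 0)].
Proof.
move=> a0 a1.
have E0 u : (H 0 < k1 \/ u 0 != 0) -> high_zeros u 0 = set0.
  move=> hu; apply/seteqP; split=> // t [t0 [Ht ut]].
  have {t0} t0 : t = 0 by apply/eqP; rewrite eq_le andbC.
  by move: hu Ht ut; rewrite t0 => -[h|/eqP//]; rewrite leNgt h.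
have G0 : G 0.
  have Ef : high_zeros f 0 = set0 by apply: E0; case: a0 => [|[]]; [left|right].
  have Eg : high_zeros g 0 = set0 by apply: E0; case: a0 => [|[]]; [left|right].
  by split; rewrite ?Ef ?Eg//= /par fset_set0 cardfs0.
pose S := [set c | 0 <= c <= 1 /\ G c].
have S0 : S 0 by split => //; rewrite lexx ler01.
have supS : has_sup S by split; [exists 0|exists 1 => c [/andP[]]].
have s01 : 0 <= sup S <= 1.
  apply/andP; split; first by apply: ub_le_sup => //; exists 1 => c [/andP[]].
  by apply: sup_le_ub => [|c [/andP[]]//]; exists 0.
have [r r0 [hadm hstep]] := parity_step s01.
have [c [/andP[c0 c1] Gc] cs] := sup_adherent r0 supS.
have cs' : c <= sup S by apply: ub_le_sup; [exists 1 => ? [/andP[]]|split=> //; rewrite c0].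
have cr : `|c - sup S| < r by rewrite ltr_norml; apply/andP; split; lra.
have [s1|s1] := eqVneq (sup S) 1.
  have [_ ? ? <-] : G 1.
    apply: (hstep c 1) => //; rewrite s1 subrr normr0//.
  split=> //; rewrite /par; case: (odd _); case: (odd _) => /=; by case: (_ < 0).
exfalso; pose c' := Num.min 1 (sup S + r / 2).
have s1' : sup S < 1 by rewrite lt_neqAle s1; case/andP: s01.
have sc' : sup S < c' by rewrite lt_min s1' ltrDl divr_gt0.
have c'1 : c' <= 1 by rewrite ge_min lexx.
have c'r : `|c' - sup S| < r.
  have : c' <= sup S + r / 2 by rewrite ge_min lexx orbT.
  by move=> h; rewrite ltr_norml; apply/andP; split; lra.
have c'0 : 0 <= c' by case/andP: s01 => h _; exact: le_trans h (ltW sc').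
have Gc' : G c'.
  apply: (hstep c c') => //; first exact: le_trans cs' (ltW sc').
  by apply: hadm => //; rewrite ?c'0 ?c'1// gt_eqF.
have : c' <= sup S by apply: ub_le_sup; [exists 1 => ? [/andP[]]|split=> //; rewrite c'0].
by rewrite leNgt sc'.
Qed.

End parity.

(** * Segments that touch a graph form a null set *)
Section sard.
Context {R : realType}.
Local Notation mT := (measurableTypeR R).
Local Notation leb := (@lebesgue_measure R).

Lemma compact_unif_continuous (V W : normedModType R) (A : set V) (f : V -> W) :
  compact A -> continuous f -> forall e : R, 0 < e -> exists2 d : R, 0 < d &
    forall x y, A x -> `|y - x| < d -> `|f y - f x| < e.
Proof.
move=> cA cf e e0.
apply: (@compact_ind R V A (fun B => exists2 d : R, 0 < d &
  forall x y, B x -> `|y - x| < d -> `|f y - f x| < e) cA).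
- by exists 1.
- move=> B C [d d0 hd] [d' d'0 hd']; exists (Num.min d d'); first by rewrite lt_min d0.
  by move=> x y [Bx|Cx]; rewrite lt_min => /andP[h h']; [exact: hd|exact: hd'].
- by move=> B C BC [d d0 hd]; exists d => // x y /BC; exact: hd.
move=> z Az; have e20 : 0 < e / 2 by rewrite divr_gt0.
have [d d0 hd] := (continuous_normedP _ _).1 (cf z) _ e20.
exists (d / 2); rewrite ?divr_gt0//; exists (d / 2); rewrite ?divr_gt0//.
move=> x y [_ xz] yx.
have yz : `|y - z| < d.
  rewrite (_ : y - z = (y - x) + (x - z)); last by rewrite addrA subrK.
  by apply: le_lt_trans (ler_normD _ _) _; lra.
have xz' : `|x - z| < d by lra.
have := hd _ yz; have := hd _ xz'; rewrite (distrC (f x)) => h1 h2.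
rewrite (_ : f y - f x = (f y - f z) + (f z - f x)); last by rewrite addrA subrK.
by apply: le_lt_trans (ler_normD _ _) _; lra.
Qed.

(** One-dimensional Sard theorem: around a critical point, an interval of length
1/m is sent by f to an interval of length o(1/m), by uniform continuity of
f'. *)
Lemma critical_values_null (f f' : R -> R) (A : set mT) :
  (forall t : R, is_derive t (1 : R) f (f' t)) -> continuous f' -> measurable A ->
  (forall a, A a -> exists2 t : R, 0 <= t <= 1 & f t = a /\ f' t = 0) ->
  leb A = 0%E.
Proof.
move=> df cf' mA hA; apply/eqP; rewrite eq_le measure_ge0 andbT.
apply/lee_addgt0Pr => e e0; rewrite add0e.
have e40 : 0 < e / 4 by rewrite divr_gt0.
have [d d0 hd] := compact_unif_continuous (@segment_compact R 0 1) cf' e40.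
pose k := (Num.truncn d^-1).+1.
have k0 : 0 < k%:R :> R by rewrite ltr0n.
have kd : k%:R^-1 < d.
  rewrite -[ltRHS]invrK ltf_pV2 ?posrE ?invr_gt0//; exact: truncnS_gt.
pose t_ (i : nat) : R := i%:R / k%:R.
pose I (i : nat) : set mT := `[f (t_ i) - e / 4 / k%:R, f (t_ i) + e / 4 / k%:R]%classic.
have eps0 : 0 < e / 4 / k%:R by rewrite divr_gt0.
have mI i : leb (I i) = (e / 2 / k%:R)%:E.
  rewrite lebesgue_measure_itv/= lte_fin ltrD2l gtrN// -EFinB; congr (_%:E).
  by move: (k%:R) k0 => K K0; field; rewrite gt_eqF.
have AI : A `<=` \big[setU/set0]_(i < k.+1) I i.
  move=> a /hA[t /andP[t0 t1] [<- f't]]; rewrite -bigcup_mkord.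
  have tk0 : 0 <= t * k%:R by rewrite mulr_ge0// ler0n.
  have /andP[h1 h2] := truncn_itv tk0; set i := Num.truncn _ in h1 h2.
  exists i => /=.
    by rewrite ltnS -(ler_nat R); apply: le_trans h1 _; rewrite ler_piMl// ler0n.
  have ti : t_ i <= t by rewrite ler_pdivrMr.
  have tti : t - t_ i < k%:R^-1.
    rewrite -(ltr_pM2r k0) mulVf ?gt_eqF// mulrBl divfK ?gt_eqF//.
    by move: h2; rewrite -addn1 natrD; lra.
  have [|c] := MVT_segment ti (fun x _ => df x).
    apply: continuous_subspaceT => x; apply: differentiable_continuous.
    by apply/derivable1_diffP; have [] := df x.
  rewrite in_itv/= => /andP[c0 c1] fE.
  have f'c : `|f' c| < e / 4.
    rewrite -[f' c]subr0 -f't; apply: hd; first by rewrite /= in_itv/= t0.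
    by rewrite distrC ger0_norm ?subr_ge0//; lra.
  have : `|f t - f (t_ i)| <= e / 4 / k%:R.
    rewrite fE normrM ler_pM// ?ltW//.
    by rewrite ger0_norm ?subr_ge0.
  by rewrite /I/= in_itv/= ler_norml => /andP[? ?]; apply/andP; split; lra.
apply: (@le_trans _ _ (\sum_(i < k.+1) leb (I i))%E).
  by apply: content_subadditive => // i _; exact: measurable_itv.
rewrite (eq_bigr (fun=> (e / 2 / k%:R)%:E)) => [|i _]; last exact: mI.
rewrite sumEFin lee_fin sumr_const card_ord -[leLHS]mulr_natl -addn1 natrD.
have k1 : 1 <= k%:R :> R by rewrite ler1n.
move: (k%:R) k0 k1 => K K0 K1; rewrite mulrA ler_pdivrMr//; nra.
Qed.

End sard.

Lemma null_setU3 d (T : measurableType d) (R : realType)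
    (m : {measure set T -> \bar R}) (A B C : set T) :
  measurable A -> measurable B -> measurable C ->
  m A = 0%E -> m B = 0%E -> m C = 0%E -> m (A `|` B `|` C) = 0%E.
Proof.
move=> mA mB mC A0 B0 C0; rewrite measureU0//; last exact: measurableU.
by rewrite measureU0.
Qed.

Section touching.
Context {R : realType} {n : nat}.
Local Notation mT := (measurableTypeR R).
Local Notation leb := (@lebesgue_measure R).
Local Notation W := 'rV[R]_n.+1.
Local Notation V := 'rV[R]_n.+2.
Local Notation tW := (n.+1.-tuple (measurableTypeR R)).
Local Notation tV := (n.+2.-tuple (measurableTypeR R)).
Local Notation mu := (@lebesgue_tuple R).
Variables (sg : bool) (u : W -> R).
Hypothesis C1u : Ck 1 [set: W] u.

Definition over (x y : V) (t : R) : R :=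
  ht sg (x + t *: (y - x)) - u (hproj (x + t *: (y - x))).
Definition over' (x y : V) (t : R) : R :=
  ht sg (y - x) - 'D_(hproj (y - x)) u (hproj (x + t *: (y - x))).

(** Pairs for which crossings cannot be counted by sign changes: an endpoint on
the graph, or a tangency. *)
Definition touching (x y : V) : Prop := exists t : R,
  [/\ 0 <= t <= 1, over x y t = 0 & [\/ t = 0, t = 1 | over' x y t = 0]].

Lemma Ck1_continuous : continuous u.
Proof. by move=> x; apply: differentiable_continuous; case: C1u => h _; exact: h. Qed.

Lemma over_derive x y (t : R) : is_derive t (1 : R) (over x y) (over' x y t).
Proof.
rewrite /over /over'.
have -> : (fun t : R => ht sg (x + t *: (y - x)) - u (hproj (x + t *: (y - x)))) =
  (fun t : R => ht sg x + t * ht sg (y - x)) -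
  (fun t : R => u (hproj x + t *: hproj (y - x))).
  by apply/funext => r; rewrite /= !fctE htD htZ hprojD hprojZ.
have d1 : is_derive t (1 : R) (fun t : R => ht sg x + t * ht sg (y - x)) (ht sg (y - x)).
  have := @is_deriveD R R R (cst (ht sg x)) (fun t : R => t * ht sg (y - x)) t 1 0
    (ht sg (y - x)) (is_derive_cst _ _ _).
  rewrite add0r => H; apply: H.
  have := @is_deriveM _ _ id (cst (ht sg (y - x))) t 1 _ _ (is_derive_id _ _) (is_derive_cst _ _ _).
  by rewrite scaler0 add0r /GRing.scale /= mulr1.
rewrite (hprojD x) (hprojZ t); apply: is_deriveB.
apply: is_derive_line; apply: diff_derivable; case: C1u => h _; exact: h.
Qed.

Lemma over'_continuous x y : continuous (over' x y).
Proof.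
move=> t; rewrite /over'; apply: cvgB; first exact: cvg_cst.
apply: (@continuous_comp R W R (fun t => hproj (x + t *: (y - x)))
  (fun w => 'D_(hproj (y - x)) u w) t); last by case: C1u => _ h; exact: h.
apply: (@continuous_comp R V W (fun t => x + t *: (y - x)) (@hproj R n) t).
  by apply: cvgD; [exact: cvg_cst|apply: cvgZr_tmp; exact: cvg_id].
exact: continuous_hproj.
Qed.

Let mker1 : measurable_vec (fun p : tV * tV => row_of p.1).
Proof. exact: measurable_vec_pair1. Qed.
Let mker2 : measurable_vec (fun p : tV * tV => row_of p.2).
Proof. exact: measurable_vec_pair2. Qed.

Let mseg (t : R) :
  measurable_vec (fun p : tV * tV => row_of p.1 + t *: (row_of p.2 - row_of p.1)).
Proof.
move=> i; rewrite (_ : (fun p => _) = (fun p : tV * tV => row_of p.1 0 i +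
  t * (row_of p.2 - row_of p.1) 0 i)); last by apply/funext => p; rewrite !mxE.
apply: measurable_funD; first exact: mker1.
by apply: measurable_funM => //; exact: measurable_vecB.
Qed.

Lemma measurable_over (t : R) :
  measurable_fun [set: tV * tV] (fun p : tV * tV => over (row_of p.1) (row_of p.2) t).
Proof.
apply: measurable_funB; first (apply: measurable_ht; exact: mseg).
by apply: measurable_continuous_vec; [exact: Ck1_continuous|(apply: measurable_vec_hproj; exact: mseg)].
Qed.

Lemma measurable_over' (t : R) :
  measurable_fun [set: tV * tV] (fun p : tV * tV => over' (row_of p.1) (row_of p.2) t).
Proof.
apply: measurable_funB; first (apply: measurable_ht; exact: measurable_vecB).
rewrite (_ : (fun p => _) = (fun p : tV * tV => \sum_j (hproj (row_of p.2 - row_of p.1)) 0 j *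
   'D_(delta_mx 0 j) u (hproj (row_of p.1 + t *: (row_of p.2 - row_of p.1))))); last first.
  by apply/funext => p; rewrite derive_delta//; case: C1u => h _; exact: h.
apply: measurable_sum => j; apply: measurable_funM.
  (apply: measurable_vec_hproj; exact: measurable_vecB).
apply: (@measurable_continuous_vec _ _ _ _ (fun w => 'D_(delta_mx 0 j) u w)).
  by move=> w; case: C1u => _ h; exact: h.
(apply: measurable_vec_hproj; exact: mseg).
Qed.

Definition tangent_lines : set (tV * tV) := [set p | exists2 t : R, 0 <= t <= 1 &
  over (row_of p.1) (row_of p.2) t = 0 /\ over' (row_of p.1) (row_of p.2) t = 0].

Let h (p : tV * tV) (t : R) : R :=
  `|over (row_of p.1) (row_of p.2) t| + `|over' (row_of p.1) (row_of p.2) t|.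

Let ch p : continuous (h p).
Proof.
move=> t; apply: cvgD; apply: cvg_norm; last exact: over'_continuous.
apply: differentiable_continuous; apply/derivable1_diffP.
by have [] := over_derive (row_of p.1) (row_of p.2) t.
Qed.

Lemma measurable_tangent_lines : measurable tangent_lines.
Proof.
rewrite (_ : tangent_lines = \bigcap_(m in [set: nat])
  \bigcup_q [set p | 0 <= (ratr q : R) <= 1 /\ h p (ratr q) < m.+1%:R^-1]).
  apply: bigcapT_measurable => m; apply: bigcupT_measurable_rat => q.
  have [q01|q01] := boolP (0 <= (ratr q : R) <= 1); last first.
    by rewrite (_ : [set p | _] = set0)//; apply/seteqP; split=> // p [].
  rewrite (_ : [set p | _] = [set p | h p (ratr q) < m.+1%:R^-1]); last first.
    by apply/seteqP; split=> p; [case|split].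
  rewrite -[X in measurable X]setTI; apply: measurable_fun_ltr => //.
  apply: measurable_funD; apply: measurableT_comp => //;
    [exact: measurable_over|exact: measurable_over'].
apply/seteqP; split=> p.
  move=> [t /andP[t0 t1] [ov0 oD0]] m _.
  have e0 : 0 < m.+1%:R^-1 :> R by rewrite invr_gt0.
  have [d d0 hd] := (continuous_normedP _ _).1 (@ch p t) _ e0.
  have lt : Num.max 0 (t - d) < Num.min 1 (t + d).
    by rewrite gt_max !lt_min; apply/andP; split; apply/andP; split; lra.
  have [q] := rat_in_itvoo lt; rewrite in_itv/= gt_max lt_min => /andP[/andP[q0 q1] /andP[q2 q3]].
  exists q => //; split; first by rewrite !ltW.
  have : `|ratr q - t| < d by rewrite ltr_norml; apply/andP; split; lra.
  move=> /hd; rewrite {2}/h ov0 oD0 normr0 addr0 subr0 ger0_norm//.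
  by rewrite addr_ge0.
move=> hp; have [|t] := @EVT_min R (h p) 0 1 ler01.
  exact/continuous_subspaceT/ch.
rewrite in_itv/= => t01 tmin; exists t => //.
have h0 : 0 <= h p t by rewrite addr_ge0.
suff : h p t = 0.
  move=> /eqP; rewrite paddr_eq0// !normr_eq0 => /andP[/eqP ? /eqP ?]; by split.
apply/eqP; rewrite eq_le h0 andbT; apply/ler_addgt0Pl => e e0; rewrite addr0.
have [q _ [q01 hq]] := hp (Num.truncn e^-1) I.
apply: le_trans (tmin _ _) _; first by rewrite in_itv; exact: q01.
apply: le_trans (ltW hq) _; rewrite -[leRHS]invrK lef_pV2 ?posrE ?invr_gt0//.
exact/ltW/truncnS_gt.
Qed.

Lemma measurable_temb_height d (T : measurableType d) (w : tW) (m : T -> mT) :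
  measurable_fun [set: T] m -> measurable_fun [set: T] (fun q => temb sg w (m q)).
Proof.
move=> mm; have mp : measurable_fun [set: T] (fun q => (w, m q)).
  exact: measurable_fun_pair.
exact: (measurableT_comp (@measurable_temb R n sg) mp).
Qed.

(** Once the horizontal parts of the two points and the difference m of their
heights are fixed, the segment can only be moved vertically, and the heights
at which it is tangent to the graph of u are critical values of the C^1
function t |-> u (w + t v) - t m. *)
Lemma tangent_lines_null : (mu n.+2 \x mu n.+2)%E tangent_lines = 0%E.
Proof.
have mB := measurable_tangent_lines.
rewrite -[tangent_lines]setIT -integral_indic//.
have mI : measurable_fun [set: tV * tV] (fun p : tV * tV => (\1_tangent_lines p)%:E : \bar R).
  (apply/measurable_EFinP; exact: measurable_indic).
have I0 (p : tV * tV) : (0 <= (\1_tangent_lines p : R)%:E)%E by rewrite lee_fin.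
have [_ ->] := integral_temb2 sg mI I0.
apply: integral0_eq => -[w w'] _ /=.
pose F (q : mT * mT) : \bar R := (\1_tangent_lines (temb sg w q.1, temb sg w' (q.1 + q.2)))%:E.
have mF : measurable_fun [set: mT * mT] F.
  apply: (measurableT_comp mI); apply: measurable_fun_pair; apply: measurable_temb_height => //.
  exact: measurable_funD.
transitivity (\int[leb]_r \int[leb]_m F (r, m))%E.
  apply: eq_integral => r _.
  pose f1 (y : R) : \bar R := (\1_tangent_lines (temb sg w r, temb sg w' y))%:E.
  have mf1 : measurable_fun [set: mT] f1.
    apply: (measurableT_comp mI); apply: measurable_fun_pair => //.
    exact: measurable_temb_height.
  have f10 y : (0 <= f1 y)%E by rewrite lee_fin.
  apply: (@etrans _ _ (\int[leb]_y f1 y)%E); first by [].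
  apply: esym; apply: (etrans _ (integral_shift r mf1 f10)).
  by apply: eq_integral => m _; rewrite /F/f1/= addrC.
have F0 q : (0 <= F q)%E by rewrite lee_fin.
apply: (etrans (fubini_tonelli F mF F0)).
apply: integral0_eq => m _.
pose A : set mT := [set r | tangent_lines (temb sg w r, temb sg w' (r + m))].
have mA : measurable A.
  rewrite -[X in measurable X]setTI.
  apply: (_ : measurable_fun setT (fun r : mT => (temb sg w r, temb sg w' (r + m)))) => //.
  apply: measurable_fun_pair; apply: measurable_temb_height => //; exact: measurable_funD.
change (\int[leb]_r (\1_A r)%:E = 0)%E.
rewrite integral_indic// setIT.
pose v := row_of w' - row_of w.
apply: (@critical_values_null R (fun t => u (row_of w + t *: v) - t * m)
  (fun t => 'D_v u (row_of w + t *: v) - m)) => //.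
- move=> t; apply: is_deriveB.
    by apply: is_derive_line; apply: diff_derivable; case: C1u => H _; exact: H.
  have := @is_deriveM _ _ id (cst m) t 1 _ _ (is_derive_id _ _) (is_derive_cst _ _ _).
  by rewrite scaler0 add0r /GRing.scale /= mulr1.
- move=> t; apply: cvgB; last exact: cvg_cst.
  apply: (@continuous_comp R W R (fun t => row_of w + t *: v) (fun x => 'D_v u x) t).
    by apply: cvgD; [exact: cvg_cst|apply: cvgZr_tmp; exact: cvg_id].
  by case: C1u => _ H; exact: H.
move=> r [t t01 /=]; rewrite /over /over' !row_of_temb htD htZ hprojD hprojZ !htB !hprojB.
rewrite !ht_emb !hproj_emb => -[ov0 oD0]; exists t => //; rewrite -/v in ov0 oD0.
by split; lra.
Qed.

Lemma touching_null : exists N : set (tV * tV),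
  [/\ measurable N, (mu n.+2 \x mu n.+2)%E N = 0%E &
    forall p, touching (row_of p.1) (row_of p.2) -> N p].
Proof.
have cu := Ck1_continuous.
pose gr : set tV := [set t | ht sg (row_of t) - u (hproj (row_of t)) = 0].
have mgr : measurable gr.
  rewrite -[X in measurable X]setTI.
  have mg : measurable_fun [set: tV] (fun t : tV => ht sg (row_of t) - u (hproj (row_of t))).
    apply: measurable_funB; first (apply: measurable_ht; exact: measurable_row_of).
    by apply: measurable_continuous_vec => //; (apply: measurable_vec_hproj; exact: measurable_row_of).
  exact: (mg measurableT [set 0] (measurable_set1 _)).
have gr0 : mu n.+2 gr = 0%E.
  rewrite -[gr]setIT -integral_indic// (integral_temb sg).
  - apply: integral0_eq => w _.
    rewrite (_ : (fun r => _) = (fun r : mT => (\1_[set u (row_of w)] r)%:E)); last first.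
      apply/funext => r; rewrite !indicE /gr; congr ((nat_of_bool _)%:R%:E).
      apply/idP/idP => /set_mem; rewrite /gr/=.
        rewrite row_of_temb ht_emb hproj_emb => /eqP; rewrite subr_eq0 => /eqP h0.
        exact/mem_set.
      by move=> h0; apply/mem_set; rewrite /= row_of_temb ht_emb hproj_emb h0 subrr.
    rewrite integral_indic//; rewrite setIT; exact: lebesgue_measure_set1.
  - (apply/measurable_EFinP; exact: measurable_indic).
  - by move=> x; rewrite lee_fin.
exists ((gr `*` setT) `|` (setT `*` gr) `|` tangent_lines); split.
- apply: measurableU; last exact: measurable_tangent_lines.
  by apply: measurableU; exact: measurableX.
- have z1 : (mu n.+2 \x mu n.+2)%E (gr `*` setT) = 0%E.
    apply: (@etrans _ _ (mu n.+2 gr * mu n.+2 setT)%E); first exact: product_measure1E.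
    by rewrite gr0 mul0e.
  have z2 : (mu n.+2 \x mu n.+2)%E (setT `*` gr) = 0%E.
    apply: (@etrans _ _ (mu n.+2 setT * mu n.+2 gr)%E); first exact: product_measure1E.
    by rewrite gr0 mule0.
  apply: (null_setU3 _ _ measurable_tangent_lines z1 z2 tangent_lines_null);
    exact: measurableX.
move=> p [t [t01 ot [t0|t1|oDt]]].
- by left; left; split=> //=; move: ot; rewrite /over t0 scale0r addr0.
- by left; right; split=> //=; move: ot; rewrite /over t1 scale1r (addrC (row_of p.1)) subrK.
- by right; exists t.
Qed.

End touching.

(** * Crossing parity of a hypersurface that is a graph above a level *)
Section simple_zero.
Context {R : realType}.

Lemma derive_sign_change (f : R -> R) (t d : R) :
  is_derive t (1 : R) f d -> f t = 0 -> d != 0 -> sign_change f t.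
Proof.
move=> [df dE] ft0 d0.
have df' : differentiable f t by apply/derivable1_diffP.
have cl : continuous ('d f t) by exact: diff_continuous.
have d20 : 0 < `|d| / 2 by rewrite divr_gt0// normr_gt0.
have [r r0 hr] := (is_diff_normedP _ _ cl).1 (differentiableP df') _ d20.
exists d, r; split=> // s st sr; have := hr s sr.
have -> : 'd f t (s - t) = (s - t) * d.
  have -> : s - t = (s - t) *: (1 : R) by rewrite /GRing.scale/= mulr1.
  by rewrite linearZ/= -deriveE// dE /GRing.scale/= mulr1.
rewrite ft0 subr0 => h.
have st0 : 0 < `|s - t| by rewrite normr_gt0 subr_eq0.
have E : f s * (d * (s - t)) =
    ((s - t) * d) ^+ 2 + (f s - (s - t) * d) * ((s - t) * d) by ring.
rewrite E.
have h1 : `|(f s - (s - t) * d) * ((s - t) * d)| <= (`|s - t| * `|d|) ^+ 2 / 2.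
  rewrite !normrM; apply: (@le_trans _ _ (`|d| / 2 * `|s - t| * (`|s - t| * `|d|))).
    by rewrite ler_wpM2r// mulr_ge0.
  by rewrite le_eqVlt; apply/orP; left; apply/eqP; field.
have h2 : ((s - t) * d) ^+ 2 = (`|s - t| * `|d|) ^+ 2 by rewrite -normrM real_normK// num_real.
have h3 : 0 < (`|s - t| * `|d|) ^+ 2 by rewrite exprn_gt0// mulr_gt0// normr_gt0.
rewrite h2; move: h1; rewrite ler_norml => /andP[h1 _]; lra.
Qed.

Lemma sign_change_nz (f : R -> R) (t : R) : sign_change f t ->
  exists2 r : R, 0 < r & forall s, t < s -> s < t + r -> f s != 0.
Proof.
move=> [d [r [d0 r0 h]]]; exists r => // s ts sr.
have := h s; rewrite gt_eqF// ger0_norm ?subr_ge0 ?ltW// ltrBlDl => /(_ isT sr).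
by apply: contraTneq => ->; rewrite mul0r ltxx.
Qed.

Lemma sign_change_near (f g : R -> R) (t : R) : sign_change f t ->
  (exists2 r : R, 0 < r & forall s, `|s - t| < r -> g s = f s) -> sign_change g t.
Proof.
move=> [d [r [d0 r0 h]]] [r' r'0 h']; exists d, (Num.min r r'); split=> //.
  by rewrite lt_min r0.
by move=> s st; rewrite lt_min => /andP[sr /h' ->]; exact: h.
Qed.

Definition odd_set (A : set R) : Prop := exists2 k, odd k & (A #= `I_k)%card.

Lemma odd_setE (A : set R) : finite_set A -> odd_set A <-> odd #|` fset_set A|.
Proof.
move=> fA; split=> [[k ok /card_fset_set ->]//|oA].
by exists #|` fset_set A| => //; have [k Ak] := fA; rewrite (card_fset_set Ak).
Qed.

Lemma odd_setU (L A : set R) : finite_set A -> (forall t, L t -> ~ A t) ->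
  odd_set (L `|` A) <-> finite_set L /\ odd #|` fset_set L| (+) odd #|` fset_set A|.
Proof.
move=> fA LA; have card : finite_set L -> #|` fset_set (L `|` A)| = (#|` fset_set L| + #|` fset_set A|)%N.
  move=> fL; rewrite fset_setU// cardfsU (_ : (_ `&` _)%fset = fset0) ?cardfs0 ?subn0//.
  apply/fsetP => t; rewrite in_fsetI !in_fset_set// in_fset0; apply/negbTE/negP.
  by move=> /andP[/set_mem h1 /set_mem]; exact: LA.
split=> [oLA|[fL o]].
  have : finite_set (L `|` A) by case: oLA => k _ ?; exists k.
  rewrite finite_setU => -[fL _]; split=> //; rewrite -oddD -card//.
  by apply/odd_setE => //; rewrite finite_setU.
by apply/odd_setE; rewrite ?finite_setU// card// oddD.
Qed.

End simple_zero.

Section one_surface.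
Context {R : realType} {n : nat}.
Local Notation W := 'rV[R]_n.+1.
Local Notation V := 'rV[R]_n.+2.
Variables (sg : bool) (M : set V) (u : W -> R) (c : R).
Hypothesis C1u : Ck 1 [set: W] u.
Hypothesis M_graph : forall x, c < ht sg x -> (M x <-> ht sg x = u (hproj x)).

(** Only the part above the level c is known to be a graph; truncating u at c
gives a continuous function whose graph agrees with M above c. *)
Let U (w : W) : R := Num.max (u w) c.
Definition seg (x y : V) (t : R) : V := x + t *: (y - x).
Definition over_clamp (x y : V) (t : R) : R := ht sg (seg x y t) - U (hproj (seg x y t)).

Lemma seg_continuous x y : continuous (seg x y).
Proof. by move=> t; apply: cvgD; [exact: cvg_cst|apply: cvgZr_tmp; exact: cvg_id]. Qed.

Lemma seg_ht_continuous x y : continuous (fun t => ht sg (seg x y t)).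
Proof.
move=> t; apply: (continuous_comp (@seg_continuous x y t)); exact: continuous_ht.
Qed.

Lemma clamp_continuous : continuous U.
Proof.
move=> w; apply: (@continuous_max R W u (cst c) w); last exact: cst_continuous.
exact: Ck1_continuous.
Qed.

Lemma over_clamp_continuous x y : continuous (over_clamp x y).
Proof.
move=> t; apply: cvgB; first exact: seg_ht_continuous.
apply: (@continuous_comp R V R (seg x y) (fun p => U (hproj p)) t); first exact: seg_continuous.
by apply: continuous_comp; [exact: continuous_hproj|exact: clamp_continuous].
Qed.

(** A curve in M that starts above the level c stays in the graph of u, so its
velocity is tangent to this graph. *)
Lemma graph_velocity p v : c < ht sg p -> M p -> inward_velocity M p v ->
  ht sg v = 'D_(hproj v) u (hproj p).
Proof.
move=> cp Mp [g [g0 dg Mg]]; pose f (t : R) := ht sg (g t) - u (hproj (g t)).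
have du : differentiable u (hproj p) by case: C1u => h _; exact: h.
have dfg : differentiable g (0 : R) by apply/derivable1_diffP; case: dg.
have gE : 'd g (0 : R) (1 : R) = v by rewrite -deriveE//; case: dg => _ ->.
have dhg : is_diff (0 : R) (ht sg \o g) (ht sg \o 'd g (0 : R)).
  apply: is_diff_comp; [exact: differentiableP|exact: is_diff_ht].
have dpg : is_diff (0 : R) (@hproj R n \o g) (@hproj R n \o 'd g (0 : R)).
  apply: is_diff_comp; [exact: differentiableP|exact: is_diff_hproj].
have dug : is_diff (0 : R) (u \o (@hproj R n \o g)) ('d u (hproj p) \o (@hproj R n \o 'd g (0 : R))).
  by apply: is_diff_comp; rewrite /= g0; exact: differentiableP.
have df : is_derive (0 : R) (1 : R) f (ht sg v - 'D_(hproj v) u (hproj p)).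
  apply: is_deriveB.
    apply: DeriveDef; first by apply: diff_derivable; case: dhg.
    by rewrite deriveE; [rewrite diff_val/= gE|case: dhg].
  apply: DeriveDef; first by apply: diff_derivable; case: dug.
  by rewrite deriveE; [rewrite diff_val/= gE deriveE|case: dug].
apply/eqP; rewrite -subr_eq0; apply/negP => /negP nz.
have f0 : f 0 = 0 by rewrite /f g0; apply/eqP; rewrite subr_eq0; apply/eqP/M_graph.
have [r r0 hr] := sign_change_nz (derive_sign_change df f0 nz).
have chg : {for (0 : R), continuous (ht sg \o g)} by apply: differentiable_continuous; case: dhg.
have pc : 0 < ht sg p - c by rewrite subr_gt0.
have [r' r'0 hr'] := (continuous_normedP _ _).1 chg _ pc.
have : \forall t \near (0 : R)^'+, False; last by move=> /filter_ex[].
near=> t; have t0 : 0 < t by [].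
have tr : t < 0 + r by rewrite add0r; near: t; exact: nbhs_right_lt.
have tr' : t < r' by near: t; exact: nbhs_right_lt.
have : `|t - 0| < r' by rewrite subr0 gtr0_norm.
move=> /hr'; rewrite /= g0 ltr_norml => /andP[h _].
have ct : c < ht sg (g t) by lra.
have /eqP := hr t t0 tr; apply; rewrite /f; apply/eqP; rewrite subr_eq0; apply/eqP/M_graph => //.
by near: t.
Unshelve. all: by end_near. Qed.

Lemma transversal x y p : ~ touching sg u x y -> crossings M x y p -> c < ht sg p ->
  ~ tangent_space M p (y - x).
Proof.
move=> nt [Mp [t t01 pE]] cp tan; apply: nt; exists t.
have t01' : 0 <= t <= 1 by case/andP: t01 => *; rewrite !ltW.
split=> //; first by rewrite /over -pE; apply/eqP; rewrite subr_eq0; apply/eqP/M_graph.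
constructor 3; rewrite /over' -pE; apply/eqP; rewrite subr_eq0; apply/eqP.
case: tan => [/(graph_velocity cp Mp)//|/(graph_velocity cp Mp)].
have du : differentiable u (hproj p) by case: C1u => h _; exact: h.
rewrite htN (linearN (@hproj R n)) !deriveE// linearN => /eqP.
by rewrite eqr_opp => /eqP.
Qed.

Lemma clamp_simple x y (t : R) : ~ touching sg u x y -> 0 <= t <= 1 ->
  c < ht sg (seg x y t) -> over_clamp x y t = 0 -> sign_change (over_clamp x y) t.
Proof.
move=> nt t01 ct /eqP; rewrite subr_eq0 => /eqP hU.
have cu : c < u (hproj (seg x y t)).
  by move: ct; rewrite hU /U lt_max ltxx orbF.
have hu : ht sg (seg x y t) = u (hproj (seg x y t)).
  by rewrite hU /U; apply/max_idPl/ltW.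
have o0 : over sg u x y t = 0 by rewrite /over -/(seg x y t) hu subrr.
apply: (@sign_change_near _ (over sg u x y)).
  apply: (derive_sign_change (over_derive sg C1u x y t) o0); apply/eqP => o1.
  by apply: nt; exists t; split=> //; constructor 3.
have cus : continuous (fun t => u (hproj (seg x y t))).
  move=> s; apply: (@continuous_comp R V R (seg x y) (fun p => u (hproj p)) s); first exact: seg_continuous.
  by apply: continuous_comp; [exact: continuous_hproj|exact: Ck1_continuous].
have pc : 0 < u (hproj (seg x y t)) - c by rewrite subr_gt0.
have [r r0 hr] := (continuous_normedP _ _).1 (cus t) _ pc.
exists r => // s /hr; rewrite ltr_norml => /andP[h _].
rewrite /over_clamp /over -/(seg x y s) /U; congr (_ - _); apply/max_idPl; lra.
Qed.

Lemma odd_crossingE x y : x != y ->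
  odd_crossing M x y <-> (forall p, crossings M x y p -> ~ tangent_space M p (y - x)) /\
    odd_set [set t | 0 < t < 1 /\ M (seg x y t)].
Proof.
move=> xy; rewrite /odd_crossing /odd_set.
have E : crossings M x y = seg x y @` [set t | 0 < t < 1 /\ M (seg x y t)].
  apply/seteqP; split=> p; first by move=> [Mp [t t01 pE]]; exists t => //; rewrite /= /seg -pE.
  by move=> [t [t01 Mt] <-]; split=> //; exists t.
have inj : {in [set t | 0 < t < 1 /\ M (seg x y t)] &, injective (seg x y)}.
  move=> s t _ _ /addrI/eqP; rewrite -subr_eq0 -scalerBl scaler_eq0 [y - x == _]subr_eq0.
  by rewrite [y == x]eq_sym (negbTE xy) orbF subr_eq0 => /eqP.
have eqk := inj_card_eq inj; rewrite -E in eqk.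
split=> -[h [k ok hk]]; split=> //; exists k => //; first by rewrite -(card_eql eqk).
by rewrite (card_eql eqk).
Qed.

End one_surface.

Section crossing_parity.
Context {R : realType} {n : nat}.
Local Notation W := 'rV[R]_n.+1.
Local Notation V := 'rV[R]_n.+2.
Variables (sg : bool).

Definition clamp (u : W -> R) (c : R) (w : W) : R := Num.max (u w) c.

Lemma seg0 (x y : V) : seg x y 0 = x. Proof. by rewrite /seg scale0r addr0. Qed.
Lemma seg1 (x y : V) : seg x y 1 = y. Proof. by rewrite /seg scale1r addrC subrK. Qed.

Lemma odd_crossing_diag (M : set V) x : ~ odd_crossing M x x.
Proof.
move=> [nt [k ok Ek]]; have k0 : (0 < k)%N by case: k ok {Ek}.
have [p cp] : crossings M x x !=set0.
  apply/set0P; apply/eqP => p0; have := card_fset_set Ek.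
  by rewrite p0 fset_set0 cardfs0 => k00; rewrite -k00 in k0.
apply: (nt p cp); left; rewrite subrr; exists (fun=> p); split=> //.
- exact: is_derive_cst.
- by case: cp => Mp _; apply: filterE.
Qed.

Section one.
Variables (M : set V) (u : W -> R) (c : R).
Hypothesis C1u : Ck 1 [set: W] u.
Hypothesis M_graph : forall x, c < ht sg x -> (M x <-> ht sg x = u (hproj x)).

Lemma over_clamp_eq0 x y t : c < ht sg (seg x y t) ->
  over_clamp sg u c x y t = 0 <-> M (seg x y t).
Proof.
move=> ct; rewrite M_graph// /over_clamp; split=> [/eqP|h].
  rewrite subr_eq0 => /eqP hU; rewrite hU; apply/max_idPl.
  by move: ct; rewrite hU lt_max ltxx orbF => /ltW.
by rewrite -h; apply/eqP; rewrite subr_eq0 eq_sym; apply/eqP/max_idPl/ltW.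
Qed.

Lemma over_clamp_end x y t : ~ touching sg u x y -> t = 0 \/ t = 1 ->
  c < ht sg (seg x y t) -> over_clamp sg u c x y t != 0.
Proof.
move=> nt t01 ct; apply/eqP => /(over_clamp_eq0 ct)/(M_graph ct) h; apply: nt; exists t.
split; last by case: t01; [constructor 1|constructor 2].
- by case: t01 => ->; rewrite ?lexx ?ler01.
- by rewrite /over -/(seg x y t) h subrr.
Qed.

(** The segment stays above c by convexity, so the number of crossings has the
parity of the number of sign changes of the height above the truncated
graph, which is decided at the endpoints.  This is pair_parity with the
second function constant. *)
Lemma crossing_above x y : ~ touching sg u x y -> c < ht sg x -> c < ht sg y ->
  odd_crossing M x y <->
  (ht sg x < clamp u c (hproj x)) (+) (ht sg y < clamp u c (hproj y)).
Proof.
move=> nt cx cy; have [<-|xy] := eqVneq x y.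
  by split; [move/odd_crossing_diag|rewrite addbb].
have seg_above t : 0 <= t <= 1 -> c < ht sg (seg x y t).
  move=> /andP[t0 t1]; rewrite /seg htD htZ htB.
  have [tx|tx] := leP (ht sg x) (ht sg y); first by have := mulr_ge0 t0 (ltac:(lra) : 0 <= ht sg y - ht sg x); lra.
  have := mulr_ge0 (ltac:(lra) : 0 <= 1 - t) (ltac:(lra) : 0 <= ht sg x - ht sg y); lra.
pose f := over_clamp sg u c x y; pose H t := ht sg (seg x y t).
have f0 : f 0 != 0 by apply: (over_clamp_end nt); [left|rewrite seg0].
have f1 : f 1 != 0 by apply: (over_clamp_end nt); [right|rewrite seg1].
have [] := @pair_parity R f (fun=> -1) H c.
- exact: over_clamp_continuous.
- exact: cst_continuous.
- exact: seg_ht_continuous.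
- by move=> t /seg_above h; rewrite ltNge ltW.
- by move=> t t01 _; apply: clamp_simple => //; exact: seg_above.
- by move=> t _ _ /eqP; rewrite oppr_eq0 oner_eq0.
- by right; rewrite f0 oppr_eq0 oner_eq0.
- by right; rewrite f1 oppr_eq0 oner_eq0.
move=> fin _; have -> : high_zeros H c (fun=> -1) 1 = set0.
  by apply/seteqP; split=> // t [_ [_ /eqP]]; rewrite oppr_eq0 oner_eq0.
rewrite fset_set0 cardfs0 addbF => oddE.
have TE : [set t | 0 < t < 1 /\ M (seg x y t)] = high_zeros H c f 1.
  apply/seteqP; split=> t /=.
    move=> [/andP[t0 t1] Mt]; have t01 : 0 <= t <= 1 by rewrite !ltW.
    split=> //; split; first exact/ltW/seg_above.
    by apply/over_clamp_eq0 => //; exact: seg_above.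
  move=> [/andP[t0 t1] [_ ft]]; have t01 : 0 <= t <= 1 by rewrite t0.
  split; last by apply/over_clamp_eq0 => //; exact: seg_above.
  rewrite !lt_neqAle t0 t1 !andbT; apply/andP; split; apply/eqP => E.
    by move/eqP: f0; apply; rewrite -[RHS]ft; congr f.
  by move/eqP: f1; apply; rewrite -[RHS]ft; congr f.
rewrite odd_crossingE// TE odd_setE// oddE !mulrN1 !oppr_lt0.
rewrite /f /over_clamp seg0 seg1 !subr_gt0.
have neg z w : z != w -> (w < z :> R) = ~~ (z < w) by move=> zw; rewrite -leNgt lt_neqAle eq_sym zw.
have nx : ht sg x != clamp u c (hproj x) by move: f0; rewrite /f /over_clamp seg0 subr_eq0.
have ny : ht sg y != clamp u c (hproj y) by move: f1; rewrite /f /over_clamp seg1 subr_eq0.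
rewrite -/(clamp u c _) -/(clamp u c _) (neg _ _ nx) (neg _ _ ny) addbN addNb negbK.
split=> [[]//|->]; split=> // p cp; apply: (transversal C1u M_graph nt cp).
by case: cp => _ [t /andP[t0 t1] ->]; apply: seg_above; rewrite !ltW.
Qed.

End one.

Lemma inward_velocity_local (M M' : set V) (k1 : R) p v :
  (forall x, ht sg x < k1 -> M x -> M' x) -> ht sg p < k1 ->
  inward_velocity M p v -> inward_velocity M' p v.
Proof.
move=> MM' pk [g [g0 dg Mg]]; exists g; split=> //.
have chg : {for (0 : R), continuous (ht sg \o g)}.
  apply: continuous_comp; last exact: continuous_ht.
  by apply: differentiable_continuous; apply/derivable1_diffP; case: dg.
have pc : 0 < k1 - ht sg p by rewrite subr_gt0.
have [r r0 hr] := (continuous_normedP _ _).1 chg _ pc.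
near=> t; have t0 : 0 < t by [].
have tr : t < r by near: t; exact: nbhs_right_lt.
apply: MM'; last by near: t.
have : `|t - 0| < r by rewrite subr0 gtr0_norm.
by move=> /hr; rewrite /= g0 ltr_norml => /andP[_]; lra.
Unshelve. all: by end_near. Qed.

Section two.
Variables (u : W -> R) (c k1 : R).
Hypothesis ck1 : c < k1.

Lemma transversal_transfer (M M' : set V) (u' : W -> R) x y :
  Ck 1 [set: W] u' ->
  (forall z, c < ht sg z -> (M' z <-> ht sg z = u' (hproj z))) ->
  (forall z, ht sg z < k1 -> (M z <-> M' z)) -> ~ touching sg u' x y ->
  (forall p, crossings M x y p -> ~ tangent_space M p (y - x)) ->
  forall p, crossings M' x y p -> ~ tangent_space M' p (y - x).
Proof.
move=> C1u' gM' MM' nt trM p cp; have [pk|kp] := ltP (ht sg p) k1; last first.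
  by apply: (transversal C1u' gM' nt cp); exact: lt_le_trans kp.
have cpM : crossings M x y p by case: cp => /(MM' p pk).
move=> tan; apply: (trM p cpM).
have M'M z : ht sg z < k1 -> M' z -> M z by move=> /MM'[].
by case: tan => h; [left|right]; apply: (inward_velocity_local M'M pk h).
Qed.

Variables (M Mt : set V) (ut : W -> R).
Hypotheses (C1u : Ck 1 [set: W] u) (C1ut : Ck 1 [set: W] ut).
Hypothesis M_graph : forall x, c < ht sg x -> (M x <-> ht sg x = u (hproj x)).
Hypothesis Mt_graph : forall x, c < ht sg x -> (Mt x <-> ht sg x = ut (hproj x)).
Hypothesis M_low : forall x, ht sg x < k1 -> (M x <-> Mt x).
Hypothesis ut_low : forall w, u w < k1 -> ut w = u w.
Hypothesis ut_high : forall w, k1 <= u w -> k1 <= ut w <= u w.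

Let U := clamp u c.
Let Ut := clamp ut c.

Lemma clamp_le w : Ut w <= U w.
Proof.
rewrite /U /Ut /clamp; have [h|h] := ltP (u w) k1; first by rewrite ut_low.
by have /andP[h1 h2] := ut_high h; rewrite ge_max !le_max h2 lexx orbT.
Qed.

(** The region that is swept when the graph of u is lowered to that of ut. *)
Definition between x := (Ut (hproj x) < ht sg x) && (ht sg x < U (hproj x)).

(** M and Mt agree below the level k1, so their crossings can only differ above
it, where both are graphs.  By pair_parity the parities agree when both or
neither of the endpoints are swept. *)
Lemma crossing_swap x y : ~ touching sg u x y -> ~ touching sg ut x y ->
  between x = between y -> odd_crossing M x y <-> odd_crossing Mt x y.
Proof.
move=> nt ntt bxy; have [<-|xy] := eqVneq x y.
  by split=> /odd_crossing_diag.
pose f := over_clamp sg u c x y; pose g := over_clamp sg ut c x y.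
pose H t := ht sg (seg x y t).
have fgE t : (f t * g t < 0) = between (seg x y t).
  have := clamp_le (hproj (seg x y t)); rewrite /f /g /over_clamp /between -/(clamp u c _) -/(clamp ut c _) -/U -/Ut.
  move: (U _) (Ut _) (ht _ _) => a b z ba.
  apply/idP/andP => [h|[h1 h2]]; last nra.
  split; rewrite ltNge; apply/negP => h'; nra.
have fin : [/\ finite_set (high_zeros H k1 f 1), finite_set (high_zeros H k1 g 1) &
    odd #|` fset_set (high_zeros H k1 f 1)| (+) odd #|` fset_set (high_zeros H k1 g 1)| =
    (f 0 * g 0 < 0) (+) (f 1 * g 1 < 0)].
  apply: pair_parity.
  - exact: over_clamp_continuous.
  - exact: over_clamp_continuous.
  - exact: seg_ht_continuous.
  - move=> t _ Ht; rewrite leNgt fgE; apply/negP => /andP[h1 h2].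
    have [h|h] := ltP (u (hproj (seg x y t))) k1.
      by move: (lt_trans h1 h2); rewrite /U /Ut /clamp (ut_low h) ltxx.
    have /andP[h3 _] := ut_high h.
    have : k1 < ht sg (seg x y t).
      by apply: le_lt_trans h1; rewrite /Ut /clamp le_max h3.
    by rewrite ltNge (ltW Ht).
  - by move=> t t01 Ht; apply: clamp_simple => //; exact: lt_le_trans Ht.
  - by move=> t t01 Ht; apply: clamp_simple => //; exact: lt_le_trans Ht.
  - have [h|h] := ltP (H 0) k1; [by left|right; split].
      by apply: (over_clamp_end M_graph nt); [left|exact: lt_le_trans h].
    by apply: (over_clamp_end Mt_graph ntt); [left|exact: lt_le_trans h].
  - have [h|h] := ltP (H 1) k1; [by left|right; split].
      by apply: (over_clamp_end M_graph nt); [right|exact: lt_le_trans h].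
    by apply: (over_clamp_end Mt_graph ntt); [right|exact: lt_le_trans h].
have [ff fg] := fin; rewrite !fgE seg0 seg1 bxy addbb => oddE.
pose L := [set t | [/\ 0 < t < 1, H t < k1 & M (seg x y t)]].
have TE (M' : set V) (u' : W -> R) : ~ touching sg u' x y ->
    (forall z, c < ht sg z -> (M' z <-> ht sg z = u' (hproj z))) ->
    (forall z, ht sg z < k1 -> (M z <-> M' z)) ->
    [set t | 0 < t < 1 /\ M' (seg x y t)] = L `|` high_zeros H k1 (over_clamp sg u' c x y) 1.
  move=> nt' gM' lM'; apply/seteqP; split=> t /=.
    move=> [t01 Mt']; have [h|h] := ltP (H t) k1.
      by left; split=> //; exact/lM'.
    right; split; first by case/andP: t01 => *; rewrite !ltW.
    by split=> //; apply/(over_clamp_eq0 gM') => //; exact: lt_le_trans h.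
  move=> [[t01 h Mt']|[/andP[t0 t1] [h ft]]]; first by split=> //; exact/lM'.
  have ch : c < ht sg (seg x y t) by exact: lt_le_trans h.
  split; last by apply/(over_clamp_eq0 gM').
  have ne s : s = 0 \/ s = 1 -> t != s.
    move=> s01; apply/eqP => E; have := over_clamp_end gM' nt' s01.
    by rewrite -E => /(_ ch)/eqP.
  rewrite !lt_neqAle t0 t1 !andbT; apply/andP; split; last by apply: ne; right.
  by rewrite eq_sym; apply: ne; left.
have Ldis v t : L t -> ~ high_zeros H k1 v 1 t by move=> [_ h _] [_ []]; rewrite leNgt h.
rewrite !odd_crossingE// (TE M u nt M_graph)// (TE Mt ut ntt Mt_graph)//.
rewrite -/f -/g !odd_setU//; try exact: Ldis.
have -> : odd #|` fset_set (high_zeros H k1 f 1)| = odd #|` fset_set (high_zeros H k1 g 1)|.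
  by move: oddE; case: (odd _); case: (odd _).
have M_low' z : ht sg z < k1 -> (Mt z <-> M z) by move=> /M_low ->.
split=> -[tr rest]; split=> //.
  exact: (transversal_transfer C1ut Mt_graph M_low ntt tr).
exact: (transversal_transfer C1u M_graph M_low' nt tr).
Qed.

End two.

End crossing_parity.

(** * Comparison of fractional areas *)
Section area_comparison.
Context {R : realType} {n : nat}.
Local Notation W := 'rV[R]_n.+1.
Local Notation V := 'rV[R]_n.+2.
Local Notation tV := (n.+2.-tuple (measurableTypeR R)).
Local Notation mu := (@lebesgue_tuple R).
Variables (sg : bool) (s : R) (u ut : W -> R) (c k1 : R) (M Mt Omega : set V).
Hypothesis ck1 : c < k1.
Hypotheses (C1u : Ck 1 [set: W] u) (C1ut : Ck 1 [set: W] ut).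
Hypothesis M_graph : forall x, c < ht sg x -> (M x <-> ht sg x = u (hproj x)).
Hypothesis Mt_graph : forall x, c < ht sg x -> (Mt x <-> ht sg x = ut (hproj x)).
Hypothesis M_low : forall x, ht sg x < k1 -> (M x <-> Mt x).
Hypothesis ut_low : forall w, u w < k1 -> ut w = u w.
Hypothesis ut_high : forall w, k1 <= u w -> k1 <= ut w <= u w.

Let U := clamp u c.
Let Ut := clamp ut c.
Hypothesis between_Omega : forall x, Ut (hproj x) <= ht sg x < U (hproj x) -> Omega x.

Let b := between sg u c ut.

Lemma measurable_between d (T : measurableType d) (x : T -> V) :
  measurable_vec x -> measurable_fun [set: T] (fun t => b (x t)).
Proof.
move=> mx; have mU v : continuous v -> measurable_fun [set: T] (fun t => v (hproj (x t)) : R).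
  by move=> cv; apply: measurable_continuous_vec => //; exact: measurable_vec_hproj.
apply: measurable_and; apply: measurable_fun_ltr;
  do ?[exact: measurable_ht|apply: (mU (clamp _ c)); exact: clamp_continuous].
Qed.

Lemma touching_l (v : W -> R) (x y : V) : ht sg x = v (hproj x) -> touching sg v x y.
Proof.
move=> h; exists 0; split; rewrite ?lexx ?ler01//; last by constructor 1.
by rewrite /over scale0r addr0 h subrr.
Qed.

Lemma touching_r (v : W -> R) (x y : V) : ht sg y = v (hproj y) -> touching sg v x y.
Proof.
move=> h; exists 1; split; rewrite ?lexx ?ler01//; last by constructor 2.
by rewrite /over scale1r (addrC x) subrK h subrr.
Qed.

(** A pair whose points are both in or both out of the swept region is odd for M
exactly when it is odd for Mt, by crossing_swap.  Now let exactly one point be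
swept.  If the pair is odd for Mt, then crossing_above forces the other point
to lie below the graph of Ut, so the pair is counted by loss.  A pair counted
by gain is odd for M, and it has weight 1 since its swept point lies in
Omega. *)
Lemma area_comparison e :
  (\int[mu n.+2 \x mu n.+2]_p loss sg s U Ut (row_of p.1) (row_of p.2) + e%:E <=
   \int[mu n.+2 \x mu n.+2]_p gain sg s U Ut (row_of p.1) (row_of p.2))%E ->
  (\int[mu n.+2 \x mu n.+2]_p area_density s Mt Omega p + e%:E <=
   \int[mu n.+2 \x mu n.+2]_p area_density s M Omega p)%E.
Proof.
have C1c : Ck 1 [set: W] (cst c : W -> R).
  split=> [w _|v w _]; first exact: differentiable_cst.
  by rewrite (_ : (fun x => _) = cst 0); [exact: cst_continuous|apply/funext => z; exact: derive_cst].
have [N1 [mN1 N10 tN1]] := touching_null sg C1u.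
have [N2 [mN2 N20 tN2]] := touching_null sg C1ut.
have [N3 [mN3 N30 tN3]] := touching_null sg C1c.
have cU : continuous U by exact: clamp_continuous.
have cUt : continuous Ut by exact: clamp_continuous.
pose D : set (tV * tV) := [set p | b (row_of p.1) != b (row_of p.2)].
have mb1 : measurable_fun [set: tV * tV] (fun p : tV * tV => b (row_of p.1)).
  by apply: measurable_between; exact: measurable_vec_pair1.
have mb2 : measurable_fun [set: tV * tV] (fun p : tV * tV => b (row_of p.2)).
  by apply: measurable_between; exact: measurable_vec_pair2.
have mD : measurable D.
  rewrite (_ : D = [set p : tV * tV | b (row_of p.1) && ~~ b (row_of p.2)] `|`
    [set p : tV * tV | ~~ b (row_of p.1) && b (row_of p.2)]); last first.
    by apply/seteqP; split=> p; rewrite /D/=; case: (b _); case: (b _) => //=;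
      [left|right|case|case].
  apply: measurableU; rewrite -[X in measurable X]setTI;
    apply: (measurable_and (f := fun p => _) (g := fun p => _)) => //; exact: measurable_neg.
apply: (integral_exchange_le (D := D) (N := N1 `|` N2 `|` N3) mD).
- by apply: measurableU => //; exact: measurableU.
- exact: (null_setU3 mN1 mN2 mN3 N10 N20 N30).
- exact: measurable_loss.
- exact: measurable_gain.
- exact: area_density_ge0.
- exact: area_density_ge0.
- by move=> p; exact: loss_ge0.
- by move=> p; exact: gain_ge0.
all: move=> p /not_orP[/not_orP[nN1 nN2] nN3].
all: have nt1 : ~ touching sg u (row_of p.1) (row_of p.2) by move/tN1.
all: have nt2 : ~ touching sg ut (row_of p.1) (row_of p.2) by move/tN2.
all: have nt3 : ~ touching sg (cst c) (row_of p.1) (row_of p.2) by move/tN3.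
all: rewrite /D/= /area_density; move: nt1 nt2 nt3.
all: set x := row_of p.1; set y := row_of p.2 => nt1 nt2 nt3.
- move=> /negP; rewrite negbK => /eqP bxy.
  have E := crossing_swap ck1 C1u C1ut M_graph Mt_graph M_low ut_low ut_high nt1 nt2 bxy.
  by case: asboolP => [/E h|_]; case: asboolP => // _; rewrite lee_fin mulr_ge0 ?ker_ge0// le_max indicE ler0n.
all: have clampN v z : ht sg z <> v (hproj z) -> ht sg z <> c -> ht sg z != clamp v c (hproj z).
1,3,5: by move=> h1 h2; rewrite /clamp; case: leP => _; exact/eqP.
all: have nx3 : ht sg x <> c by move=> /(@touching_l (cst c) x y).
all: have ny3 : ht sg y <> c by move=> /(@touching_r (cst c) x y).
all: have xU : ht sg x != U (hproj x) by apply: clampN => // /(@touching_l u x y).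
all: have yU : ht sg y != U (hproj y) by apply: clampN => // /(@touching_r u x y).
all: have xUt : ht sg x != Ut (hproj x) by apply: clampN => // /(@touching_l ut x y).
all: have yUt : ht sg y != Ut (hproj y) by apply: clampN => // /(@touching_r ut x y).
all: have UtU := clamp_le c ut_low ut_high.
all: have Utc w : c <= Ut w by rewrite /Ut /clamp le_max lexx orbT.
all: have above z z' : (z = x /\ z' = y) \/ (z = y /\ z' = x) -> b z -> ~~ b z' ->
  (odd_crossing Mt x y -> ht sg z' < Ut (hproj z')) /\
  (U (hproj z') < ht sg z' -> odd_crossing M x y).
1,3,5: move=> zz /andP[z1 z2] nbz'.
1-3: have cz : c < ht sg z by exact: le_lt_trans z1.
1-3: have oM : c < ht sg z' -> odd_crossing M x y <->
    (ht sg z < U (hproj z)) (+) (ht sg z' < U (hproj z')).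
1,3,5: by case: zz cz => -[-> ->] h h'; rewrite (crossing_above C1u M_graph nt1)//; split; rewrite // addbC.
1-3: have oMt : c < ht sg z' -> odd_crossing Mt x y <->
    (ht sg z < Ut (hproj z)) (+) (ht sg z' < Ut (hproj z')).
1,3,5: by case: zz cz => -[-> ->] h h'; rewrite (crossing_above C1ut Mt_graph nt2)//; split; rewrite // addbC.
1-3: split; last by
  move=> h; apply/oM; [exact: le_lt_trans (le_trans (Utc _) (UtU _)) h|
    rewrite z2 (ltNge (ht sg z')) (ltW h)].
1-3: have z'Ut : ht sg z' != Ut (hproj z') by case: zz => -[_ ->].
1-3: rewrite ltNge => o; apply/negP => h.
1-3: have h1 : Ut (hproj z') < ht sg z' by rewrite lt_neqAle eq_sym z'Ut.
1-3: have h2 := (oMt (le_lt_trans (Utc _) h1)).1 o.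
1-3: by move: h2; rewrite (ltNge (ht sg z)) (ltW z1) (ltNge (ht sg z')) (ltW h1).
all: have ind1 (z : V) : \1_Omega z <= 1 :> R by rewrite indicE; case: (_ \in _).
all: have maxle : Num.max (\1_Omega x) (\1_Omega y) * ker s x y <= ker s x y by
  rewrite ler_piMl ?ker_ge0// ge_max !ind1.
- move=> bxy; case: asboolP => o; last exact: loss_ge0.
  apply: le_trans (_ : _ <= (ker s x y)%:E)%E _; first by rewrite lee_fin.
  have k0 : (0 <= (ker s x y)%:E)%E by rewrite lee_fin ker_ge0.
  rewrite /loss; have [bx|bx] := boolP (b x); have [by_|by_] := boolP (b y).
  + by rewrite bx by_ in bxy.
  + have [h _] := above x y (or_introl (conj erefl erefl)) bx by_.
    rewrite (h o) andbT; have /andP[h1 h2] := bx.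
    by rewrite -/Ut -/U h1 (ltW h2)/= leeDl//; case: ifP.
  + have [h _] := above y x (or_intror (conj erefl erefl)) by_ bx.
    rewrite (h o) /=; have /andP[h1 h2] := by_.
    by rewrite -/Ut -/U h1 (ltW h2)/= leeDr//; case: ifP.
  + by rewrite (negbTE bx) (negbTE by_) in bxy.
- move=> bxy.
  have f0 : (0 <= if `[< odd_crossing M x y >]
    then (Num.max (\1_Omega x) (\1_Omega y) * ker s x y)%:E else 0)%E.
    by case: ifP => // _; rewrite lee_fin mulr_ge0 ?ker_ge0// le_max indicE ler0n.
  have full : odd_crossing M x y -> Omega x \/ Omega y -> ((ker s x y)%:E <=
      if `[< odd_crossing M x y >]
      then (Num.max (\1_Omega x) (\1_Omega y) * ker s x y)%:E else 0)%E.
    move=> o O; case: asboolP => // _; rewrite lee_fin ler_peMl ?ker_ge0// le_max.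
    by case: O => h; apply/orP; [left|right]; rewrite indicE mem_set.
  have bO z : b z -> Omega z.
    by move=> /andP[h1 h2]; apply: between_Omega; rewrite h2 ltW.
  rewrite /gain; have [bx|bx] := boolP (b x); have [by_|by_] := boolP (b y).
  + by rewrite bx by_ in bxy.
  + have [_ h] := above x y (or_introl (conj erefl erefl)) bx by_.
    have /andP[h1 h2] := bx; rewrite [U (hproj x) < _]ltNge (ltW h2) /= adde0.
    by case: ifP => // /andP[_ /h o]; apply: full => //; left; exact: bO.
  + have [_ h] := above y x (or_intror (conj erefl erefl)) by_ bx.
    have /andP[h1 h2] := by_; rewrite [U (hproj y) < _]ltNge (ltW h2) andbF add0e.
    by case: ifP => // /andP[/h o _]; apply: full => //; right; exact: bO.
  + by rewrite (negbTE bx) (negbTE by_) in bxy.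
- move=> /negP; rewrite negbK => /eqP bxy; rewrite /gain.
  rewrite !ifF ?adde0//; apply/negbTE/negP.
    move=> /andP[h1 /andP[h2 h3]].
    have : b y by rewrite /b /between -/U -/Ut h3 lt_neqAle eq_sym yUt h2.
    by rewrite -bxy /b /between -/U -/Ut (ltNge _ (U _)) (ltW h1) andbF.
  move=> /andP[/andP[h2 h3] h1].
  have : b x by rewrite /b /between -/U -/Ut h3 lt_neqAle eq_sym xUt h2.
  by rewrite bxy /b /between -/U -/Ut (ltNge _ (U _)) (ltW h1) andbF.
Qed.

End area_comparison.

(** * Functions of class C^1 with a given differential *)
Section differential.
Context {R : realType} {E : normedModType R}.
Implicit Types (F P Q : E -> R) (x y v : E).

Lemma is_diff_small F x :
  (forall e : R, 0 < e -> exists2 d : R, 0 < d &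
    forall y, `|y - x| < d -> `|F y - F x| <= e * `|y - x|) -> is_diff x F (cst 0).
Proof.
move=> h; have c0 : continuous (\0 : E -> R) by exact: cst_continuous.
apply/(is_diff_normedP F x (df := [the {linear E -> R} of \0]) c0) => e /h[d d0 hd].
by exists d => // y /hd; rewrite /= subr0.
Qed.

Lemma differentiable_locally_lipschitz F x : differentiable F x ->
  exists C d : R, [/\ 0 < C, 0 < d & forall y, `|y - x| < d -> `|F y - F x| <= C * `|y - x|].
Proof.
move=> dF; have cl : continuous ('d F x) by exact: diff_continuous.
have [d d0 hd] := (is_diff_normedP _ _ cl).1 (differentiableP dF) 1 ltr01.
have [C [C0 hC]] : exists C : R, 0 < C /\ forall v, `|'d F x v| <= C * `|v|.
  have [r r0 hr] := (continuous_normedP _ _).1 (cl 0) 1 ltr01.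
  have hr' w : `|w| < r -> `|'d F x w| < 1.
    have d00 : 'd F x 0 = 0 by exact: linear0.
    by move=> wr; have := hr w; rewrite d00 !subr0 => /(_ wr).
  have r20 : 0 < r / 2 by rewrite divr_gt0.
  exists (2 / r); split; first by rewrite divr_gt0.
  move=> v; have [->|v0] := eqVneq v 0; first by rewrite linear0 !normr0 mulr0.
  have nv : 0 < `|v| by rewrite normr_gt0.
  have k0 : 0 < r / 2 / `|v| by rewrite divr_gt0.
  have := hr' ((r / 2 / `|v|) *: v).
  have -> : 'd F x ((r / 2 / `|v|) *: v) = (r / 2 / `|v|) * 'd F x v by exact: linearZ.
  rewrite normrZ (gtr0_norm k0) divfK ?gt_eqF// => /(_ ltac:(lra)); rewrite normrM (gtr0_norm k0).
  rewrite -ltr_pdivlMl// mulr1 => /ltW h; apply: le_trans h _.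
  by rewrite invf_div invf_div mulrC.
exists (C + 1), d; split=> //; first by rewrite addr_gt0.
move=> y /hd h; rewrite (_ : F y - F x = (F y - F x - 'd F x (y - x)) + 'd F x (y - x)); last by rewrite subrK.
by apply: le_trans (ler_normD _ _) _; rewrite mulrDl addrC lerD.
Qed.

(** The differential is carried along explicitly, so that Hoelder bounds on it
can be computed. *)
Definition C1d F (dF : E -> E -> R) : Prop :=
  (forall x, is_diff x F (dF x)) /\ forall v, continuous (dF^~ v).

Lemma C1d_derive F dF x v : C1d F dF -> 'D_v F x = dF x v.
Proof. by move=> [h _]; have dx := h x; rewrite deriveE ?diff_val//; case: dx. Qed.

Lemma C1d_differentiable F dF x : C1d F dF -> differentiable F x.
Proof. by move=> [h _]; case: (h x). Qed.

Lemma C1d_continuous F dF : C1d F dF -> continuous F.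
Proof. by move=> h x; apply/differentiable_continuous/C1d_differentiable/h. Qed.

Lemma C1d_Ck F dF : C1d F dF -> Ck 1 [set: E] F.
Proof.
move=> h; split=> [x _|v x _]; first exact: C1d_differentiable h.
by rewrite (_ : (fun x => _) = dF^~ v); [case: h => _; apply|apply/funext => y; exact: C1d_derive].
Qed.

Lemma Ck_C1d F : Ck 1 [set: E] F -> C1d F (fun x v => 'D_v F x).
Proof.
move=> [dF cF]; split=> [x|v x]; last exact: cF.
have h := dF x I; apply: DiffDef => //; apply/funext => v; by rewrite deriveE.
Qed.

Lemma C1d_ext F dF dG : C1d F dF -> (forall x v, dF x v = dG x v) -> C1d F dG.
Proof.
by move=> h e; rewrite (_ : dG = dF)//; apply/funext => x; apply/funext => v; rewrite e.
Qed.

Lemma C1d_cst (k : R) : C1d (cst k) (fun _ _ => 0).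
Proof. by split=> [x|v]; [exact: is_diff_cst|exact: cst_continuous]. Qed.

Lemma C1d_add F G dF dG : C1d F dF -> C1d G dG ->
  C1d (fun x => F x + G x) (fun x v => dF x v + dG x v).
Proof.
move=> [hF cF] [hG cG]; split=> [x|v x]; first exact: (is_diffD (hF x) (hG x)).
by apply: cvgD; [exact: cF|exact: cG].
Qed.

Lemma C1d_mul F G dF dG : C1d F dF -> C1d G dG ->
  C1d (fun x => F x * G x) (fun x v => F x * dG x v + G x * dF x v).
Proof.
move=> h1 h2; have [hF cF] := h1; have [hG cG] := h2; split=> [x|v x].
  exact: (is_diffM (hF x) (hG x)).
by apply: cvgD; apply: cvgM; (exact: (C1d_continuous h1) || exact: (C1d_continuous h2) || exact: cF || exact: cG).
Qed.

Lemma C1d_scale F dF (k : R) : C1d F dF -> C1d (fun x => k * F x) (fun x v => k * dF x v).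
Proof.
move=> h; have := C1d_mul (C1d_cst k) h; move/C1d_ext; apply => x v /=.
by rewrite mulr0 addr0.
Qed.

Lemma C1d_comp (g g' : R -> R) F dF : C1d F dF ->
  (forall r : R, is_derive r (1 : R) g (g' r)) -> continuous g' ->
  C1d (fun x => g (F x)) (fun x v => g' (F x) * dF x v).
Proof.
move=> h dg cg; have [hF cF] := h; split=> [x|v x].
  have dgx : is_diff (F x) g ( *%R (g' (F x))).
    have [d1 d2] := dg (F x); have dd : differentiable g (F x) by apply/derivable1_diffP.
    apply: DiffDef => //; apply/funext => r.
    have -> : r = r *: (1 : R) by rewrite /GRing.scale/= mulr1.
    by rewrite linearZ/= -deriveE// d2 /GRing.scale/= mulr1 mulrC.
  exact: (is_diff_comp (hF x) dgx).
apply: cvgM; last exact: cF.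
by apply: (continuous_comp (C1d_continuous h (x:=x))); exact: cg.
Qed.

Lemma row_sumE N (Y : 'I_N -> E -> R) : (fun x => \row_i Y i x) =
  \sum_i (fun x => Y i x *: (delta_mx 0 i : 'rV[R]_N)).
Proof.
apply/funext => x; rewrite fct_sumE [LHS]row_sum_delta.
by apply: eq_bigr => i _; rewrite mxE.
Qed.

Lemma is_diff_row N (Y : 'I_N -> E -> R) (dY : 'I_N -> E -> R) x :
  (forall i, is_diff x (Y i) (dY i)) ->
  is_diff x (fun x => \row_i Y i x) (fun v => \row_i dY i v).
Proof.
move=> hY; have di i : is_diff x (fun x => Y i x *: (delta_mx 0 i : 'rV[R]_N))
    (fun v => dY i v *: (delta_mx 0 i : 'rV[R]_N)).
  exact: (is_diff_comp (hY i) (is_diff_scalel _ _)).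
have df : differentiable (fun x => \row_i Y i x) x.
  by rewrite row_sumE; apply: differentiable_sum => i; case: (di i).
apply: DiffDef => //; apply/funext => v; rewrite -deriveE// row_sumE derive_sum; last first.
  by move=> i; apply: diff_derivable; case: (di i).
rewrite [RHS]row_sum_delta; apply: eq_bigr => i _; rewrite mxE deriveE; last by case: (di i).
by have dii := di i; rewrite diff_val.
Qed.

Lemma continuous_row N (Y : 'I_N -> E -> R) : (forall i, continuous (Y i)) ->
  continuous (fun x => \row_i Y i x).
Proof.
move=> cY; have -> : (fun x => \row_i Y i x) =
    (fun x => \sum_i Y i x *: (delta_mx 0 i : 'rV[R]_N)).
  by rewrite row_sumE; apply/funext => x; rewrite fct_sumE.
apply: continuous_big => [|i _ x].
  by move=> p; apply: cvgD; [exact: cvg_fst|exact: cvg_snd].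
apply: (@continuous_comp E R 'rV[R]_N (Y i) (fun r => r *: delta_mx 0 i) x); first exact: cY.
apply: (@lipschitz_continuous _ _ _ _ `|(delta_mx 0 i : 'rV[R]_N)|) => a b.
by rewrite -scalerBl normrZ mulrC.
Qed.

Lemma C1d_vec N (u : 'rV[R]_N -> R) (Y : 'I_N -> E -> R) (dY : 'I_N -> E -> E -> R) :
  Ck 1 [set: 'rV[R]_N] u -> (forall i, C1d (Y i) (dY i)) ->
  C1d (fun x => u (\row_i Y i x))
    (fun x v => \sum_i 'D_(delta_mx 0 i) u (\row_i Y i x) * dY i x v).
Proof.
move=> [du cu] hY.
have dYx x : is_diff x (fun x => \row_i Y i x) (fun v => \row_i dY i x v).
  by apply: is_diff_row => i; exact: (hY i).1.
have cY : continuous (fun x => \row_i Y i x).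
  by apply: continuous_row => i; exact: C1d_continuous (hY i).
split=> [x|v x].
  have h := is_diff_comp (dYx x) (differentiableP (du _ I)).
  apply: is_diff_eq h _; apply/funext => v /=.
  rewrite -deriveE; last exact: du.
  by rewrite derive_delta; [apply: eq_bigr => i _; rewrite mxE mulrC|exact: du].
move: x; apply: continuous_big => [|i _ x].
  by move=> p; apply: cvgD; [exact: cvg_fst|exact: cvg_snd].
apply: cvgM; last by case: (hY i) => _; apply.
apply: (@continuous_comp E _ R (fun x => \row_i Y i x) (fun w => 'D_(delta_mx 0 i) u w) x (@cY x)).
exact: (cu _ _ I).
Qed.

End differential.

(** * Hoelder classes of families of functions *)
Section holder_classes.
Context {R : realType} {V : normedModType R}.
Local Notation E := (R * V)%type.
Variable alpha : R.
Hypotheses (alpha0 : 0 < alpha) (alpha1 : alpha <= 1).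

Lemma le_powR_small (d : R) : 0 <= d -> d <= 1 -> d <= d `^ alpha.
Proof.
move=> d0 d1; have [->|dn] := eqVneq d 0; first exact: powR_ge0.
by rewrite -[leLHS](powRr1 d0); apply: ger_powR => //; rewrite d1 lt_neqAle eq_sym dn d0.
Qed.

Lemma min_le_powR (a C d : R) : 0 <= d -> 0 <= C -> a <= C -> a <= C * d ->
  a <= C * d `^ alpha.
Proof.
move=> d0 C0 aC aCd; have [d1|d1] := leP d 1.
  by apply: le_trans aCd _; rewrite ler_wpM2l// le_powR_small.
apply: le_trans aC _; rewrite ler_peMr// -(powRr0 d) ler_powR ?ltW//.
Qed.

(** Bounded and Hoelder in x, uniformly in the parameters |t| <= 1 and
|v| <= 1. *)
Definition bholder (f : R -> V -> V -> R) : Prop := exists2 C : R, 0 <= C &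
  forall t v x y, `|t| <= 1 -> `|v| <= 1 ->
    `|f t v x| <= C /\ `|f t v x - f t v y| <= C * `|x - y| `^ alpha.

Lemma bholder_ext f g : bholder f -> (forall t v x, f t v x = g t v x) -> bholder g.
Proof. by move=> [C C0 h] e; exists C => // t v x y t1 v1; rewrite -!e; exact: h. Qed.

Lemma bholder_cst (k : R -> V -> R) (B : R) :
  (forall t v, `|t| <= 1 -> `|v| <= 1 -> `|k t v| <= B) -> bholder (fun t v _ => k t v).
Proof.
move=> h; exists `|B| => // t v x y t1 v1; split; first exact: le_trans (h _ _ t1 v1) (ler_norm _).
by rewrite subrr normr0 mulr_ge0// powR_ge0.
Qed.

Lemma bholder_add f g : bholder f -> bholder g -> bholder (fun t v x => f t v x + g t v x).
Proof.
move=> [C C0 hf] [D D0 hg]; exists (C + D); first exact: addr_ge0.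
move=> t v x y t1 v1; have [f1 f2] := hf t v x y t1 v1; have [g1 g2] := hg t v x y t1 v1.
split; first exact: le_trans (ler_normD _ _) (lerD f1 g1).
by rewrite opprD addrACA mulrDl; exact: le_trans (ler_normD _ _) (lerD f2 g2).
Qed.

Lemma bholder_mul f g : bholder f -> bholder g -> bholder (fun t v x => f t v x * g t v x).
Proof.
move=> [C C0 hf] [D D0 hg]; exists (2 * (C * D)); first by rewrite !mulr_ge0.
move=> t v x y t1 v1; have [f1 f2] := hf t v x y t1 v1; have [g1 g2] := hg t v x y t1 v1.
have [fy _] := hf t v y y t1 v1.
have CD : 0 <= C * D by rewrite mulr_ge0.
split.
  by rewrite normrM; apply: le_trans (ler_pM _ _ f1 g1) _ => //; lra.
have -> : f t v x * g t v x - f t v y * g t v y =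
  (f t v x - f t v y) * g t v x + f t v y * (g t v x - g t v y) by ring.
apply: le_trans (ler_normD _ _) _; rewrite !normrM.
have h1 := ler_pM (normr_ge0 _) (normr_ge0 _) f2 g1.
have h2 := ler_pM (normr_ge0 _) (normr_ge0 _) fy g2.
apply: le_trans (lerD h1 h2) _; rewrite le_eqVlt; apply/orP; left; apply/eqP; ring.
Qed.

Lemma bholder_sum (I : finType) (f : I -> R -> V -> V -> R) :
  (forall i, bholder (f i)) -> bholder (fun t v x => \sum_i f i t v x).
Proof.
move=> h; have H : forall s : seq I, bholder (fun t v x => \sum_(i <- s) f i t v x).
  elim=> [|i s IH].
    apply: (bholder_ext (bholder_cst (k := fun _ _ => 0) (B := 0) _)).
      by move=> *; rewrite normr0.
    by move=> t v x; rewrite big_nil.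
  by apply: (bholder_ext (bholder_add (h i) IH)) => t v x; rewrite big_cons.
exact: H.
Qed.

Lemma bholder_lipschitz f (C : R) :
  (forall t v x y, `|t| <= 1 -> `|v| <= 1 ->
    `|f t v x| <= C /\ `|f t v x - f t v y| <= C * `|x - y|) -> bholder f.
Proof.
move=> h; have C0 : 0 <= C.
  have [] := h 0 0 0 0; rewrite ?normr0 ?ler01// => h1 _; exact: le_trans h1.
exists (2 * C); first by rewrite mulr_ge0.
move=> t v x y t1 v1; have [f1 f2] := h t v x y t1 v1; have [f3 _] := h t v y y t1 v1.
split; first lra.
apply: min_le_powR => //; first by rewrite mulr_ge0.
  by apply: le_trans (ler_normB _ _) _; lra.
apply: le_trans f2 _; rewrite ler_wpM2r//; lra.
Qed.

Lemma bholder_inv f : bholder f -> (forall t v x, 1 <= f t v x) ->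
  bholder (fun t v x => (f t v x)^-1).
Proof.
move=> [C C0 h] f1; exists (C + 1); first by rewrite addr_ge0.
have p t v x : 0 < f t v x by exact: lt_le_trans (f1 _ _ _).
have i1 t v x : `|(f t v x)^-1| <= 1.
  by rewrite gtr0_norm ?invr_gt0// invf_le1.
move=> t v x y t1 v1; split; first by apply: le_trans (i1 _ _ _) _; lra.
have -> : (f t v x)^-1 - (f t v y)^-1 = (f t v y - f t v x) * ((f t v x)^-1 * (f t v y)^-1).
  by field; rewrite !gt_eqF.
have [_ h2] := h t v x y t1 v1; rewrite normrM distrC normrM.
apply: (@le_trans _ _ (C * `|x - y| `^ alpha * 1)).
  by apply: ler_pM => //; apply: mulr_ile1.
by rewrite mulr1 ler_wpM2r ?powR_ge0//; lra.
Qed.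

(** Class C^1 in (t, x), with Hoelder differential in x for each t, uniformly in
|t| <= 1. *)
Definition regular (F : E -> R) (dF : E -> E -> R) : Prop :=
  C1d F dF /\ bholder (fun t v x => dF (t, x) (0, v)).

Definition tame (F : E -> R) : Prop := bholder (fun t _ x => F (t, x)).

Lemma regular_add F G dF dG : regular F dF -> regular G dG ->
  regular (fun x => F x + G x) (fun x v => dF x v + dG x v).
Proof.
by move=> [? ?] [? ?]; split; [exact: C1d_add|exact: bholder_add].
Qed.

Lemma regular_mul F G dF dG : regular F dF -> regular G dG -> tame F -> tame G ->
  regular (fun x => F x * G x) (fun x v => F x * dG x v + G x * dF x v).
Proof.
move=> [? ?] [? ?] ? ?; split; first exact: C1d_mul.
by apply: bholder_add; exact: bholder_mul.
Qed.

Lemma regular_scale F dF (k : R) : regular F dF ->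
  regular (fun x => k * F x) (fun x v => k * dF x v).
Proof.
move=> [h1 h2]; split; first exact: C1d_scale.
apply: bholder_mul => //; apply: (bholder_cst (k := fun _ _ => k) (B := `|k|)) => //.
Qed.

Lemma regular_lipschitz F dF : regular F dF -> exists2 C : R, 0 <= C &
  forall t x y, `|t| <= 1 -> `|F (t, x) - F (t, y)| <= C * `|x - y|.
Proof.
move=> [h [C C0 hC]]; exists C => // t x y t1.
have [xy|xy] := eqVneq x y; first by rewrite xy !subrr !normr0 mulr0.
have [s|s _ ->] := @MVT_line _ _ F (t, y) (t, x).
  by move=> _; exact: C1d_differentiable h.
have E1 : (t, x) - (t, y) = (0, x - y) :> E by congr pair; rewrite /= subrr.
have n0 : 0 < `|x - y| by rewrite normr_gt0 subr_eq0.
rewrite E1 (C1d_derive _ _ h).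
set p := _ + _; have -> : p = (t, y + s *: (x - y)).
  by rewrite /p; congr pair; rewrite /= scaler0 addr0.
set q := (t, _).
have -> : dF q (0, x - y) = `|x - y| * dF q (0, `|x - y|^-1 *: (x - y)).
  have hd := h.1 q; rewrite -[dF q]diff_val.
  have {1}-> : (0, x - y) = `|x - y| *: (0, `|x - y|^-1 *: (x - y)) :> E.
    by congr pair; rewrite /= ?scaler0// scalerA mulfV ?gt_eqF// scale1r.
  by rewrite linearZ.
rewrite normrM normr_id mulrC ler_wpM2r//.
have v1 : `| (`|x - y|^-1 *: (x - y)) | <= 1 by rewrite normrZ normfV normr_id mulVf ?gt_eqF.
by have [] := hC t _ (y + s *: (x - y)) 0 t1 v1.
Qed.

Lemma regular_tame F dF (C : R) : regular F dF ->
  (forall t x, `|t| <= 1 -> `|F (t, x)| <= C) -> tame F.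
Proof.
move=> /regular_lipschitz[L L0 hL] hC; apply: (@bholder_lipschitz _ (`|C| + L)).
move=> t v x y t1 _; split.
  by apply: le_trans (hC _ _ t1) _; apply: le_trans (ler_norm _) _; rewrite lerDl.
by apply: le_trans (hL _ _ _ t1) _; rewrite ler_wpM2r// lerDr.
Qed.

Lemma regular_comp (g g' : R -> R) (C : R) F dF : regular F dF ->
  (forall r : R, is_derive r (1 : R) g (g' r)) ->
  (forall r, `|g' r| <= C) -> (forall r r', `|g' r - g' r'| <= C * `|r - r'|) ->
  regular (fun x => g (F x)) (fun x v => g' (F x) * dF x v).
Proof.
move=> h dg bg lg; split.
  by apply: C1d_comp h.1 dg _; exact: lipschitz_continuous lg.
apply: bholder_mul; last exact: h.2.
have [L L0 hL] := regular_lipschitz h.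
have C0 : 0 <= C by exact: le_trans (bg 0).
apply: (@bholder_lipschitz _ (C + C * L)) => t v x y t1 _; split.
  by apply: le_trans (bg _) _; rewrite lerDl mulr_ge0.
apply: le_trans (lg _ _) _; apply: le_trans (ler_wpM2l C0 (hL _ _ _ t1)) _.
by rewrite mulrA ler_wpM2r// lerDr.
Qed.

Lemma regular_vec N (u : 'rV[R]_N -> R) (B L : R) (Y : 'I_N -> E -> R) dY :
  Ck 1 [set: 'rV[R]_N] u -> (forall j x, `|'D_(delta_mx 0 j) u x| <= B) ->
  0 <= L -> (forall j x y, `|'D_(delta_mx 0 j) u x - 'D_(delta_mx 0 j) u y| <= L * `|x - y| `^ alpha) ->
  (forall i, regular (Y i) (dY i)) ->
  regular (fun x => u (\row_i Y i x))
    (fun x v => \sum_i 'D_(delta_mx 0 i) u (\row_i Y i x) * dY i x v).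
Proof.
move=> Cu bu L0 hu hY; split; first by apply: C1d_vec => // i; exact: (hY i).1.
apply: bholder_sum => i; apply: bholder_mul; last exact: (hY i).2.
have /choice[c hc] : forall j, exists c : R, 0 <= c /\
    forall t x y, `|t| <= 1 -> `|Y j (t, x) - Y j (t, y)| <= c * `|x - y|.
  by move=> j; have [c c0 h] := regular_lipschitz (hY j); exists c.
pose c0 := \sum_j c j; have c00 : 0 <= c0 by rewrite sumr_ge0// => j _; case: (hc j).
exists (B + L * c0 `^ alpha).
  by rewrite addr_ge0 ?mulr_ge0 ?powR_ge0//; exact: le_trans (bu i 0).
move=> t v x y t1 _; split.
  by apply: le_trans (bu _ _) _; rewrite lerDl mulr_ge0// powR_ge0.
apply: le_trans (hu _ _ _) _.
apply: (@le_trans _ _ (L * c0 `^ alpha * `|x - y| `^ alpha)).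
  rewrite -mulrA -powRM// ler_wpM2l// ge0_ler_powR ?nnegrE ?mulr_ge0//; first exact: ltW.
  apply: norm_rV_le => [|j]; first by rewrite mulr_ge0.
  rewrite !mxE; have [_ h] := hc j; apply: le_trans (h _ _ _ t1) _.
  rewrite ler_wpM2r// /c0 (bigD1 j)//= lerDl sumr_ge0// => k _; by case: (hc k).
by rewrite ler_wpM2r ?powR_ge0// lerDr; exact: le_trans (bu i 0).
Qed.

(** The factor t is a gain of regularity: for a function p that is merely
Hoelder, t * p may still be of class C^1 in (t, x).  The difference quotients
of a C^(1, alpha) function are the relevant example.  Such functions form an
algebra, which contains the inverse of each p >= 1. *)
Definition tamed (p : E -> R) : Prop :=
  [/\ continuous p, tame p & exists dP, regular (fun x => x.1 * p x) dP].

Lemma fst_C1d : C1d (fun x : E => x.1) (fun _ v => v.1).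
Proof.
have cf : continuous (fun x : E => x.1 : R) by move=> x; exact: cvg_fst.
split=> [x|v]; last exact: cst_continuous.
by apply: DiffDef; [exact: linear_differentiable|rewrite diff_lin].
Qed.

(** The error term of the product rule: its first factor is Lipschitz at x and
the second one vanishes at x, so that the product is o(|y - x|). *)
Lemma tamed_remainder (p P q dP : E -> R) (r : E -> R) x :
  (forall y, P y = y.1 * p y) -> differentiable P x -> {for x, continuous q} -> q x = 0 ->
  (forall y, r y = (y.1 * (p y - p x)) * q y) -> is_diff x r (cst 0).
Proof.
move=> PE dP' cq q0 rE; apply: is_diff_small => e e0.
have [C [d [C0 d0 hd]]] := differentiable_locally_lipschitz dP'.
pose K := C + `|p x|; have K0 : 0 < K by rewrite ltr_pwDl.
have eK : 0 < e / K by rewrite divr_gt0.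
have [d' d'0 hd'] := (continuous_normedP _ _).1 cq _ eK.
exists (Num.min d d'); first by rewrite lt_min d0.
move=> y; rewrite lt_min => /andP[/hd h1 /hd']; rewrite q0 subr0 => h2.
rewrite (rE x) q0 mulr0 subr0 rE normrM.
have yx1 : `|y.1 - x.1| <= `|y - x|.
  by rewrite [leRHS]/Num.Def.normr/= /Num.norm/= le_max lexx.
have h3 : `|y.1 * (p y - p x)| <= K * `|y - x|.
  have -> : y.1 * (p y - p x) = (P y - P x) - p x * (y.1 - x.1) by rewrite !PE; ring.
  apply: le_trans (ler_normB _ _) _; rewrite normrM mulrDl lerD//.
  by rewrite ler_wpM2l.
apply: le_trans (ler_pM (normr_ge0 _) (normr_ge0 _) h3 (ltW h2)) _.
by rewrite le_eqVlt; apply/orP; left; apply/eqP; field; rewrite gt_eqF.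
Qed.

Lemma tamed_cst (k : R) : tamed (cst k).
Proof.
split; first exact: cst_continuous.
- by apply: (bholder_cst (k := fun _ _ => k) (B := `|k|)).
exists (fun _ v => k * v.1); split.
  rewrite (_ : (fun x => _) = (fun x : E => k * x.1)); first exact: C1d_scale fst_C1d.
  by apply/funext => x; rewrite mulrC.
by apply: (bholder_cst (k := fun _ _ => k * 0) (B := 0)) => *; rewrite mulr0 normr0.
Qed.

Lemma tamed_add p q : tamed p -> tamed q -> tamed (fun x => p x + q x).
Proof.
move=> [cp tp [dP rP]] [cq tq [dQ rQ]]; split.
- by move=> x; apply: cvgD; [exact: cp|exact: cq].
- exact: bholder_add.
exists (fun x v => dP x v + dQ x v).
rewrite (_ : (fun x => _) = (fun x : E => x.1 * p x + x.1 * q x)); first exact: regular_add.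
by apply/funext => x; rewrite mulrDr.
Qed.

Lemma tamed_sum (I : finType) (p : I -> E -> R) :
  (forall i, tamed (p i)) -> tamed (fun x => \sum_i p i x).
Proof.
move=> h; have H : forall s : seq I, tamed (fun x => \sum_(i <- s) p i x).
  elim=> [|i s IH].
    rewrite (_ : (fun x => _) = cst 0); first exact: tamed_cst.
    by apply/funext => x; rewrite big_nil.
  rewrite (_ : (fun x => _) = (fun x => p i x + \sum_(i <- s) p i x)); first exact: tamed_add.
  by apply/funext => x; rewrite big_cons.
exact: H.
Qed.

(** The differential of t * (p * q) is formally p d(t q) + q d(t p) - p q dt; the
remainder is the one of tamed_remainder. *)
Lemma tamed_mul p q : tamed p -> tamed q -> tamed (fun x => p x * q x).
Proof.
move=> [cp tp [dP rP]] [cq tq [dQ rQ]]; split.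
- by move=> x; apply: cvgM; [exact: cp|exact: cq].
- exact: bholder_mul.
exists (fun x v => p x * dQ x v + q x * dP x v - p x * q x * v.1); split; last first.
  have b0 : bholder (fun t v x => p (t, x) * dQ (t, x) (0, v) + q (t, x) * dP (t, x) (0, v)).
    by apply: bholder_add; apply: bholder_mul => //; [exact: rQ.2|exact: rP.2].
  by apply: bholder_ext b0 _ => t v x; rewrite /= mulr0 subr0.
have [[[hP cP] _] [[hQ cQ] _]] := (rP, rQ).
split=> [x|v x]; last first.
  apply: cvgB; first by apply: cvgD; apply: cvgM; [exact: cp|exact: cQ|exact: cq|exact: cP].
  by apply: cvgM; [apply: cvgM; [exact: cp|exact: cq]|exact: cvg_cst].
have tt := fst_C1d.1 x.
pose r (y : E) := (y.1 * (p y - p x)) * (q y - q x).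
have hr : is_diff x r (cst 0).
  apply: (@tamed_remainder p (fun x => x.1 * p x) (fun y => q y - q x)) => //.
  - by apply: cvgB; [exact: cq|exact: cvg_cst].
  - by rewrite subrr.
have h := is_diffD (is_diffB (is_diffD (is_diffZ (p x) (hQ x)) (is_diffZ (q x) (hP x))) (is_diffZ (p x * q x) tt)) hr.
have -> : (fun x0 : E => x0.1 * (p x0 * q x0)) =
  ((p x *: (fun x => x.1 * q x) + q x *: (fun x => x.1 * p x)) - (p x * q x) *: (fun x : E => x.1)) + r.
  apply/funext => y; rewrite /= !fctE /r /GRing.scale/=; ring.
apply: is_diff_eq h _; apply/funext => v; rewrite /= !fctE /GRing.scale/=; ring.
Qed.

Lemma tamed_inv p : tamed p -> (forall x, 1 <= p x) -> tamed (fun x => (p x)^-1).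
Proof.
move=> [cp tp [dP rP]] p1.
have pp x : 0 < p x by exact: lt_le_trans (p1 x).
have ci : continuous (fun x => (p x)^-1).
  by move=> x; apply: cvgV; [rewrite gt_eqF|exact: cp].
have ti : tame (fun x => (p x)^-1) by apply: bholder_inv => // t _ x; exact: p1.
split=> //; exists (fun x v => (p x)^-1 * (2 * v.1) - (p x)^-1 * (p x)^-1 * dP x v); split; last first.
  have b0 : bholder (fun t v x => (p (t, x))^-1 * (p (t, x))^-1 * ((-1) * dP (t, x) (0, v))).
    apply: bholder_mul; first exact: bholder_mul.
    apply: bholder_mul; last exact: rP.2.
    by apply: (bholder_cst (k := fun _ _ => -1) (B := 1)) => *; rewrite normrN1.
  by apply: bholder_ext b0 _ => t v x; rewrite /= !mulr0 add0r; ring.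
have [[hP cP] _] := rP.
split=> [x|v x]; last first.
  apply: cvgB; apply: cvgM; [exact: ci|exact: cvg_cst|by apply: cvgM; exact: ci|exact: cP].
have tt := fst_C1d.1 x.
pose r (y : E) := (y.1 * (p y - p x)) * ((p y - p x) * (p y)^-1 * (p x)^-1 * (p x)^-1).
have hr : is_diff x r (cst 0).
  apply: (@tamed_remainder p (fun x => x.1 * p x)
    (fun y => (p y - p x) * (p y)^-1 * (p x)^-1 * (p x)^-1)) => //.
  - apply: cvgM; last exact: cvg_cst.
    apply: cvgM; last exact: cvg_cst.
    by apply: cvgM; [apply: cvgB; [exact: cp|exact: cvg_cst]|exact: ci].
  - by rewrite subrr !mul0r.
have h := is_diffD (is_diffB (is_diffZ ((p x)^-1 * 2) tt) (is_diffZ ((p x)^-1 * (p x)^-1) (hP x))) hr.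
have -> : (fun x0 : E => x0.1 * (p x0)^-1) =
  (((p x)^-1 * 2) *: (fun x : E => x.1) - ((p x)^-1 * (p x)^-1) *: (fun x => x.1 * p x)) + r.
  apply/funext => y; rewrite /= !fctE /r /GRing.scale/=; field; rewrite !gt_eqF//.
apply: is_diff_eq h _; apply/funext => v; rewrite /= !fctE /GRing.scale/=; ring.
Qed.

End holder_classes.

(** * The flow along the normal of a graph *)
Section slices.
Context {R : realType} {V : normedModType R}.
Local Notation E := (R * V)%type.
Variable alpha : R.
Hypotheses (alpha0 : 0 < alpha) (alpha1 : alpha <= 1).

Lemma derive_slice (W : normedModType R) (F : E -> W) t x v :
  'D_v (fun x => F (t, x)) x = 'D_(0, v) F (t, x).
Proof.
have E1 : (fun h : R => h^-1 *: (((fun x => F (t, x)) \o shift x) (h *: v) - F (t, x))) =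
    (fun h : R => h^-1 *: ((F \o shift (t, x)) (h *: (0, v)) - F (t, x))).
  apply/funext => h; congr (_ *: (_ - _)); rewrite /=; congr F.
  by congr pair; rewrite /= scaler0 add0r.
by rewrite /derive E1.
Qed.

Lemma regular_rV N (F : E -> 'rV[R]_N) (dF : 'I_N -> E -> E -> R) :
  (forall i, regular alpha (fun p => F p 0 i) (dF i)) ->
  Ck 1 [set: E] F /\ exists L : R, forall t, `|t| <= 1 ->
    holder_diff alpha L [set: V] (fun x => F (t, x)).
Proof.
move=> h; have FE : F = (fun p => \row_i F p 0 i).
  by apply/funext => p; apply/rowP => i; rewrite mxE.
have dFp p : is_diff p F (fun v => \row_i dF i p v).
  by rewrite {1}FE; apply: is_diff_row => i; exact: (h i).1.1.
have DF p v : 'D_v F p = \row_i dF i p v.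
  by have dp := dFp p; rewrite deriveE ?diff_val//; case: dp.
split.
  split=> [p _|v p _]; first by case: (dFp p).
  rewrite (_ : (fun x => _) = (fun p => \row_i dF i p v)); last by apply/funext => q.
  by apply: continuous_row => i; exact: (h i).1.2.
have /choice[c hc] : forall i, exists c : R, 0 <= c /\
    forall t v x y, `|t| <= 1 -> `|v| <= 1 ->
      `|dF i (t, x) (0, v) - dF i (t, y) (0, v)| <= c * `|x - y| `^ alpha.
  move=> i; have [C C0 hC] := (h i).2; exists C; split=> // t v x y t1 v1.
  by have [] := hC t v x y t1 v1.
pose c0 := \sum_i c i.
exists c0 => t t1 x y v _ _; rewrite !derive_slice.
have c00 : 0 <= c0 by rewrite sumr_ge0// => i _; case: (hc i).
have [->|v0] := eqVneq v 0.
  have z0 i p : dF i p (0, 0) = 0.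
    by have hd := (h i).1.1 p; rewrite -[dF i p]diff_val; exact: linear0.
  rewrite normr0 mulr0 !DF (_ : _ - _ = 0) ?normr0//.
  by apply/rowP => i; rewrite !mxE !z0 subrr.
have nv : 0 < `|v| by rewrite normr_gt0.
have vE : (0, v) = `|v| *: (0, `|v|^-1 *: v) :> E.
  by congr pair; rewrite /= ?scaler0// scalerA mulfV ?gt_eqF// scale1r.
have lin i p : dF i p (0, v) = `|v| * dF i p (0, `|v|^-1 *: v).
  by have hd := (h i).1.1 p; rewrite -[dF i p]diff_val {1}vE linearZ.
rewrite !DF; apply: norm_rV_le => [|i].
  by rewrite !mulr_ge0// powR_ge0.
rewrite !mxE !lin -mulrBr normrM normr_id mulrC ler_wpM2r//.
have v1 : `| (`|v|^-1 *: v) | <= 1 by rewrite normrZ normfV normr_id mulVf ?gt_eqF.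
have [ci0 hi] := hc i; apply: le_trans (hi t _ x y t1 v1) _.
rewrite ler_wpM2r ?powR_ge0// /c0 (bigD1 i)//= lerDl sumr_ge0// => k _; by case: (hc k).
Qed.

Lemma tamed_bounded (p : E -> R) : tamed alpha p -> exists2 C : R, 0 <= C &
  forall t x, `|t| <= 1 -> `|p (t, x)| <= C.
Proof.
move=> [_ [C C0 h] _]; exists C => // t x t1.
by have [] := h t 0 x x t1; rewrite ?normr0 ?ler01.
Qed.

Lemma tamed_regular (p : E -> R) : tamed alpha p ->
  (exists dP, regular alpha (fun x => x.1 * p x) dP) /\ tame alpha (fun x => x.1 * p x).
Proof.
move=> tp; have [_ _ [dP rP]] := tp; have [C C0 hC] := tamed_bounded tp.
split; first by exists dP.
apply: (regular_tame alpha0 alpha1 (C := C) rP) => t x t1 /=.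
by rewrite normrM -[leRHS]mul1r ler_pM// hC.
Qed.

Lemma regular_fst : regular alpha (fun x : E => x.1) (fun _ v => v.1).
Proof.
split; first exact: fst_C1d.
by apply: (@bholder_cst _ _ _ (fun _ _ => 0) 0) => *; rewrite normr0.
Qed.

Lemma is_derive_mul_id (p : R -> R) : {for 0, continuous p} ->
  is_derive (0 : R) (1 : R) (fun t => t * p t) (p 0).
Proof.
move=> cp.
have h : is_diff (0 : R) (fun t : R => t * (p t - p 0)) (cst 0).
  apply: is_diff_small => e /((continuous_normedP _ _).1 cp)[d d0 hd].
  exists d => // y /hd h; rewrite mul0r !subr0 normrM mulrC ler_wpM2r// ltW//.
have h2 := is_diffD h (is_diffZ (p 0) (is_diff_id (0 : R))).
have E1 : (fun t : R => t * p t) = (fun t => t * (p t - p 0)) + p 0 *: id.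
  by apply/funext => t; rewrite !fctE /GRing.scale/=; ring.
rewrite E1; apply: DeriveDef; first by apply: diff_derivable; case: h2.
rewrite deriveE; last by case: h2.
by rewrite diff_val !fctE add0r /GRing.scale/= mulr1.
Qed.

End slices.

Section normal_flow.
Context {R : realType} {n : nat}.
Local Notation W := 'rV[R]_n.+1.
Local Notation V := 'rV[R]_n.+2.
Local Notation E := (R * V)%type.
Variables (sg : bool) (alpha : R) (u : W -> R) (B L : R).
Hypotheses (alpha0 : 0 < alpha) (alpha1 : alpha <= 1) (L0 : 0 <= L).
Hypothesis C1u : Ck 1 [set: W] u.
Let e_ (j : 'I_n.+1) : W := delta_mx 0 j.
Let D_ (j : 'I_n.+1) (w : W) : R := 'D_(e_ j) u w.
Hypothesis D_bound : forall j w, `|D_ j w| <= B.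
Hypothesis D_holder : forall j w w', `|D_ j w - D_ j w'| <= L * `|w - w'| `^ alpha.
Variables (g g' : R -> R) (C : R).
Hypothesis g_derive : forall r : R, is_derive r (1 : R) g (g' r).
Hypothesis g_bound : forall r, `|g r| <= C.
Hypothesis g'_bound : forall r, `|g' r| <= C.
Hypothesis g'_lip : forall r r', `|g' r - g' r'| <= C * `|r - r'|.

(** The normal of a C^(1, alpha) graph is not differentiable, and moving along it
would not give a C^1 map.  The partial derivative is therefore replaced at
time t by the symmetric difference quotient at scale t: it tends to the
derivative as t tends to 0, and t times it is (u (w + t e) - u (w - t e)) / 2,
which is of class C^1 jointly in (t, w). *)
Definition slope (j : 'I_n.+1) (t : R) (w : W) : R :=
  if t == 0 then 'D_(delta_mx 0 j) u w
  else (u (w + t *: delta_mx 0 j) - u (w - t *: delta_mx 0 j)) / (2 * t).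

Definition slope_norm (t : R) (w : W) : R := 1 + \sum_j slope j t w * slope j t w.

(** At t = 0 these are the components of Du / (1 + |Du|^2), the horizontal part
of the normal velocity whose vertical displacement of the graph is -1. *)
Definition dir (i : 'I_n.+1) (t : R) (w : W) : R := slope i t w * (slope_norm t w)^-1.

Let B0 : 0 <= B. Proof. exact: le_trans (D_bound ord0 0). Qed.
Let C0 : 0 <= C. Proof. exact: le_trans (g_bound 0). Qed.
Let du w : differentiable u w. Proof. by case: C1u => h _; exact: h. Qed.

Lemma norm_pair1 (p : E) : `|p.1| <= `|p|.
Proof. by rewrite [leRHS]/Num.Def.normr/= /Num.norm/= le_max lexx. Qed.

Lemma norm_pair2 (p : E) : `|p.2| <= `|p|.
Proof. by rewrite [leRHS]/Num.Def.normr/= /Num.norm/= le_max lexx orbT. Qed.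

Lemma regular_lin (F : E -> R) : (forall (a : R) x y, F (a *: x + y) = a * F x + F y) ->
  (forall v, `|F v| <= `|v|) -> regular alpha F (fun _ v => F v).
Proof.
move=> lF bF; have lF' : linear (F : E -> R^o) by move=> a x y; rewrite lF.
pose G : {linear E -> R^o} := HB.pack F (GRing.isLinear.Build R E R^o _ F lF').
have cF : continuous F.
  apply: (@lipschitz_continuous _ _ _ _ 1) => x y; rewrite mul1r.
  by rewrite (_ : F x - F y = F (x - y))// -[LHS]/(G x - G y) -linearB.
split.
  split=> [x|v]; last exact: cst_continuous.
  have hd : differentiable G x by exact: linear_differentiable.
  by apply: DiffDef => //; exact: (@diff_lin _ _ _ G x cF).
apply: (@bholder_cst _ _ _ (fun _ v => F (0, v)) 1) => t v _ v1.
apply: le_trans (bF _) _; rewrite [leLHS]/Num.Def.normr/= /Num.norm/= ge_max /= v1 andbT.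
by rewrite normr0.
Qed.

Lemma regular_hproj i : regular alpha (fun p : E => hproj p.2 0 i) (fun _ v => hproj v.2 0 i).
Proof.
apply: regular_lin => [a x y|v]; first by rewrite /= hprojD hprojZ !mxE.
by apply: le_trans (norm_coord _ _) _; exact: le_trans (norm_hproj _) (norm_pair2 _).
Qed.

Lemma regular_ht : regular alpha (fun p : E => ht sg p.2) (fun _ v => ht sg v.2).
Proof.
apply: regular_lin => [a x y|v]; first by rewrite /= htD htZ.
exact: le_trans (norm_ht _ _) (norm_pair2 _).
Qed.

Lemma regular_u (Y : 'I_n.+1 -> E -> R) : (forall i, exists dY, regular alpha (Y i) dY) ->
  exists dF, regular alpha (fun p => u (\row_i Y i p)) dF.
Proof.
move=> /choice[dY h]; eexists.
exact: (regular_vec alpha0 C1u D_bound L0 D_holder h).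
Qed.

Lemma mul_slope j t w : t * slope j t w =
  (u (w + t *: e_ j) - u (w - t *: e_ j)) * 2^-1.
Proof.
rewrite /slope; case: eqVneq => [->|t0]; last by rewrite /e_; field.
by rewrite !scale0r addr0 subr0 subrr mul0r mul0r.
Qed.

Lemma slope_MVT j t w : t != 0 -> exists2 s : R, `|s| <= `|t| &
  slope j t w = D_ j (w + s *: e_ j).
Proof.
move=> t0; have [s /andP[s0 s1] E1] := @MVT_line _ _ u (w - t *: e_ j) (w + t *: e_ j) (fun _ _ => du _).
have Ev : (w + t *: e_ j) - (w - t *: e_ j) = (2 * t) *: e_ j.
  by rewrite opprD opprK addrACA subrr add0r -scalerDl; congr (_ *: _); ring.
exists ((2 * s - 1) * t).
  by rewrite normrM ler_piMl// ler_norml; apply/andP; split; lra.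
rewrite /slope (negbTE t0) E1 Ev.
have -> : w - t *: e_ j + s *: (2 * t *: e_ j) = w + ((2 * s - 1) * t) *: e_ j.
  rewrite -addrA; congr (_ + _); rewrite scalerA -scaleNr -scalerDl; congr (_ *: _); ring.
rewrite deriveE// linearZ/= -deriveE// /GRing.scale/=; rewrite /D_ mulrAC divff ?mul1r//.
by rewrite mulf_neq0// pnatr_eq0.
Qed.

Lemma norm_e j : `|e_ j| <= 1.
Proof.
apply: norm_rV_le => // i; rewrite mxE eqxx /=; case: (_ == _); rewrite ?normr1// normr0//.
Qed.

Lemma slope_near j t w : `|slope j t w - D_ j w| <= L * `|t| `^ alpha.
Proof.
have [->|t0] := eqVneq t 0.
  by rewrite /slope eqxx subrr normr0 mulr_ge0// powR_ge0.
have [s st ->] := slope_MVT j w t0; apply: le_trans (D_holder _ _ _) _.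
rewrite ler_wpM2l// ge0_ler_powR ?nnegrE//; first exact: ltW.
rewrite addrC addKr normrZ; apply: le_trans (ler_wpM2l _ (norm_e j)) _ => //.
by rewrite mulr1.
Qed.

Lemma slope_bound j t w : `|slope j t w| <= B.
Proof.
have [->|t0] := eqVneq t 0; first by rewrite /slope eqxx; exact: D_bound.
by have [s _ ->] := slope_MVT j w t0; exact: D_bound.
Qed.

Lemma slope_holder j t w w' : `|slope j t w - slope j t w'| <= L * `|w - w'| `^ alpha.
Proof.
have [->|t0] := eqVneq t 0; first by rewrite /slope eqxx; exact: D_holder.
pose f (s : R) : R := u (w + s *: e_ j) - u (w' + s *: e_ j).
have df (s : R) : is_derive s (1 : R) f (D_ j (w + s *: e_ j) - D_ j (w' + s *: e_ j)).
  by apply: is_deriveB; apply: is_derive_line; exact: diff_derivable.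
have [|s _ E1] := @MVT_line _ _ f (- t) t.
  by move=> s _; apply/derivable1_diffP; have [] := df (- t + s *: (t - - t)).
move: E1; set r := - t + s *: (t - - t); have [_ dfr] := df r.
have dfd : differentiable f r by apply/derivable1_diffP; have [] := df r.
have -> : 'D_(t - - t) f r = (2 * t) * 'D_1 f r.
  rewrite !deriveE//; have -> : t - - t = (2 * t) *: (1 : R) by rewrite /GRing.scale/=; ring.
  by rewrite linearZ.
rewrite dfr => E1.
have -> : slope j t w - slope j t w' = (f t - f (- t)) / (2 * t).
  rewrite /slope (negbTE t0) /f !scaleNr /e_.
  by move: (u _) (u _) (u _) (u _) => a b c d; field.
rewrite E1 mulrAC divff ?mul1r; last by rewrite mulf_neq0// pnatr_eq0.
by apply: le_trans (D_holder _ _ _) _; rewrite opprD addrACA subrr addr0.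
Qed.

(** The difference quotient is Hoelder in w by the mean value theorem, and the numerator (u (w + t e) - u (w - t e)) / 2 is
regular. *)
Lemma slope_tamed j : tamed alpha (fun p : E => slope j p.1 (hproj p.2)).
Proof.
have cu : continuous u by exact: Ck1_continuous.
have chp (p : E) : {for p, continuous (fun p : E => hproj p.2 : W)}.
  by apply: (@continuous_comp E V W snd (@hproj R n) p); [exact: cvg_snd|exact: continuous_hproj].
have reg : exists dP, regular alpha (fun p : E => p.1 * slope j p.1 (hproj p.2)) dP.
  have shift (k : R) : exists dF, regular alpha
      (fun p : E => u (\row_i (hproj p.2 0 i + k * e_ j 0 i * p.1))) dF.
    apply: regular_u => i; eexists; apply: regular_add; first exact: regular_hproj.
    exact/regular_scale/regular_fst.
  have [d1 r1] := shift 1; have [d2 r2] := shift (-1).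
  eexists.
  rewrite (_ : (fun p : E => p.1 * slope j p.1 (hproj p.2)) = (fun p : E =>
     2^-1 * (u (\row_i (hproj p.2 0 i + 1 * e_ j 0 i * p.1)) +
       (-1) * u (\row_i (hproj p.2 0 i + (-1) * e_ j 0 i * p.1))))).
    exact: (regular_scale _ (regular_add r1 (regular_scale _ r2))).
  apply/funext => p; rewrite mul_slope mulrC mulN1r; congr (_ * (u _ - u _)).
    by apply/rowP => i; rewrite !mxE mul1r [_ * p.1]mulrC.
  by apply/rowP => i; rewrite !mxE mulN1r mulNr [_ * p.1]mulrC.
split=> //; last first.
  exists (B + L); first exact: addr_ge0.
  move=> t v x y _ _ /=; split; first by apply: le_trans (slope_bound _ _ _) _; rewrite lerDl.
  apply: le_trans (slope_holder _ _ _ _) _.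
  apply: (@le_trans _ _ (L * `|x - y| `^ alpha)).
    by rewrite ler_wpM2l// ge0_ler_powR ?nnegrE//; [exact: ltW|rewrite -hprojB; exact: norm_hproj].
  by rewrite ler_wpM2r ?powR_ge0// lerDr.
move=> p; have [p0|p0] := eqVneq p.1 0.
  apply/continuous_normedP => e e0.
  have cD : {for p, continuous (fun q : E => D_ j (hproj q.2))}.
    apply: (@continuous_comp E W R (fun p : E => hproj p.2) (D_ j) p); first exact: chp.
    by case: C1u => _ h; exact: h.
  have e20 : 0 < e / 2 by rewrite divr_gt0.
  have [d d0 hd] := (continuous_normedP _ _).1 cD _ e20.
  have L1 : 0 < L + 1 by rewrite ltr_wpDl.
  pose d' := (e / 2 / (L + 1)) `^ alpha^-1.
  have d'0 : 0 < d' by rewrite powR_gt0// !divr_gt0.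
  exists (Num.min d d'); first by rewrite lt_min d0.
  move=> q; rewrite lt_min => /andP[/hd h1 hq].
  have h2 : L * `|q.1| `^ alpha <= e / 2.
    have q1d : `|q.1| <= d'.
      have := norm_pair1 (q - p); rewrite /= p0 subr0 => h; exact: le_trans h (ltW hq).
    have : `|q.1| `^ alpha <= e / 2 / (L + 1).
      have <- : d' `^ alpha = e / 2 / (L + 1).
        by rewrite /d' -powRrM mulVf ?gt_eqF// powRr1// !divr_ge0// ltW.
      by rewrite ge0_ler_powR ?nnegrE ?powR_ge0// ltW.
    rewrite ler_pdivlMr// => h; apply: le_trans h; rewrite mulrC ler_wpM2l ?powR_ge0//; lra.
  have h3 := slope_near j q.1 (hproj q.2).
  have E0 : slope j p.1 (hproj p.2) = D_ j (hproj p.2) by rewrite /slope p0 eqxx.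
  rewrite E0 (_ : slope j q.1 (hproj q.2) - D_ j (hproj p.2) =
    (slope j q.1 (hproj q.2) - D_ j (hproj q.2)) + (D_ j (hproj q.2) - D_ j (hproj p.2))); last by ring.
  by apply: le_lt_trans (ler_normD _ _) _; lra.
have [dP [cP _]] := reg.
have ->: (fun p : E => slope j p.1 (hproj p.2)) =
    (fun p : E => if p.1 == 0 then D_ j (hproj p.2) else (p.1)^-1 * (p.1 * slope j p.1 (hproj p.2))).
  by apply/funext => q; rewrite /slope; case: eqVneq => // q0; rewrite mulKf.
have cq : {for p, continuous (fun p : E => (p.1)^-1 * (p.1 * slope j p.1 (hproj p.2)))}.
  apply: cvgM; last exact: (C1d_continuous cP).
  by apply: cvgV => //; exact: cvg_fst.
apply/continuous_normedP => e e0.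
have [d d0 hd] := (continuous_normedP _ _).1 cq _ e0.
exists (Num.min d `|p.1|); first by rewrite lt_min d0 normr_gt0.
move=> q; rewrite lt_min => /andP[/hd h1 h2].
rewrite (negbTE p0) ifF//; apply/eqP => q0; move: h2; rewrite ltNge => /negP; apply.
by apply: le_trans (norm_pair1 _); rewrite /= q0 sub0r normrN.
Qed.

Lemma dir_tamed i : tamed alpha (fun p : E => dir i p.1 (hproj p.2)).
Proof.
have tN : tamed alpha (fun p : E => slope_norm p.1 (hproj p.2)).
  apply: (tamed_add (tamed_cst _ 1)); apply: tamed_sum => j; apply: tamed_mul => //; exact: slope_tamed.
apply: tamed_mul => //; first exact: slope_tamed.
apply: tamed_inv => // p; rewrite /slope_norm lerDl sumr_ge0// => j _.
by rewrite -expr2 sqr_ge0.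
Qed.

Variable eps : R.

(** The speed is a product of two truncations, of the height and of u, so that
the flow is the identity off a compact set and its speed is eps * g^2 on the
graph. *)
Definition rho (x : V) : R := eps * (g (ht sg x) * g (u (hproj x))).
Definition slide (t : R) (x : V) : W :=
  \row_i (hproj x 0 i + rho x * (t * dir i t (hproj x))).
(** The point is first moved horizontally, parallel to the graph of u, and then
lowered. *)
Definition level (t : R) (x : V) : R := ht sg x + u (slide t x) - u (hproj x).
(** Lowering at the new base point keeps the image of the graph explicit: it is
again a graph, of r |-> r - t eps g(r)^2 composed with u.  The horizontal
motion makes the initial velocity normal. *)
Definition flow (t : R) (x : V) : V :=
  emb sg (slide t x) (level t x - t * (eps * (g (level t x) * g (u (slide t x))))).

Let reg (F : E -> R) := exists dF, regular alpha F dF.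

Let reg_g F : reg F -> reg (fun p => g (F p)) /\ tame alpha (fun p => g (F p)).
Proof.
move=> [dF rF]; have r := regular_comp alpha0 alpha1 rF g_derive g'_bound g'_lip.
split; first by eexists; exact: r.
by apply: (regular_tame alpha0 alpha1 (C := C) r) => t x _; exact: g_bound.
Qed.

Let reg_mul F G : reg F /\ tame alpha F -> reg G /\ tame alpha G ->
  reg (fun p => F p * G p) /\ tame alpha (fun p => F p * G p).
Proof.
move=> [[dF rF] tF] [[dG rG] tG]; split; last exact: bholder_mul.
by eexists; exact: (regular_mul rF rG tF tG).
Qed.

Let reg_add F G : reg F -> reg G -> reg (fun p => F p + G p).
Proof. by move=> [dF rF] [dG rG]; eexists; exact: (regular_add rF rG). Qed.

Let reg_scale k F : reg F -> reg (fun p => k * F p).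
Proof. by move=> [dF rF]; eexists; exact: (regular_scale k rF). Qed.

Let reg_eps F : reg F /\ tame alpha F -> reg (fun p => eps * F p) /\ tame alpha (fun p => eps * F p).
Proof.
move=> [r t]; split; first exact: reg_scale.
by apply: bholder_mul => //; apply: (@bholder_cst _ _ _ (fun _ _ => eps) `|eps|).
Qed.

Let hprojE (x : V) : \row_i hproj x 0 i = hproj x.
Proof. by apply/rowP => i; rewrite !mxE. Qed.

Lemma flow_regular : Ck 1 [set: E] (fun p => flow p.1 p.2) /\
  exists L' : R, forall t, `|t| <= 1 -> holder_diff alpha L' [set: V] (flow t).
Proof.
have r_h : reg (fun p => ht sg p.2) by eexists; exact: regular_ht.
have r_w i : reg (fun p => hproj p.2 0 i) by eexists; exact: regular_hproj.
have r_u : reg (fun p => u (hproj p.2)).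
  have [dF rF] := regular_u r_w; exists dF; move: rF; congr regular.
  by apply/funext => p; rewrite hprojE.
have r_rho := reg_eps (reg_mul (reg_g r_h) (reg_g r_u)).
have r_dir i := tamed_regular alpha0 alpha1 (dir_tamed i).
have r_y i : reg (fun p => hproj p.2 0 i + rho p.2 * (p.1 * dir i p.1 (hproj p.2))).
  by apply: reg_add => //; exact: (reg_mul r_rho (r_dir i)).1.
have r_uy : reg (fun p => u (slide p.1 p.2)) by exact: regular_u.
have r_z : reg (fun p => level p.1 p.2).
  have := reg_add (reg_add r_h r_uy) (reg_scale (-1) r_u); congr reg.
  by apply/funext => p; rewrite mulN1r.
have r_t : reg (fun p => p.1) /\ tame alpha (fun p : E => p.1).
  have r : reg (fun p => p.1) by eexists; exact: regular_fst.
  split=> //; case: r => dF rF; apply: (regular_tame alpha0 alpha1 (C := 1) rF) => //.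
have r_H : reg (fun p => level p.1 p.2 -
    p.1 * (eps * (g (level p.1 p.2) * g (u (slide p.1 p.2))))).
  have := reg_add r_z (reg_scale (-1)
    (reg_mul r_t (reg_eps (reg_mul (reg_g r_z) (reg_g r_uy)))).1).
  by congr reg; apply/funext => p; rewrite mulN1r.
have /choice[dF hF] : forall i, exists d, regular alpha (fun p : E => flow p.1 p.2 0 i) d.
  move=> i; case: (unliftP ord_max i) => [j|] ->.
    have [d rd] := r_y j; exists d; move: rd; congr regular; apply/funext => p.
    by rewrite !mxE liftK !mxE.
  have [d rd] := reg_scale ((-1) ^+ sg) r_H; exists d; move: rd; congr regular.
  by apply/funext => p; rewrite !mxE unlift_none.
exact: (regular_rV hF).
Qed.

Lemma flow_id t x : g (ht sg x) = 0 \/ g (u (hproj x)) = 0 -> flow t x = x.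
Proof.
move=> h; have r0 : rho x = 0 by rewrite /rho; case: h => ->; rewrite ?mul0r ?mulr0 ?mulr0.
have s0 : slide t x = hproj x.
  by rewrite /slide r0 -[RHS]hprojE; apply/rowP => i; rewrite !mxE mul0r addr0.
have l0 : level t x = ht sg x by rewrite /level s0 addrK.
rewrite /flow l0 s0; have -> : g (ht sg x) * g (u (hproj x)) = 0.
  by case: h => ->; rewrite ?mul0r ?mulr0.
by rewrite !mulr0 subr0 emb_hproj.
Qed.

Lemma flow0 x : flow 0 x = x.
Proof.
have s0 : slide 0 x = hproj x.
  by rewrite /slide -[RHS]hprojE; apply/rowP => i; rewrite !mxE mul0r mulr0 addr0.
by rewrite /flow /level s0 addrK mul0r subr0 emb_hproj.
Qed.

Definition shift (t : R) (w : W) : W :=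
  \row_i ((g (u w) * g (u w)) * (t * dir i t w)).

(** The base point is moved by shift, and the new height depends on the new base
point only. *)
Lemma flow_graph t w : flow t (emb sg w (u w)) =
  let w' := w + eps *: shift t w in
  emb sg w' (u w' - t * (eps * (g (u w') * g (u w')))).
Proof.
have s0 : slide t (emb sg w (u w)) = w + eps *: shift t w.
  by rewrite /slide /rho ht_emb !hproj_emb; apply/rowP => i; rewrite !mxE !mulrA.
rewrite /flow /level s0 ht_emb hproj_emb /=.
by have -> : forall a b : R, a + b - a = b by move=> a b; ring.
Qed.

Lemma slope_norm_ge1 t w : 1 <= slope_norm t w.
Proof. by rewrite /slope_norm lerDl sumr_ge0// => j _; rewrite -expr2 sqr_ge0. Qed.

Lemma shift_lipschitz : exists2 K : R, 0 <= K & forall t, `|t| <= 1 -> forall w w',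
  `|shift t w - shift t w'| <= K * `|w - w'| /\ `|shift t w| <= K * `|t|.
Proof.
have r_w i : reg (fun p => hproj p.2 0 i) by eexists; exact: regular_hproj.
have r_u : reg (fun p => u (hproj p.2)).
  have [dF rF] := regular_u r_w; exists dF; move: rF; congr regular.
  by apply/funext => p; rewrite hprojE.
have r_dir i := tamed_regular alpha0 alpha1 (dir_tamed i).
have /choice[k hk] : forall i, exists k : R, 0 <= k /\ forall t x y, `|t| <= 1 ->
    `|(g (u (hproj x)) * g (u (hproj x))) * (t * dir i t (hproj x)) -
      (g (u (hproj y)) * g (u (hproj y))) * (t * dir i t (hproj y))| <= k * `|x - y|.
  move=> i; have [[dF rF] _] := reg_mul (reg_mul (reg_g r_u) (reg_g r_u)) (r_dir i).
  by have [k k0 h] := regular_lipschitz rF; exists k; split=> // t x y t1; exact: h.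
pose K1 := \sum_i k i; have K10 : 0 <= K1 by rewrite sumr_ge0// => i _; case: (hk i).
pose K2 := C * C * B; have K20 : 0 <= K2 by rewrite !mulr_ge0.
exists (K1 + K2); first exact: addr_ge0.
move=> t t1 w w'; split; apply: norm_rV_le => [|i]; rewrite ?mulr_ge0 ?addr_ge0// !mxE.
  have [_ h] := hk i; have := h t (emb sg w 0) (emb sg w' 0) t1; rewrite !hproj_emb => h'.
  apply: le_trans h' _; apply: ler_pM => //; first by case: (hk i).
    have h3 : k i <= K1 by rewrite /K1 (bigD1 i)//= lerDl sumr_ge0// => j _; case: (hk j).
    by apply: le_trans h3 _; rewrite lerDl.
  rewrite -embB; apply: le_trans (norm_emb _ _ _) _.
  by rewrite subrr normr0 ge_max lexx normr_ge0.
have d1 : `|dir i t w| <= B.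
  rewrite /dir normrM; apply: (@le_trans _ _ (B * 1)); last by rewrite mulr1.
  apply: ler_pM => //; first exact: slope_bound.
  have N1 := slope_norm_ge1 t w; rewrite normfV ger0_norm ?(le_trans ler01)//.
  by rewrite invf_le1// (lt_le_trans ltr01).
rewrite !normrM (mulrC (Num.norm t)) mulrA ler_wpM2r//.
apply: (@le_trans _ _ K2); last by rewrite lerDr.
have gg : `|g (u w)| * `|g (u w)| <= C * C by apply: ler_pM.
by apply: ler_pM; [rewrite mulr_ge0|rewrite mulr_ge0|exact: gg|rewrite -normrM].
Qed.

(** The displacement w |-> eps * shift t w is a contraction, so Banach's fixed
point theorem inverts the horizontal motion. *)
Lemma shift_onto t (K : R) : 0 <= eps ->
  (forall w w', `|shift t w - shift t w'| <= K * `|w - w'|) -> eps * K <= 2^-1 ->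
  forall b, exists w, w + eps *: shift t w = b.
Proof.
move=> e0 hK eK b; pose f (w : W) : W := b - eps *: shift t w.
pose X : completeNormedModType R :=
  HB.pack 'rV[R]_n.+1 (NormedModule.on 'rV[R]_n.+1) (Complete.on 'rV[R]_n.+1).
pose F : {fun [set: X] >-> [set: X]} := HB.pack f (isFun.Build _ _ setT setT f (fun _ _ => I)).
have ctr : is_contraction F.
  exists (2^-1)%:nng; split => /=; first lra.
  move=> [x y] _ /=; rewrite /f opprD addrACA subrr add0r opprK -scalerN -scalerDr.
  rewrite addrC normrZ (ger0_norm e0) -[shift t y - _]opprB normrN.
  apply: le_trans (ler_wpM2l e0 (hK x y)) _.
  by rewrite mulrA ler_wpM2r.
have [w _ wE] := @banach_fixed_point R X setT F ctr closedT (ex_intro _ 0 I).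
by exists w; rewrite {1}wE /= /f subrK.
Qed.

(** Writing N = 1 + |Du|^2, the vertical velocity is rho * (|Du|^2 / N - 1), that
is -rho / N, while the horizontal one is rho * Du / N. *)
Lemma flow_velocity x : is_derive (0 : R) (1 : R) (flow ^~ x)
  ((- rho x / slope_norm 0 (hproj x)) *:
    emb sg (\row_i - 'D_(delta_mx 0 i) u (hproj x)) 1).
Proof.
set w := hproj x; set N := slope_norm 0 w.
have N0 : N != 0 by rewrite gt_eqF// (lt_le_trans ltr01)// slope_norm_ge1.
pose q i := dir i 0 w.
have s0 : slide 0 x = w.
  by rewrite /slide -[RHS]hprojE; apply/rowP => i; rewrite !mxE mul0r mulr0 addr0.
have cdir i : {for 0, continuous (fun t => dir i t w)}.
  have [cp _ _] := dir_tamed i.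
  apply: (@continuous_comp R E R (fun t => (t, x)) (fun p => dir i p.1 (hproj p.2)) 0).
    apply: (@lipschitz_continuous R R E (fun t => (t, x)) 1) => a b; rewrite mul1r.
    by rewrite [leLHS]/Num.Def.normr/= /Num.norm/= ge_max /= lexx subrr normr0 normr_ge0.
  exact: cp.
have diff1 (f : R -> R) (d : R) : is_derive (0 : R) (1 : R) f d -> is_diff (0 : R) f ( *%R d).
  move=> [df dE]; have dd : differentiable f (0 : R) by apply/derivable1_diffP.
  apply: DiffDef => //; apply/funext => r.
  have -> : r = r *: (1 : R) by rewrite /GRing.scale/= mulr1.
  by rewrite linearZ/= -deriveE// dE /GRing.scale/= mulr1 mulrC.
have dY : is_diff (0 : R) (fun t => slide t x) (fun r => \row_i (rho x * q i * r)).
  apply: is_diff_row => i; apply: diff1.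
  have h := is_deriveD (is_derive_cst (hproj x 0 i) (0 : R) (1 : R))
    (is_deriveZ (rho x) (is_derive_mul_id (cdir i))).
  by apply: is_derive_eq h _; rewrite add0r.
have duY : is_diff (0 : R) (fun t => u (slide t x)) (fun r => 'D_(\row_i (rho x * q i * r)) u w).
  have h := is_diff_comp dY (differentiableP (du (slide 0 x))).
  by apply: is_diff_eq h _; apply/funext => r /=; rewrite s0 -deriveE.
have dz : is_diff (0 : R) (fun t => level t x) (fun r => 'D_(\row_i (rho x * q i * r)) u w).
  have h := is_diffB (is_diffD (is_diff_cst (ht sg x) (0 : R)) duY) (is_diff_cst (u (hproj x)) (0 : R)).
  by apply: is_diff_eq h _; apply/funext => r; rewrite !fctE add0r subr0.
have l0 : level 0 x = ht sg x by rewrite /level s0 addrK.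
have cg : continuous g.
  by move=> r; apply: differentiable_continuous; apply/derivable1_diffP; have [] := g_derive r.
have cG : {for 0, continuous (fun t => eps * (g (level t x) * g (u (slide t x))))}.
  apply: cvgM; first exact: cvg_cst.
  apply: cvgM.
    apply: (@continuous_comp R R R (fun t => level t x) g 0); last exact: cg.
    by apply: differentiable_continuous; case: dz.
  apply: (@continuous_comp R R R (fun t => u (slide t x)) g 0); last exact: cg.
  by apply: differentiable_continuous; case: duY.
have dG := is_derive_mul_id cG; rewrite l0 s0 -/(rho x) in dG.
have dH := is_diffB dz (diff1 _ _ dG).
have h0 := is_diff_comp (is_diff_pair dY dH) (is_diff_embp sg _).
have h := h0 : is_diff (0 : R) (flow ^~ x) _.
apply: DeriveDef; first by apply: diff_derivable; case: h.
rewrite deriveE; last by case: h.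
rewrite diff_val /= /embp /= -embZ; congr emb.
  apply/rowP => i; by rewrite !mxE !mulr1 /q /dir /slope eqxx -/w -/N; field.
change ('D_(\row_i (rho x * q i * 1)) u w - rho x * 1 = - rho x / N * 1).
rewrite !(mulr1 (_ : R)) derive_delta//.
have -> : \sum_j (\row_i (rho x * q i * 1)) 0 j *: 'D_(delta_mx 0 j) u w =
    rho x / N * (N - 1).
  have -> : N - 1 = \sum_j slope j 0 w * slope j 0 w by rewrite /N /slope_norm addrC addKr.
  rewrite mulr_sumr; apply: eq_bigr => j _.
  by rewrite mxE mulr1 /q /dir /slope eqxx -/w -/N /GRing.scale/=; field.
by field.
Qed.

End normal_flow.

(** * Truncations of class C^(1,1) *)
Section truncations.
Context {R : realType}.

Definition sqp (r : R) : R := Num.max r 0 ^+ 2.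

Lemma sqp_le0 r : r <= 0 -> sqp r = 0.
Proof. by move=> r0; rewrite /sqp (max_idPr r0) expr0n. Qed.

Lemma sqp_ge0 r : 0 <= r -> sqp r = r ^+ 2.
Proof. by move=> r0; rewrite /sqp (max_idPl r0). Qed.

Lemma max0_lip (r r' : R) : `|Num.max r 0 - Num.max r' 0| <= `|r - r'|.
Proof.
have [r0|r0] := leP r 0; have [r'0|r'0] := leP r' 0.
- by rewrite subrr normr0.
- by rewrite sub0r normrN distrC ger0_norm ?ger0_norm; lra.
- by rewrite subr0 !ger0_norm; lra.
- by [].
Qed.

Lemma sqp_taylor (r y : R) :
  `|sqp y - sqp r - 2 * Num.max r 0 * (y - r)| <= (y - r) * (y - r).
Proof.
have s0 : 0 <= (y - r) * (y - r) by rewrite -expr2 sqr_ge0.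
have r2 : 0 <= r * r by rewrite -expr2 sqr_ge0.
have y2 : 0 <= y * y by rewrite -expr2 sqr_ge0.
rewrite /sqp; have [r0|r0] := leP r 0; have [y0|y0] := leP y 0;
  rewrite ler_norml !expr2.
- by apply/andP; split; lra.
- by have p : 0 <= y * - r by [rewrite mulr_ge0 ?oppr_ge0// ltW]; apply/andP; split; lra.
- by have p : 0 <= - y * r by [rewrite mulr_ge0 ?oppr_ge0// ltW]; apply/andP; split; lra.
- by apply/andP; split; lra.
Qed.

Lemma sqp_derive (r : R) : is_derive r (1 : R) sqp (2 * Num.max r 0).
Proof.
have h : is_diff r (fun s => sqp s - 2 * Num.max r 0 * s) (cst 0).
  apply: is_diff_small => e e0; exists e => // y ye.
  rewrite (_ : _ - _ = sqp y - sqp r - 2 * Num.max r 0 * (y - r)); last by ring.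
  apply: (@le_trans _ _ (`|y - r| * `|y - r|)); last by rewrite ler_wpM2r// ltW.
  have -> : `|y - r| * `|y - r| = (y - r) * (y - r) by rewrite -normrM ger0_norm// -expr2 sqr_ge0.
  exact: sqp_taylor.
have h2 := is_diffD h (is_diffZ (2 * Num.max r 0) (is_diff_id r)).
have -> : sqp = (fun s => sqp s - 2 * Num.max r 0 * s) + (2 * Num.max r 0) *: id.
  by apply/funext => s; rewrite !fctE /GRing.scale/= subrK.
apply: DeriveDef; first by apply: diff_derivable; case: h2.
rewrite deriveE; last by case: h2.
by rewrite diff_val !fctE add0r /GRing.scale/= mulr1.
Qed.

Lemma sqp_shift_derive (a r : R) : is_derive r (1 : R) (fun s => sqp (s - a)) (2 * Num.max (r - a) 0).
Proof.
have h := (@is_derive_line _ _ _ sqp (- a) 1 r).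
have E1 (t : R) : - a + t *: (1 : R) = t - a by rewrite /GRing.scale/= mulr1 addrC.
rewrite E1 in h; have [d1 d2] := sqp_derive (r - a).
have := h d1; rewrite d2; by under eq_fun do rewrite E1.
Qed.

(** A quadratic B-spline: a third difference of the squares of positive parts,
hence supported in [a, a + 3 T], and equal to (r - a)^2 on [a, a + T]. *)
Definition bump (a T r : R) : R :=
  sqp (r - a) - 3 * sqp (r - (a + T)) + 3 * sqp (r - (a + 2 * T)) - sqp (r - (a + 3 * T)).

Definition dbump (a T r : R) : R := 2 * Num.max (r - a) 0 - 3 * (2 * Num.max (r - (a + T)) 0)
  + 3 * (2 * Num.max (r - (a + 2 * T)) 0) - 2 * Num.max (r - (a + 3 * T)) 0.

Lemma bump_derive a T r : is_derive r (1 : R) (bump a T) (dbump a T r).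
Proof.
have h := is_deriveB (is_deriveD (is_deriveB (sqp_shift_derive a r)
  (is_deriveZ 3 (sqp_shift_derive (a + T) r)))
  (is_deriveZ 3 (sqp_shift_derive (a + 2 * T) r))) (sqp_shift_derive (a + 3 * T) r).
exact: h.
Qed.

Lemma bump_low a T r : 0 < T -> r <= a + T -> bump a T r = sqp (r - a).
Proof. by move=> T0 h; rewrite /bump !(@sqp_le0 (r - (_ + _))) ?mulr0 ?subr0 ?addr0//; lra. Qed.

Lemma bump_high a T r : 0 < T -> a + 3 * T <= r -> bump a T r = 0.
Proof. by move=> T0 h; rewrite /bump !sqp_ge0; [ring|lra..]. Qed.

Lemma dbump_lip a T r r' : `|dbump a T r - dbump a T r'| <= 16 * `|r - r'|.
Proof.
have h b : `|Num.max (r - b) 0 - Num.max (r' - b) 0| <= `|r - r'|.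
  by apply: le_trans (max0_lip _ _) _; rewrite opprB addrA subrK.
have := h a; have := h (a + T); have := h (a + 2 * T); have := h (a + 3 * T).
rewrite /dbump; move: (Num.max _ _) (Num.max _ _) (Num.max _ _) (Num.max _ _).
move: (Num.max _ _) (Num.max _ _) (Num.max _ _) (Num.max _ _) => x1 x2 x3 x4 y1 y2 y3 y4.
move: `|r - r'| => D; rewrite !ler_norml => /andP[? ?] /andP[? ?] /andP[? ?] /andP[? ?].
apply/andP; split; lra.
Qed.

Lemma dbump_bound a T r : 0 < T -> `|dbump a T r| <= 48 * T.
Proof.
move=> T0; have d0 : dbump a T a = 0.
  by rewrite /dbump !(@max_idPr _ _ _ 0 _); [ring|lra..].
have [h|h] := leP r a.
  rewrite (_ : dbump a T r = 0) ?normr0; first lra.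
  by rewrite /dbump !(@max_idPr _ _ _ 0 _); [ring|lra..].
have [h'|h'] := leP (a + 3 * T) r.
  rewrite (_ : dbump a T r = 0) ?normr0; first lra.
  by rewrite /dbump !(@max_idPl _ _ _ 0 _); [ring|lra..].
have ra : 0 <= r - a by lra.
have := dbump_lip a T r a; rewrite d0 subr0 (ger0_norm ra); lra.
Qed.

Lemma bump_bound a T r : 0 < T -> `|bump a T r| <= 72 * T ^+ 2.
Proof.
move=> T0; have T2 : 0 < T ^+ 2 by rewrite exprn_gt0.
have [h|h] := leP r a.
  by rewrite bump_low ?sqp_le0 ?normr0; nra.
have [h'|h'] := leP (a + 3 * T) r; first by rewrite bump_high// normr0; nra.
have b b' : 0 <= b' - a -> 0 <= sqp (r - b') <= 9 * T ^+ 2.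
  move=> h2; rewrite sqr_ge0 /=; have [h3|h3] := leP (r - b') 0; first by rewrite sqp_le0//; nra.
  by rewrite sqp_ge0 ?ltW//; nra.
rewrite /bump ler_norml; have /andP[? ?] := b a ltac:(lra).
have /andP[? ?] := b (a + T) ltac:(lra); have /andP[? ?] := b (a + 2 * T) ltac:(lra).
have /andP[? ?] := b (a + 3 * T) ltac:(lra); apply/andP; split; lra.
Qed.

(** A C^(1, 1) function, constant equal to m below m - d and the identity above
m + d. *)
Definition ramp (m d r : R) : R :=
  m + (4 * d)^-1 * (sqp (r - (m - d)) - sqp (r - (m + d))).
Definition dramp (m d r : R) : R :=
  (4 * d)^-1 * (2 * Num.max (r - (m - d)) 0 - 2 * Num.max (r - (m + d)) 0).

Lemma ramp_derive m d r : is_derive r (1 : R) (ramp m d) (dramp m d r).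
Proof.
have h := is_deriveD (is_derive_cst m r (1 : R)) (is_deriveZ (4 * d)^-1
  (is_deriveB (sqp_shift_derive (m - d) r) (sqp_shift_derive (m + d) r))).
by apply: is_derive_eq h _; rewrite add0r.
Qed.

Lemma ramp_low m d r : 0 < d -> r <= m - d -> ramp m d r = m.
Proof. by move=> d0 h; rewrite /ramp !sqp_le0 ?subr0 ?mulr0 ?addr0//; lra. Qed.

Lemma ramp_high m d r : 0 < d -> m + d <= r -> ramp m d r = r.
Proof. by move=> d0 h; rewrite /ramp !sqp_ge0; [field; rewrite gt_eqF|lra..]. Qed.

Lemma ramp_mid m d r : 0 < d -> r <= m + d -> ramp m d r <= m + d.
Proof.
move=> d0 h; have [h'|h'] := leP r (m - d); first by rewrite ramp_low//; lra.
rewrite /ramp (@sqp_le0 (r - (m + d))) ?subr0; last lra.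
rewrite sqp_ge0; last lra.
rewrite lerD2l mulrC ler_pdivrMr ?mulr_gt0//; nra.
Qed.

Lemma dramp_bound m d r : 0 < d -> `|dramp m d r| <= 1.
Proof.
move=> d0; rewrite /dramp normrM gtr0_norm ?invr_gt0 ?mulr_gt0//.
rewrite mulrC ler_pdivrMr ?mulr_gt0// mul1r -mulrBr normrM gtr0_norm//.
have d2 : 0 <= 2 * d by lra.
have := max0_lip (r - (m - d)) (r - (m + d)).
rewrite (_ : r - (m - d) - (r - (m + d)) = 2 * d); last by ring.
by rewrite (ger0_norm d2) => h; lra.
Qed.

Lemma dramp_lip m d r r' : 0 < d -> `|dramp m d r - dramp m d r'| <= d^-1 * `|r - r'|.
Proof.
move=> d0; rewrite /dramp -mulrBr normrM gtr0_norm ?invr_gt0 ?mulr_gt0//.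
have h b : `|Num.max (r - b) 0 - Num.max (r' - b) 0| <= `|r - r'|.
  by apply: le_trans (max0_lip _ _) _; rewrite opprB addrA subrK.
have := h (m - d); have := h (m + d).
move: (Num.max _ _) (Num.max _ _) (Num.max _ _) (Num.max _ _) => x1 x2 y1 y2.
move: `|r - r'| => D h1 h2; set A := `| _ |.
have hA : A <= 4 * D.
  move: h1 h2; rewrite /A !ler_norml => /andP[? ?] /andP[? ?]; apply/andP; split; lra.
rewrite invfM -mulrA mulrCA; apply: ler_wpM2l; first by rewrite invr_ge0 ltW.
lra.
Qed.

End truncations.

(** * The top of the hypersurface is a graph *)
Section local_graph.
Context {R : realType} {n : nat}.
Local Notation W := 'rV[R]_n.+1.
Local Notation V := 'rV[R]_n.+2.

Definition locreg (alpha Lam : R) (f : W -> R) (w0 : W) (r : R) : Prop :=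
  forall w, `|w - w0| < r -> [/\ differentiable f w,
    forall eta, `|'D_eta f w| <= Lam * `|eta| &
    forall w', `|w' - w0| < r -> `|f w - f w'| <= Lam * `|w - w'| /\
      forall eta, `|'D_eta f w - 'D_eta f w'| <= Lam * `|w - w'| `^ alpha * `|eta|].

Lemma is_diff_near (E F : normedModType R) (f g : E -> F) (x : E) (r : R) :
  0 < r -> (forall y, `|y - x| < r -> f y = g y) -> differentiable g x ->
  is_diff x f ('d g x).
Proof.
move=> r0 fg dg; have cl : continuous ('d g x) by exact: diff_continuous.
apply/(is_diff_normedP f x cl) => e e0.
have [d d0 hd] := (is_diff_normedP _ _ cl).1 (differentiableP dg) e e0.
exists (Num.min r d); first by rewrite lt_min r0.
by move=> y; rewrite lt_min => /andP[/fg -> /hd]; rewrite (fg x) // subrr normr0.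
Qed.

Lemma is_diff_valE (E F : normedModType R) (f df : E -> F) (x : E) :
  is_diff x f df -> 'd f x = df :> (E -> F).
Proof. by move=> hd; rewrite diff_val. Qed.

Variables (sg : bool) (alpha : R) (M : set V) (z : V) (h : R).
Hypotheses (alpha0 : 0 < alpha).
Hypothesis M_le : forall x, M x -> ht sg x <= h.
Hypothesis z_top : ht sg z = h.
Let e : V := emb sg 0 1.

(** If the vertical direction e were tangent to M at a point z of maximal height,
then the image under theta of the straight line from psi z in the direction
of dpsi(e) would be a curve in M through z with velocity e, along which the
height increases. *)
Lemma top_transversal (A B : set V) psi theta : open A -> open B -> psi @` A = B ->
  Ck 1 A psi -> Ck 1 B theta -> (forall p, A p -> theta (psi p) = p) -> A z -> M z ->
  (forall p, A p -> (M p <-> psi p 0 ord_max = 0)) ->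
  'D_e psi z 0 ord_max != 0.
Proof.
move=> oA oB AB [dpsi _] [dth _] thK Az Mz MA; apply/eqP => a0.
set q := psi z; set eta := 'D_e psi z in a0; have Bq : B q by rewrite -AB; exists z.
have thB b : B b -> A (theta b) /\ psi (theta b) = b.
  by rewrite -AB => -[p Ap <-]; rewrite thK.
have [rA rA0 hA] := (open_normedP _).1 oA z Az.
have dE : 'D_eta theta q = e.
  have h1 := is_diff_comp (differentiableP (dpsi z Az)) (differentiableP (dth q Bq)).
  have h2 : is_diff z (theta \o psi) ('d (id : V -> V) z).
    by apply: (is_diff_near rA0) => // y /hA/thK.
  have e1 := congr1 (fun f : V -> V => f e) (is_diff_valE h1).
  have e2 := congr1 (fun f : V -> V => f e) (is_diff_valE h2).
  have e3 := congr1 (fun f : V -> V => f e) (is_diff_valE (is_diff_id z)).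
  rewrite /= in e1 e2 e3.
  have -> : 'D_eta theta q = 'd theta q ('d psi z e).
    rewrite (deriveE eta (dth q Bq)); congr ('d theta q _); exact: (deriveE e (dpsi z Az)).
  exact: (etrans (esym e1) (etrans e2 e3)).
pose f (t : R) := ht sg (theta (q + t *: eta)) - h.
have df : is_derive (0 : R) (1 : R) f 1.
  have d0 : derivable theta (q + (0 : R) *: eta) eta.
    by apply: diff_derivable; rewrite scale0r addr0; exact: dth.
  have [d1 d2] := is_derive_line d0.
  have dg : differentiable (fun t : R => theta (q + t *: eta)) (0 : R) by apply/derivable1_diffP.
  have hd := is_diffB (is_diff_comp (differentiableP dg) (is_diff_ht sg _)) (is_diff_cst h (0 : R)).
  have hf := hd : is_diff (0 : R) f _.
  apply: DeriveDef; first by apply: diff_derivable; case: hf.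
  rewrite deriveE; last by case: hf.
  rewrite diff_val !fctE subr0 /= -deriveE// d2 scale0r addr0 dE.
  by rewrite /e ht_emb.
have f0 : f 0 = 0 by rewrite /f scale0r addr0 thK// z_top subrr.
have [d [r [d0 r0 hr]]] := derive_sign_change df f0 (oner_neq0 _).
have [rB rB0 hB] := (open_normedP _).1 oB q Bq.
have le0 t : `|t| * `|eta| < rB -> f t <= 0.
  move=> tB; have Bt : B (q + t *: eta) by apply: hB; rewrite addrC addKr normrZ.
  have [At pt] := thB _ Bt; rewrite /f subr_le0; apply: M_le; apply/MA => //.
  by rewrite pt !mxE a0 mulr0 addr0; apply/(MA z Az).
pose t := Num.min (r / 2) (rB / 2 / (`|eta| + 1)).
have n1 : 0 < `|eta| + 1 by rewrite ltr_wpDl.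
have t0 : 0 < t by rewrite lt_min !divr_gt0.
have tr : t < r by rewrite gt_min ltr_pdivrMr// ltr_pMr// ltr1n.
have tB : t * `|eta| < rB.
  have : t <= rB / 2 / (`|eta| + 1) by rewrite ge_min lexx orbT.
  rewrite ler_pdivlMr// => h'; apply: le_lt_trans (_ : t * (`|eta| + 1) < rB).
    by rewrite ler_wpM2l ?ltW// ltrDl.
  by apply: le_lt_trans h' _; lra.
have := hr t; rewrite subr0 gt_eqF// gtr0_norm// => /(_ isT tr) p1.
have := hr (- t); rewrite subr0 oppr_eq0 gt_eqF// normrN gtr0_norm// => /(_ isT tr) p2.
have l1 := le0 t; rewrite gtr0_norm// in l1; have {}l1 := l1 tB.
have l2 := le0 (- t); rewrite normrN gtr0_norm// in l2; have {}l2 := l2 tB.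
have q1 : d * t < 0 by nra.
have q2 : d * (- t) < 0 by nra.
by move: q2; rewrite mulrN oppr_lt0 ltNge ltW.
Qed.

Lemma norm_emb_le (w : W) (r c : R) : `|w| <= c -> `|r| <= c -> `|emb sg w r| <= c.
Proof. by move=> h1 h2; apply: le_trans (norm_emb _ _ _) _; rewrite ge_max h1. Qed.

(** The last coordinate of the chart has a nonzero vertical derivative at the top
point by top_transversal, and the equation of M is solved for the height as in the
implicit function theorem, the Hoelder bound on the derivative being
inherited from the chart. *)
Lemma local_graph : interior_point alpha M z -> exists (v : W -> R) (r Lam : R),
  [/\ 0 < r, 0 <= Lam, locreg alpha Lam v (hproj z) r,
    forall w, `|w - hproj z| < r -> M (emb sg w (v w)) &
    forall x, `|x - z| < r -> M x -> ht sg x = v (hproj x)].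
Proof.
move=> [A [B' [psi [[oA oB psiAB [C1psi [Lp Hp]] [theta [thK [C1th _]]]] Az Mz MA]]]].
have a0 := top_transversal oA oB psiAB C1psi C1th thK Az Mz MA.
have CF : Ck 1 A (fun p => psi p 0 ord_max) by exact: Ck1_coord.
have DF p x : A p -> 'D_x (fun p => psi p 0 ord_max) p = 'D_x psi p 0 ord_max.
  by move=> Ap; apply: derive_coord; case: C1psi => hd _; exact: hd.
set a := 'D_e psi z 0 ord_max in a0.
pose F (p : V) : R := a * psi p 0 ord_max.
have dF p : A p -> differentiable F p.
  by move=> Ap; apply: differentiableZ; case: CF => hd _; exact: hd.
have DFE p x : A p -> 'D_x F p = a * 'D_x psi p 0 ord_max.
  move=> Ap; rewrite -DF//; apply: (@deriveZ _ _ _ (fun p => psi p 0 ord_max) a).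
  by apply: diff_derivable; case: CF => hd _; exact: hd.
have cDF x p : A p -> {for p, continuous (fun p => 'D_x F p)}.
  move=> Ap; apply/continuous_normedP => eps eps0.
  have a1 : 0 < `|a| by rewrite normr_gt0.
  have [d d0 hd] := (continuous_normedP _ _).1 (CF.2 x p Ap) (eps / `|a|) ltac:(by rewrite divr_gt0).
  have [d' d'0 hd'] := (open_normedP _).1 oA p Ap.
  exists (Num.min d d'); first by rewrite lt_min d0.
  move=> y; rewrite lt_min => /andP[/hd h1 /hd' Ay]; rewrite !DFE// -mulrBr normrM.
  by rewrite -ltr_pdivlMl// mulrC; move: h1; rewrite !DF.
have CF1 : Ck 1 A F by split=> // x p Ap; exact: cDF.
have hF x y v : A x -> A y -> `|'D_v F x - 'D_v F y| <= `|a| * `|Lp| * `|x - y| `^ alpha * `|v|.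
  move=> Ax Ay; rewrite !DFE// -mulrBr normrM -!mulrA ler_wpM2l//.
  have h1 := norm_coord ('D_v psi x - 'D_v psi y) ord_max; rewrite !mxE in h1.
  apply: le_trans h1 _; apply: le_trans (Hp _ _ _ Ax Ay) _.
  by rewrite -mulrA ler_wpM2r ?ler_norm// mulr_ge0// powR_ge0.
pose b := a * a / 2; have aa : 0 < a * a by rewrite -expr2 exprn_even_gt0.
have b0 : 0 < b by rewrite divr_gt0.
have [r0 [B [r00 B0 hA hB]]] := C1_bounded_derive oA Az CF1.
have [r0' r0'0 hr0'] := (continuous_normedP _ _).1 (cDF e z Az) b b0.
pose r1 := Num.min r0 r0'; have r10 : 0 < r1 by rewrite lt_min r00.
have inA x : `|x - z| < r1 -> A x by rewrite lt_min => /andP[/hA].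
have De x : `|x - z| < r1 -> b <= 'D_e F x.
  rewrite lt_min => /andP[_ /hr0']; rewrite (DFE z)// -/a ltr_norml => /andP[h1 _].
  by move: h1; rewrite /b; lra.
have DB x v : `|x - z| < r1 -> `|'D_v F x| <= B * `|v|.
  by rewrite lt_min => /andP[/hB].
have FB x y : `|x - z| < r1 -> `|y - z| < r1 -> `|F x - F y| <= B * `|x - y|.
  move=> hx hy; have [|t /andP[t0 t1] ->] := @MVT_line _ _ F y x.
    by move=> t t01; apply: dF; apply: inA; exact: ball_segment.
  by apply: DB; apply: ball_segment => //; rewrite !ltW.
have zE : z = emb sg (hproj z) h by rewrite -z_top emb_hproj.
have vert w s s' : `|emb sg w s - z| < r1 -> `|emb sg w s' - z| < r1 ->
    exists2 t : R, 0 < t < 1 & F (emb sg w s') - F (emb sg w s) =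
      (s' - s) * 'D_e F (emb sg w s + t *: (emb sg w s' - emb sg w s)).
  move=> hs hs'; have [|t t01 E1] := @MVT_line _ _ F (emb sg w s) (emb sg w s').
    by move=> t t01; apply: dF; apply: inA; exact: ball_segment.
  exists t => //; rewrite E1; set x := _ + _.
  have dx : differentiable F x.
    by apply: dF; apply: inA; apply: ball_segment => //; case/andP: t01 => *; rewrite !ltW.
  have -> : emb sg w s' - emb sg w s = (s' - s) *: e.
    by rewrite -embB subrr /e -embZ scaler0 mulr1.
  by rewrite deriveE// linearZ/= -deriveE.
have mono w s s' : `|emb sg w s - z| < r1 -> `|emb sg w s' - z| < r1 ->
    b * `|s' - s| <= `|F (emb sg w s') - F (emb sg w s)|.
  move=> hs hs'; have [t /andP[t0 t1] ->] := vert w s s' hs hs'.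
  have := De _ (ball_segment (t := t) (ltac:(by rewrite !ltW) : 0 <= t <= 1) hs hs').
  by move=> h1; rewrite normrM mulrC ler_wpM2l// (le_trans h1)// ler_norm.
pose rho := r1 / 2; have rho0 : 0 < rho by rewrite divr_gt0.
pose r2 := Num.min rho (b * rho / (B + 1)).
have B1 : 0 < B + 1 by rewrite ltr_wpDl.
have r20 : 0 < r2 by rewrite lt_min rho0 divr_gt0// mulr_gt0.
have inb w s : `|w - hproj z| < r2 -> `|s - h| <= rho -> `|emb sg w s - z| < r1.
  rewrite lt_min => /andP[h1 _] h2; rewrite zE -embB; apply: le_lt_trans (_ : rho < r1).
    by apply: norm_emb_le => //; exact: ltW.
  by rewrite /rho; lra.
have Fz : F z = 0 by rewrite /F (iffLR (MA z Az) Mz) mulr0.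
have cFv w s : `|w - hproj z| < r2 -> `|s - h| <= rho -> {for s, continuous (fun s => F (emb sg w s))}.
  move=> hw hs; apply: (@continuous_comp R V R (fun s => emb sg w s) F s).
    apply: (@lipschitz_continuous _ _ _ _ 1) => x y; rewrite mul1r -embB subrr.
    by apply: norm_emb_le => //; rewrite normr0.
  by apply: differentiable_continuous; apply: dF; apply: inA; exact: inb.
have /choice[v hv] : forall w, exists s, `|w - hproj z| < r2 -> `|s - h| <= rho /\ F (emb sg w s) = 0.
  move=> w; have [hw|hw] := ltP `|w - hproj z| r2; last by exists 0 => //.
  have zz : `|hproj z - hproj z| < r2 by rewrite subrr normr0.
  have hup : `|h + rho - h| <= rho by rewrite addrC addKr gtr0_norm.
  have hdn : `|h - rho - h| <= rho by rewrite addrC addKr normrN gtr0_norm.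
  have h0 : `|h - h| <= rho by rewrite subrr normr0 ltW.
  have Bw : B * `|w - hproj z| < b * rho.
    apply: le_lt_trans (_ : (B + 1) * `|w - hproj z| < _); first by rewrite ler_wpM2r// lerDl.
    by move: hw; rewrite lt_min => /andP[_]; rewrite ltr_pdivlMr// mulrC.
  have close s : `|s - h| <= rho -> `|F (emb sg w s) - F (emb sg (hproj z) s)| < b * rho.
    move=> hs; apply: le_lt_trans (FB _ _ (inb _ _ hw hs) (inb _ _ zz hs)) _.
    apply: le_lt_trans Bw; rewrite ler_wpM2l// -embB subrr.
    by apply: norm_emb_le => //; rewrite normr0.
  have up : 0 < F (emb sg w (h + rho)).
    have [t /andP[t0 t1] E1] := vert _ _ _ (inb _ _ zz h0) (inb _ _ zz hup).
    have := De _ (ball_segment (t := t) (ltac:(by rewrite !ltW) : 0 <= t <= 1) (inb _ _ zz h0) (inb _ _ zz hup)).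
    move: E1; rewrite -zE Fz subr0 (_ : h + rho - h = rho); last by ring.
    move=> E1 h1.
    have := close _ hup; rewrite E1 ltr_norml => /andP[h2 _].
    by have := ler_wpM2l (ltW rho0) h1; lra.
  have dn : F (emb sg w (h - rho)) < 0.
    have [t /andP[t0 t1] E1] := vert _ _ _ (inb _ _ zz h0) (inb _ _ zz hdn).
    have := De _ (ball_segment (t := t) (ltac:(by rewrite !ltW) : 0 <= t <= 1) (inb _ _ zz h0) (inb _ _ zz hdn)).
    move: E1; rewrite -zE Fz subr0 (_ : h - rho - h = - rho); last by ring.
    move=> E1 h1.
    have := close _ hdn; rewrite E1 ltr_norml => /andP[_ h2].
    by have := ler_wpM2l (ltW rho0) h1; lra.
  have [|||s] := @IVT R (fun s => F (emb sg w s)) (h - rho) (h + rho) 0.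
  - lra.
  - apply: continuous_in_subspaceT => s; rewrite inE/= in_itv/= => /andP[h1 h2].
    by apply: cFv => //; rewrite ler_norml; apply/andP; split; lra.
  - by rewrite ge_min le_max (ltW dn) (ltW up) orbT.
  rewrite in_itv/= => /andP[h1 h2] Fs; exists s => _; split=> //.
  by rewrite ler_norml; apply/andP; split; lra.
pose P w := emb sg w (v w).
have PE w : `|w - hproj z| < r2 -> `|P w - z| < r1 by move=> hw; have [h1 _] := hv w hw; exact: inb.
have FP w : `|w - hproj z| < r2 -> F (P w) = 0 by move=> /hv[].
pose Lv := B / b; have Lv0 : 0 <= Lv by rewrite divr_ge0// ltW.
have mid w w' : `|w - hproj z| < r2 -> `|w' - hproj z| < r2 -> `|emb sg w' (v w) - z| < r1.
  by move=> hw hw'; have [h1 _] := hv w hw; exact: inb.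
have vL w w' : `|w - hproj z| < r2 -> `|w' - hproj z| < r2 -> `|v w - v w'| <= Lv * `|w - w'|.
  move=> hw hw'; have := mono w' (v w) (v w') (mid _ _ hw hw') (PE _ hw').
  rewrite -/(P w') FP// -(FP w hw) => h1.
  rewrite /Lv mulrAC ler_pdivlMr// mulrC distrC; apply: le_trans h1 _.
  apply: le_trans (FB _ _ (PE _ hw) (mid _ _ hw hw')) _.
  rewrite ler_wpM2l// /P -embB subrr; apply: norm_emb_le => //; by rewrite normr0.
have PL w w' : `|w - hproj z| < r2 -> `|w' - hproj z| < r2 -> `|P w - P w'| <= (1 + Lv) * `|w - w'|.
  move=> hw hw'; rewrite /P -embB; apply: norm_emb_le; first by rewrite ler_peMl// lerDl.
  by apply: le_trans (vL _ _ hw hw') _; rewrite ler_wpM2r// lerDr.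
have dv w : `|w - hproj z| < r2 ->
    is_diff w v (fun eta => - (('D_e F (P w))^-1 * 'D_(emb sg eta 0) F (P w))).
  move=> hw; set N := 'D_e F (P w); have bN : b <= N by exact: De (PE _ hw).
  have N0 : 0 < N by exact: lt_le_trans bN.
  pose phi (w' : W) : R := N^-1 * F (emb sg w' (v w)).
  have AP : A (P w) by exact: inA (PE _ hw).
  have dphi : is_diff w phi (fun eta => N^-1 * 'D_(emb sg eta 0) F (P w)).
    have i1 := is_diff_comp (is_diff_pair (is_diff_id w) (is_diff_cst (v w) w)) (is_diff_embp sg _).
    have i2 := is_diffZ N^-1 (is_diff_comp i1 (differentiableP (dF (P w) AP))).
    by apply: is_diff_eq i2 _; apply/funext => eta; rewrite !fctE /= deriveE//; exact: dF.
  have dQ : is_diff w (fun w' => v w' + phi w') (cst 0).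
    apply: is_diff_small => eps eps0.
    have L2 : 0 < Lv + 1 by rewrite ltr_wpDl.
    have eb : 0 < eps * b / (Lv + 1) by apply: divr_gt0 => //; exact: mulr_gt0.
    have [d d0 hd] := (continuous_normedP _ _).1 (cDF e (P w) AP) _ eb.
    have L1 : 0 < 1 + Lv by rewrite ltr_pwDl.
    exists (Num.min (d / (1 + Lv)) (r2 - `|w - hproj z|)).
      by rewrite lt_min divr_gt0//= subr_gt0.
    move=> w'; rewrite lt_min => /andP[wd ww'].
    have hw' : `|w' - hproj z| < r2.
      rewrite (_ : w' - hproj z = (w' - w) + (w - hproj z)); last by rewrite addrA subrK.
      by apply: le_lt_trans (ler_normD _ _) _; move: ww'; rewrite ltrBrDr.
    have [t /andP[t0 t1] E1] := vert w' (v w) (v w') (mid _ _ hw hw') (PE _ hw').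
    rewrite -/(P w') FP// sub0r in E1; move: E1.
    set x := emb sg w' (v w) + t *: (P w' - emb sg w' (v w)) => E1.
    have E2 : v w' + phi w' - (v w + phi w) = (v w' - v w) * (N^-1 * (N - 'D_e F x)).
      rewrite /phi -/(P w) FP// mulr0 addr0 -[F (emb sg w' _)]opprK E1.
      by field; rewrite gt_eqF.
    have xP : `|x - P w| < d.
      have -> : x - P w = emb sg (w' - w) (t * (v w' - v w)).
        rewrite /x /P -embB subrr -embZ scaler0 -embD -embB addr0; congr emb; ring.
      move: wd; rewrite ltr_pdivlMr// mulrC; apply: le_lt_trans.
      apply: norm_emb_le; first by rewrite ler_peMl// lerDl.
      rewrite normrM gtr0_norm//; apply: le_trans (_ : `|v w' - v w| <= _).
        by rewrite ler_piMl// ltW.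
      by apply: le_trans (vL _ _ hw' hw) _; rewrite ler_wpM2r// lerDr.
    have {}hd := hd x xP; rewrite -/N distrC in hd.
    have hN : `|N^-1 * (N - 'D_e F x)| <= eps / (Lv + 1).
      rewrite normrM normfV (gtr0_norm N0) ler_pdivrMl//; apply: le_trans (ltW hd) _.
      rewrite (_ : eps * b / (Lv + 1) = b * (eps / (Lv + 1))); last by ring.
      by apply: ler_wpM2r => //; apply: divr_ge0; exact: ltW.
    rewrite E2 normrM; apply: le_trans (ler_pM _ _ (vL _ _ hw' hw) hN) _ => //.
    rewrite (_ : Lv * `|w' - w| * (eps / (Lv + 1)) = (Lv / (Lv + 1)) * (eps * `|w' - w|)); last first.
      by field; rewrite gt_eqF.
    apply: ler_piMl; first by rewrite mulr_ge0// ltW.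
    by rewrite ler_pdivrMr// mul1r lerDl.
  have i3 := is_diffB dQ dphi.
  have -> : v = (fun w' => v w' + phi w') - phi by apply/funext => w'; rewrite !fctE addrK.
  by apply: is_diff_eq i3 _; apply/funext => eta; rewrite !fctE sub0r.
pose K := `|a| * `|Lp| * (1 + Lv) `^ alpha; have K0 : 0 <= K by rewrite !mulr_ge0// powR_ge0.
pose Lam := Lv + b^-1 * K + b^-1 * b^-1 * (B * K).
have b'0 : 0 <= b^-1 by rewrite invr_ge0 ltW.
have bK : 0 <= b^-1 * K by rewrite mulr_ge0.
have bBK : 0 <= b^-1 * b^-1 * (B * K) by apply: mulr_ge0; apply: mulr_ge0.
have Lam0 : 0 <= Lam by rewrite /Lam !addr_ge0.
have LvLam : Lv <= Lam by rewrite /Lam -addrA lerDl addr_ge0.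
have e1 (eta : W) : `|emb sg eta 0| <= `|eta| by apply: norm_emb_le => //; rewrite normr0.
have Dv w eta : `|w - hproj z| < r2 ->
    'D_eta v w = - (('D_e F (P w))^-1 * 'D_(emb sg eta 0) F (P w)).
  by move=> /dv dvw; rewrite deriveE ?diff_val//; case: dvw.
exists v, r2, Lam; split=> //.
- move=> w hw; have bN := De _ (PE _ hw).
  have N0 : 0 < 'D_e F (P w) by exact: lt_le_trans bN.
  have iN : `|('D_e F (P w))^-1| <= b^-1.
    by rewrite gtr0_norm ?invr_gt0// lef_pV2.
  split; first by case: (dv w hw).
    move=> eta; rewrite Dv// normrN normrM.
    apply: (@le_trans _ _ (b^-1 * (B * `|eta|))).
      apply: ler_pM => //; apply: le_trans (DB _ _ (PE _ hw)) _; exact: ler_wpM2l.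
    by rewrite mulrA ler_wpM2r// mulrC.
  move=> w' hw'; split.
    apply: le_trans (vL _ _ hw hw') _; by rewrite ler_wpM2r.
  move=> eta; have bN' := De _ (PE _ hw').
  have N'0 : 0 < 'D_e F (P w') by exact: lt_le_trans bN'.
  have iN' : `|('D_e F (P w'))^-1| <= b^-1.
    by rewrite gtr0_norm ?invr_gt0// lef_pV2.
  rewrite !Dv// -opprD normrN.
  have dd : 0 <= `|a| * `|Lp| * `|P w - P w'| `^ alpha by rewrite !mulr_ge0// powR_ge0.
  have dK : `|a| * `|Lp| * `|P w - P w'| `^ alpha <= K * `|w - w'| `^ alpha.
    rewrite (_ : K * _ = `|a| * `|Lp| * ((1 + Lv) `^ alpha * `|w - w'| `^ alpha)); last by rewrite mulrA.
    apply: ler_wpM2l; first exact: mulr_ge0.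
    have L1 : 0 <= 1 + Lv by rewrite addr_ge0.
    rewrite -powRM//; apply: ge0_ler_powR; rewrite ?nnegrE ?mulr_ge0//; first exact: ltW.
    exact: PL.
  have hol x : `|x| <= `|eta| -> `|'D_x F (P w) - 'D_x F (P w')| <= K * `|w - w'| `^ alpha * `|eta|.
    move=> xe; apply: le_trans (hF _ _ _ (inA _ (PE _ hw)) (inA _ (PE _ hw'))) _.
    exact: ler_pM.
  have hole : `|'D_e F (P w') - 'D_e F (P w)| <= K * `|w - w'| `^ alpha.
    rewrite distrC; apply: le_trans (hF _ _ _ (inA _ (PE _ hw)) (inA _ (PE _ hw'))) _.
    rewrite -[leRHS]mulr1; apply: ler_pM => //.
    by apply: norm_emb_le; rewrite ?normr0 ?normr1.
  move: hole (hol _ (e1 eta)) (DB _ (emb sg eta 0) (PE _ hw')).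
  move: ('D_(emb sg eta 0) F (P w)) ('D_(emb sg eta 0) F (P w')) iN iN' N0 N'0.
  move: ('D_e F (P w)) ('D_e F (P w')) => N N' X X' iN iN' N0 N'0 h1 h2 h3.
  have -> : N^-1 * X - N'^-1 * X' = N^-1 * (X - X') + N^-1 * N'^-1 * ((N' - N) * X').
    by field; rewrite !gt_eqF.
  apply: le_trans (ler_normD _ _) _.
  have g1 : `|N^-1 * (X - X')| <= b^-1 * K * (`|w - w'| `^ alpha * `|eta|).
    by rewrite normrM -mulrA; apply: ler_pM => //; rewrite mulrA.
  have g2 : `|N^-1 * N'^-1 * ((N' - N) * X')| <= b^-1 * b^-1 * (B * K) * (`|w - w'| `^ alpha * `|eta|).
    rewrite normrM [leRHS](_ : _ = (b^-1 * b^-1) * ((K * `|w - w'| `^ alpha) * (B * `|eta|))); last by ring.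
    apply: ler_pM => //; first by rewrite normrM; apply: ler_pM.
    rewrite normrM; apply: ler_pM => //; apply: le_trans h3 _; exact: ler_wpM2l.
  apply: le_trans (lerD g1 g2) _; rewrite -mulrDl -[leRHS]mulrA; apply: ler_wpM2r.
    by rewrite mulr_ge0// powR_ge0.
  by rewrite /Lam -addrA lerDr.
- move=> w hw; have := FP w hw; rewrite /F => /eqP; rewrite mulf_eq0 (negbTE a0)/= => /eqP h1.
  by apply/MA => //; exact: inA (PE _ hw).
move=> x xz Mx.
have xw : `|hproj x - hproj z| < r2 by rewrite -hprojB; exact: le_lt_trans (norm_hproj _) xz.
have xh : `|ht sg x - h| <= rho.
  rewrite -z_top -htB; apply: le_trans (norm_ht _ _) (ltW (lt_le_trans xz _)).
  by rewrite ge_min lexx.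
have ix := inb _ _ xw xh.
have Fx : F (emb sg (hproj x) (ht sg x)) = 0.
  by rewrite emb_hproj /F (iffLR (MA x _) Mx) ?mulr0//; apply: inA; rewrite emb_hproj in ix.
have := mono (hproj x) _ _ ix (PE _ xw); rewrite -/(P (hproj x)) FP// Fx subrr normr0.
rewrite pmulr_rle0// normr_le0 subr_eq0 => /eqP ->//.
Qed.

End local_graph.

(** * From local graphs to a global one *)
Section global_graph.
Context {R : realType} {n : nat}.
Local Notation W := 'rV[R]_n.+1.
Local Notation V := 'rV[R]_n.+2.
Variables (sg : bool) (alpha : R).
Hypotheses (alpha0 : 0 < alpha) (alpha1 : alpha <= 1).

Lemma locreg_sub Lam Lam' (f : W -> R) w0 w1 r0 r1 :
  Lam <= Lam' -> `|w1 - w0| + r1 <= r0 -> locreg alpha Lam f w0 r0 -> locreg alpha Lam' f w1 r1.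
Proof.
move=> LL h hf; have inb w : `|w - w1| < r1 -> `|w - w0| < r0.
  move=> hw; rewrite (_ : w - w0 = (w - w1) + (w1 - w0)); last by rewrite addrA subrK.
  by apply: le_lt_trans (ler_normD _ _) _; lra.
move=> w /inb/hf[df bf hh]; split=> // [eta|w' /inb/hh[h1 h2]].
  by apply: le_trans (bf eta) _; rewrite ler_wpM2r.
split; first by apply: le_trans h1 _; rewrite ler_wpM2r.
by move=> eta; apply: le_trans (h2 eta) _; rewrite !ler_wpM2r// powR_ge0.
Qed.

Lemma locreg_ext Lam (f g : W -> R) w0 r : (forall w, `|w - w0| < r -> f w = g w) ->
  locreg alpha Lam g w0 r -> locreg alpha Lam f w0 r.
Proof.
move=> fg hg; have D w : `|w - w0| < r -> differentiable f w /\ forall eta, 'D_eta f w = 'D_eta g w.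
  move=> hw; have [dg _ _] := hg w hw.
  have s0 : 0 < r - `|w - w0| by rewrite subr_gt0.
  have hd : is_diff w f ('d g w).
    apply: (is_diff_near s0) => // y yw; apply: fg.
    rewrite (_ : y - w0 = (y - w) + (w - w0)); last by rewrite addrA subrK.
    by apply: le_lt_trans (ler_normD _ _) _; move: yw; rewrite ltrBrDr.
  have df : differentiable f w by case: hd.
  by split=> // eta; rewrite (deriveE eta df) (deriveE eta dg) (is_diff_valE hd).
move=> w hw; have [df E1] := D w hw; have [dg bg hh] := hg w hw; split=> // [eta|w' hw'].
  by rewrite E1.
have [_ E2] := D w' hw'; have [h1 h2] := hh w' hw'; rewrite !fg//; split=> // eta.
by rewrite E1 E2.
Qed.

Lemma locreg_cst (k : R) (w0 : W) r Lam : 0 <= Lam -> locreg alpha Lam (cst k) w0 r.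
Proof.
move=> L0 w _; split; first exact: differentiable_cst.
  by move=> eta; rewrite derive_cst normr0 mulr_ge0.
by move=> w' _; split=> [|eta]; rewrite /= ?derive_cst subrr normr0 ?mulr_ge0// mulr_ge0// powR_ge0.
Qed.

Lemma is_derive_diff (f : R -> R) (t d : R) : is_derive t (1 : R) f d -> is_diff t f ( *%R d).
Proof.
move=> [df dE]; have dd : differentiable f t by apply/derivable1_diffP.
apply: DiffDef => //; apply/funext => r.
have -> : r = r *: (1 : R) by rewrite /GRing.scale/= mulr1.
by rewrite linearZ/= -deriveE// dE /GRing.scale/= mulr1 mulrC.
Qed.

Lemma ramp_lip (m d r r' : R) : 0 < d -> `|ramp m d r - ramp m d r'| <= `|r - r'|.
Proof.
move=> d0; have dr s : differentiable (ramp m d) s.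
  by apply/derivable1_diffP; have [] := ramp_derive m d s.
have [t _|t _ ->] := @MVT_line _ _ (ramp m d) r' r; first exact: dr.
rewrite deriveE//; set s := r' + _; have hd := is_derive_diff (ramp_derive m d s).
by rewrite (is_diff_valE hd) normrM ler_piMl// dramp_bound.
Qed.

Lemma locreg_ramp (m d Lam : R) (v : W -> R) w0 r : 0 < d -> 0 <= Lam -> r <= 2^-1 ->
  locreg alpha Lam v w0 r ->
  locreg alpha (Lam + d^-1 * (Lam * Lam)) (fun w => ramp m d (v w)) w0 r.
Proof.
move=> d0 L0 r2 hv; have d'0 : 0 <= d^-1 by rewrite invr_ge0 ltW.
have LL : 0 <= d^-1 * (Lam * Lam) by rewrite mulr_ge0// mulr_ge0.
have D w : `|w - w0| < r -> differentiable (fun w => ramp m d (v w)) w /\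
    forall eta, 'D_eta (fun w => ramp m d (v w)) w = dramp m d (v w) * 'D_eta v w.
  move=> hw; have [dv _ _] := hv w hw.
  have h0 := is_diff_comp (differentiableP dv) (is_derive_diff (ramp_derive m d (v w))).
  have hd := h0 : is_diff w (fun w => ramp m d (v w)) _.
  split=> [|eta]; first by case: hd.
  by rewrite deriveE; [rewrite (is_diff_valE hd) /= deriveE|case: hd].
have rb s := dramp_bound m s d0; have rl s s' := dramp_lip m s s' d0.
move=> w hw; have [dr E1] := D w hw; have [dv bv hh] := hv w hw; split=> // [eta|w' hw'].
  rewrite E1 normrM -[leRHS]mul1r; apply: ler_pM => //; apply: le_trans (bv eta) _.
  by rewrite ler_wpM2r// lerDl.
have [_ E2] := D w' hw'; have [h1 h2] := hh w' hw'; split.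
  apply: le_trans (ramp_lip m _ _ d0) _; apply: le_trans h1 _.
  by rewrite ler_wpM2r// lerDl.
move=> eta; rewrite E1 E2; have [_ bv' _] := hv w' hw'.
have ww : `|w - w'| <= 1.
  rewrite (_ : w - w' = (w - w0) - (w' - w0)); last by rewrite opprB addrA subrK.
  by apply: le_trans (ler_normB _ _) _; lra.
have wa := le_powR_small alpha1 (normr_ge0 _) ww.
have -> : dramp m d (v w) * 'D_eta v w - dramp m d (v w') * 'D_eta v w' =
  dramp m d (v w) * ('D_eta v w - 'D_eta v w') + (dramp m d (v w) - dramp m d (v w')) * 'D_eta v w'.
  by ring.
apply: le_trans (ler_normD _ _) _.
rewrite (normrM (dramp m d (v w))) (normrM (dramp m d (v w) - dramp m d (v w'))).
have g1 : `|dramp m d (v w)| * `|'D_eta v w - 'D_eta v w'| <= Lam * `|w - w'| `^ alpha * `|eta|.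
  by rewrite -[leRHS]mul1r; apply: ler_pM.
have g2 : `|dramp m d (v w) - dramp m d (v w')| * `|'D_eta v w'| <=
    d^-1 * (Lam * Lam) * `|w - w'| `^ alpha * `|eta|.
  rewrite (_ : d^-1 * (Lam * Lam) * _ * _ = (d^-1 * (Lam * `|w - w'| `^ alpha)) * (Lam * `|eta|)); last by ring.
  apply: ler_pM => //; apply: le_trans (rl _ _) _; rewrite ler_wpM2l//.
  by apply: le_trans h1 _; rewrite ler_wpM2l.
by apply: le_trans (lerD g1 g2) _; rewrite -!mulrDl.
Qed.

(** Between points at distance less than r the local bounds apply; at distance at
least r the bound on the derivative is itself a Hoelder bound, since
(|w - w'| / r)^alpha is at least 1. *)
Lemma locreg_global (u : W -> R) (Lam r : R) : 0 <= Lam -> 0 < r ->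
  (forall w0, locreg alpha Lam u w0 r) ->
  Ck 1 [set: W] u /\ exists2 C : R, 0 <= C &
    (forall w eta, `|'D_eta u w| <= C * `|eta|) /\
    (forall w w' eta, `|'D_eta u w - 'D_eta u w'| <= C * `|w - w'| `^ alpha * `|eta|).
Proof.
move=> L0 r0 hu; have ww (w : W) : `|w - w| < r by rewrite subrr normr0.
split.
  split=> [w _|eta w _]; first by have [] := hu w w (ww w).
  apply/continuous_normedP => e e0; pose K := Lam * `|eta| + 1.
  have K0 : 0 < K by rewrite ltr_wpDl// mulr_ge0.
  exists (Num.min r ((e / K) `^ alpha^-1)); first by rewrite lt_min r0 powR_gt0// divr_gt0.
  move=> w'; rewrite lt_min => /andP[h1 h2].
  have [_ _ /(_ w (ww w))[_ h3]] := hu w w' h1.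
  apply: le_lt_trans (h3 eta) _.
  have : `|w' - w| `^ alpha <= e / K.
    have <- : ((e / K) `^ alpha^-1) `^ alpha = e / K.
      by rewrite -powRrM mulVf ?gt_eqF// powRr1// divr_ge0// ltW.
    by rewrite ge0_ler_powR ?nnegrE ?powR_ge0// ltW.
  move: (`|w' - w| `^ alpha) (powR_ge0 `|w' - w| alpha) => p p0.
  rewrite ler_pdivlMr// /K mulrDr mulr1 => h4; rewrite mulrAC mulrC.
  have [p00|p00] := eqVneq p 0; first by rewrite p00 mul0r.
  have pp : 0 < p by rewrite lt_neqAle eq_sym p00.
  by lra.
pose C := Lam + 2 * Lam * r^-1 `^ alpha; have C1 : 0 <= 2 * Lam * r^-1 `^ alpha.
  by rewrite !mulr_ge0// powR_ge0.
exists C; first exact: addr_ge0.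
have bd w eta : `|'D_eta u w| <= Lam * `|eta| by have [] := hu w w (ww w).
split=> [w eta|w w' eta].
  by apply: le_trans (bd w eta) _; rewrite ler_wpM2r// lerDl.
have [h|h] := ltP `|w - w'| r.
  have [_ _ /(_ w' (ww w'))[_ h3]] := hu w' w h.
  by apply: le_trans (h3 eta) _; rewrite !ler_wpM2r ?powR_ge0// lerDl.
apply: le_trans (ler_normB _ _) _; apply: le_trans (lerD (bd _ _) (bd _ _)) _.
rewrite -mulrDl ler_wpM2r//; apply: (@le_trans _ _ (2 * Lam * (r^-1 `^ alpha * `|w - w'| `^ alpha))).
  rewrite -[leLHS]mulr1 (_ : Lam + Lam = 2 * Lam); last by ring.
  rewrite ler_wpM2l ?mulr_ge0// -powRM ?invr_ge0 ?(ltW r0)//.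
  have i0 : 0 <= r^-1 by rewrite invr_ge0 ltW.
  have p1 : (1 : R) `^ alpha = 1 by rewrite powR1.
  rewrite -[leLHS]p1; apply: ge0_ler_powR; rewrite ?nnegrE ?mulr_ge0//; first exact: ltW.
  by rewrite ler_pdivlMl// mulr1.
by rewrite mulrA ler_wpM2r ?powR_ge0// lerDr.
Qed.

Variables (M : set V) (h k0 : R).
Hypotheses (cM : compact M) (k0h : k0 < h).
Hypothesis M_le : forall x, M x -> ht sg x <= h.
Hypothesis M_int : forall z, M z -> k0 < ht sg z -> interior_point alpha M z.

(** A point at which M is a graph on a ball of radius d, with constants bounded
by Lam. *)
Let good (z : V) (d Lam : R) := exists v : W -> R, [/\ locreg alpha Lam v (hproj z) d,
  forall w, `|w - hproj z| < d -> M (emb sg w (v w)) &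
  forall x, `|x - z| < d -> M x -> ht sg x = v (hproj x)].

(** Compactness of M makes the radius and the constants uniform over all points
of maximal height. *)
Lemma uniform_top : exists d Lam, [/\ 0 < d, 0 <= Lam &
  forall z, M z -> ht sg z = h -> good z d Lam].
Proof.
apply: (@compact_ind R V M (fun B => exists d Lam, [/\ 0 < d, 0 <= Lam &
  forall z, B z -> ht sg z = h -> good z d Lam]) cM).
- by exists 1, 0.
- move=> B C [d [L [d0 L0 hB]]] [d' [L' [d'0 L'0 hC]]].
  exists (Num.min d d'), (L + L'); split; [by rewrite lt_min d0|exact: addr_ge0|].
  have sub z dd LL : good z dd LL -> Num.min d d' <= dd -> LL <= L + L' -> good z (Num.min d d') (L + L').
    move=> [v [h1 h2 h3]] md ll; exists v; split.
    - by apply: locreg_sub h1 => //; rewrite subrr normr0 add0r.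
    - by move=> w hw; apply: h2; exact: lt_le_trans md.
    - by move=> x hx; apply: h3; exact: lt_le_trans md.
  move=> z [Bz|Cz] hz.
    by apply: sub (hB z Bz hz) _ _; rewrite ?ge_min ?lexx// lerDl.
  by apply: sub (hC z Cz hz) _ _; rewrite ?ge_min ?lexx ?orbT// lerDr.
- by move=> B C BC [d [L [d0 L0 hC]]]; exists d, L; split=> // z /BC; exact: hC.
move=> z Mz; have [hz|hz] := eqVneq (ht sg z) h; last first.
  have lt : 0 < h - ht sg z by rewrite subr_gt0 lt_neqAle hz M_le.
  have [d d0 hd] := (continuous_normedP _ _).1 (@continuous_ht _ _ sg z) _ lt.
  exists d => //; exists 1, 0; split=> // y [_ /hd]; rewrite ltr_norml => /andP[_ h1] hy.
  by move: h1; rewrite hy ltxx.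
have iz : interior_point alpha M z by apply: M_int => //; rewrite hz.
have [v [r [Lam [r0 L0 hl hM hv]]]] := local_graph alpha0 M_le hz iz.
have r20 : 0 < r / 2 by rewrite divr_gt0.
exists (r / 2) => //; exists (r / 2), Lam; split=> // y [My yz] hy; exists v.
have hyz : `|hproj y - hproj z| <= `|y - z| by rewrite -hprojB; exact: norm_hproj.
split; first by apply: locreg_sub hl => //; lra.
- move=> w hw; apply: hM; rewrite (_ : w - hproj z = (w - hproj y) + (hproj y - hproj z)); last by rewrite addrA subrK.
  by apply: le_lt_trans (ler_normD _ _) _; lra.
- move=> x hx; apply: hv; rewrite (_ : x - z = (x - y) + (y - z)); last by rewrite addrA subrK.
  by apply: le_lt_trans (ler_normD _ _) _; lra.
Qed.

(** By compactness, points of M whose height is almost maximal are close to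
points of maximal height. *)
Lemma top_close d : 0 < d -> exists2 k : R, k < h &
  forall x, M x -> k < ht sg x -> exists z, [/\ M z, ht sg z = h & `|x - z| < d].
Proof.
move=> d0; apply: (@compact_ind R V M (fun B => exists2 k : R, k < h &
  forall x, B x -> k < ht sg x -> exists z, [/\ M z, ht sg z = h & `|x - z| < d]) cM).
- by exists (h - 1) => //; lra.
- move=> B C [k kh hB] [k' k'h hC]; exists (Num.max k k'); first by rewrite gt_max kh.
  by move=> x [Bx|Cx]; rewrite gt_max => /andP[h1 h2]; [exact: hB|exact: hC].
- by move=> B C BC [k kh hC]; exists k => // x /BC; exact: hC.
move=> z Mz; have [hz|hz] := eqVneq (ht sg z) h.
  by exists d => //; exists (h - 1); [lra|move=> x [_ xz] _; exists z].
have lt : 0 < (h - ht sg z) / 2.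
  by rewrite divr_gt0// subr_gt0 lt_neqAle hz M_le.
have [d' d'0 hd] := (continuous_normedP _ _).1 (@continuous_ht _ _ sg z) _ lt.
exists d' => //; exists ((h + ht sg z) / 2); first lra.
by move=> x [_ /hd]; rewrite ltr_norml => /andP[_ h1] h2; exfalso; lra.
Qed.

(** Above a level k close to the maximal height h, every point of M lies in one of
the uniform local graphs, and every vertical line meets M at most once.  The
height function, truncated by the ramp slightly above k, extends by a
constant to all of R^(N-1) as a C^(1, alpha) function, since where M does not
reach the level k the truncated function is constant. *)
Lemma global_graph : exists (u : W -> R) (k C R0 : R), [/\ k0 <= k < h, Ck 1 [set: W] u,
  [/\ 0 <= C, forall w eta, `|'D_eta u w| <= C * `|eta| &
    forall w w' eta, `|'D_eta u w - 'D_eta u w'| <= C * `|w - w'| `^ alpha * `|eta| ],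
  (forall w, u w <= h) /\ (forall w, R0 < `|w| -> u w <= k) &
  forall x, k < ht sg x -> (M x <-> ht sg x = u (hproj x))].
Proof.
have [d1 [Lam [d10 L0 hg]]] := uniform_top.
pose d := Num.min d1 1; have d0 : 0 < d by rewrite lt_min d10 ltr01.
have dd1 : d <= d1 by rewrite ge_min lexx.
have d1' : d <= 1 by rewrite ge_min lexx orbT.
have d40 : 0 < d / 4 by rewrite divr_gt0.
have [k1 k1h hk1] := top_close d40.
pose k := Num.max k0 (Num.max k1 (h - d)).
have kh : k < h by rewrite !gt_max k0h k1h/= ltrBlDr ltrDl.
have kk0 : k0 <= k by rewrite le_max lexx.
have near x : M x -> k < ht sg x -> exists z, [/\ M z, ht sg z = h, `|x - z| < d / 4 & h - d < ht sg x].
  rewrite !gt_max => Mx /andP[_ /andP[h1 h2]].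
  by have [z [? ? ?]] := hk1 x Mx h1; exists z.
have inball z x : ht sg z = h -> `|hproj x - hproj z| < d -> h - d < ht sg x -> M x -> `|x - z| < d1.
  move=> hz h1 h2 Mx; apply: lt_le_trans dd1.
  rewrite -(emb_hproj sg x) -(emb_hproj sg z) -embB; apply: le_lt_trans (norm_emb _ _ _) _.
  by rewrite gt_max h1 hz/= ltr_norml; have := M_le Mx; move=> ?; apply/andP; split; lra.
have uniq w r r' : M (emb sg w r) -> k < r -> M (emb sg w r') -> k < r' -> r = r'.
  move=> h1 kr h2 kr'; have [z [Mz hz xz hr]] := near _ h1 ltac:(by rewrite ht_emb).
  have [v [_ _ hv]] := hg z Mz hz.
  have wz : `|w - hproj z| < d.
    have := norm_hproj (emb sg w r - z); rewrite hprojB hproj_emb => h3.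
    by apply: le_lt_trans h3 _; lra.
  have kd : h - d <= k by rewrite !le_max lexx !orbT.
  have e1 := hv _ (inball z (emb sg w r) hz ltac:(by rewrite hproj_emb) ltac:(by rewrite ht_emb; lra) h1) h1.
  have e2 := hv _ (inball z (emb sg w r') hz ltac:(by rewrite hproj_emb) ltac:(by rewrite ht_emb; lra) h2) h2.
  by move: e1 e2; rewrite !ht_emb !hproj_emb => -> ->.
pose m := (k + h) / 2; pose t := (h - k) / 4; have t0 : 0 < t by rewrite divr_gt0// subr_gt0.
pose u (w : W) : R := if pselect (exists r, k < r /\ M (emb sg w r)) is left H
  then ramp m t (projT1 (cid H)) else m.
have uM w r : k < r -> M (emb sg w r) -> u w = ramp m t r.
  move=> kr Mr; rewrite /u; case: pselect => [H|[]]; last by exists r.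
  by case: (cid H) => r' [kr' Mr'] /=; rewrite (uniq w r' r).
have uN w : ~ (exists r, k < r /\ M (emb sg w r)) -> u w = m by rewrite /u; case: pselect.
pose Lam' := Lam + t^-1 * (Lam * Lam).
have L'0 : 0 <= Lam' by rewrite addr_ge0// mulr_ge0 ?mulr_ge0// invr_ge0 ltW.
have reg w0 : locreg alpha Lam' u w0 (d / 4).
  have [[z [Mz hz wz]]|nz] := pselect (exists z, [/\ M z, ht sg z = h & `|w0 - hproj z| < d / 2]).
    have [v [lv Mv hv]] := hg z Mz hz.
    apply: (@locreg_ext _ _ (fun w => ramp m t (v w))); last first.
      by apply: locreg_ramp => //; [lra|apply: locreg_sub lv => //; lra].
    move=> w ww0; have wz' : `|w - hproj z| < d.
      rewrite (_ : w - hproj z = (w - w0) + (w0 - hproj z)); last by rewrite addrA subrK.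
      by apply: le_lt_trans (ler_normD _ _) _; lra.
    have Mw := Mv w (lt_le_trans wz' dd1).
    have [kv|kv] := ltP k (v w); first exact: uM.
    rewrite ramp_low//; last by rewrite /m /t; lra.
    apply: uN => -[r [kr Mr]]; have kd : h - d <= k by rewrite !le_max lexx !orbT.
    have := hv _ (inball z (emb sg w r) hz ltac:(by rewrite hproj_emb) ltac:(by rewrite ht_emb; lra) Mr) Mr.
    by rewrite ht_emb hproj_emb => e1; move: kr; rewrite e1 ltNge kv.
  apply: (@locreg_ext _ _ (cst m)); last exact: locreg_cst.
  move=> w ww0; apply: uN => -[r [kr Mr]]; apply: nz.
  have [z [Mz hz xz _]] := near _ Mr ltac:(by rewrite ht_emb); exists z; split=> //.
  have := norm_hproj (emb sg w r - z); rewrite hprojB hproj_emb => h3.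
  rewrite (_ : w0 - hproj z = (w0 - w) + (w - hproj z)); last by rewrite addrA subrK.
  apply: le_lt_trans (ler_normD _ _) _; rewrite distrC; lra.
have [C1u [C C0 [bu hu]]] := locreg_global L'0 d40 reg.
have [R0 hR0] : exists R0 : R, forall x, M x -> `|x| <= R0.
  apply: (@compact_ind R V M (fun B => exists R0 : R, forall x, B x -> `|x| <= R0) cM).
  - by exists 0.
  - move=> B B' [r hr] [r' hr']; exists (Num.max r r') => x [/hr|/hr'] hx; rewrite le_max hx ?orbT//.
  - by move=> B B' BB [r hr]; exists r => x /BB/hr.
  move=> z _; exists 1 => //; exists (`|z| + 1) => x [_ xz].
  rewrite -[x](subrK z) addrC; apply: le_trans (ler_normD _ _) _; lra.
exists u, (m + t), C, R0; split=> //.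
- by rewrite /m /t; apply/andP; split; lra.
- split=> w; last first.
    move=> Rw; rewrite uN ?lerDl ?ltW// => -[r [_ Mr]].
    have := le_trans (norm_hproj _) (hR0 _ Mr); rewrite hproj_emb => h1.
    by move: Rw; rewrite ltNge h1.
  have [[r [kr Mr]]|nr] := pselect (exists r, k < r /\ M (emb sg w r)); last first.
    by rewrite (uN _ nr) /m; lra.
  rewrite (uM _ _ kr Mr); have := M_le Mr; rewrite ht_emb => rh.
  have [r1|r1] := leP r (m + t); last by rewrite ramp_high// ltW.
  by apply: le_trans (ramp_mid t0 r1) _; rewrite /m /t; lra.
move=> x kx; have kx' : k < ht sg x by move: kx; rewrite /m /t; lra.
split=> [Mx|xu].
  by rewrite (uM _ (ht sg x)) ?emb_hproj// ramp_high// ltW.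
have [[r [kr Mr]]|nr] := pselect (exists r, k < r /\ M (emb sg (hproj x) r)); last first.
  by move: kx; rewrite xu (uN _ nr) => ?; exfalso; lra.
have xr := uM _ _ kr Mr; rewrite xr in xu.
have [r1|r1] := leP r (m + t).
  by have := ramp_mid t0 r1; move: kx; rewrite xu ltNge => /negbTE ->.
by rewrite -(emb_hproj sg x) xu ramp_high// ltW.
Qed.

End global_graph.

(** * Lowering the top decreases the area *)
Section graph_normal.
Context {R : realType} {n : nat}.
Local Notation W := 'rV[R]_n.+1.
Local Notation V := 'rV[R]_n.+2.

(** The coordinate curves of the graph of u lie in M, so a normal field is
orthogonal to their velocities and proportional to (-Du, 1). *)
Lemma graph_normal (sg : bool) (M : set V) (u : W -> R) (k : R) nu z :
  Ck 1 [set: W] u -> (forall x, k < ht sg x -> (M x <-> ht sg x = u (hproj x))) ->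
  unit_normal_field M nu -> M z -> k < ht sg z ->
  nu z = ht sg (nu z) *: emb sg (\row_i - 'D_(delta_mx 0 i) u (hproj z)) 1 /\ ht sg (nu z) != 0.
Proof.
move=> C1u gM [_ nu1 nuT] Mz kz; have zu : ht sg z = u (hproj z) by apply/gM.
have du w : differentiable u w by case: C1u => hd _; exact: hd.
have tan j : inward_velocity M z (emb sg (delta_mx 0 j) ('D_(delta_mx 0 j) u (hproj z))).
  set e := delta_mx 0 j; pose a (t : R) : W := hproj z + t *: e.
  have a0 : a 0 = hproj z by rewrite /a scale0r addr0.
  have da : is_diff (0 : R) a (fun r => r *: e).
    have hd := is_diffD (is_diff_cst (hproj z) (0 : R)) (is_diff_scalel (0 : R) e).
    by apply: is_diff_eq hd _; apply/funext => r; rewrite !fctE add0r.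
  have dua : is_diff (0 : R) (fun t => u (a t)) ( *%R ('D_e u (hproj z))).
    have dd : derivable u (hproj z + (0 : R) *: e) e by exact: diff_derivable.
    apply: is_derive_diff; have := is_derive_line dd.
    by rewrite scale0r addr0.
  exists (fun t => emb sg (a t) (u (a t))); split.
  - by rewrite a0 -zu emb_hproj.
  - have hd := is_diff_comp (is_diff_pair da dua) (is_diff_embp sg _).
    have hd' := hd : is_diff (0 : R) (fun t => emb sg (a t) (u (a t))) _.
    apply: DeriveDef; first by apply: diff_derivable; case: hd'.
    rewrite deriveE; last by case: hd'.
    by rewrite (is_diff_valE hd') /= /embp /= scale1r mulr1.
  have cua : {for (0 : R), continuous (fun t => u (a t))} by apply: differentiable_continuous; case: dua.
  have pc : 0 < u (hproj z) - k by rewrite -zu subr_gt0.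
  have [r r0 hr] := (continuous_normedP _ _).1 cua _ pc.
  near=> t; apply/gM; rewrite ht_emb ?hproj_emb//.
  have t0 : 0 < t by [].
  have tr : t < r by near: t; exact: nbhs_right_lt.
  have : `|t - 0| < r by rewrite subr0 gtr0_norm.
  by move=> /hr; rewrite a0 ltr_norml => /andP[]; lra.
have nuE : hproj (nu z) = ht sg (nu z) *: \row_i - 'D_(delta_mx 0 i) u (hproj z).
  apply/rowP => j; have := nuT z _ Mz (or_introl (tan j)).
  rewrite -{1}(emb_hproj sg (nu z)) dot_emb /dot (bigD1 j)//= big1 => [|i ij].
    rewrite addr0 [X in X * _ + _]mxE !eqxx mul1r => h.
    by rewrite [RHS]mxE [X in _ = _ * X]mxE mulrN mulrC; apply/eqP; rewrite -addr_eq0 h.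
  by rewrite [X in X * _]mxE (negbTE ij) andbF mul0r.
split.
  by rewrite -[LHS](emb_hproj sg) nuE -embZ mulr1.
apply/eqP => h0; have := nu1 z Mz; rewrite -(emb_hproj sg (nu z)) nuE h0 scale0r /enorm dot_emb.
rewrite /dot big1 ?mulr0 ?addr0 ?sqrtr0; last by move=> i _; rewrite mxE mul0r.
by move/esym/eqP; rewrite oner_eq0.
Unshelve. all: by end_near. Qed.

End graph_normal.

Lemma half_drop {R : realType} (a b d : R) :
  - (d / 2) <= a - b -> a <= b - d -> 0 < d -> False.
Proof. by move=> *; lra. Qed.

Section lowering.
Context {R : realType} {n : nat}.
Local Notation W := 'rV[R]_n.+1.
Local Notation V := 'rV[R]_n.+2.
Local Notation mu := (@lebesgue_tuple R).
Variables (sg : bool) (alpha : R) (M Omega : set V) (u : W -> R) (h k C R0 : R).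
Hypotheses (alpha0 : 0 < alpha) (alpha1 : alpha <= 1) (kh : k < h) (C0 : 0 <= C).
Hypothesis C1u : Ck 1 [set: W] u.
Hypothesis Du_bound : forall w eta, `|'D_eta u w| <= C * `|eta|.
Hypothesis Du_holder : forall w w' eta,
  `|'D_eta u w - 'D_eta u w'| <= C * `|w - w'| `^ alpha * `|eta|.
Hypothesis u_le : forall w, u w <= h.
Hypothesis u_far : forall w, R0 < `|w| -> u w <= k.
Hypothesis M_graph : forall x, k < ht sg x -> (M x <-> ht sg x = u (hproj x)).

(** The levels k < c0 < k1 < h: M is a graph above k, and the deformation only
moves points above k1; the margin between k and c0 absorbs the horizontal
motion. *)
Let c0 := k + (h - k) / 3.
Let k1 := k + (h - k) * 2 / 3.
Let T := h - k1.
Let g := bump k1 T.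
(** A common bound for g, its derivative, and the Lipschitz constant of the
latter. *)
Let CC := 72 * T ^+ 2 + 48 * T + 16.

Let T0 : 0 < T. Proof. by have := kh; rewrite /T /k1; lra. Qed.
Let kc0 : k < c0. Proof. by have := kh; rewrite /c0; lra. Qed.
Let c0k1 : c0 < k1. Proof. by have := kh; rewrite /c0 /k1; lra. Qed.
Let T2 : 0 < T ^+ 2. Proof. by rewrite exprn_gt0. Qed.

Let g_derive (r : R) : is_derive r (1 : R) g (dbump k1 T r). Proof. exact: bump_derive. Qed.
Let g_bound r : `|g r| <= CC.
Proof. by apply: le_trans (bump_bound k1 r T0) _; rewrite /CC; have := T0; have := T2; lra. Qed.
Let g'_bound r : `|dbump k1 T r| <= CC.
Proof. by apply: le_trans (dbump_bound k1 r T0) _; rewrite /CC; have := T0; have := T2; lra. Qed.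
Let g'_lip r r' : `|dbump k1 T r - dbump k1 T r'| <= CC * `|r - r'|.
Proof. by apply: le_trans (dbump_lip _ _ _ _) _; rewrite ler_wpM2r// /CC; have := T0; have := T2; lra. Qed.

Let e_le j : `|(delta_mx 0 j : W)| <= 1. Proof. exact: norm_e. Qed.
Let D_bound j w : `|'D_(delta_mx 0 j) u w| <= C.
Proof. by apply: le_trans (Du_bound _ _) _; rewrite -[leRHS]mulr1 ler_wpM2l. Qed.
Let D_holder j w w' :
  `|'D_(delta_mx 0 j) u w - 'D_(delta_mx 0 j) u w'| <= C * `|w - w'| `^ alpha.
Proof.
by apply: le_trans (Du_holder _ _ _) _; rewrite -[leRHS]mulr1 ler_wpM2l// mulr_ge0// powR_ge0.
Qed.

Let u_lip w w' : `|u w - u w'| <= C * `|w - w'|.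
Proof.
have [|t _ ->] := @MVT_line _ _ u w' w; last exact: Du_bound.
by move=> t _; case: C1u => hd _; exact: hd.
Qed.

Let p (r : R) := Num.max (r - k1) 0.
Let gE r : r <= h -> g r * g r = p r ^+ 4.
Proof. by move=> rh; rewrite /g bump_low// /T ?subrKC// /sqp -/(p r) -exprD. Qed.
Let g_low r : r <= k1 -> g r = 0.
Proof. by move=> rk; rewrite /g bump_low ?sqp_le0//; have := T0; lra. Qed.
Let pT r : r <= h -> 0 <= p r <= T.
Proof. by move=> rh; rewrite /p le_max lexx orbT ge_max (ltW T0) andbT /T; have := rh; lra. Qed.

Let pow4_le (a b : R) : 0 <= a -> a <= b -> b <= T -> 0 <= b ^+ 4 - a ^+ 4 <= 4 * T ^+ 3 * (b - a).
Proof.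
move=> a0 ab bT; have b0 : 0 <= b by exact: le_trans ab.
have E : b ^+ 4 - a ^+ 4 = (b - a) * ((b + a) * (b ^+ 2 + a ^+ 2)) by ring.
have ba : 0 <= b - a by rewrite subr_ge0.
have q0 : 0 <= (b + a) * (b ^+ 2 + a ^+ 2) by rewrite mulr_ge0 ?addr_ge0 ?exprn_ge0.
rewrite E mulr_ge0//= mulrC ler_wpM2r//.
have bb : b ^+ 2 <= T ^+ 2 by rewrite lerXn2r ?nnegrE// (le_trans b0).
have aa : a ^+ 2 <= T ^+ 2 by rewrite lerXn2r ?nnegrE ?(le_trans ab)// (le_trans b0).
apply: (@le_trans _ _ ((2 * T) * (2 * T ^+ 2))); last by rewrite le_eqVlt; apply/orP; left; apply/eqP; ring.
by apply: ler_pM; rewrite ?addr_ge0 ?exprn_ge0//; lra.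
Qed.

Section time.
Variables (eps K t : R).
Hypotheses (eps0 : 0 < eps) (t0 : 0 < t) (t1 : t <= 1).
Hypothesis K_lip : forall w w', `|shift u g t w - shift u g t w'| <= K * `|w - w'| /\
  `|shift u g t w| <= K * `|t|.
Hypotheses (epsK : eps * K <= 2^-1) (small1 : t * eps * (4 * T ^+ 3) <= 1).
Hypothesis small2 : C * (eps * (K * t)) < c0 - k.

(** The lowering of heights.  For small t * eps it does not increase
differences of heights up to h, and it is strict at the top, since g vanishes up to the level k1 and is increasing
between k1 and h. *)
Definition drop (r : R) : R := r - t * (eps * (g r * g r)).
Let ut w := drop (u w).
Let te : 0 <= t * eps. Proof. by rewrite mulr_ge0// ltW. Qed.

Let drop_low r : r <= k1 -> drop r = r.
Proof. by move=> rk; rewrite /drop (g_low rk) mul0r !mulr0 subr0. Qed.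

Let drop_mono r r' : r' <= r -> r <= h -> drop r' <= drop r /\ drop r - drop r' <= r - r'.
Proof.
move=> rr rh; have r'h := le_trans rr rh; rewrite /drop !gE// !mulrA.
have /andP[p0 _] := pT r'h; have /andP[_ pT'] := pT rh.
have pp : p r' <= p r by rewrite /p ge_max le_max lerB ?lexx//= le_max lexx orbT.
have dp : p r - p r' <= r - r'.
  have := max0_lip (r - k1) (r' - k1); rewrite -/(p r) -/(p r') opprB addrA subrK.
  by rewrite ger0_norm ?subr_ge0// ger0_norm ?subr_ge0.
have /andP[q1 q2] := pow4_le p0 pp pT'.
have m1 : t * eps * (p r ^+ 4 - p r' ^+ 4) <= p r - p r'.
  apply: le_trans (ler_wpM2l te q2) _; rewrite mulrA ler_piMl// subr_ge0//.
have m2 := mulr_ge0 te q1; split; lra.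
Qed.

Let drop_le r : drop r <= r.
Proof. by rewrite /drop gerBl mulr_ge0 ?(ltW t0)// mulr_ge0 ?(ltW eps0)// -expr2 sqr_ge0. Qed.

Let drop_high r : k1 <= r -> r <= h -> k1 <= drop r.
Proof.
move=> kr rh; have [+ _] := drop_mono kr rh.
by rewrite (drop_low (lexx _)).
Qed.

Let ut_low w : u w < k1 -> ut w = u w. Proof. by move=> /ltW; exact: drop_low. Qed.
Let ut_high w : k1 <= u w -> k1 <= ut w <= u w.
Proof. by move=> h1; rewrite drop_high//= drop_le. Qed.

Let near_shift w : `|u (w + eps *: shift u g t w) - u w| < c0 - k.
Proof.
apply: le_lt_trans (u_lip _ _) _; apply: le_lt_trans small2; rewrite ler_wpM2l//.
rewrite addrC addKr normrZ gtr0_norm// ler_wpM2l ?(ltW eps0)//.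
by have [_] := K_lip w w; rewrite (gtr0_norm t0).
Qed.

Let St := flow sg u g eps t @` M.

(** Above k1 the horizontal motion is onto, so the image of the graph of u covers
the whole graph of ut above this level. *)
Lemma flow_image x : St x <->
  (ht sg x < k1 /\ M x) \/ (k1 <= ht sg x /\ ht sg x = ut (hproj x)).
Proof.
have kk1 : k < k1 by exact: lt_trans c0k1.
split.
  move=> [y My <-]; have [yk|yk] := leP (ht sg y) k1.
    rewrite flow_id; last by left; exact: g_low.
    have [yk'|yk'] := ltP (ht sg y) k1; first by left.
    right; split=> //; have yE : ht sg y = k1 by apply/eqP; rewrite eq_le yk.
    have uy : ht sg y = u (hproj y) by apply/M_graph => //; rewrite yE.
    by rewrite /ut -uy drop_low.
  have yu : ht sg y = u (hproj y) by apply/M_graph => //; exact: lt_trans yk.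
  rewrite -(emb_hproj sg y) yu flow_graph /=; set w' := _ + _.
  rewrite ht_emb hproj_emb -/(drop (u w')).
  have kw' : k < u w'.
    have := near_shift (hproj y); rewrite -/w' ltr_norml => /andP[h1 _].
    by move: yk; rewrite yu; have := c0k1; lra.
  have [h1|h1] := ltP (u w') k1.
    left; rewrite drop_low ?(ltW h1)//; split=> //.
    by apply/M_graph; rewrite ht_emb ?hproj_emb.
  by right; split=> //; exact: drop_high.
move=> [[xk Mx]|[kx xE]]; first by exists x => //; rewrite flow_id//; left; exact: g_low (ltW xk).
have ub : k1 <= u (hproj x).
  rewrite leNgt; apply/negP => h1; move: kx; rewrite xE (ut_low h1) leNgt h1//.
have [w wE] := shift_onto (ltW eps0) (fun w w' => (K_lip w w').1) epsK (hproj x).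
have kw : k < u w.
  have := near_shift w; rewrite wE ltr_norml => /andP[_ h1].
  by have := c0k1; lra.
exists (emb sg w (u w)); first by apply/M_graph; rewrite ht_emb ?hproj_emb.
by rewrite flow_graph /= wE -/(drop _) -/(ut _) -xE emb_hproj.
Qed.

Lemma image_low x : ht sg x < k1 -> (M x <-> St x).
Proof.
move=> xk; rewrite flow_image; split=> [Mx|]; first by left.
by move=> [[]//|[]]; rewrite leNgt xk.
Qed.

Lemma image_graph x : c0 < ht sg x -> (St x <-> ht sg x = ut (hproj x)).
Proof.
move=> cx; have kx : k < ht sg x by exact: lt_trans cx.
rewrite flow_image; split.
  move=> [[xk Mx]|[]//]; have xu : ht sg x = u (hproj x) by apply/M_graph.
  by rewrite ut_low -?xu.
move=> xE; have [xk|xk] := ltP (ht sg x) k1; last by right.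
left; split=> //; apply/M_graph => //; rewrite xE ut_low//.
by rewrite ltNge; apply/negP => /ut_high/andP[]; rewrite -xE leNgt xk.
Qed.

Let C1ut : Ck 1 [set: W] ut.
Proof.
apply: C1d_Ck; have h1 := Ck_C1d C1u.
have cg' : continuous (dbump k1 T) by apply: lipschitz_continuous g'_lip.
have h2 := C1d_comp h1 g_derive cg'.
have h3 := C1d_add h1 (C1d_scale (- (t * eps)) (C1d_mul h2 h2)).
have -> : ut = (fun w => u w + - (t * eps) * (g (u w) * g (u w))); last exact: h3.
by apply/funext => w; rewrite /ut /drop mulNr -mulrA.
Qed.

Variables (s : R) (w0 : W) (rb Cb : R).
Hypothesis between_Omega :
  forall x, ut (hproj x) <= ht sg x < u (hproj x) -> k1 <= u (hproj x) -> Omega x.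

Let U := clamp u c0.
Let Ut := clamp ut c0.
Let UtE w : Ut w = drop (U w).
Proof.
rewrite /Ut /U /clamp; have [h1|h1] := ltP (u w) k1.
  rewrite ut_low//; case: leP => h2; rewrite drop_low// ltW//.
have /andP[h2 _] := ut_high h1; have c1 := le_trans (ltW c0k1) h1.
by rewrite (max_idPl c1) (max_idPl (le_trans (ltW c0k1) h2)).
Qed.
Let U_le w : U w <= h.
Proof. by rewrite /U /clamp ge_max u_le /c0; have := kh; lra. Qed.

(** The boxes of radius at most 1 around this base point lie in the region where
u is at most k, so that nothing moves over them. *)
Definition far_point : W := \row_i (`|R0| + 2).

Hypothesis rb1 : 0 < rb <= 1.
Hypothesis box_top : forall w, `|w - w0| <= rb -> k1 + T / 2 <= u w.
Hypothesis gain_box : forall (U' Ut' : W -> R) (del : R),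
    continuous U' -> continuous Ut' -> 0 <= del ->
    (forall w, Ut' w <= U' w) ->
    (forall w w', U' w' <= U' w -> Ut' w' <= Ut' w /\ Ut' w - Ut' w' <= U' w - U' w') ->
    (forall w w' : n.+1.-tuple (measurableTypeR R), box w0 rb w -> box far_point rb w' ->
      k1 - c0 <= Ut' (row_of w) - Ut' (row_of w') /\
      del <= (U' (row_of w) - U' (row_of w')) - (Ut' (row_of w) - Ut' (row_of w'))) ->
    (\int[mu n.+2 \x mu n.+2]_p loss sg s U' Ut' (row_of p.1) (row_of p.2) + (del * Cb)%:E <=
    \int[mu n.+2 \x mu n.+2]_p gain sg s U' Ut' (row_of p.1) (row_of p.2))%E.

(** The difference of heights between a box near the maximum of u and a box
around far_point shrinks by at least t eps (T / 2)^4. *)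
Lemma area_drop :
  (\int[mu n.+2 \x mu n.+2]_p area_density s St Omega p +
     (t * (eps * (T / 2) ^+ 4) * Cb)%:E <=
   \int[mu n.+2 \x mu n.+2]_p area_density s M Omega p)%E.
Proof.
apply: (@area_comparison R n sg s u ut c0 k1) => //.
- by move=> x cx; apply: M_graph; exact: lt_trans cx.
- exact: image_graph.
- exact: image_low.
- move=> x /andP[h1 h2]; have [uk|uk] := ltP (u (hproj x)) k1.
    by move: (le_lt_trans h1 h2); rewrite /clamp ut_low// ltxx.
  have /andP[h3 h4] := ut_high uk; apply: between_Omega => //; move: h1 h2.
  rewrite /clamp (max_idPl (le_trans (ltW c0k1) uk)) (max_idPl (le_trans (ltW c0k1) h3)).
  by move=> -> ->.
apply: gain_box.
- exact: clamp_continuous.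
- exact: clamp_continuous.
- by rewrite mulr_ge0 ?(ltW t0)// mulr_ge0 ?(ltW eps0)// exprn_ge0// divr_ge0// ltW.
- by move=> w; rewrite -/(Ut w) -/(U w) UtE.
- by move=> w w'; rewrite -/(Ut w) -/(Ut w') -/(U w) -/(U w') !UtE => h1; exact: drop_mono.
move=> w w' hw hw'; rewrite -/(Ut _) -/(Ut (row_of w')) -/(U _) -/(U (row_of w')).
have near_box (z : W) v : box z rb v -> `|row_of v - z| <= rb.
  move=> hv; apply: norm_rV_le => [|i]; first by case/andP: rb1 => /ltW.
  by rewrite !mxE; have := hv i; rewrite !mxE.
have uw := box_top (near_box _ _ hw).
have far : u (row_of w') <= k.
  apply: u_far; apply: lt_le_trans (norm_coord _ ord0).
  have := norm_coord (row_of w' - far_point) ord0; have := near_box _ _ hw'.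
  rewrite !mxE => h1 h2; have h3 : `|tnth w' ord0 - (`|R0| + 2)| <= rb by exact: le_trans h1.
  apply: lt_le_trans (ler_norm _); move: h3; rewrite ler_norml => /andP[h3 _].
  have := ler_norm R0; case/andP: rb1 => _; lra.
have U0 : U (row_of w') = c0 by rewrite /U /clamp; apply/max_idPr; exact: le_trans (ltW kc0).
have c0l : drop c0 = c0 by apply: drop_low; exact: ltW.
have TT := T0; have ckk := c0k1.
have Uw : U (row_of w) = u (row_of w) by rewrite /U /clamp; apply/max_idPl; lra.
rewrite !UtE U0 c0l Uw; split.
  have : k1 <= drop (u (row_of w)) by apply: drop_high => //; lra.
  lra.
rewrite /drop gE//.
have pw : T / 2 <= p (u (row_of w)) by rewrite /p le_max; apply/orP; left; lra.
have p4 : (T / 2) ^+ 4 <= p (u (row_of w)) ^+ 4.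
  by rewrite lerXn2r ?nnegrE ?divr_ge0 ?(ltW TT)//; case/andP: (pT (u_le (row_of w))).
have := ler_wpM2l te p4; rewrite -!mulrA; lra.
Qed.

End time.

(** The flow is an admissible normal variation, and the area along it decreases
at least linearly in t > 0, so its derivative at 0 cannot vanish.  Finiteness
of the area is used to pass to real values. *)
Lemma not_critical (c s Cc : R) nu : 0 < c -> 0 < s < 1 -> 0 < k -> compact M ->
  covered M Cc -> open Omega -> (exists2 Bo : R, 0 <= Bo & forall x, Omega x -> `|x| <= Bo) ->
  M `<=` Omega -> (forall z, boundary_point alpha M z -> ht sg z <= 0) ->
  unit_normal_field M nu -> (exists w, u w = h) -> ~ critical_point c s alpha Omega M.
Proof.
move=> cp s01 k0 cM cov oO [Bo Bo0 hBo] MO bd hnu [w1 uw1] crit.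
have TT := T0; have kcc := kc0; have ckk := c0k1; have khh := kh.
have [K K0 hK] := shift_lipschitz sg alpha0 alpha1 C0 C1u D_bound D_holder g_derive g_bound g'_bound g'_lip.
pose eps := (2 * (K + 1))^-1.
have K1 : 0 < K + 1 by rewrite ltr_wpDl.
have eps0 : 0 < eps by rewrite invr_gt0 mulr_gt0.
have epsK : eps * K <= 2^-1.
  by rewrite /eps invfM -mulrA ler_piMr// mulrC ler_pdivrMr// mul1r lerDl.
pose Phi := flow sg u g eps.
pose phi z := - rho sg u g eps z / slope_norm u 0 (hproj z) / ht sg (nu z).
have var : normal_variation alpha M nu phi Phi.
  have [ck [L' hol]] := flow_regular sg alpha0 alpha1 C0 C1u D_bound D_holder g_derive g_bound g'_bound g'_lip eps.
  split=> //; first exact: flow0.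
  - by exists L'; apply/nbhs_normedP; exists 1 => // t; rewrite subr0 => /ltW; exact: hol.
  - exists [set x | [/\ k1 <= ht sg x, ht sg x <= k1 + 3 * T & `|hproj x| <= R0] ]; split.
    + apply: bounded_closed_compact.
        exists (Num.max `|R0| (`|k1| + `|k1 + 3 * T|)); split; first exact: num_real.
        move=> N hN x /= [h1 h2 h3]; rewrite -(emb_hproj sg x).
        apply: le_trans (norm_emb _ _ _) _; rewrite ge_max; move: hN; rewrite gt_max => /andP[h4 h5].
        apply/andP; split; first by apply: le_trans h3 (le_trans (ler_norm _) (ltW h4)).
        apply: le_trans (ltW h5); have q1 := ler_norm (k1 + 3 * T); have q2 := ler_norm (- k1).
        rewrite normrN in q2; have q3 := normr_ge0 k1; have q4 := normr_ge0 (k1 + 3 * T).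
        by rewrite ler_norml; apply/andP; split; lra.
      rewrite (_ : [set x | _] = [set x | k1 <= ht sg x] `&` [set x | ht sg x <= k1 + 3 * T] `&`
          [set x | `|hproj x| <= R0]); last by apply/seteqP; split=> x /=; [case|case; case].
      have ch := @continuous_ht R n sg.
      have cn : continuous (fun x : V => `|hproj x|).
        move=> x; apply: (@continuous_comp V W R (@hproj R n) (fun w => `|w|) x).
          exact: continuous_hproj.
        exact: norm_continuous.
      apply: closedI; first apply: closedI.
      * exact: (closed_comp (fun x _ => ch x) (@closed_ge R k1)).
      * exact: (closed_comp (fun x _ => ch x) (@closed_le R (k1 + 3 * T))).
      * exact: (closed_comp (fun x _ => cn x) (@closed_le R R0)).
    + apply/seteqP; split=> // x [/= [h1 _ _]] /bd h2.
      have h3 : k1 <= 0 by exact: le_trans h1 h2.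
      by exfalso; lra.
    + move=> t x nK; apply: flow_id.
      have [h1|h1] := leP (ht sg x) k1; first by left; exact: g_low.
      have [h2|h2] := leP (k1 + 3 * T) (ht sg x); first by left; exact: bump_high.
      have [h3|h3] := leP `|hproj x| R0; last by right; apply: g_low; apply: le_trans (u_far h3) _; lra.
      by exfalso; apply: nK; split=> //; exact: ltW.
  - move=> z Mz; have := flow_velocity sg alpha0 C0 C1u D_bound D_holder g_derive eps z.
    rewrite (_ : _ *: _ = phi z *: nu z)//.
    have [zk|zk] := leP (ht sg z) k1.
      have r0 : rho sg u g eps z = 0 by rewrite /rho (g_low zk) mul0r mulr0.
      by rewrite /phi r0 oppr0 !mul0r !scale0r.
    have kz : k < ht sg z by lra.
    have [nE n0] := graph_normal C1u M_graph hnu Mz kz.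
    by rewrite [X in _ = _ *: X]nE /phi scalerA divfK.
have dA := crit nu phi Phi hnu var.
have cu : continuous u by exact: Ck1_continuous.
have T20 : 0 < T / 2 by rewrite divr_gt0.
have [d d0 hd] := (continuous_normedP _ _).1 (cu w1) _ T20.
pose rb := Num.min (d / 2) 1.
have rb0 : 0 < rb by rewrite lt_min divr_gt0//= ltr01.
have rb1 : 0 < rb <= 1 by rewrite rb0 ge_min lexx orbT.
have btop w : `|w - w1| <= rb -> k1 + T / 2 <= u w.
  rewrite le_min => /andP[h1 _]; have : `|w - w1| < d by lra.
  by move=> /hd; rewrite uw1 ltr_norml => /andP[h2 _]; move: h2; rewrite /T; lra.
have eta0 : 0 < k1 - c0 by lra.
have s0 : 0 <= s by case/andP: s01 => /ltW.
have [Cb Cb0 hgain] := @integral_loss_gain R n sg s w1 far_point rb (k1 - c0) rb0 eta0 s0.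
have [dO dO0 hdO] : exists2 dO : R, 0 < dO & forall m x, M m -> `|x - m| < dO -> Omega x.
  apply: (@compact_ind R V M (fun B => exists2 dO : R, 0 < dO & forall m x, B m -> `|x - m| < dO -> Omega x) cM).
  - by exists 1.
  - move=> B B' [d1 d10 h1] [d2 d20 h2]; exists (Num.min d1 d2); first by rewrite lt_min d10.
    by move=> m x [Bm|Bm]; rewrite lt_min => /andP[q1 q2]; [exact: h1 Bm q1|exact: h2 Bm q2].
  - by move=> B B' BB [d1 d10 h1]; exists d1 => // m x /BB; exact: h1.
  move=> z Mz; have [d1 d10 h1] := (open_normedP _).1 oO z (MO z Mz).
  have d20 : 0 < d1 / 2 by rewrite divr_gt0.
  exists (d1 / 2) => //; exists (d1 / 2) => // m x [_ mz] xm; apply: h1.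
  rewrite (_ : x - z = (x - m) + (m - z)); last by rewrite addrA subrK.
  by apply: le_lt_trans (ler_normD _ _) _; lra.
pose kap := c * (eps * (T / 2) ^+ 4 * Cb).
have kap0 : 0 < kap by rewrite !mulr_gt0// exprn_gt0.
pose A t := fine (fractional_area c s (Phi t @` M) Omega).
have T3 : 0 < T ^+ 3 by rewrite exprn_gt0.
have T4 : 0 < T ^+ 4 by rewrite exprn_gt0.
have decr t : 0 < t -> t <= 1 -> t * eps * (4 * T ^+ 3) <= 1 -> C * (eps * (K * t)) < c0 - k ->
    t * eps * T ^+ 4 < dO -> A t <= A 0 - kap * t.
  move=> t0 t1 sm1 sm2 sm3.
  have tK w w' := hK t ltac:(by rewrite gtr0_norm) w w'.
  have bO x : drop eps t (u (hproj x)) <= ht sg x < u (hproj x) -> k1 <= u (hproj x) -> Omega x.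
    move=> /andP[h1 h2] h3; apply: (hdO (emb sg (hproj x) (u (hproj x)))).
      by apply/M_graph; rewrite ht_emb ?hproj_emb//; lra.
    rewrite -{1}(emb_hproj sg x) -embB subrr; apply: le_lt_trans sm3.
    apply: le_trans (norm_emb _ _ _) _; rewrite ge_max normr0 !mulr_ge0 ?exprn_ge0 ?(ltW t0) ?(ltW eps0) ?(ltW TT)//=.
    rewrite ltr0_norm ?subr_lt0// opprB; move: h1; rewrite /drop gE// => h1.
    have /andP[p0 pT'] := pT (u_le (hproj x)).
    have h4 : p (u (hproj x)) ^+ 4 <= T ^+ 4 by rewrite lerXn2r ?nnegrE// ltW.
    have := ler_wpM2l (ltac:(by rewrite mulr_ge0 ?(ltW t0) ?(ltW eps0)) : 0 <= t * eps) h4.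
    by rewrite -!mulrA in h1 *; lra.
  have := area_drop eps0 t0 tK epsK sm1 sm2 bO rb1 btop hgain.
  have P0 : Phi 0 @` M = M.
    by apply/seteqP; split=> [x [y My <-]|x Mx]; [rewrite /Phi flow0|exists x => //; exact: flow0].
  rewrite /A P0 !fractional_areaE.
  have fM := area_density_finite s01 cov Bo0 hBo.
  set X := (\int[_]_p area_density s (Phi t @` M) Omega p)%E.
  set Y := (\int[_]_p area_density s M Omega p)%E in fM *.
  have X0 : (0 <= X)%E by apply: integral_ge0 => q _; exact: area_density_ge0.
  have Y0 : (0 <= Y)%E by apply: integral_ge0 => q _; exact: area_density_ge0.
  have e0 : 0 <= t * (eps * (T / 2) ^+ 4) * Cb.
    apply: mulr_ge0; last exact: ltW.
    apply: mulr_ge0; first exact: ltW.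
    by apply: mulr_ge0; [exact: ltW|apply: exprn_ge0; exact: ltW].
  move: X0 Y0 fM; rewrite -/X; case: X => [x| |] //; case: Y => [y| |] //= _ _ _.
  rewrite -EFinD lee_fin => hxy; rewrite /kap.
  have := ler_wpM2l (ltW cp) hxy; rewrite mulrDr.
  by rewrite (_ : c * (t * (eps * (T / 2) ^+ 4) * Cb) = c * (eps * (T / 2) ^+ 4 * Cb) * t); [lra|ring].
have dfA : differentiable A (0 : R) by apply/derivable1_diffP; case: dA.
have cl : continuous ('d A (0 : R)) by exact: diff_continuous.
have kap20 : 0 < kap / 2 by rewrite divr_gt0.
have [r r0 hr] := (is_diff_normedP _ _ cl).1 (differentiableP dfA) _ kap20.
pose e1 := (eps * (4 * T ^+ 3))^-1; pose e2 := (c0 - k) / (C * (eps * K) + 1).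
pose e3 := dO / (eps * T ^+ 4).
have q1 : 0 < eps * (4 * T ^+ 3) by rewrite !mulr_gt0.
have q2 : 0 < C * (eps * K) + 1 by rewrite ltr_wpDl// !mulr_ge0// ltW.
have q3 : 0 < eps * T ^+ 4 by rewrite mulr_gt0.
have e10 : 0 < e1 by rewrite invr_gt0.
have e20 : 0 < e2 by rewrite divr_gt0//; lra.
have e30 : 0 < e3 by rewrite divr_gt0.
pose t := Num.min (Num.min r 1) (Num.min e1 (Num.min e2 e3)) / 2.
have m0 : 0 < Num.min (Num.min r 1) (Num.min e1 (Num.min e2 e3)) by rewrite !lt_min r0 ltr01 e10 e20.
have t0 : 0 < t by rewrite divr_gt0.
have : t < Num.min (Num.min r 1) (Num.min e1 (Num.min e2 e3)) by rewrite /t; lra.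
rewrite !lt_min => /andP[/andP[tr t1] /andP[te1 /andP[te2 te3]]].
have At : A t <= A 0 - kap * t.
  apply: decr => //; first exact: ltW.
  - by rewrite -mulrA -ler_pdivlMr// mul1r ltW.
  - move: te2; rewrite /e2 ltr_pdivlMr// mulrDr mulr1 => h2.
    by rewrite (_ : C * (eps * (K * t)) = t * (C * (eps * K))); [lra|ring].
  - by rewrite -mulrA -ltr_pdivlMr.
have := hr t; rewrite subr0 gtr0_norm// => /(_ tr).
have -> : 'd A (0 : R) t = 0.
  have -> : t = t *: (1 : R) by rewrite /GRing.scale/= mulr1.
  by rewrite linearZ/= -deriveE//; case: dA => _ ->; rewrite scaler0.
rewrite subr0 ler_norml => /andP[h1 _].
have kt : 0 < kap * t by rewrite mulr_gt0.
by rewrite (mulrAC kap) in h1; exact: (half_drop h1 At kt).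
Qed.

End lowering.

(** * Flat hypersurfaces *)
Section local_constancy.
Context {R : realType} {V : normedModType R}.

Lemma locally_constant_unit (Q : R -> Prop) :
  (forall t, 0 <= t <= 1 -> exists2 r : R, 0 < r &
    forall s, 0 <= s <= 1 -> `|s - t| < r -> (Q s <-> Q t)) -> Q 0 -> Q 1.
Proof.
move=> loc Q0; pose S := [set t | 0 <= t <= 1 /\ Q t].
have S0 : S 0 by split=> //; rewrite lexx ler01.
have ubS : has_ubound S by exists 1 => t [/andP[]].
have s01 : 0 <= sup S <= 1.
  apply/andP; split; first exact: ub_le_sup.
  by apply: sup_le_ub => [|t [/andP[]]//]; exists 0.
have [r r0 hr] := loc _ s01.
have [t [t01 Qt] ts] := sup_adherent r0 (conj (ex_intro _ 0 S0) ubS).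
have ts' : t <= sup S by apply: ub_le_sup.
have Qs : Q (sup S) by apply/(hr t t01) => //; rewrite ltr_norml; apply/andP; split; lra.
have [<-//|s1] := eqVneq (sup S) 1; exfalso.
have s1' : sup S < 1 by rewrite lt_neqAle s1; case/andP: s01.
pose t' := Num.min 1 (sup S + r / 2).
have st' : sup S < t' by rewrite lt_min s1' ltrDl divr_gt0.
have t'1 : t' <= 1 by rewrite ge_min lexx.
have t'r : t' <= sup S + r / 2 by rewrite ge_min lexx orbT.
have t'01 : 0 <= t' <= 1 by rewrite t'1 andbT; case/andP: s01 => h _; lra.
have : t' <= sup S.
  apply: ub_le_sup => //; split=> //; apply/(hr t' t'01) => //.
  by rewrite ltr_norml; apply/andP; split; lra.
by rewrite leNgt st'.
Qed.

Lemma locally_constant_segment (P : V -> Prop) (x y : V) :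
  (forall t : R, 0 <= t <= 1 -> exists2 r : R, 0 < r &
    forall p, `|p - (x + t *: (y - x))| < r -> (P p <-> P (x + t *: (y - x)))) -> P x -> P y.
Proof.
move=> loc Px; have [->//|xy] := eqVneq y x.
have n0 : 0 < `|y - x| by rewrite normr_gt0 subr_eq0.
have := @locally_constant_unit (fun t => P (x + t *: (y - x))).
rewrite scale0r addr0 scale1r (addrC x) subrK; apply=> // t t01.
have [r r0 hr] := loc t t01; exists (r / `|y - x|); first by rewrite divr_gt0.
move=> s _ st; apply: hr; rewrite opprD addrACA subrr add0r -scalerBl normrZ.
by rewrite -ltr_pdivlMr.
Qed.

(** A superlevel set of a function that increases along v is connected near z:
both points are first pushed along v, away from the zero set of f, and then
joined by a segment on which f is positive. *)
Lemma locally_constant_side (P : V -> Prop) (f : V -> R) (z v : V) (b B r1 rho : R) :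
  0 < b -> 0 <= B -> 0 < rho -> rho * (1 + (B + 1) / b * `|v|) < r1 ->
  (forall p (t : R), `|p - z| < r1 -> `|p + t *: v - z| < r1 -> 0 <= t ->
    f p + b * t <= f (p + t *: v)) ->
  (forall p, `|p - z| < r1 -> - (B * `|p - z|) <= f p) ->
  (forall p, `|p - z| < r1 -> 0 < f p -> exists2 r : R, 0 < r &
    forall p', `|p' - p| < r -> (P p' <-> P p)) ->
  forall w1 w2, `|w1 - z| < rho -> `|w2 - z| < rho -> 0 < f w1 -> 0 < f w2 -> P w1 -> P w2.
Proof.
move=> b0 B0 rho0 hrho mono low loc w1 w2 h1 h2 f1 f2.
pose s := (B + 1) / b * rho; have B1 : 0 < B + 1 by rewrite ltr_wpDl.
have s0 : 0 < s by rewrite mulr_gt0// divr_gt0.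
have inb p t : `|p - z| < rho -> 0 <= t <= s -> `|p + t *: v - z| < r1.
  move=> hp /andP[t0 ts]; rewrite addrAC; apply: le_lt_trans (ler_normD _ _) _.
  rewrite normrZ (ger0_norm t0); apply: le_lt_trans hrho; rewrite mulrDr mulr1.
  apply: lerD; first exact: ltW.
  rewrite mulrA [rho * _]mulrC -/s; exact: ler_wpM2r.
have inb0 p : `|p - z| < rho -> `|p - z| < r1.
  by move=> hp; have := inb p 0 hp; rewrite scale0r addr0 lexx (ltW s0); apply.
have up p t : `|p - z| < rho -> 0 <= t <= s -> 0 < f p -> 0 < f (p + t *: v).
  move=> hp ts fp; have := mono p t (inb0 _ hp) (inb _ _ hp ts).
  case/andP: ts => t0 _ /(_ t0); have := mulr_ge0 (ltW b0) t0; lra.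
have top p : `|p - z| < rho -> 0 < f (p + s *: v).
  move=> hp; have ss : 0 <= s <= s by rewrite lexx ltW.
  have := mono p s (inb0 _ hp) (inb _ _ hp ss) (ltW s0).
  have := low p (inb0 _ hp); have : B * `|p - z| <= B * rho by rewrite ler_wpM2l// ltW.
  have -> : b * s = (B + 1) * rho by rewrite /s; field; rewrite gt_eqF.
  by rewrite mulrDl mul1r; lra.
have seg p q : (forall t : R, 0 <= t <= 1 -> `|p + t *: (q - p) - z| < r1 /\ 0 < f (p + t *: (q - p))) -> P p -> P q.
  by move=> hpq; apply: locally_constant_segment => t /hpq[q1 q2]; exact: loc.
have ts (t : R) : 0 <= t <= 1 -> 0 <= t * s <= s.
  by move=> /andP[t0 t1]; rewrite mulr_ge0 ?(ltW s0)//= ler_piMl// ltW.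
move=> P1; have P1s : P (w1 + s *: v).
  apply: (seg w1) P1 => t t01.
  have -> : w1 + s *: v - w1 = s *: v by rewrite addrC addKr.
  rewrite scalerA.
  by split; [exact: inb (ts _ t01)|exact: up (ts _ t01) _].
have P2s : P (w2 + s *: v).
  apply: (seg (w1 + s *: v)) P1s => t t01.
  have -> : w1 + s *: v + t *: (w2 + s *: v - (w1 + s *: v)) = (w1 + t *: (w2 - w1)) + s *: v.
    by rewrite opprD addrACA subrr addr0 addrAC.
  have hp := ball_segment t01 h1 h2; split; last exact: top.
  by apply: inb => //; rewrite lexx ltW.
apply: (seg (w2 + s *: v)) P2s => t t01.
have -> : w2 + s *: v + t *: (w2 - (w2 + s *: v)) = w2 + ((1 - t) * s) *: v.
  rewrite opprD addNKr scalerN scalerA -addrA -scalerBl mulrBl mul1r//.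
have t01' : 0 <= 1 - t <= 1 by case/andP: t01 => ? ?; apply/andP; split; lra.
by split; [exact: inb (ts _ t01')|exact: up (ts _ t01') _].
Qed.

End local_constancy.

Section boundary_charts.
Context {R : realType} {n : nat}.
Local Notation W := 'rV[R]_n.+1.
Local Notation V := 'rV[R]_n.+2.
Variables (alpha : R) (M : set V) (z : V).
Hypothesis bz : boundary_point alpha M z.

(** In a boundary chart, the points whose first coordinate is positive are
interior ones; moving psi z along the first coordinate yields such points
arbitrarily close to z. *)
Lemma boundary_has_interior (r : R) : 0 < r ->
  exists y, [/\ M y, `|y - z| < r & interior_point alpha M y].
Proof.
move=> r0; have [A [B [psi [[oA oB psiAB [C1psi hpsi] [theta [thK [C1th hth]]]] Az Mz z0 MA]]]] := bz.
have thB b : B b -> A (theta b) /\ psi (theta b) = b.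
  by rewrite -psiAB => -[p Ap <-]; rewrite thK.
set q := psi z; have Bq : B q by rewrite -psiAB; exists z.
have [qN _] := (MA z Az).1 Mz.
have cth : {for q, continuous theta} by apply: differentiable_continuous; case: C1th => hd _; exact: hd.
have [d1 d10 hd1] := (continuous_normedP _ _).1 cth r r0.
have [d2 d20 hd2] := (open_normedP _).1 oB q Bq.
pose t := Num.min d1 d2 / 2; have m0 : 0 < Num.min d1 d2 by rewrite lt_min d10.
have t0 : 0 < t by rewrite divr_gt0.
pose y' : V := q + t *: delta_mx 0 ord0.
have y'q : `|y' - q| < Num.min d1 d2.
  rewrite /y' addrC addKr normrZ gtr0_norm//; apply: le_lt_trans (_ : t * 1 < _); last by rewrite mulr1 /t; lra.
  rewrite ler_wpM2l ?(ltW t0)//; apply: norm_rV_le => // i; rewrite mxE eqxx /=.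
  by case: (_ == _); rewrite ?normr1// normr0.
move: y'q; rewrite lt_min => /andP[/hd1 h1 /hd2 By'].
have [Ay ypsi] := thB _ By'.
have y0 : y' 0 ord0 = t by rewrite !mxE -/q z0 eqxx mulr1 add0r.
have yN : y' 0 ord_max = 0 by rewrite !mxE qN /= mulr0 addr0.
exists (theta y'); split.
- by apply/MA => //; rewrite ypsi yN y0; split=> //; exact: ltW.
- by rewrite thK in h1.
exists (A `&` [set p | 0 < psi p 0 ord0]), (B `&` [set p : V | 0 < p 0 ord0]), psi; split=> //.
- split.
  + apply/open_normedP => p [Ap /= p0]; have [d d0 hd] := (open_normedP _).1 oA p Ap.
    have cp : {for p, continuous psi} by apply: differentiable_continuous; case: C1psi => hd' _; exact: hd'.
    have [d' d'0 hd'] := (continuous_normedP _ _).1 cp _ p0.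
    exists (Num.min d d'); first by rewrite lt_min d0.
    move=> x; rewrite lt_min => /andP[/hd Ax /hd' hx]; split=> //=.
    have := norm_coord (psi x - psi p) ord0; rewrite !mxE => /le_lt_trans/(_ hx).
    by rewrite ltr_norml => /andP[]; lra.
  + apply/open_normedP => p [Bp /= p0]; have [d d0 hd] := (open_normedP _).1 oB p Bp.
    exists (Num.min d (p 0 ord0)); first by rewrite lt_min d0.
    move=> x; rewrite lt_min => /andP[/hd Bx hx]; split=> //=.
    have := norm_coord (x - p) ord0; rewrite !mxE => /le_lt_trans/(_ hx).
    by rewrite ltr_norml => /andP[]; lra.
  + apply/seteqP; split=> p; first by move=> [x [Ax /= x0] <-]; split=> //; rewrite -psiAB; exists x.
    by move=> [Bp /= p0]; have [Atp tp] := thB p Bp; exists (theta p); rewrite ?tp//; split=> //=; rewrite tp.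
  + split; first by case: C1psi => hd hc; split=> [x [Ax _]|v x [Ax _]]; [exact: hd|exact: hc].
    by case: hpsi => L hL; exists L => x y v [Ax _] [Ay' _]; exact: hL.
  exists theta; split; first by move=> p [Ap _]; exact: thK.
  split; first by case: C1th => hd hc; split=> [x [Ax _]|v x [Ax _]]; [exact: hd|exact: hc].
  by case: hth => L hL; exists L => x y v [Ax _] [Ay' _]; exact: hL.
- by split=> //=; rewrite ypsi y0.
- by apply/MA => //; rewrite ypsi yN y0; split=> //; exact: ltW.
move=> p [Ap /= p0]; rewrite MA//; split=> [[]//|pN]; split=> //; exact: ltW.
Qed.

Lemma min_derive0 (f : R -> R) (d : R) : is_derive (0 : R) (1 : R) f d -> f 0 = 0 ->
  (exists2 r : R, 0 < r & forall t, `|t| < r -> 0 <= f t) -> d = 0.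
Proof.
move=> df f0 [r r0 hr]; apply/eqP; apply/negP => /negP dn.
have [d' [r' [d'0 r'0 hr']]] := derive_sign_change df f0 dn.
pose t := Num.min r r' / 2; have m0 : 0 < Num.min r r' by rewrite lt_min r0.
have t0 : 0 < t by rewrite divr_gt0.
have : t < Num.min r r' by rewrite /t; lra.
rewrite lt_min => /andP[tr tr'].
have p1 := hr' t; rewrite subr0 gt_eqF// gtr0_norm// in p1; have {}p1 := p1 isT tr'.
have p2 := hr' (- t); rewrite subr0 oppr_eq0 gt_eqF// normrN gtr0_norm// in p2; have {}p2 := p2 isT tr'.
have q1 := hr t; rewrite gtr0_norm// in q1; have {}q1 := q1 tr.
have q2 := hr (- t); rewrite normrN gtr0_norm// in q2; have {}q2 := q2 tr.
have s1 : 0 < d' * t by rewrite ltNge; apply/negP => h; nra.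
have s2 : 0 < d' * (- t) by rewrite ltNge; apply/negP => h; nra.
by move: s2; rewrite mulrN oppr_gt0 ltNge ltW.
Qed.

(** If M contained a flat disc around a boundary point z, the first coordinate of
the chart would have a minimum at z along the disc and the last one would
vanish on it.  The differentials of both coordinates would vanish on
horizontal vectors, hence be proportional, although the differential of the
chart is invertible. *)
Lemma boundary_not_full (r : R) : 0 < r -> ht false z = 0 ->
  ~ (forall w : W, `|w - hproj z| < r -> M (emb false w 0)).
Proof.
move=> r0 hz full; have [A [B [psi [[oA oB psiAB [C1psi _] [theta [thK [C1th _]]]] Az Mz z0 MA]]]] := bz.
have thB b : B b -> A (theta b) /\ psi (theta b) = b.
  by rewrite -psiAB => -[p Ap <-]; rewrite thK.
set q := psi z; have Bq : B q by rewrite -psiAB; exists z.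
have [qN _] := (MA z Az).1 Mz.
have dpsi p : A p -> differentiable psi p by case: C1psi => hd _; exact: hd.
have [rA rA0 hA] := (open_normedP _).1 oA z Az.
have flat (eta : W) i : i = ord0 \/ i = ord_max -> 'D_(emb false eta 0) psi z 0 i = 0.
  move=> hi; set x := emb false eta 0.
  have df : is_derive (0 : R) (1 : R) (fun t : R => psi (z + t *: x) 0 i) ('D_x psi z 0 i).
    have dc : differentiable (fun p => psi p 0 i) z.
      exact: (differentiable_comp (dpsi z Az) (differentiable_coord _ _ _)).
    have dd : derivable (fun p => psi p 0 i) (z + (0 : R) *: x) x.
      by apply: diff_derivable; rewrite scale0r addr0.
    by have := is_derive_line dd; rewrite scale0r addr0 derive_coord//; exact: dpsi.
  apply: min_derive0 df _ _.
    by rewrite scale0r addr0; case: hi => ->.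
  have n1 : 0 < `|eta| + 1 by rewrite ltr_wpDl.
  exists (Num.min r rA / (`|eta| + 1)); first by rewrite divr_gt0// lt_min r0.
  move=> t; rewrite ltr_pdivlMr// => ht'.
  have te : `|t| * `|eta| < Num.min r rA by apply: le_lt_trans ht'; rewrite ler_wpM2l// lerDl.
  move: te; rewrite lt_min => /andP[tr tA].
  have xe : `|x| <= `|eta| by apply: le_trans (norm_emb _ _ _) _; rewrite normr0 ge_max lexx normr_ge0.
  have Ap : A (z + t *: x).
    by apply: hA; rewrite addrC addKr normrZ; apply: le_lt_trans tA; rewrite ler_wpM2l.
  have Mp : M (z + t *: x).
    have -> : z + t *: x = emb false (hproj z + t *: eta) 0.
      by rewrite -[in LHS](emb_hproj false z) hz /x -embZ -embD mulr0 addr0.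
    by apply: full; rewrite addrC addKr normrZ.
  by have [h1 h2] := (MA _ Ap).1 Mp; case: hi => ->; rewrite ?h1.
set e : V := emb false 0 1.
have vertical x i : i = ord0 \/ i = ord_max -> ('d psi z x) 0 i = ht false x * ('d psi z e) 0 i.
  move=> hi; have -> : x = emb false (hproj x) 0 + ht false x *: e.
    by rewrite /e -embZ scaler0 mulr1 -embD addr0 add0r emb_hproj.
  rewrite linearD linearZ !mxE -(deriveE (emb false (hproj x) 0) (dpsi z Az)) flat// add0r.
  by rewrite htD htZ !ht_emb add0r mulr1.
have onto y : exists x, 'd psi z x = y.
  have dth : differentiable theta q by case: C1th => hd _; exact: hd.
  have [rB rB0 hB] := (open_normedP _).1 oB q Bq.
  have dpt : differentiable psi (theta q) by rewrite thK//; exact: dpsi.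
  have h1 := is_diff_comp (differentiableP dth) (differentiableP dpt).
  have h2 : is_diff q (psi \o theta) ('d (id : V -> V) q).
    by apply: (is_diff_near rB0) => // b /hB/thB[].
  have e1 := congr1 (fun f : V -> V => f y) (is_diff_valE h1).
  have e2 := congr1 (fun f : V -> V => f y) (is_diff_valE h2).
  have e3 := congr1 (fun f : V -> V => f y) (is_diff_valE (is_diff_id q)).
  rewrite /= in e1 e2 e3; exists ('d theta q y).
  have tz : theta q = z by exact: thK.
  by rewrite -[in LHS]tz -e1 e2 e3.
have [x0 hx0] := onto (delta_mx 0 ord0); have [x1 hx1] := onto (delta_mx 0 ord_max).
have a1 := vertical x0 ord0 (or_introl erefl); have a2 := vertical x0 ord_max (or_intror erefl).
have a3 := vertical x1 ord_max (or_intror erefl).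
move: a1 a2 a3; rewrite hx0 hx1 !mxE !eqxx /= => a1 a2 a3.
have nz : ht false x0 != 0 by apply/eqP => h; move: a1; rewrite h mul0r => /eqP; rewrite oner_eq0.
have dN : ('d psi z e) 0 ord_max = 0.
  by move/esym/eqP: a2; rewrite mulf_eq0 (negbTE nz) => /eqP.
by move: a3; rewrite dN mulr0 => /eqP; rewrite oner_eq0.
Qed.

End boundary_charts.

Section flat_hypersurface.
Context {R : realType} {n : nat}.
Local Notation W := 'rV[R]_n.+1.
Local Notation V := 'rV[R]_n.+2.

Lemma closure_normedP (E : normedModType R) (A : set E) (x : E) :
  closure A x <-> forall r : R, 0 < r -> exists2 y, A y & `|y - x| < r.
Proof.
split=> [cl r r0|h B /nbhs_normedP[d d0 hd]].
  have [|y [Ay yr]] := cl [set y | `|y - x| < r]; last by exists y.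
  by apply/nbhs_normedP; exists r.
by have [y Ay yd] := h d d0; exists y; split=> //; exact: hd.
Qed.

Lemma frontier_openP (E : normedModType R) (A : set E) x : open A ->
  frontier A x <-> closure A x /\ ~ A x.
Proof.
move=> oA; split=> -[h1 h2]; split=> // h3; apply: h2.
  by move/open_normedP : oA => /(_ x h3)/nbhs_normedP.
by have /nbhs_normedP[d d0] := h3; apply; rewrite subrr normr0.
Qed.

Lemma cylinder_closure (G : set W) (x : V) : closure (cylinder G) x <-> closure G (hproj x).
Proof.
split=> /closure_normedP h; apply/closure_normedP => r r0; have [y Gy yr] := h r r0.
  by exists (hproj y) => //; rewrite -hprojB; exact: le_lt_trans (norm_hproj _) yr.
exists (emb false y (ht false x)); first by rewrite /cylinder /= hproj_emb.
rewrite -[X in _ - X](emb_hproj false x) -embB subrr; apply: le_lt_trans (norm_emb _ _ _) _.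
by rewrite normr0 gt_max yr r0.
Qed.

Variables (alpha : R) (M : set V) (G : set W).
Hypotheses (alpha0 : 0 < alpha) (cM : compact M).
Hypothesis M_flat : forall x, M x -> ht false x = 0.
Hypothesis M_points : forall z, M z -> interior_point alpha M z \/ boundary_point alpha M z.
Hypothesis M_bd : forall z, boundary_point alpha M z <-> frontier G (hproj z) /\ ht false z = 0.
Hypotheses (oG : open G) (G_smooth : smooth_boundary G).
Hypothesis G_bd : exists Bo : R, forall w, G w -> `|w| <= Bo.

(** The trace of M on its hyperplane. *)
Let M0 (w : W) := M (emb false w 0).
Let F := frontier G.

Let FG w : F w <-> closure G w /\ ~ G w. Proof. exact: frontier_openP. Qed.

Let F_boundary w : F w -> boundary_point alpha M (emb false w 0).
Proof. by move=> Fw; apply/M_bd; rewrite hproj_emb ht_emb. Qed.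

Let F_M0 w : F w -> M0 w.
Proof. by move=> /F_boundary[A [B [psi []]]]. Qed.

Let M_emb x : M x -> x = emb false (hproj x) 0.
Proof. by move=> Mx; rewrite -{1}(emb_hproj false x) (M_flat Mx). Qed.

Let emb_lip w w' : `|emb false w 0 - emb false w' 0 : V| <= `|w - w'|.
Proof.
by rewrite -embB subrr; apply: le_trans (norm_emb _ _ _) _; rewrite normr0 ge_max lexx normr_ge0.
Qed.

Let interior_M0 w : interior_point alpha M (emb false w 0) ->
  exists2 r : R, 0 < r & forall w', `|w' - w| < r -> M0 w'.
Proof.
move=> iw; have le0 x : M x -> ht false x <= 0 by move=> /M_flat ->.
have [v [r [L [r0 _ _ hM _]]]] := local_graph alpha0 le0 (ht_emb false w 0) iw.
rewrite hproj_emb in hM; exists r => // w' /hM Mw'.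
by have := M_flat Mw'; rewrite ht_emb => v0; rewrite /M0 -v0.
Qed.

Let locally_constant w : ~ F w -> exists2 r : R, 0 < r & forall w', `|w' - w| < r ->
  [/\ ~ F w', M0 w' <-> M0 w & G w' <-> G w].
Proof.
move=> nF.
have [r1 r10 h1] : exists2 r : R, 0 < r & forall w', `|w' - w| < r -> ~ F w' /\ (G w' <-> G w).
  have [Gw|nG] := pselect (G w).
    have [r r0 hr] := (open_normedP _).1 oG w Gw; exists r => // w' /hr Gw'.
    by split; [move/FG => -[]|].
  have ncl : ~ closure G w by move=> cl; apply: nF; apply/FG.
  have [r r0 hr] := (open_normedP _).1 (closed_openC (@closed_closure _ G)) w ncl.
  exists r => // w' /hr ncl'; split; first by move=> /FG[].
  by split=> // Gw'; exfalso; apply: ncl'; exact: subset_closure.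
have [r2 r20 h2] : exists2 r : R, 0 < r & forall w', `|w' - w| < r -> (M0 w' <-> M0 w).
  have [Mw|nM] := pselect (M0 w).
    have iw : interior_point alpha M (emb false w 0).
      by case: (M_points Mw) => // /M_bd[]; rewrite hproj_emb.
    by have [r r0 hr] := interior_M0 iw; exists r => // w' /hr.
  have clM : closed M by apply: compact_closed => //; exact: norm_hausdorff.
  have [r r0 hr] := (open_normedP _).1 (closed_openC clM) _ nM.
  exists r => // w' ww'; split=> // Mw'; exfalso.
  by apply: (hr (emb false w' 0)) Mw'; exact: le_lt_trans (emb_lip _ _) ww'.
exists (Num.min r1 r2); first by rewrite lt_min r10.
by move=> w'; rewrite lt_min => /andP[/h1[? ?] /h2 ?].
Qed.

(** Across a frontier point, M0 occupies exactly one of the two sides of the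
frontier of G.  On each side M0 is locally constant, hence all or nothing.
If it contained both sides, boundary_not_full would be violated; if it
contained neither, boundary_has_interior would give a flat disc of M inside the frontier, which
has empty interior. *)
Let one_side z : F z -> exists rho : R, [/\ 0 < rho,
  (forall w, `|w - z| < rho -> ~ F w -> (M0 w <-> G w)) \/
  (forall w, `|w - z| < rho -> ~ F w -> (M0 w <-> ~ G w)) &
  forall w r, `|w - z| < rho -> 0 < r -> exists w', [/\ `|w' - w| < r, `|w' - z| < rho & ~ F w'] ].
Proof.
move=> Fz; have [A [f [oA Az Cf [v0 Dv0] hf]]] := G_smooth Fz.
have [v Dv] : exists v, 0 < 'D_v f z.
  have dfz : differentiable f z by case: (Cf 1%N) => hd _; exact: hd.
  have [h|h] := ltP 0 ('D_v0 f z); first by exists v0.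
  by exists (- v0); rewrite deriveE// linearN -deriveE// oppr_gt0 lt_neqAle Dv0.
have C1f : Ck 1 A f by exact: (Cf 1%N).
have df p : A p -> differentiable f p by case: C1f => hd _; exact: hd.
have cf p : A p -> {for p, continuous f} by move=> /df; exact: differentiable_continuous.
have Ff p : A p -> F p -> f p = 0.
  move=> Ap /FG[cl nG]; have [f0|f0|//] := ltgtP (f p) 0; last by case: nG; apply/hf.
  have pc : 0 < - f p by rewrite oppr_gt0.
  have [d d0 hd] := (continuous_normedP _ _).1 (cf p Ap) _ pc.
  have [d' d'0 hd'] := (open_normedP _).1 oA p Ap.
  have [|y Gy] := (closure_normedP _ _).1 cl (Num.min d d'); first by rewrite lt_min d0.
  rewrite lt_min => /andP[/hd + /hd' Ay]; rewrite ltr_norml => /andP[_].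
  by have := (hf y Ay).1 Gy; lra.
have fz : f z = 0 by exact: Ff.
have [r0 [B [r00 B0 hA hB]]] := C1_bounded_derive oA Az C1f.
pose b := 'D_v f z / 2; have b0 : 0 < b by rewrite divr_gt0.
have cD : {for z, continuous (fun p => 'D_v f p)} by case: C1f => _ h; exact: h.
have [r0' r0'0 hr0'] := (continuous_normedP _ _).1 cD b b0.
pose r1 := Num.min r0 r0'; have r10 : 0 < r1 by rewrite lt_min r00.
have inA p : `|p - z| < r1 -> A p by rewrite lt_min => /andP[/hA].
have Db p : `|p - z| < r1 -> b <= 'D_v f p.
  by rewrite lt_min => /andP[_ /hr0']; rewrite ltr_norml => /andP[]; rewrite /b; lra.
have mono p (t : R) : `|p - z| < r1 -> `|p + t *: v - z| < r1 -> 0 <= t ->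
    f p + b * t <= f (p + t *: v).
  move=> h1 h2 t0; have [|s /andP[s0 s1]] := @MVT_line _ _ f p (p + t *: v).
    by move=> s s01; apply: df; apply: inA; exact: ball_segment.
  set x := p + s *: _; have hx : `|x - z| < r1 by apply: ball_segment => //; rewrite !ltW.
  rewrite (_ : p + t *: v - p = t *: v); last by rewrite addrC addKr.
  have dfx := df x (inA x hx).
  rewrite deriveE// linearZ/= -deriveE// /GRing.scale/= => E1.
  by have := ler_wpM2l t0 (Db x hx); lra.
have flip p : `|p - z| < r1 -> `|f p| <= B * `|p - z|.
  move=> hp; have zz : `|z - z| < r1 by rewrite subrr normr0.
  have [|s /andP[s0 s1]] := @MVT_line _ _ f z p.
    by move=> s s01; apply: df; apply: inA; exact: ball_segment.
  rewrite fz subr0 => ->; apply: hB.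
  have hx := ball_segment (t := s) (ltac:(by rewrite !ltW) : 0 <= s <= 1) zz hp.
  by move: hx; rewrite lt_min => /andP[].
have nF p : `|p - z| < r1 -> f p != 0 -> ~ F p.
  by move=> hp fp Fp; move/eqP: fp; apply; exact: Ff (inA _ hp) Fp.
pose K := 1 + (B + 1) / b * `|v|; have K0 : 0 < K.
  by rewrite ltr_pwDl// mulr_ge0// divr_ge0// ?addr_ge0// ltW.
pose rho := r1 / 2 / K; have rho0 : 0 < rho by rewrite !divr_gt0.
have rhoK : rho * K < r1 by rewrite /rho divfK ?gt_eqF//; lra.
have K1 : 1 <= K by rewrite lerDl mulr_ge0// divr_ge0// ?addr_ge0// ltW.
have rr1 : rho < r1 by apply: le_lt_trans rhoK; rewrite ler_peMr// ltW.
have in1 p : `|p - z| < rho -> `|p - z| < r1 by move=> h; exact: lt_trans rr1.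
have step p r : `|p - z| < rho -> 0 < r -> exists t : R, [/\ 0 < t, `|p + t *: v - p| < r,
    `|p - t *: v - p| < r, `|p + t *: v - z| < rho & `|p - t *: v - z| < rho].
  move=> hp r_0; pose m := Num.min r (rho - `|p - z|).
  have m0 : 0 < m by rewrite lt_min r_0 subr_gt0.
  have v1 : 0 < `|v| + 1 by rewrite ltr_wpDl.
  exists (m / (`|v| + 1)); have t0 : 0 < m / (`|v| + 1) by rewrite divr_gt0.
  have tv : `|(m / (`|v| + 1)) *: v| < m.
    by rewrite normrZ (gtr0_norm t0) mulrAC ltr_pdivrMr// ltr_pM2l// ltrDl.
  move: (tv); rewrite lt_min => /andP[tv1 tv2].
  by split=> //; rewrite ?[_ - p]addrC ?addKr ?normrN// addrAC;
    apply: le_lt_trans (ler_normD _ _) _; rewrite ?normrN; lra.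
have up p (t : R) : `|p - z| < rho -> `|p + t *: v - z| < rho -> 0 < t -> f p < f (p + t *: v).
  move=> h1 h2 t0; have := mono p t (in1 _ h1) (in1 _ h2) (ltW t0).
  by have := mulr_gt0 b0 t0; lra.
have f0F p : `|p - z| < rho -> f p = 0 -> F p.
  move=> hp fp; apply: contrapT => nFp; have [r r_0 hr] := locally_constant nFp.
  have [t [t0 h1 _ h2 _]] := step p r hp r_0; have [_ _ GG] := hr _ h1.
  have := up p t hp h2 t0; rewrite fp => ft.
  have Gp : G p by apply/GG; apply/hf => //; exact: inA (in1 _ h2).
  by have := (hf p (inA _ (in1 _ hp))).1 Gp; rewrite fp ltxx.
have locM p : `|p - z| < r1 -> f p != 0 -> exists2 r : R, 0 < r & forall p', `|p' - p| < r -> (M0 p' <-> M0 p).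
  by move=> hp fp; have [r r_0 hr] := locally_constant (nF _ hp fp); exists r => // p' /hr[].
have pos w1 w2 : `|w1 - z| < rho -> `|w2 - z| < rho -> 0 < f w1 -> 0 < f w2 -> M0 w1 -> M0 w2.
  apply: (locally_constant_side (v := v) b0 B0 rho0 rhoK mono) => p hp.
    by have := flip p hp; rewrite ler_norml => /andP[].
  by move=> fp; apply: locM => //; rewrite gt_eqF.
have neg w1 w2 : `|w1 - z| < rho -> `|w2 - z| < rho -> f w1 < 0 -> f w2 < 0 -> M0 w1 -> M0 w2.
  move=> h1 h2 f1 f2; apply: (@locally_constant_side R W M0 (fun p => - f p) z (- v) b B r1 rho) => //.
  - by rewrite normrN.
  - move=> p t hp hpt t0; rewrite scalerN in hpt *.
    have := mono (p - t *: v) t hpt; rewrite subrK => /(_ hp t0); lra.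
  - by move=> p hp; have := flip p hp; rewrite ler_norml => /andP[]; lra.
  - by move=> p hp; rewrite oppr_gt0 => fp; apply: locM => //; rewrite lt_eqF.
  - by rewrite oppr_gt0.
  - by rewrite oppr_gt0.
have zz : `|z - z| < rho by rewrite subrr normr0.
have [t [t0 _ _ hp hm]] := step z 1 zz ltr01.
have fp : 0 < f (z + t *: v) by have := up z t zz hp t0; rewrite fz.
have fm : f (z - t *: v) < 0.
  by have := up (z - t *: v) t hm; rewrite subrK fz => /(_ zz t0).
have side w : `|w - z| < rho -> ~ F w -> (0 < f w /\ G w) \/ (f w < 0 /\ ~ G w).
  move=> hw nFw; have Aw := inA _ (in1 _ hw); have [h|h|h] := ltgtP (f w) 0.
  - by right; split=> // /(hf w Aw); rewrite ltNge ltW.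
  - by left; split=> //; apply/hf.
  - by case: nFw; exact: f0F.
exists rho; split=> //; last first.
  move=> w r hw r_0; have [Fw|nFw] := pselect (F w); last by exists w; rewrite subrr normr0.
  have [s [s0 h1 _ h2 _]] := step w r hw r_0.
  exists (w + s *: v); split=> //; apply: nF; first exact: in1.
  by have := up w s hw h2 s0; rewrite (Ff w (inA _ (in1 _ hw)) Fw) => h; rewrite gt_eqF.
have bz := F_boundary Fz.
have [Mp|nMp] := pselect (M0 (z + t *: v)); have [Mm|nMm] := pselect (M0 (z - t *: v)).
- exfalso; apply: (boundary_not_full bz rho0 (ht_emb _ _ _)) => w; rewrite hproj_emb => hw.
  have [Fw|nFw] := pselect (F w); first exact: F_M0.
  by case: (side w hw nFw) => -[fw _]; [exact: pos hp hw fp fw Mp|exact: neg hm hw fm fw Mm].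
- left=> w hw nFw; case: (side w hw nFw) => -[fw Gw]; split=> // Mw.
    exact: pos hp hw fp fw Mp.
  by case: nMm; exact: neg hw hm fw fm Mw.
- right=> w hw nFw; case: (side w hw nFw) => -[fw Gw]; split=> // Mw.
  + by case: nMp; exact: pos hw hp fw fp Mw.
  + exact: neg hm hw fm fw Mm.
- exfalso; have [y [My yz iy]] := boundary_has_interior bz rho0.
  have yE := M_emb My; rewrite yE in My iy yz.
  have [r r_0 hr] := interior_M0 iy.
  have hy : `|hproj y - z| < rho.
    have := norm_hproj (emb false (hproj y) 0 - emb false z 0); rewrite hprojB !hproj_emb => h.
    exact: le_lt_trans h yz.
  have zero w : `|w - z| < rho -> M0 w -> f w = 0.
    move=> hw Mw; have [h|h|//] := ltgtP (f w) 0.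
      by case: nMm; exact: neg hw hm h fm Mw.
    by case: nMp; exact: pos hw hp h fp Mw.
  have [s [s0 h1 _ h2 _]] := step _ r hy r_0.
  have := up _ s hy h2 s0; rewrite (zero _ hy My) (zero _ h2 (hr _ h1)) ltxx//.
Qed.

(** Near w, M0 and G coincide off the frontier of G. *)
Let agree (w : W) : Prop := exists2 r : R, 0 < r &
  forall w', `|w' - w| < r -> ~ F w' -> (M0 w' <-> G w').

Let agreeE w : ~ F w -> agree w <-> (M0 w <-> G w).
Proof.
move=> nF; split=> [[r r0 hr]|MG]; first by apply: hr => //; rewrite subrr normr0.
have [r r0 hr] := locally_constant nF; exists r => // w' /hr[_ h1 h2] _.
by rewrite h1 h2.
Qed.

(** Near a frontier point, M0 agrees with G on both sides or on neither one, by
one_side. *)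
Let agree_constant w : exists2 r : R, 0 < r & forall w', `|w' - w| < r -> (agree w' <-> agree w).
Proof.
have [Fw|nF] := pselect (F w); last first.
  have [r r0 hr] := locally_constant nF; exists r => // w' /hr[nF' h1 h2].
  by rewrite !agreeE// h1 h2.
have [rho [rho0 side dense]] := one_side Fw; exists rho => // w' hw'.
have ww : `|w - w| < rho by rewrite subrr normr0.
have s0 : 0 < rho - `|w' - w| by rewrite subr_gt0.
case: side => side.
  split=> _; first by exists rho.
  exists (rho - `|w' - w|) => // p hp; apply: side.
  rewrite (_ : p - w = (p - w') + (w' - w)); last by rewrite addrA subrK.
  by apply: le_lt_trans (ler_normD _ _) _; move: hp; rewrite ltrBrDr.
have no p : `|p - w| < rho -> ~ agree p.
  move=> hp [r r0 hr]; have [q [h1 h2 nFq]] := dense p r hp r0.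
  by have := hr q h1 nFq; have := side q h2 nFq; tauto.
by split=> h; exfalso; [exact: (no w')|exact: (no w)].
Qed.

(** Agreement of M0 with G is locally constant, hence constant on R^(N-1), and it
holds far away, where both are empty.  On the frontier of G, all points
belong to M and to the closure of G. *)
Lemma flat_hypersurfaceE x : M x <-> closure G (hproj x) /\ ht false x = 0.
Proof.
have [Bo hBo] := G_bd.
have [Bm hBm] : exists Bm : R, forall w, M0 w -> `|w| <= Bm.
  have [r [_ hr]] := compact_bounded cM; exists (`|r| + 1) => w Mw.
  have h1 : r < `|r| + 1 by apply: le_lt_trans (ler_norm r) _; rewrite ltrDl.
  have := hr _ h1 _ Mw => h2; apply: le_trans h2.
  by have := norm_hproj (emb false w 0); rewrite hproj_emb.
pose far : W := \row_i (`|Bo| + `|Bm| + 2).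
have agree_far : agree far.
  exists 1 => // w hw _; have big : `|Bo| + `|Bm| + 1 < `|w|.
    have h1 := norm_coord (w - far) ord0; rewrite !mxE in h1.
    have h2 := le_lt_trans h1 hw; apply: lt_le_trans (norm_coord w ord0).
    apply: lt_le_trans (ler_norm _); move: h2; rewrite ltr_norml => /andP[h2 _]; lra.
  split=> [/hBm|/hBo] h; exfalso.
    by have := ler_norm Bm; have := normr_ge0 Bo; lra.
  by have := ler_norm Bo; have := normr_ge0 Bm; lra.
have all_agree w : agree w.
  by apply: (locally_constant_segment _ agree_far) => t _; exact: agree_constant.
have M0E w : M0 w <-> closure G w.
  have [Fw|nF] := pselect (F w).
    by split=> _; [have /FG[] := Fw|exact: F_M0].
  rewrite ((agreeE nF).1 (all_agree w)); split; first exact: subset_closure.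
  by move=> cl; apply: contrapT => nG; apply: nF; apply/FG.
split=> [Mx|[cl hx]].
  by split; [apply/M0E; rewrite /M0 -M_emb|exact: M_flat].
by rewrite -(emb_hproj false x) hx; apply/M0E.
Qed.

End flat_hypersurface.

(** If M rose above the hyperplane, its boundary would stay below the top part, so
that a neighbourhood of the top would consist of interior points and be a
graph, which can be lowered. *)
Lemma critical_height_le0 (R : realType) (n : nat) (sg : bool) (c s alpha : R)
    (M Omega : set 'rV[R]_n.+2) : 0 < c -> 0 < s -> s < alpha -> alpha <= 1 -> s < 1 ->
  compact_hypersurface alpha M -> orientable M ->
  (forall z, boundary_point alpha M z -> ht sg z <= 0) ->
  open Omega -> bounded_set Omega -> M `<=` Omega ->
  critical_point c s alpha Omega M -> forall x, M x -> ht sg x <= 0.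
Proof.
move=> c0 s0 sa a1 s1 hM [nu nuM] bd oO [r [_ hr]] MO crit x0 Mx0.
rewrite leNgt; apply/negP => x0_gt0.
have [cM pM] := hM; have a0 : 0 < alpha by exact: lt_trans sa.
have [C covC] := hypersurface_covered hM.
have cont : {within M, continuous (ht sg : _ -> R)}.
  by apply: continuous_subspaceT; exact: continuous_ht.
have [|z zM zmax] := compact_EVT_max _ cM cont; first by exists x0.
rewrite inE in zM; have Mle x : M x -> ht sg x <= ht sg z.
  by move=> Mx; apply: zmax; rewrite inE.
have h0 : 0 < ht sg z by apply: lt_le_trans (Mle _ Mx0).
have kh : ht sg z / 2 < ht sg z by lra.
have M_int p : M p -> ht sg z / 2 < ht sg p -> interior_point alpha M p.
  by move=> Mp hp; case: (pM p Mp) => // /bd; lra.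
have [u [k [C' [R0 [/andP[k0 k1] C1u [C'0 bu hu] [ule ufar] graph]]]]] :=
  global_graph a0 a1 cM kh Mle M_int.
apply: (not_critical a0 a1 k1 C'0 C1u bu hu ule ufar graph c0 _ _ cM covC oO _ MO bd nuM _ crit).
- by rewrite s0 s1.
- lra.
- exists (`|r| + 1); first by rewrite addr_ge0.
  move=> x Ox; apply: (hr (`|r| + 1)) Ox.
  by apply: le_lt_trans (ler_norm r) _; rewrite ltrDl.
- by exists (hproj z); apply/esym/graph.
Qed.

Theorem theorem1p1 (R : realType) (n : nat) (c s alpha : R)
    (G : set 'rV[R]_n.+1) (M Omega : set 'rV[R]_n.+2)
    (c_gt0 : 0 < c) (s_gt0 : 0 < s) (s_lt1 : s < 1)
    (s_lt_alpha : s < alpha) (alpha_le1 : alpha <= 1)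
    (G_neq0 : G !=set0) (G_bounded : bounded_set G) (G_open : open G)
    (G_smooth : smooth_boundary G)
    (M_hypersurface : compact_hypersurface alpha M)
    (M_orientable : orientable M)
    (M_boundary :
      manifold_boundary alpha M = frontier (cylinder G) `&` height0)
    (Omega_open : open Omega) (Omega_connected : connected Omega)
    (Omega_bounded : bounded_set Omega) (M_Omega : M `<=` Omega)
    (M_critical : critical_point c s alpha Omega M) :
  M = closure (cylinder G) `&` height0.
Proof.
have alpha0 : 0 < alpha by exact: lt_trans s_lt_alpha.
have ht0 x : ht false x = 0 <-> height0 x by rewrite /height0 /ht/= expr0 mul1r.
have htN x : ht true x = - ht false x by rewrite /ht expr1 expr0 mulN1r mul1r.
have oC : open (cylinder G).
  apply/open_normedP => x Gx; have [r r0 hr] := (open_normedP _).1 G_open _ Gx.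
  exists r => // y yx; apply: hr; rewrite -hprojB.
  exact: le_lt_trans (norm_hproj _) yx.
have M_bd z : boundary_point alpha M z <-> frontier G (hproj z) /\ ht false z = 0.
  have -> : boundary_point alpha M z <-> (frontier (cylinder G) `&` height0) z.
    by rewrite -M_boundary.
  by split=> -[/frontier_openP h hz]; split; try exact/ht0; apply/frontier_openP => //;
    have := h ltac:(by []) => -[/cylinder_closure cl nG].
have bd0 sg z : boundary_point alpha M z -> ht sg z <= 0.
  by move=> /M_bd[_ hz]; case: sg; rewrite ?htN hz ?oppr0.
have below sg := critical_height_le0 c_gt0 s_gt0 s_lt_alpha alpha_le1 s_lt1
  M_hypersurface M_orientable (bd0 sg) Omega_open Omega_bounded M_Omega M_critical.
have M_flat x : M x -> ht false x = 0.
  move=> Mx; apply/eqP; rewrite eq_le (below false _ Mx)/= -oppr_le0 -htN.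
  exact: below.
have [cM pM] := M_hypersurface.
have G_bd : exists Bo : R, forall w, G w -> `|w| <= Bo.
  have [r [_ hr]] := G_bounded; exists (`|r| + 1) => w Gw; apply: (hr (`|r| + 1)) Gw.
  by apply: le_lt_trans (ler_norm r) _; rewrite ltrDl.
apply/seteqP; split=> x.
  move=> /(flat_hypersurfaceE alpha0 cM M_flat pM M_bd G_open G_smooth G_bd)[cl /ht0 hx].
  by split=> //; apply/cylinder_closure.
move=> [/cylinder_closure cl /ht0 hx].
exact/(flat_hypersurfaceE alpha0 cM M_flat pM M_bd G_open G_smooth G_bd).
Qed.
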